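(* Let $0\le\Delta\le 1$ and let $\Lambda$ be a set of positive integers. Consider power series of the form $$\sum_{m\in\Lambda}a_m z^m \qquad ( * )$$ with complex coefficients and radius of convergence $1$, which satisfy the condition $$\lim_{m\in P,\ m\to\infty}|a_m|^{1/m}=1,\qquad P=\{m\in\Lambda: a_m\neq0\}. \qquad ( ** )$$ The following properties are equivalent: ($A$) Every power series $( * )$ satisfying $( ** )$ has a singularity on the arc $I_\Delta=\{e^{i\theta}:|\theta|\le\pi\Delta\}$. ($A'$) Every power series $( * )$ satisfying $( ** )$ has a singularity on every closed arc of length $2\pi\Delta$ of the unit circle. ($B$) $\underline{D}_2(\Lambda)\le\Delta$.
   Context: For a set $\Lambda$ of non-negative integers let $n(x,\Lambda)=\#(\Lambda\cap[0,x])$. The minimum density of $\Lambda$ is $$\underline{D}_2(\Lambda)=\lim_{r\to0+}\liminf_{x\to+\infty}\frac{n((r+1)x,\Lambda)-n(x,\Lambda)}{rx}.$$ (Equivalently, by a result of Pólya, it is the supremum of the limits $\lim_{x\to\infty}n(x,\Lambda')/x$ over all subsets $\Lambda'\subset\Lambda$ for which this limit exists.) A power series $f$ of radius of convergence $1$ has a singularity on a closed arc $I$ of the unit circle if there is a point $\zeta\in I$ to which $f$ has no immediate analytic continuation from the unit disc, i.e. there is no neighborhood $V$ of $\zeta$ and analytic function on $\{|z|<1\}\cup V$ that coincides with $f$ on $\{|z|<1\}$. A closed arc of length $0$ is a single point; the closed arc of length $2\pi$ is the whole circle. *)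

(* Defs.v *)
(* Stdlib reals, with Coquelicot for complex numbers, limits and power series. *)
From Stdlib Require Import Reals List ClassicalEpsilon.
From Coquelicot Require Import Coquelicot.
Open Scope R_scope.

(* [n(x, Lam)], the number of [k] in [Lam] with [k <= x]; every such [k]
   is smaller than [up x], so the list below misses none of them. *)
Definition count (Lam : nat -> Prop) (x : R) : nat :=
  length
    (filter
       (fun k => if excluded_middle_informative (Lam k /\ INR k <= x)
                 then true else false)
       (seq 0 (Z.to_nat (up x)))).

Definition liminf_pinfty (f : R -> R) : Rbar :=
  Rbar_lub (fun l => exists M : R,
    l = Glb_Rbar (fun y => exists x : R, M <= x /\ y = f x)).

(* The lower limit is finite for every [r > 0] (for [x > 0] the quotient lies
   between 0 and [1 + 1 / (r * x)]), and by Polya the limit as [r] tends to [0+] always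
   exists, so neither [real] nor [iota] returns a default value here. *)
Definition minimum_density (Lam : nat -> Prop) : R :=
  iota (fun D : R =>
    filterlim
      (fun r : R => real (liminf_pinfty (fun x : R =>
         (INR (count Lam ((r + 1) * x)) - INR (count Lam x)) / (r * x))))
      (at_right 0) (locally D)).

Definition is_Cpseries (a : nat -> C) (z s : C) : Prop :=
  @is_pseries C_AbsRing C_NormedModule a z s.

Definition analytic_at (g : C -> C) (z0 : C) : Prop :=
  exists c : nat -> C,
    @locally C_UniformSpace z0 (fun z => is_Cpseries c (z - z0)%C (g z)).

Definition unit_disc (z : C) : Prop := Cmod z < 1.

(* [g] extends the sum of the power series with coefficients [a] from the unit
   disc to a neighbourhood of [zeta]. *)
Definition has_immediate_continuation (a : nat -> C) (zeta : C) : Prop :=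
  exists (V : C -> Prop) (g : C -> C),
    @locally C_UniformSpace zeta V /\
    (forall z : C, unit_disc z \/ V z -> analytic_at g z) /\
    (forall z : C, unit_disc z -> is_Cpseries a z (g z)).

Definition has_singularity_on (a : nat -> C) (I : C -> Prop) : Prop :=
  exists zeta : C, I zeta /\ ~ has_immediate_continuation a zeta.

(* The arc from angle [alpha] to angle [beta]; its length is [beta - alpha]
   when [0 <= beta - alpha <= 2 * PI]. *)
Definition closed_arc (alpha beta : R) (zeta : C) : Prop :=
  exists theta : R, alpha <= theta <= beta /\ zeta = (cos theta, sin theta).

(* For a complex power series the radius of convergence is that of the real
   series of moduli, [CV_radius] being defined by absolute convergence. *)
Definition series_on (Lam : nat -> Prop) (a : nat -> C) : Prop :=
  (forall m : nat, ~ Lam m -> a m = 0%C) /\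
  CV_radius (fun m => Cmod (a m)) = Finite 1.

(* On the filter used here [a m <> 0], so [Rpower] is the true [m]-th root. *)
Definition root_condition (Lam : nat -> Prop) (a : nat -> C) : Prop :=
  filterlim (fun m : nat => Rpower (Cmod (a m)) (/ INR m))
    (within (fun m => Lam m /\ a m <> 0%C) eventually) (locally 1).

(* Main.v *)
Require Import Defs.
From Stdlib Require Import Reals List FinFun Lra Lia Psatz Classical ClassicalEpsilon ZArith.
From Coquelicot Require Import Coquelicot.
Open Scope R_scope.

(** Throughout, [f] is the sum of [a m * z ^ m], and contour integrals are replaced by means over the
   [M]-th roots of unity as [M] tends to infinity ([cavg]); the only residue theorem used is
   [residue_formula], obtained from partial fractions.

   A small density forces a singularity ([singularity_of_small_density]). Suppose that [f] is regular at
   every point of an arc of length [2 * PI * Delta]. By compactness the [k]-th Taylor coefficients of [f] at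
   the points [(1 - p) * zeta], [zeta] in a slightly longer arc, are [O ((2 * p) ^ - k)]
   ([arc_taylor_bound]). Up to the factor [p ^ k], such a coefficient is the sum of the [a m] against the
   weights [bin m k * (1 - p) ^ (m - k) * p ^ k], which for [k] close to [N * p] are concentrated near
   [m = N]. So [a N], being a Fourier coefficient of this sum, would be exponentially small, were it not for the
   complementary arc (which is empty for [Delta = 1], see [regular_circle_absurd]). Against it the sum is multiplied by [1 + csum X (fun x => w x * cis (- x * t))] with all
   [N + x] outside the support of [a], which leaves the [N]-th Fourier coefficient alone. If the
   support has at most [D2 * t] points in [(N, N + t]] for each [t <= s * N], with [D2 > Delta] only slightly
   larger, there is such a trigonometric polynomial that is exponentially small on the complementary arc
   ([sparse_isolation]). This contradicts the lower bound on [a N], so that every large [N] of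
   the support is followed by a short window of density more than [D2] ([dense_window]), and chaining these windows
   yields a minimum density larger than [Delta] ([density_of_windows], [minimum_density_spec]).

   A large density allows a continuation ([regular_series_of_large_density]). If the minimum density exceeds [Delta],
   a greedy choice gives a subset [P] of [Lam] with a density [d > Delta] ([greedy_balanced]). The even canonical
   product [G w] of the factors [1 - (w / n) ^ 2], [n] in [P], then satisfies, away from its zeros,
   [|G w| >= exp (c * |Im w| - e * Re w - A)] for each [c < PI * d] and [e > 0] ([even_product_lower]), and the residues of
   [1 / G] at the points of [P] are [exp (o (m))], so that they serve as coefficients: [a m = - 2 / G' m]
   ([reciprocal_coef_bounds]). The [n]-th Taylor coefficient of [f] at [z0 = exp (- p + i * theta)] becomes a sum of
   residues of the binomial coefficient [(w choose n)] times [z0 ^ (w - n) / G w]. On the circles [|w - R| = R] the factor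
   [exp (|theta| * |Im w|)] coming from [z0 ^ w] is beaten by [G] when [|theta| <= PI * Delta], and the Taylor series at [z0] has
   a radius of convergence larger than [1 - |z0|] once [p] is small ([taylor_coef_bound]); so it
   continues [f] across [cis theta] ([continuation_of_taylor_bound]).

   Since an arc symmetric about [1] is one of the arcs of its length, these two parts close the circle of implications. *)

(** * Finite sums and products over lists *)

Fixpoint rsum {A : Type} (l : list A) (f : A -> R) : R :=
  match l with nil => 0 | x :: l => f x + rsum l f end.

Fixpoint rprod {A : Type} (l : list A) (f : A -> R) : R :=
  match l with nil => 1 | x :: l => f x * rprod l f end.

Fixpoint csum {A : Type} (l : list A) (f : A -> C) : C :=
  match l with nil => 0%C | x :: l => (f x + csum l f)%C end.

Fixpoint cprod {A : Type} (l : list A) (f : A -> C) : C :=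
  match l with nil => 1%C | x :: l => (f x * cprod l f)%C end.

Lemma rsum_ext {A} (l : list A) f g :
  (forall x, In x l -> f x = g x) -> rsum l f = rsum l g.
Proof.
  induction l as [|a l IH]; intros H; simpl; auto.
  rewrite (H a), IH; auto; intros; try apply H; simpl; auto.
Qed.

Lemma rsum_le {A} (l : list A) f g :
  (forall x, In x l -> f x <= g x) -> rsum l f <= rsum l g.
Proof.
  induction l as [|a l IH]; intros H; simpl; [lra|].
  assert (f a <= g a) by (apply H; simpl; auto).
  assert (rsum l f <= rsum l g) by (apply IH; intros; apply H; simpl; auto). lra.
Qed.

Lemma rsum_ge0 {A} (l : list A) f :
  (forall x, In x l -> 0 <= f x) -> 0 <= rsum l f.
Proof.
  induction l as [|a l IH]; intros H; simpl; [lra|].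
  assert (0 <= f a) by (apply H; simpl; auto).
  assert (0 <= rsum l f) by (apply IH; intros; apply H; simpl; auto). lra.
Qed.

Lemma rsum_plus {A} (l : list A) f g :
  rsum l (fun x => f x + g x) = rsum l f + rsum l g.
Proof. induction l as [|a l IH]; simpl; [ring|]; rewrite IH; ring. Qed.

Lemma rsum_minus {A} (l : list A) f g :
  rsum l (fun x => f x - g x) = rsum l f - rsum l g.
Proof. induction l as [|a l IH]; simpl; [ring|]; rewrite IH; ring. Qed.

Lemma rsum_scal {A} (l : list A) c f :
  rsum l (fun x => c * f x) = c * rsum l f.
Proof. induction l as [|a l IH]; simpl; [ring|]; rewrite IH; ring. Qed.

Lemma rsum_const {A} (l : list A) c : rsum l (fun _ => c) = INR (length l) * c.
Proof.
  induction l as [|a l IH]; [simpl; ring|].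
  change (c + rsum l (fun _ => c) = INR (S (length l)) * c).
  rewrite IH, S_INR; ring.
Qed.

Lemma rsum_app {A} (l m : list A) f : rsum (l ++ m) f = rsum l f + rsum m f.
Proof. induction l as [|a l IH]; simpl; [ring|]; rewrite IH; ring. Qed.

Lemma rsum_abs {A} (l : list A) f : Rabs (rsum l f) <= rsum l (fun x => Rabs (f x)).
Proof.
  induction l as [|a l IH]; simpl; [rewrite Rabs_R0; lra|].
  eapply Rle_trans; [apply Rabs_triang|lra].
Qed.

Lemma rsum_seq_S j n f : rsum (seq j (S n)) f = rsum (seq j n) f + f (j + n)%nat.
Proof. rewrite seq_S, rsum_app. simpl. ring. Qed.

Lemma rsum_S n f : rsum (seq 0 (S n)) f = rsum (seq 0 n) f + f n.
Proof. apply rsum_seq_S. Qed.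

Lemma rsum_seq_mono n m f : (n <= m)%nat -> (forall k, 0 <= f k) ->
  rsum (seq 0 n) f <= rsum (seq 0 m) f.
Proof.
  intros H Hf. induction H as [|m H IH]; [lra|].
  rewrite rsum_S. specialize (Hf m). lra.
Qed.

Lemma rsum_incl {A} (l m : list A) f : NoDup l -> incl l m ->
  (forall x, In x m -> 0 <= f x) -> rsum l f <= rsum m f.
Proof.
  revert m. induction l as [|a l IH]; intros m Hn Hi Hf; simpl.
  - now apply rsum_ge0.
  - inversion Hn as [|? ? Hna Hnl]; subst.
    assert (Ha : In a m) by (apply Hi; simpl; auto).
    destruct (in_split _ _ Ha) as [m1 [m2 ->]].
    rewrite rsum_app; simpl.
    assert (rsum l f <= rsum (m1 ++ m2) f).
    { apply IH; auto.
      - intros x Hx. assert (In x (m1 ++ a :: m2)) by (apply Hi; simpl; auto).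
        apply in_app_iff in H. apply in_app_iff. simpl in H.
        destruct H as [H|[H|H]]; auto. subst; contradiction.
      - intros x Hx; apply Hf. apply in_app_iff in Hx. apply in_app_iff. simpl; tauto. }
    rewrite rsum_app in H. lra.
Qed.

Lemma rprod_ext {A} (l : list A) f g :
  (forall x, In x l -> f x = g x) -> rprod l f = rprod l g.
Proof.
  induction l as [|a l IH]; intros H; simpl; auto.
  rewrite (H a), IH; auto; intros; try apply H; simpl; auto.
Qed.

Lemma rprod_ge0 {A} (l : list A) f :
  (forall x, In x l -> 0 <= f x) -> 0 <= rprod l f.
Proof.
  induction l as [|a l IH]; intros H; simpl; [lra|].
  apply Rmult_le_pos; [apply H; simpl; auto|apply IH; intros; apply H; simpl; auto].
Qed.

Lemma rprod_pos {A} (l : list A) f :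
  (forall x, In x l -> 0 < f x) -> 0 < rprod l f.
Proof.
  induction l as [|a l IH]; intros H; simpl; [lra|].
  apply Rmult_lt_0_compat; [apply H; simpl; auto|apply IH; intros; apply H; simpl; auto].
Qed.

Lemma rprod_le {A} (l : list A) f g :
  (forall x, In x l -> 0 <= f x <= g x) -> rprod l f <= rprod l g.
Proof.
  induction l as [|a l IH]; intros H; simpl; [lra|].
  assert (0 <= f a <= g a) by (apply H; simpl; auto).
  apply Rmult_le_compat; try lra.
  - apply rprod_ge0; intros; apply H; simpl; auto.
  - apply IH; intros; apply H; simpl; auto.
Qed.

Lemma rprod_mult {A} (l : list A) f g :
  rprod l (fun x => f x * g x) = rprod l f * rprod l g.
Proof. induction l as [|a l IH]; simpl; [ring|]; rewrite IH; ring. Qed.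

Lemma rprod_inv {A} (l : list A) f :
  rprod l (fun x => / f x) = / rprod l f.
Proof.
  induction l as [|a l IH]; simpl; [rewrite Rinv_1; ring|].
  now rewrite IH, Rinv_mult.
Qed.

Lemma rprod_const {A} (l : list A) c : rprod l (fun _ => c) = c ^ length l.
Proof. induction l as [|a l IH]; simpl; [ring|]; rewrite IH; ring. Qed.

Lemma rprod_app {A} (l m : list A) f : rprod (l ++ m) f = rprod l f * rprod m f.
Proof. induction l as [|a l IH]; simpl; [ring|]; rewrite IH; ring. Qed.

Lemma rprod_map {A B} (l : list A) (g : A -> B) f :
  rprod (map g l) f = rprod l (fun x => f (g x)).
Proof. induction l as [|a l IH]; simpl; [ring|]; rewrite IH; ring. Qed.

Lemma rprod_exp {A} (l : list A) f :
  rprod l (fun x => exp (f x)) = exp (rsum l f).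
Proof. induction l as [|a l IH]; simpl; [now rewrite exp_0|]; now rewrite IH, exp_plus. Qed.

Lemma ln_rprod {A} (l : list A) f : (forall x, In x l -> 0 < f x) ->
  ln (rprod l f) = rsum l (fun x => ln (f x)).
Proof.
  induction l as [|a l IH]; intros H; simpl; [apply ln_1|].
  rewrite ln_mult, IH; auto.
  - intros; apply H; simpl; auto.
  - apply H; simpl; auto.
  - apply rprod_pos; intros; apply H; simpl; auto.
Qed.

Lemma csum_ext {A} (l : list A) f g :
  (forall x, In x l -> f x = g x) -> csum l f = csum l g.
Proof.
  induction l as [|a l IH]; intros H; simpl; auto.
  rewrite (H a), IH; auto; intros; try apply H; simpl; auto.
Qed.

Lemma csum_plus {A} (l : list A) f g :
  csum l (fun x => f x + g x)%C = (csum l f + csum l g)%C.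
Proof. induction l as [|a l IH]; simpl; [ring|]; rewrite IH; ring. Qed.

Lemma csum_minus {A} (l : list A) f g :
  csum l (fun x => f x - g x)%C = (csum l f - csum l g)%C.
Proof. induction l as [|a l IH]; simpl; [ring|]; rewrite IH; ring. Qed.

Lemma csum_scal {A} (l : list A) c f :
  csum l (fun x => c * f x)%C = (c * csum l f)%C.
Proof. induction l as [|a l IH]; simpl; [ring|]; rewrite IH; ring. Qed.

Lemma csum_scal_r {A} (l : list A) c f :
  csum l (fun x => f x * c)%C = (csum l f * c)%C.
Proof. induction l as [|a l IH]; simpl; [ring|]; rewrite IH; ring. Qed.

Lemma csum_0 {A} (l : list A) (f : A -> C) :
  (forall x, In x l -> f x = 0%C) -> csum l f = 0%C.
Proof.
  induction l as [|a l IH]; intros H; simpl; auto.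
  rewrite (H a), IH; simpl; auto; [ring|]. intros; apply H; simpl; auto.
Qed.

Lemma csum_app {A} (l m : list A) f : csum (l ++ m) f = (csum l f + csum m f)%C.
Proof. induction l as [|a l IH]; simpl; [ring|]; rewrite IH; ring. Qed.

Lemma csum_map {A B} (l : list A) (g : A -> B) f :
  csum (map g l) f = csum l (fun x => f (g x)).
Proof. induction l as [|a l IH]; simpl; [ring|]; rewrite IH; ring. Qed.

Lemma csum_const {A} (l : list A) c :
  csum l (fun _ => c) = (INR (length l) * c)%C.
Proof.
  induction l as [|a l IH]; [simpl; ring|].
  change ((c + csum l (fun _ => c))%C = (INR (S (length l)) * c)%C).
  rewrite IH, S_INR, RtoC_plus. ring.
Qed.

Lemma csum_swap {A B} (l : list A) (m : list B) f :
  csum l (fun x => csum m (fun y => f x y)) = csum m (fun y => csum l (fun x => f x y)).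
Proof.
  induction l as [|a l IH]; simpl.
  - symmetry. now apply csum_0.
  - rewrite IH, <- csum_plus. reflexivity.
Qed.

Lemma Cmod_csum {A} (l : list A) f : Cmod (csum l f) <= rsum l (fun x => Cmod (f x)).
Proof.
  induction l as [|a l IH]; simpl; [rewrite Cmod_0; lra|].
  eapply Rle_trans; [apply Cmod_triangle|lra].
Qed.

Lemma csum_S n f : csum (seq 0 (S n)) f = (csum (seq 0 n) f + f n)%C.
Proof. rewrite seq_S, csum_app; simpl; ring. Qed.

Lemma cprod_ext {A} (l : list A) f g :
  (forall x, In x l -> f x = g x) -> cprod l f = cprod l g.
Proof.
  induction l as [|a l IH]; intros H; simpl; auto.
  rewrite (H a), IH; auto; intros; try apply H; simpl; auto.
Qed.

Lemma cprod_neq0 {A} (l : list A) (f : A -> C) :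
  (forall x, In x l -> f x <> 0%C) -> cprod l f <> 0%C.
Proof.
  induction l as [|a l IH]; intros H; simpl.
  - intros E. apply (f_equal fst) in E; simpl in E; lra.
  - apply Cmult_neq_0; [apply H; simpl; auto|apply IH; intros; apply H; simpl; auto].
Qed.

Lemma cprod_app {A} (l m : list A) (f : A -> C) : cprod (l ++ m) f = (cprod l f * cprod m f)%C.
Proof. induction l as [|a l IH]; simpl; [ring|]; rewrite IH; ring. Qed.

Lemma cprod_map {A B} (l : list A) (g : A -> B) f :
  cprod (map g l) f = cprod l (fun x => f (g x)).
Proof. induction l as [|a l IH]; simpl; [ring|]; rewrite IH; ring. Qed.

Lemma cprod_mult {A} (l : list A) f g :
  cprod l (fun x => f x * g x)%C = (cprod l f * cprod l g)%C.
Proof. induction l as [|a l IH]; simpl; [ring|]; rewrite IH; ring. Qed.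

Lemma Cmod_cprod {A} (l : list A) f : Cmod (cprod l f) = rprod l (fun x => Cmod (f x)).
Proof.
  induction l as [|a l IH]; simpl; [apply Cmod_1|]. now rewrite Cmod_mult, IH.
Qed.

Lemma cprod_RtoC {A} (l : list A) (f : A -> R) :
  cprod l (fun x => RtoC (f x)) = RtoC (rprod l f).
Proof.
  induction l as [|a l IH]; simpl; auto. now rewrite IH, RtoC_mult.
Qed.

(** * The complex exponential *)

Definition cis (t : R) : C := (cos t, sin t).

Lemma Cmod_cis t : Cmod (cis t) = 1.
Proof.
  unfold Cmod, cis; simpl.
  replace (cos t * (cos t * 1) + sin t * (sin t * 1)) with 1; [apply sqrt_1|].
  generalize (sin2_cos2 t); unfold Rsqr; lra.
Qed.

Lemma cis_plus s t : cis (s + t) = (cis s * cis t)%C.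
Proof. unfold cis, Cmult; simpl. rewrite cos_plus, sin_plus. f_equal; ring. Qed.

Lemma cis_0 : cis 0 = 1%C.
Proof. unfold cis. now rewrite cos_0, sin_0. Qed.

Lemma cis_pow t n : Cpow (cis t) n = cis (INR n * t).
Proof.
  induction n as [|n IH].
  - simpl. now rewrite Rmult_0_l, cis_0.
  - rewrite Cpow_S, IH, S_INR, <- cis_plus. f_equal; ring.
Qed.

Lemma cis_2PI n : cis (2 * PI * INR n) = 1%C.
Proof.
  replace (2 * PI * INR n) with (0 + 2 * INR n * PI) by ring.
  unfold cis. rewrite cos_period, sin_period, cos_0, sin_0. reflexivity.
Qed.

Definition Cexp (z : C) : C := (exp (fst z) * cis (snd z))%C.

Lemma Cexp_plus z w : Cexp (z + w)%C = (Cexp z * Cexp w)%C.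
Proof.
  unfold Cexp; simpl. rewrite exp_plus, cis_plus, RtoC_mult. ring.
Qed.

Lemma Cmod_Cexp z : Cmod (Cexp z) = exp (fst z).
Proof.
  unfold Cexp. rewrite Cmod_mult, Cmod_cis, Cmod_R, Rabs_pos_eq; [ring|].
  apply Rlt_le, exp_pos.
Qed.

Lemma Cexp_0 : Cexp 0 = 1%C.
Proof. unfold Cexp; simpl. rewrite exp_0, cis_0. ring. Qed.

Lemma Cexp_pow z n : Cpow (Cexp z) n = Cexp (INR n * z)%C.
Proof.
  induction n as [|n IH].
  - simpl. now rewrite Cmult_0_l, Cexp_0.
  - rewrite Cpow_S, IH, S_INR, RtoC_plus, <- Cexp_plus. f_equal; ring.
Qed.

Lemma Cmod_le_abs (z : C) : Cmod z <= Rabs (fst z) + Rabs (snd z).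
Proof.
  replace z with (RtoC (fst z) + Ci * RtoC (snd z))%C at 1.
  - eapply Rle_trans; [apply Cmod_triangle|].
    rewrite Cmod_mult, Cmod_Ci, !Cmod_R; lra.
  - destruct z; unfold Ci, RtoC, Cmult, Cplus; simpl; f_equal; ring.
Qed.

Lemma Rabs_fst_le (z : C) : Rabs (fst z) <= Cmod z.
Proof. eapply Rle_trans; [|apply Rmax_Cmod]. apply Rmax_l. Qed.

Lemma Rabs_snd_le (z : C) : Rabs (snd z) <= Cmod z.
Proof. eapply Rle_trans; [|apply Rmax_Cmod]. apply Rmax_r. Qed.

Lemma Cmod_sub_le (x y : C) : Cmod x - Cmod y <= Cmod (x - y).
Proof.
  generalize (Cmod_triangle (x - y) y). replace (x - y + y)%C with x by ring. lra.
Qed.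

Lemma Cmod_sym (x y : C) : Cmod (x - y) = Cmod (y - x).
Proof. rewrite <- Cmod_opp. f_equal; ring. Qed.

Lemma Cmod_sqr (z : C) : Cmod z * Cmod z = fst z * fst z + snd z * snd z.
Proof. generalize (Cmod2_alt z). unfold Re, Im. simpl. lra. Qed.

(** * Limits of complex sequences and absolutely convergent series *)

Definition clim (u : nat -> C) (l : C) : Prop :=
  forall eps, 0 < eps -> exists N, forall n, (N <= n)%nat -> Cmod (u n - l) < eps.

Definition summable (v : nat -> R) (S : R) : Prop :=
  (forall k, 0 <= v k) /\ forall n, rsum (seq 0 n) v <= S.

Definition cseries (u : nat -> C) (l : C) : Prop := clim (fun n => csum (seq 0 n) u) l.

Lemma Cminus_diag (x : C) : (x - x)%C = 0%C.
Proof. ring. Qed.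

Lemma clim_unique u l m : clim u l -> clim u m -> l = m.
Proof.
  intros Hl Hm. destruct (Req_dec (Cmod (l - m)) 0) as [E|E].
  - apply Cmod_eq_0 in E. replace l with (l - m + m)%C by ring. rewrite E; ring.
  - assert (P : 0 < Cmod (l - m)) by (generalize (Cmod_ge_0 (l - m)); lra).
    destruct (Hl (Cmod (l - m) / 2)) as [N1 H1]; [lra|].
    destruct (Hm (Cmod (l - m) / 2)) as [N2 H2]; [lra|].
    specialize (H1 (N1 + N2)%nat ltac:(lia)). specialize (H2 (N1 + N2)%nat ltac:(lia)).
    generalize (Cmod_triangle (l - u (N1 + N2)%nat) (u (N1 + N2)%nat - m)).
    replace (l - u (N1 + N2)%nat + (u (N1 + N2)%nat - m))%C with (l - m)%C by ring.
    rewrite (Cmod_sym l (u (N1 + N2)%nat)). lra.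
Qed.

Lemma clim_const l : clim (fun _ => l) l.
Proof.
  intros eps He; exists 0%nat; intros n _. cbv beta. rewrite Cminus_diag.
  now rewrite Cmod_0.
Qed.

Lemma clim_ext u v l : (exists N, forall n, (N <= n)%nat -> u n = v n) -> clim u l -> clim v l.
Proof.
  intros [N H] Hu eps He. destruct (Hu eps He) as [N' H'].
  exists (N + N')%nat; intros n Hn. rewrite <- H by lia. apply H'; lia.
Qed.

Lemma clim_plus u v l m : clim u l -> clim v m -> clim (fun n => u n + v n)%C (l + m)%C.
Proof.
  intros Hl Hm eps He.
  destruct (Hl (eps / 2)) as [N1 H1]; [lra|]. destruct (Hm (eps / 2)) as [N2 H2]; [lra|].
  exists (N1 + N2)%nat; intros n Hn. specialize (H1 n ltac:(lia)). specialize (H2 n ltac:(lia)).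
  replace (u n + v n - (l + m))%C with ((u n - l) + (v n - m))%C by ring.
  eapply Rle_lt_trans; [apply Cmod_triangle|lra].
Qed.

Lemma clim_scal c u l : clim u l -> clim (fun n => c * u n)%C (c * l)%C.
Proof.
  intros Hl eps He. generalize (Cmod_ge_0 c); intros Hc.
  destruct (Hl (eps / (Cmod c + 1))) as [N H]; [apply Rdiv_lt_0_compat; lra|].
  exists N; intros n Hn. specialize (H n Hn).
  replace (c * u n - c * l)%C with (c * (u n - l))%C by ring. rewrite Cmod_mult.
  apply Rle_lt_trans with ((Cmod c) * (eps / (Cmod c + 1))).
  - apply Rmult_le_compat_l; lra.
  - apply Rlt_le_trans with ((Cmod c + 1) * (eps / (Cmod c + 1))).
    + apply Rmult_lt_compat_r; [apply Rdiv_lt_0_compat|]; lra.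
    + right; field; lra.
Qed.

Lemma clim_csum {A} (L : list A) (u : A -> nat -> C) l :
  (forall x, In x L -> clim (u x) (l x)) ->
  clim (fun n => csum L (fun x => u x n)) (csum L l).
Proof.
  induction L as [|a L IH]; intros H; simpl.
  - apply clim_const.
  - apply clim_plus; [apply H; simpl; auto|apply IH; intros; apply H; simpl; auto].
Qed.

Lemma clim_Cmod_le u l B : clim u l -> (forall N, exists n, (N <= n)%nat /\ Cmod (u n) <= B) ->
  Cmod l <= B.
Proof.
  intros H Hb. apply Rnot_lt_le; intros Hlt.
  destruct (H (Cmod l - B)) as [N HN]; [lra|].
  destruct (Hb N) as [n [Hn Hun]]. specialize (HN n Hn).
  generalize (Cmod_sub_le l (u n)). rewrite Cmod_sym. lra.
Qed.

Lemma summable_tail v S : summable v S -> forall eps, 0 < eps ->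
  exists N, forall n, (N <= n)%nat -> rsum (seq 0 n) v - rsum (seq 0 N) v <= eps.
Proof.
  intros [Hv HS] eps He.
  destruct (completeness (fun x => exists n, x = rsum (seq 0 n) v)) as [s [Hub Hl]].
  - exists S. intros x [n ->]. apply HS.
  - exists 0. exists 0%nat. reflexivity.
  - apply NNPP. intros Hno.
    assert (is_upper_bound (fun x => exists n, x = rsum (seq 0 n) v) (s - eps)).
    { intros x [N ->]. apply Rnot_lt_le. intros Hlt. apply Hno.
      exists N. intros n Hn. assert (rsum (seq 0 n) v <= s) by (apply Hub; exists n; auto). lra. }
    specialize (Hl _ H). lra.
Qed.

Lemma csum_diff_le (u : nat -> C) v N n : (N <= n)%nat -> (forall k, Cmod (u k) <= v k) ->
  Cmod (csum (seq 0 n) u - csum (seq 0 N) u) <= rsum (seq 0 n) v - rsum (seq 0 N) v.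
Proof.
  intros H Hv. induction H as [|m H IH].
  - rewrite Cminus_diag, Cmod_0; lra.
  - rewrite csum_S, rsum_S.
    replace (csum (seq 0 m) u + u m - csum (seq 0 N) u)%C
      with ((csum (seq 0 m) u - csum (seq 0 N) u) + u m)%C by ring.
    eapply Rle_trans; [apply Cmod_triangle|]. specialize (Hv m). lra.
Qed.

Lemma cauchy_clim (u : nat -> C) :
  (forall eps, 0 < eps -> exists N, forall n, (N <= n)%nat -> Cmod (u n - u N) <= eps) ->
  exists l, clim u l.
Proof.
  intros HC.
  assert (K : forall p : C -> R, (forall z w, Rabs (p z - p w) <= Cmod (z - w)) ->
            exists l, Un_cv (fun n => p (u n)) l).
  { intros p Hp. destruct (Rcomplete.R_complete (fun n => p (u n))) as [l Hl]; [|now exists l].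
    intros eps He. destruct (HC (eps / 3)) as [N HN]; [lra|].
    exists N. intros n m Hn Hm. unfold Rdist.
    generalize (Rabs_triang (p (u n) - p (u N)) (p (u N) - p (u m))).
    replace (p (u n) - p (u N) + (p (u N) - p (u m))) with (p (u n) - p (u m)) by ring.
    generalize (Hp (u n) (u N)) (Hp (u N) (u m)).
    specialize (HN n) as H1; specialize (HN m) as H2.
    rewrite (Cmod_sym (u N)). specialize (H1 ltac:(lia)). specialize (H2 ltac:(lia)). lra. }
  destruct (K fst) as [x Hx].
  { intros z w. apply (Rabs_fst_le (z - w)). }
  destruct (K snd) as [y Hy].
  { intros z w. apply (Rabs_snd_le (z - w)). }
  exists (x, y). intros eps He.
  destruct (Hx (eps / 2)) as [N1 H1]; [lra|]. destruct (Hy (eps / 2)) as [N2 H2]; [lra|].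
  exists (N1 + N2)%nat. intros n Hn.
  specialize (H1 n ltac:(lia)). specialize (H2 n ltac:(lia)). unfold Rdist in *.
  eapply Rle_lt_trans; [apply Cmod_le_abs|]. simpl. unfold Rminus in *. lra.
Qed.

Lemma summable_cseries u v S : summable v S -> (forall k, Cmod (u k) <= v k) ->
  exists l, cseries u l /\ Cmod l <= S.
Proof.
  intros Hs Hv. destruct (cauchy_clim (fun n => csum (seq 0 n) u)) as [l Hl].
  { intros eps He. destruct (summable_tail _ _ Hs eps He) as [N HN]. exists N.
    intros n Hn. eapply Rle_trans; [apply (csum_diff_le u v); auto|auto]. }
  exists l; split; [exact Hl|].
  apply (clim_Cmod_le _ _ _ Hl). intros N. exists N; split; [lia|].
  eapply Rle_trans; [apply Cmod_csum|]. eapply Rle_trans; [|apply (proj2 Hs N)].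
  apply rsum_le; auto.
Qed.

Lemma cseries_tail u v S l : summable v S -> (forall k, Cmod (u k) <= v k) -> cseries u l ->
  forall N eps, (forall n, (N <= n)%nat -> rsum (seq 0 n) v - rsum (seq 0 N) v <= eps) ->
  Cmod (l - csum (seq 0 N) u) <= eps.
Proof.
  intros Hs Hv Hl N eps HN.
  apply (clim_Cmod_le (fun n => csum (seq 0 n) u + - csum (seq 0 N) u)%C).
  - apply (clim_plus _ (fun _ => - csum (seq 0 N) u)%C); [exact Hl|apply clim_const].
  - intros K. exists (K + N)%nat; split; [lia|].
    eapply Rle_trans; [|apply (HN (K + N)%nat); lia].
    apply (csum_diff_le u v); auto; lia.
Qed.

Lemma cseries_ext u v l : (forall n, u n = v n) -> cseries u l -> cseries v l.
Proof.
  intros H. apply clim_ext. exists 0%nat; intros n _. apply csum_ext; auto.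
Qed.

Lemma cseries_plus u v l m : cseries u l -> cseries v m ->
  cseries (fun n => u n + v n)%C (l + m)%C.
Proof.
  intros Hu Hv. eapply clim_ext; [|apply (clim_plus _ _ _ _ Hu Hv)].
  exists 0%nat; intros n _. now rewrite csum_plus.
Qed.

Lemma cseries_scal c u l : cseries u l -> cseries (fun n => c * u n)%C (c * l)%C.
Proof.
  intros Hu. eapply clim_ext; [|apply (clim_scal c _ _ Hu)].
  exists 0%nat; intros n _. now rewrite csum_scal.
Qed.

Lemma cseries_csum {A} (L : list A) (u : A -> nat -> C) l :
  (forall x, In x L -> cseries (u x) (l x)) ->
  cseries (fun n => csum L (fun x => u x n)) (csum L l).
Proof.
  intros H. eapply clim_ext; [|apply (clim_csum L (fun x n => csum (seq 0 n) (u x)) l); exact H].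
  exists 0%nat; intros n _. apply csum_swap.
Qed.

Lemma summable_le v w S : summable w S -> (forall k, 0 <= v k <= w k) -> summable v S.
Proof.
  intros [Hw HS] H. split; [apply H|]. intros n.
  eapply Rle_trans; [|apply HS]. apply rsum_le; intros; apply H.
Qed.

Lemma summable_scal c v S : 0 <= c -> summable v S -> summable (fun k => c * v k) (c * S).
Proof.
  intros Hc [Hv HS]. split.
  - intros k; now apply Rmult_le_pos.
  - intros n. rewrite rsum_scal. now apply Rmult_le_compat_l.
Qed.

Lemma geom_partial q n : q <> 1 -> rsum (seq 0 n) (fun k => q ^ k) = (1 - q ^ n) / (1 - q).
Proof.
  intros Hq. induction n as [|n IH].
  - simpl; field; lra.
  - rewrite rsum_S, IH. simpl. field. lra.
Qed.

Lemma summable_geom q : 0 <= q < 1 -> summable (fun k => q ^ k) (/ (1 - q)).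
Proof.
  intros Hq. split; [intros; apply pow_le; lra|].
  intros n. rewrite geom_partial by lra. unfold Rdiv.
  rewrite <- (Rmult_1_l (/ (1 - q))) at 2. apply Rmult_le_compat_r.
  - apply Rlt_le, Rinv_0_lt_compat; lra.
  - generalize (pow_le q n (proj1 Hq)); lra.
Qed.

Lemma is_Cpseries_cseries c z s :
  is_Cpseries c z s <-> cseries (fun k => c k * Cpow z k)%C s.
Proof.
  assert (E : forall n, sum_n (fun k => scal (pow_n (z : C_AbsRing) k) (c k : C_NormedModule)) n
              = csum (seq 0 (S n)) (fun k => c k * Cpow z k)%C).
  { assert (P : forall k, pow_n (K := C_Ring) z k = Cpow z k)
      by (induction k as [|k IH]; simpl; [reflexivity|now rewrite <- IH]).
    induction n as [|n IH].
    - rewrite sum_O. simpl. unfold scal; simpl. unfold mult; simpl.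
      unfold one; simpl. ring.
    - rewrite sum_Sn, IH, (csum_S (S n)).
      change (csum (seq 0 (S n)) (fun k => c k * z ^ k) +
              pow_n (K := C_Ring) z (S n) * c (S n)
              = csum (seq 0 (S n)) (fun k => c k * z ^ k) + c (S n) * z ^ S n)%C.
      rewrite (P (S n)). ring. }
  split.
  - intros H eps He.
    assert (He2 : 0 < eps / 2) by lra.
    unfold is_Cpseries, is_pseries, is_series in H.
    destruct (H (fun y => Cmod (y - s) < eps)) as [N HN].
    { exists (mkposreal _ He2). intros y Hy.
      apply C_NormedModule_mixin_compat2 in Hy.
      change (Cmod (y - s) < sqrt 2 * (eps / 2)) in Hy.
      assert (sqrt 2 <= 2).
      { rewrite <- (sqrt_square 2) at 2 by lra. apply sqrt_le_1; lra. }
      assert (sqrt 2 * (eps/2) <= 2 * (eps / 2)) by (apply Rmult_le_compat_r; lra). lra. }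
    exists (S N). intros n Hn. destruct n as [|n]; [lia|].
    rewrite <- E. apply HN. lia.
  - intros H P [eps HP]. destruct (H eps (cond_pos eps)) as [N HN].
    exists N. intros n Hn. apply HP. apply C_NormedModule_mixin_compat1.
    change (Cmod (sum_n (fun k => scal (pow_n (z : C_AbsRing) k) (c k : C_NormedModule)) n - s) < eps).
    rewrite E. apply HN. lia.
Qed.

Lemma locally_Cmod (z : C) (P : C -> Prop) :
  @locally C_UniformSpace z P <-> exists r, 0 < r /\ forall y, Cmod (y - z) < r -> P y.
Proof.
  split.
  - intros [eps H]. exists eps; split; [apply cond_pos|]. intros y Hy.
    apply H. now apply C_NormedModule_mixin_compat1.
  - intros [r [Hr H]]. assert (Hr2 : 0 < r / 2) by lra.
    exists (mkposreal _ Hr2). intros y Hy. apply H.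
    apply C_NormedModule_mixin_compat2 in Hy.
    change (Cmod (y - z) < sqrt 2 * (r / 2)) in Hy.
    assert (sqrt 2 <= 2).
    { rewrite <- (sqrt_square 2) at 2 by lra. apply sqrt_le_1; lra. }
    assert (sqrt 2 * (r/2) <= 2 * (r / 2)) by (apply Rmult_le_compat_r; lra). lra.
Qed.

Lemma exp_INR_mult n x : exp (INR n * x) = exp x ^ n.
Proof.
  induction n as [|n IH]; [simpl; rewrite Rmult_0_l; apply exp_0|].
  rewrite S_INR, Rmult_plus_distr_r, Rmult_1_l, exp_plus, IH. simpl. ring.
Qed.

Lemma exp_le x y : x <= y -> exp x <= exp y.
Proof. intros [H|H]; [left; now apply exp_increasing|rewrite H; lra]. Qed.

Lemma INR_ge1 n : (0 < n)%nat -> 1 <= INR n.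
Proof. intros Hn. change 1 with (INR 1). now apply le_INR. Qed.

(** * Averages over roots of unity *)

Definition root_angle (M j : nat) : R := 2 * PI * INR j / INR M.

(** The mean over the [M]-th roots of unity; its limit in [M] plays the role of the integral of [h] over a circle. *)
Definition cavg (M : nat) (h : R -> C) : C :=
  (/ INR M * csum (seq 0 M) (fun j => h (root_angle M j)))%C.

Lemma cavg_ext M h g :
  (forall j, (j < M)%nat -> h (root_angle M j) = g (root_angle M j)) ->
  cavg M h = cavg M g.
Proof.
  intros H. unfold cavg. f_equal. apply csum_ext. intros j Hj. apply H.
  apply in_seq in Hj; lia.
Qed.

Lemma cavg_plus M h g : cavg M (fun t => h t + g t)%C = (cavg M h + cavg M g)%C.
Proof. unfold cavg. rewrite csum_plus. ring. Qed.

Lemma cavg_minus M h g : cavg M (fun t => h t - g t)%C = (cavg M h - cavg M g)%C.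
Proof. unfold cavg. rewrite csum_minus. ring. Qed.

Lemma cavg_scal M c h : cavg M (fun t => c * h t)%C = (c * cavg M h)%C.
Proof. unfold cavg. rewrite csum_scal. ring. Qed.

Lemma cavg_csum {A} M (l : list A) h :
  cavg M (fun t => csum l (fun x => h x t)) = csum l (fun x => cavg M (h x)).
Proof. unfold cavg. rewrite csum_swap, <- csum_scal. reflexivity. Qed.

Lemma cavg_const M c : (0 < M)%nat -> cavg M (fun _ => c) = c.
Proof.
  intros H. unfold cavg. rewrite csum_const, length_seq.
  assert (INR M <> 0) by (apply not_0_INR; lia).
  field. intros E. apply RtoC_inj in E. auto.
Qed.

Lemma cavg_le M h (b : R -> R) :
  (forall j, (j < M)%nat ->
     Cmod (h (root_angle M j)) <= b (root_angle M j)) ->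
  Cmod (cavg M h) <= / INR M * rsum (seq 0 M) (fun j => b (root_angle M j)).
Proof.
  intros H. unfold cavg.
  destruct M as [|M]; [simpl; rewrite Cmult_0_r, Cmod_0; lra|].
  assert (0 < INR (S M)) by (apply lt_0_INR; lia).
  rewrite Cmod_mult, Cmod_inv by (intros E; apply RtoC_inj in E; lra).
  rewrite Cmod_R, Rabs_pos_eq by lra.
  apply Rmult_le_compat_l; [apply Rlt_le, Rinv_0_lt_compat; auto|].
  eapply Rle_trans; [apply Cmod_csum|]. apply rsum_le. intros j Hj. apply H.
  apply in_seq in Hj; lia.
Qed.

Lemma cavg_le_const M h B : 0 <= B ->
  (forall j, (j < M)%nat -> Cmod (h (root_angle M j)) <= B) ->
  Cmod (cavg M h) <= B.
Proof.
  intros HB H. eapply Rle_trans; [apply (cavg_le M h (fun _ => B)); exact H|].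
  rewrite rsum_const, length_seq. destruct M as [|M]; [simpl; lra|].
  assert (0 < INR (S M)) by (apply lt_0_INR; lia). right; field; lra.
Qed.

Lemma cis_neq_1 t : 0 < t < 2 * PI -> cis t <> 1%C.
Proof.
  intros Ht E. assert (Ec : cos t = 1) by (apply (f_equal fst) in E; exact E).
  replace t with (2 * (t / 2)) in Ec by field. rewrite cos_2a_sin in Ec.
  assert (0 < sin (t / 2)) by (apply sin_gt_0; lra).
  nra.
Qed.

Lemma cavg_cis_pos M k : (0 < k < M)%nat -> cavg M (fun t => cis (INR k * t)) = 0%C.
Proof.
  intros Hk. unfold cavg.
  assert (HM : 0 < INR M) by (apply lt_0_INR; lia).
  set (q := cis (2 * PI * INR k / INR M)).
  assert (Hq : q <> 1%C).
  { apply cis_neq_1. generalize PI_RGT_0; intros HP.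
    assert (0 < INR k) by (apply lt_0_INR; lia).
    assert (INR k < INR M) by (apply lt_INR; lia).
    split.
    - apply Rdiv_lt_0_compat; nra.
    - apply Rmult_lt_reg_r with (INR M); auto. unfold Rdiv.
      rewrite Rmult_assoc, Rinv_l, Rmult_1_r by lra. nra. }
  assert (HqM : Cpow q M = 1%C).
  { unfold q. rewrite cis_pow. rewrite <- (cis_2PI k). f_equal. field. lra. }
  rewrite (csum_ext _ _ (fun j => Cpow q j)).
  2:{ intros j _. unfold q, root_angle. rewrite cis_pow. f_equal. field. lra. }
  assert (G : forall n, ((q - 1) * csum (seq 0 n) (fun j => Cpow q j) = Cpow q n - 1)%C).
  { induction n as [|n IH]; [simpl; ring|].
    rewrite csum_S, Cmult_plus_distr_l, IH, Cpow_S. ring. }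
  specialize (G M). rewrite HqM in G.
  assert (Hq1 : (q - 1)%C <> 0%C).
  { intros E. apply Hq. replace q with (q - 1 + 1)%C by ring. rewrite E; ring. }
  replace (csum (seq 0 M) (fun j => Cpow q j)) with (RtoC 0); [ring|].
  symmetry. replace (csum (seq 0 M) (fun j => Cpow q j))
    with ((q - 1) * csum (seq 0 M) (fun j => Cpow q j) / (q - 1))%C by (field; auto).
  rewrite G. field. auto.
Qed.

Lemma Cconj_cis t : Cconj (cis t) = cis (- t).
Proof. unfold cis, Cconj; simpl. now rewrite cos_neg, sin_neg. Qed.

Lemma Cconj_csum {A} (l : list A) f : Cconj (csum l f) = csum l (fun x => Cconj (f x)).
Proof.
  induction l as [|a l IH]; simpl.
  - unfold Cconj; simpl. apply injective_projections; simpl; ring.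
  - rewrite <- IH. unfold Cconj; simpl. apply injective_projections; simpl; ring.
Qed.

Lemma cavg_cis_Z M k : (0 < Z.abs k < Z.of_nat M)%Z ->
  cavg M (fun t => cis (IZR k * t)) = 0%C.
Proof.
  intros Hk. destruct (Z.le_gt_cases 0 k) as [H|H].
  - rewrite <- (cavg_cis_pos M (Z.to_nat k)) by lia.
    apply cavg_ext; intros. rewrite INR_IZR_INZ, Z2Nat.id by lia. reflexivity.
  - assert (E := cavg_cis_pos M (Z.to_nat (- k)) ltac:(lia)).
    unfold cavg in *. apply (f_equal Cconj) in E.
    rewrite Cmult_conj, Cconj_csum in E.
    replace (Cconj (/ INR M)) with (/ INR M)%C in E.
    2:{ rewrite <- RtoC_inv by (apply not_0_INR; lia). unfold Cconj, RtoC; simpl. f_equal; ring. }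
    replace (Cconj 0) with (RtoC 0) in E by (unfold Cconj, RtoC; simpl; f_equal; ring).
    rewrite <- E. f_equal. apply csum_ext. intros j _.
    rewrite Cconj_cis. f_equal.
    rewrite (INR_IZR_INZ (Z.to_nat (- k))), Z2Nat.id, opp_IZR by lia. ring.
Qed.

(** Averaging recovers the coefficients of an absolutely convergent Fourier series. *)
Lemma cavg_fourier (u : nat -> C) v B (F : R -> C) q :
  summable v B -> (forall k, Cmod (u k) <= v k) ->
  (forall t, cseries (fun k => u k * cis (INR k * t))%C (F t)) ->
  clim (fun M => cavg M (fun t => F t * cis (- (INR q * t)))%C) (u q).
Proof.
  intros Hs Hv HF eps He.
  destruct (summable_tail _ _ Hs (eps / 2)) as [K HK]; [lra|].
  set (K' := (K + q + 1)%nat).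
  assert (HK' : forall n, (K' <= n)%nat -> rsum (seq 0 n) v - rsum (seq 0 K') v <= eps / 2).
  { intros n Hn. specialize (HK n ltac:(unfold K' in *; lia)).
    generalize (rsum_seq_mono K K' v ltac:(unfold K'; lia) (proj1 Hs)). lra. }
  exists (K' + 1)%nat. intros M HM.
  assert (E : cavg M (fun t => csum (seq 0 K') (fun k => u k * cis (INR k * t)) * cis (- (INR q * t)))%C = u q).
  { rewrite (cavg_ext _ _ (fun t => csum (seq 0 K') (fun k => u k * cis (IZR (Z.of_nat k - Z.of_nat q) * t)))%C).
    2:{ intros j _. rewrite <- csum_scal_r. apply csum_ext. intros k _.
        rewrite <- Cmult_assoc, <- cis_plus. f_equal. f_equal.
        rewrite minus_IZR, <- !INR_IZR_INZ. ring. }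
    rewrite cavg_csum.
    assert (Q : forall n, csum (seq 0 n) (fun k => cavg M (fun t => u k * cis (IZR (Z.of_nat k - Z.of_nat q) * t)))%C
       = if Nat.ltb q n then (if Nat.leb n M then u q else csum (seq 0 n) (fun k => cavg M (fun t => u k * cis (IZR (Z.of_nat k - Z.of_nat q) * t)))%C) else
          if Nat.leb n M then 0%C else csum (seq 0 n) (fun k => cavg M (fun t => u k * cis (IZR (Z.of_nat k - Z.of_nat q) * t)))%C).
    { induction n as [|n IH]; [simpl; reflexivity|].
      destruct (Nat.leb (S n) M) eqn:EM; [|now destruct (Nat.ltb q (S n))].
      apply Nat.leb_le in EM.
      rewrite csum_S, IH. replace (Nat.leb n M) with true by (symmetry; apply Nat.leb_le; lia).
      rewrite cavg_scal.
      destruct (lt_eq_lt_dec q n) as [[Hlt|Heq]|Hgt].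
      - replace (Nat.ltb q n) with true by (symmetry; apply Nat.ltb_lt; lia).
        replace (Nat.ltb q (S n)) with true by (symmetry; apply Nat.ltb_lt; lia).
        rewrite cavg_cis_Z by lia. ring.
      - subst n. rewrite Nat.ltb_irrefl.
        replace (Nat.ltb q (S q)) with true by (symmetry; apply Nat.ltb_lt; lia).
        rewrite (cavg_ext _ _ (fun _ => 1%C)), cavg_const by
          (try lia; intros; rewrite Z.sub_diag, Rmult_0_l; apply cis_0). ring.
      - replace (Nat.ltb q n) with false by (symmetry; apply Nat.ltb_ge; lia).
        replace (Nat.ltb q (S n)) with false by (symmetry; apply Nat.ltb_ge; lia).
        rewrite cavg_cis_Z by (unfold K' in *; lia). ring. }
    rewrite Q. replace (Nat.ltb q K') with true by (symmetry; apply Nat.ltb_lt; unfold K'; lia).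
    now replace (Nat.leb K' M) with true by (symmetry; apply Nat.leb_le; lia). }
  rewrite <- E. replace (cavg M (fun t => F t * cis (- (INR q * t)))%C -
    cavg M (fun t => csum (seq 0 K') (fun k => u k * cis (INR k * t)) * cis (- (INR q * t)))%C)%C
    with (cavg M (fun t => (F t - csum (seq 0 K') (fun k => u k * cis (INR k * t))%C) * cis (- (INR q * t)))%C).
  2:{ rewrite <- cavg_minus. apply cavg_ext; intros; ring. }
  apply Rle_lt_trans with (eps / 2); [|lra].
  apply cavg_le_const; [lra|]. intros j _.
  rewrite Cmod_mult, Cmod_cis, Rmult_1_r.
  apply (cseries_tail (fun k => u k * cis (INR k * root_angle M j))%C v B); auto.
  intros k. rewrite Cmod_mult, Cmod_cis, Rmult_1_r. apply Hv.
Qed.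

(** * Residues by averaging over a circle *)

(** What the residue theorem on [|v| = R] gives for [F] holomorphic on the closed disc: the vanishing of the
   integrals of [v ^ (k - 1) * F v], and Cauchy's formula at each [mu] off the circle. Functions built from affine
   factors and exponentials have this property by closure, without any complex integration. *)
Definition has_residues (R : R) (F : C -> C) : Prop :=
  (forall k, (1 <= k)%nat ->
     clim (fun M => cavg M (fun t => (R * cis t) ^ k * F (R * cis t))%C) 0%C) /\
  (forall mu, Cmod mu <> R ->
     clim (fun M => cavg M (fun t => R * cis t * F (R * cis t) / (R * cis t - mu))%C)
          (if Rlt_dec (Cmod mu) R then F mu else 0%C)).

Lemma Cmod_circle R t : 0 <= R -> Cmod (R * cis t) = R.
Proof. intros H. rewrite Cmod_mult, Cmod_cis, Cmod_R, Rabs_pos_eq; lra. Qed.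

Lemma Cneq_of_Cmod (x y : C) : Cmod x <> Cmod y -> (x - y)%C <> 0%C.
Proof.
  intros H E. apply H. replace x with (x - y + y)%C by ring. rewrite E. f_equal; ring.
Qed.

Lemma pow_quot_lim q c : 0 <= q < 1 -> 0 < c ->
  exists N, forall n, (N <= n)%nat -> q ^ n < c /\ q ^ n <= 1 / 2.
Proof.
  intros Hq Hc. destruct (pow_lt_1_zero q) with (y := Rmin c (1/2)) as [N HN].
  - rewrite Rabs_pos_eq; lra.
  - apply Rmin_pos; lra.
  - exists N. intros n Hn. specialize (HN n Hn).
    rewrite Rabs_pos_eq in HN by (apply pow_le; lra).
    generalize (Rmin_l c (1/2)) (Rmin_r c (1/2)); lra.
Qed.

(** Since [v ^ M = R ^ M] at all nodes, [v / (v - mu)] equals the sum of [v ^ (M - i) * mu ^ i] over [i < M],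
   divided by [R ^ M - mu ^ M]; only the term [i = 0] has a nonzero mean. *)
Lemma has_residues_1 R : 0 < R -> has_residues R (fun _ => 1%C).
Proof.
  intros HR. split.
  - intros k Hk. eapply clim_ext; [|apply clim_const]. exists (S k). intros M HM.
    rewrite (cavg_ext _ _ (fun t => (RtoC R) ^ k * cis (INR k * t))%C).
    2:{ intros. rewrite Cpow_mult_l, cis_pow. ring. }
    rewrite cavg_scal, cavg_cis_pos by lia. ring.
  - intros mu Hmu.
    assert (Hv : forall t, (R * cis t - mu)%C <> 0%C).
    { intros t. apply Cneq_of_Cmod. rewrite Cmod_circle by lra. auto. }
    assert (Fac : forall (v : C) M, (csum (seq 0 M) (fun i => v ^ (M - i) * mu ^ i) * (v - mu) = v * (v ^ M - mu ^ M))%C).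
    { intros v M. induction M as [|M IH]; [simpl; ring|].
      rewrite csum_S. replace (S M - M)%nat with 1%nat by lia.
      rewrite (csum_ext _ _ (fun i => v * (v ^ (M - i) * mu ^ i))%C).
      2:{ intros i Hi. apply in_seq in Hi. replace (S M - i)%nat with (S (M - i)) by lia.
          rewrite Cpow_S; ring. }
      rewrite csum_scal.
      replace ((v * csum (seq 0 M) (fun i => v ^ (M - i) * mu ^ i) + v ^ 1 * mu ^ M) * (v - mu))%C
        with (v * (csum (seq 0 M) (fun i => v ^ (M - i) * mu ^ i) * (v - mu)) + v * mu ^ M * (v - mu))%C
        by (simpl; ring).
      rewrite IH, !Cpow_S. ring. }
    assert (HP : forall M, (0 < M)%nat -> ((RtoC R) ^ M - mu ^ M)%C <> 0%C).
    { intros M HM. apply Cneq_of_Cmod. rewrite !Cmod_pow, Cmod_R, Rabs_pos_eq by lra.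
      intros E. apply Hmu. symmetry. apply (Rle_antisym R (Cmod mu)).
      - apply Rnot_lt_le; intros H. generalize (Cmod_ge_0 mu); intros.
        assert (Cmod mu ^ M < R ^ M); [|lra].
        { clear - H HM H0. destruct M; [lia|]. clear HM. induction M as [|M IH]; [simpl; lra|].
          rewrite <- tech_pow_Rmult, <- (tech_pow_Rmult R).
          apply Rmult_le_0_lt_compat; auto. apply pow_le; auto. }
      - apply Rnot_lt_le; intros H.
        assert (R ^ M < Cmod mu ^ M); [|lra].
        { clear - H HM HR. destruct M; [lia|]. clear HM. induction M as [|M IH]; [simpl; lra|].
          rewrite <- tech_pow_Rmult, <- (tech_pow_Rmult (Cmod mu)).
          apply Rmult_le_0_lt_compat; auto; [lra|]. apply pow_le; lra. } }
    assert (HA : forall M, (0 < M)%nat ->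
       cavg M (fun t => R * cis t * 1 / (R * cis t - mu))%C = ((RtoC R) ^ M / ((RtoC R) ^ M - mu ^ M))%C).
    { intros M HM.
      rewrite (cavg_ext _ _ (fun t => / ((RtoC R) ^ M - mu ^ M) * csum (seq 0 M) (fun i => (R * cis t) ^ (M - i) * mu ^ i))%C).
      2:{ intros j Hj. set (t := root_angle M j).
          assert (E : ((R * cis t) ^ M = (RtoC R) ^ M)%C).
          { rewrite Cpow_mult_l, cis_pow. unfold t, root_angle.
            replace (INR M * (2 * PI * INR j / INR M)) with (2 * PI * INR j)
              by (field; apply not_0_INR; lia). rewrite cis_2PI. ring. }
          specialize (Fac (R * cis t)%C M). rewrite E in Fac.
          replace (csum (seq 0 M) (fun i => (R * cis t) ^ (M - i) * mu ^ i)%C)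
            with (R * cis t * (R ^ M - mu ^ M) / (R * cis t - mu))%C.
          - field. split; auto.
          - rewrite <- Fac. field. auto. }
      rewrite cavg_scal, cavg_csum. unfold Cdiv.
      rewrite (Cmult_comm ((RtoC R) ^ M)%C). f_equal.
      destruct M as [|M]; [lia|]. simpl seq. cbn [csum].
      rewrite csum_0.
      - rewrite (cavg_ext _ _ (fun _ => (RtoC R) ^ S M)%C); [rewrite cavg_const by lia; ring|].
        intros j Hj. rewrite Nat.sub_0_r. simpl (mu ^ 0)%C.
        rewrite Cpow_mult_l, cis_pow. unfold root_angle.
        replace (INR (S M) * (2 * PI * INR j / INR (S M))) with (2 * PI * INR j)
              by (field; apply not_0_INR; lia). rewrite cis_2PI. ring.
      - intros i Hi. apply in_seq in Hi.
        rewrite (cavg_ext _ _ (fun t => ((RtoC R) ^ (S M - i) * mu ^ i) * cis (INR (S M - i) * t))%C).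
        2:{ intros. rewrite Cpow_mult_l, cis_pow. ring. }
        rewrite cavg_scal, cavg_cis_pos by lia. ring. }
    intros eps He.
    destruct (Rlt_dec (Cmod mu) R) as [Hlt|Hge].
    + set (q := Cmod mu / R).
      assert (Hq : 0 <= q < 1).
      { unfold q. generalize (Cmod_ge_0 mu); intros. split.
        - apply Rmult_le_pos; auto. apply Rlt_le, Rinv_0_lt_compat; lra.
        - apply Rlt_div_l; [auto|lra]. }
      destruct (pow_quot_lim q (eps / 2) Hq) as [N HN]; [lra|].
      exists (S N). intros M HM. rewrite HA by lia. destruct (HN M ltac:(lia)) as [H1 H2].
      replace (R ^ M / (R ^ M - mu ^ M) - 1)%C with (mu ^ M / (R ^ M - mu ^ M))%C
        by (field; apply HP; lia).
      rewrite Cmod_div by (apply HP; lia).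
      generalize (Cmod_sub_le ((RtoC R) ^ M) (mu ^ M)). rewrite !Cmod_pow, Cmod_R, Rabs_pos_eq by lra.
      intros H3. assert (HRM : 0 < R ^ M) by (apply pow_lt; lra).
      assert (Eq : Cmod mu ^ M = q ^ M * R ^ M).
      { unfold q. rewrite <- Rpow_mult_distr. f_equal. field; lra. }
      assert (R ^ M / 2 <= Cmod (R ^ M - mu ^ M)) by (rewrite Eq in H3; nra).
      apply Rlt_le_trans with ((eps / 2 * R ^ M) / (R ^ M / 2)); [|right; field; lra].
      rewrite Eq. unfold Rdiv at 1 3.
      apply Rle_lt_trans with (q ^ M * R ^ M * / (R ^ M / 2)).
      * apply Rmult_le_compat_l; [apply Rmult_le_pos; [apply pow_le; lra|lra]|].
        apply Rinv_le_contravar; lra.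
      * apply Rmult_lt_compat_r; [apply Rinv_0_lt_compat; lra|]. apply Rmult_lt_compat_r; lra.
    + assert (Hgt : R < Cmod mu) by lra.
      set (q := R / Cmod mu).
      assert (Hq : 0 <= q < 1).
      { unfold q. split.
        - apply Rmult_le_pos; [lra|]. apply Rlt_le, Rinv_0_lt_compat; lra.
        - apply Rlt_div_l; [lra|lra]. }
      destruct (pow_quot_lim q (eps / 2) Hq) as [N HN]; [lra|].
      exists (S N). intros M HM. rewrite HA by lia. destruct (HN M ltac:(lia)) as [H1 H2].
      replace (R ^ M / (R ^ M - mu ^ M) - 0)%C with (R ^ M / (R ^ M - mu ^ M))%C by ring.
      rewrite Cmod_div by (apply HP; lia).
      generalize (Cmod_sub_le (mu ^ M) ((RtoC R) ^ M)).
      rewrite (Cmod_sym (mu ^ M)). rewrite !Cmod_pow, Cmod_R, Rabs_pos_eq by lra.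
      intros H3. assert (HRM : 0 < Cmod mu ^ M) by (apply pow_lt; lra).
      assert (Eq : R ^ M = q ^ M * Cmod mu ^ M).
      { unfold q. rewrite <- Rpow_mult_distr. f_equal. field; lra. }
      assert (Cmod mu ^ M / 2 <= Cmod (R ^ M - mu ^ M)) by (rewrite Eq in H3; nra).
      apply Rlt_le_trans with ((eps / 2 * Cmod mu ^ M) / (Cmod mu ^ M / 2)); [|right; field; lra].
      rewrite Eq. unfold Rdiv at 1 3.
      apply Rle_lt_trans with (q ^ M * Cmod mu ^ M * / (Cmod mu ^ M / 2)).
      * apply Rmult_le_compat_l; [apply Rmult_le_pos; [apply pow_le; lra|lra]|].
        apply Rinv_le_contravar; lra.
      * apply Rmult_lt_compat_r; [apply Rinv_0_lt_compat; lra|]. apply Rmult_lt_compat_r; lra.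
Qed.

(** [(a + b * v) / (v - mu) = (a + b * mu) / (v - mu) + b]. *)
Lemma has_residues_affine R a b F : 0 < R -> has_residues R F ->
  has_residues R (fun v => (a + b * v) * F v)%C.
Proof.
  intros HR [H1 H2]. split.
  - intros k Hk. replace (RtoC 0) with (a * 0 + b * 0)%C by ring.
    eapply clim_ext; [|apply clim_plus; [apply (clim_scal a _ _ (H1 k Hk))|apply (clim_scal b _ _ (H1 (S k) ltac:(lia)))]].
    exists 0%nat; intros M _. rewrite <- !cavg_scal, <- cavg_plus. apply cavg_ext; intros.
    rewrite Cpow_S. ring.
  - intros mu Hmu.
    assert (Hv : forall t, (R * cis t - mu)%C <> 0%C).
    { intros t. apply Cneq_of_Cmod. rewrite Cmod_circle by lra. auto. }
    replace (if Rlt_dec (Cmod mu) R then ((a + b * mu) * F mu)%C else 0%C)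
      with ((a + b * mu) * (if Rlt_dec (Cmod mu) R then F mu else 0%C) + b * 0)%C
      by (destruct (Rlt_dec (Cmod mu) R); ring).
    eapply clim_ext; [|apply clim_plus; [apply (clim_scal (a + b * mu)%C _ _ (H2 mu Hmu))|apply (clim_scal b _ _ (H1 1%nat ltac:(lia)))]].
    exists 0%nat; intros M _. rewrite <- !cavg_scal, <- cavg_plus. apply cavg_ext; intros.
    rewrite Cpow_1_r. field. auto.
Qed.

Lemma clim_approx (u : nat -> C) l :
  (forall eps, 0 < eps -> exists v m, clim v m /\ Cmod (m - l) <= eps /\
     forall n, Cmod (u n - v n) <= eps) -> clim u l.
Proof.
  intros H eps He. destruct (H (eps / 4)) as [v [m [Hv [Hm Huv]]]]; [lra|].
  destruct (Hv (eps / 4)) as [N HN]; [lra|]. exists N. intros n Hn.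
  specialize (HN n Hn). specialize (Huv n).
  replace (u n - l)%C with ((u n - v n) + ((v n - m) + (m - l)))%C by ring.
  eapply Rle_lt_trans; [apply Cmod_triangle|].
  generalize (Cmod_triangle (v n - m) (m - l)). lra.
Qed.

Lemma has_residues_unif R F : 0 < R ->
  (forall eps, 0 < eps -> exists G, has_residues R G /\
     forall v, Cmod v <= R -> Cmod (F v - G v) <= eps) -> has_residues R F.
Proof.
  intros HR H. split.
  - intros k Hk. apply clim_approx. intros eps He.
    assert (HRk : 0 < R ^ k) by (apply pow_lt; auto).
    destruct (H (eps / R ^ k)) as [G [[G1 _] HG]]; [apply Rdiv_lt_0_compat; lra|].
    exists (fun M => cavg M (fun t => (R * cis t) ^ k * G (R * cis t))%C), 0%C.
    split; [apply G1; auto|]. split; [rewrite Cminus_diag, Cmod_0; lra|].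
    intros M.
    replace (cavg M (fun t => (R * cis t) ^ k * F (R * cis t))%C - cavg M (fun t => (R * cis t) ^ k * G (R * cis t))%C)%C
      with (cavg M (fun t => (R * cis t) ^ k * (F (R * cis t) - G (R * cis t)))%C).
    2:{ rewrite <- cavg_minus. apply cavg_ext; intros; ring. }
    apply cavg_le_const; [lra|]. intros j _.
    rewrite Cmod_mult, Cmod_pow, Cmod_circle by lra.
    apply Rle_trans with (R ^ k * (eps / R ^ k)); [|right; field; lra].
    apply Rmult_le_compat_l; [lra|]. apply HG. rewrite Cmod_circle; lra.
  - intros mu Hmu. apply clim_approx. intros eps He.
    assert (Hd : 0 < Rabs (R - Cmod mu)) by (apply Rabs_pos_lt; lra).
    set (d := Rabs (R - Cmod mu)) in *.
    assert (He' : 0 < Rmin eps (eps * d / R)) by (apply Rmin_pos; [lra|apply Rdiv_lt_0_compat; nra]).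
    destruct (H _ He') as [G [[_ G2] HG]].
    exists (fun M => cavg M (fun t => R * cis t * G (R * cis t) / (R * cis t - mu))%C),
      (if Rlt_dec (Cmod mu) R then G mu else 0%C).
    split; [apply G2; auto|]. split.
    { destruct (Rlt_dec (Cmod mu) R).
      - rewrite Cmod_sym. eapply Rle_trans; [apply HG; lra|]. apply Rmin_l.
      - rewrite Cminus_diag, Cmod_0; lra. }
    assert (Hv : forall t, (R * cis t - mu)%C <> 0%C).
    { intros t. apply Cneq_of_Cmod. rewrite Cmod_circle by lra. auto. }
    intros M.
    replace (cavg M (fun t => R * cis t * F (R * cis t) / (R * cis t - mu))%C -
       cavg M (fun t => R * cis t * G (R * cis t) / (R * cis t - mu))%C)%C
      with (cavg M (fun t => R * cis t * (F (R * cis t) - G (R * cis t)) / (R * cis t - mu))%C).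
    2:{ rewrite <- cavg_minus. apply cavg_ext; intros. field. auto. }
    apply cavg_le_const; [lra|]. intros j _. set (t := root_angle M j).
    rewrite Cmod_div by auto. rewrite Cmod_mult, Cmod_circle by lra.
    assert (Hd' : d <= Cmod (R * cis t - mu)).
    { unfold d. apply Rabs_le. generalize (Cmod_sub_le (R * cis t) mu) (Cmod_sub_le mu (R * cis t)).
      rewrite (Cmod_sym mu), Cmod_circle by lra. lra. }
    assert (HGt := HG (R * cis t)%C ltac:(rewrite Cmod_circle; lra)).
    generalize (Rmin_r eps (eps * d / R)); intros Hm.
    apply Rle_trans with (R * (eps * d / R) / d); [|right; field; lra].
    unfold Rdiv at 1 2. apply Rmult_le_compat.
    + apply Rmult_le_pos; [lra|apply Cmod_ge_0].
    + apply Rlt_le, Rinv_0_lt_compat; lra.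
    + apply Rmult_le_compat_l; lra.
    + apply Rinv_le_contravar; lra.
Qed.

Lemma has_residues_ext R F G : (forall v, F v = G v) -> has_residues R F -> has_residues R G.
Proof.
  intros E [H1 H2]. split.
  - intros k Hk. eapply clim_ext; [|apply (H1 k Hk)]. exists 0%nat; intros M _.
    apply cavg_ext; intros; now rewrite E.
  - intros mu Hmu. rewrite <- E. eapply clim_ext; [|apply (H2 mu Hmu)]. exists 0%nat; intros M _.
    apply cavg_ext; intros; now rewrite E.
Qed.

Lemma has_residues_scal R c F : 0 < R -> has_residues R F -> has_residues R (fun v => c * F v)%C.
Proof.
  intros HR H. eapply has_residues_ext; [|apply (has_residues_affine R c 0%C F HR H)].
  intros v. simpl. ring.
Qed.

Lemma has_residues_prod {A} R (l : list A) (a b : A -> C) F : 0 < R -> has_residues R F ->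
  has_residues R (fun v => cprod l (fun x => a x + b x * v) * F v)%C.
Proof.
  intros HR HF. induction l as [|x l IH]; simpl.
  - eapply has_residues_ext; [|apply HF]. intros v; ring.
  - eapply has_residues_ext; [|apply (has_residues_affine R (a x) (b x) _ HR IH)].
    intros v; simpl; ring.
Qed.

Lemma exp_MVT a : exists c, Rabs c <= Rabs a /\ exp a - 1 = exp c * a.
Proof.
  destruct (Rtotal_order a 0) as [H|[H|H]].
  - destruct (MVT_cor2 exp exp a 0 H) as [c [E Hc]]; [intros; apply derivable_pt_lim_exp|].
    exists c. rewrite exp_0 in E. split; [rewrite !Rabs_left; lra|lra].
  - exists 0. subst. rewrite exp_0. split; lra.
  - destruct (MVT_cor2 exp exp 0 a H) as [c [E Hc]]; [intros; apply derivable_pt_lim_exp|].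
    exists c. rewrite exp_0 in E. split; [rewrite !Rabs_pos_eq; lra|lra].
Qed.

Lemma sin_MVT a : exists c, Rabs c <= Rabs a /\ sin a = cos c * a.
Proof.
  destruct (Rtotal_order a 0) as [H|[H|H]].
  - destruct (MVT_cor2 sin cos a 0 H) as [c [E Hc]]; [intros; apply derivable_pt_lim_sin|].
    exists c. rewrite sin_0 in E. split; [rewrite !Rabs_left; lra|lra].
  - exists 0. subst. rewrite sin_0. split; lra.
  - destruct (MVT_cor2 sin cos 0 a H) as [c [E Hc]]; [intros; apply derivable_pt_lim_sin|].
    exists c. rewrite sin_0 in E. split; [rewrite !Rabs_pos_eq; lra|lra].
Qed.

Lemma Rabs_sin_le a : Rabs (sin a) <= Rabs a.
Proof.
  destruct (sin_MVT a) as [c [_ ->]]. rewrite Rabs_mult.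
  generalize (COS_bound c) (Rabs_pos a); intros.
  assert (Rabs (cos c) <= 1) by (apply Rabs_le; lra). nra.
Qed.

Lemma one_minus_cos a : 0 <= 1 - cos a <= a * a / 2.
Proof.
  generalize (COS_bound a); intros. split; [lra|].
  replace a with (2 * (a / 2)) at 1 by field. rewrite cos_2a_sin.
  generalize (Rabs_sin_le (a / 2)); intros.
  assert (sin (a/2) * sin (a/2) <= (a/2)*(a/2)).
  { apply Rsqr_le_abs_1 in H0. exact H0. }
  lra.
Qed.

Lemma exp_le_3_of_le_1 a : a <= 1 -> exp a <= 3.
Proof.
  intros H. apply Rle_trans with (exp 1); [|apply exp_le_3].
  now apply exp_le.
Qed.

Lemma Cexp_taylor1 h : Cmod h <= 1 -> Cmod (Cexp h - (1 + h)) <= 20 * (Cmod h * Cmod h).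
Proof.
  intros Hh. destruct h as [a b]. set (r := Cmod (a, b)) in *.
  assert (Ha : Rabs a <= r) by apply (Rabs_fst_le (a, b)).
  assert (Hb : Rabs b <= r) by apply (Rabs_snd_le (a, b)).
  assert (Hr : 0 <= r) by apply Cmod_ge_0.
  destruct (exp_MVT a) as [c [Hc Ec]]. destruct (exp_MVT c) as [d [Hd Ed]].
  destruct (sin_MVT b) as [e [He Ee]].
  assert (Hexp : forall x, Rabs x <= r -> 0 < exp x <= 3).
  { intros x Hx. split; [apply exp_pos|]. apply exp_le_3_of_le_1. generalize (Rle_abs x); lra. }
  assert (X1 : Rabs (exp a - 1 - a) <= 3 * (r * r)).
  { replace (exp a - 1 - a) with (exp d * (c * a)).
    - rewrite !Rabs_mult, (Rabs_pos_eq (exp d)) by (apply Rlt_le, exp_pos).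
      generalize (Hexp d ltac:(lra)) (Rabs_pos c) (Rabs_pos a); intros.
      assert (Rabs c * Rabs a <= r * r) by (apply Rmult_le_compat; lra).
      apply Rmult_le_compat; try lra. apply Rmult_le_pos; lra.
    - rewrite Ec. rewrite <- Rmult_assoc, <- Ed. ring. }
  assert (X0 : Rabs (exp a - 1) <= 3 * r).
  { rewrite Ec, Rabs_mult, (Rabs_pos_eq (exp c)) by (apply Rlt_le, exp_pos).
    apply Rmult_le_compat; try lra; [apply Rlt_le, exp_pos|apply Rabs_pos|apply Hexp; lra]. }
  assert (Y1 : Rabs (cos b - 1) <= r * r / 2).
  { rewrite Rabs_minus_sym, Rabs_pos_eq by apply one_minus_cos.
    generalize (one_minus_cos b). assert (b * b <= r * r); [|lra].
    { apply Rsqr_le_abs_1. rewrite (Rabs_pos_eq r); lra. } }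
  assert (Y2 : Rabs (sin b - b) <= r * r).
  { rewrite Ee. replace (cos e * b - b) with (- ((1 - cos e) * b)) by ring.
    rewrite Rabs_Ropp, Rabs_mult, Rabs_pos_eq by apply one_minus_cos.
    assert (e * e <= r * r).
    { apply Rsqr_le_abs_1. rewrite (Rabs_pos_eq r); lra. }
    generalize (one_minus_cos e) (Rabs_pos b); intros. nra. }
  eapply Rle_trans; [apply Cmod_le_abs|]. unfold Cexp, cis; simpl.
  assert (Z1 : Rabs (exp a * cos b - 0 * sin b + - (1 + a)) <= 3 * (r * r) + 3 * (r * r)).
  { replace (exp a * cos b - 0 * sin b + - (1 + a)) with ((exp a - 1 - a) + exp a * (cos b - 1)) by ring.
    eapply Rle_trans; [apply Rabs_triang|]. apply Rplus_le_compat; [lra|].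
    rewrite Rabs_mult, (Rabs_pos_eq (exp a)) by (apply Rlt_le, exp_pos).
    generalize (Hexp a ltac:(lra)) (Rabs_pos (cos b - 1)); intros. nra. }
  assert (Z2 : Rabs (exp a * sin b + 0 * cos b + - (0 + b)) <= 3 * (r * r) + 3 * (r * r)).
  { replace (exp a * sin b + 0 * cos b + - (0 + b)) with (exp a * (sin b - b) + (exp a - 1) * b) by ring.
    eapply Rle_trans; [apply Rabs_triang|]. rewrite !Rabs_mult, (Rabs_pos_eq (exp a)) by (apply Rlt_le, exp_pos).
    generalize (Hexp a ltac:(lra)) (Rabs_pos (sin b - b)) (Rabs_pos b) (Rabs_pos (exp a - 1)); intros.
    apply Rplus_le_compat; nra. }
  generalize (Rmult_le_pos r r Hr Hr). lra.
Qed.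

Lemma Cpow_diff_le (A B : C) m n : Cmod A <= m -> Cmod B <= m ->
  Cmod (A ^ n - B ^ n) <= INR n * m ^ (pred n) * Cmod (A - B).
Proof.
  intros HA HB. assert (Hm : 0 <= m) by (generalize (Cmod_ge_0 A); lra).
  induction n as [|n IH].
  - simpl. rewrite Cminus_diag, Cmod_0. lra.
  - rewrite !Cpow_S. replace (A * A ^ n - B * B ^ n)%C with ((A - B) * A ^ n + B * (A ^ n - B ^ n))%C by ring.
    eapply Rle_trans; [apply Cmod_triangle|]. rewrite !Cmod_mult, Cmod_pow.
    assert (H1 : Cmod A ^ n <= m ^ n) by (apply pow_incr; split; [apply Cmod_ge_0|auto]).
    assert (H2 : Cmod B * Cmod (A ^ n - B ^ n) <= m * (INR n * m ^ pred n * Cmod (A - B))).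
    { apply Rmult_le_compat; auto; apply Cmod_ge_0. }
    assert (H3 : m * (INR n * m ^ pred n * Cmod (A - B)) = INR n * m ^ n * Cmod (A - B)).
    { destruct n; simpl; ring. }
    simpl pred. rewrite S_INR. generalize (Cmod_ge_0 (A - B)). nra.
Qed.

Lemma Cexp_approx (z : C) n : (0 < n)%nat -> Cmod z <= INR n ->
  Cmod (Cexp z - (1 + z / INR n) ^ n) <= 20 * exp (Cmod z) * (Cmod z * Cmod z) / INR n.
Proof.
  intros Hn Hz. assert (HN : 0 < INR n) by (apply lt_0_INR; auto).
  assert (HNC : RtoC (INR n) <> 0%C) by (intros E; apply RtoC_inj in E; lra).
  set (h := (z / INR n)%C).
  assert (Eh : Cmod h = Cmod z / INR n) by (unfold h; rewrite Cmod_div, Cmod_R, Rabs_pos_eq by (auto; lra); auto).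
  assert (Hh : Cmod h <= 1).
  { rewrite Eh. apply Rle_div_l; [auto|lra]. }
  replace (Cexp z) with (Cexp h ^ n)%C.
  2:{ rewrite Cexp_pow. f_equal. unfold h. field. auto. }
  set (m := exp (Cmod h)).
  assert (HB : Cmod (1 + h) <= m).
  { eapply Rle_trans; [apply Cmod_triangle|]. rewrite Cmod_1. apply exp_ineq1_le. }
  assert (HA : Cmod (Cexp h) <= m).
  { rewrite Cmod_Cexp. unfold m. generalize (Rabs_fst_le h) (Rle_abs (fst h)); intros.
    destruct (Req_dec (fst h) (Cmod h)) as [->|]; [lra|]. left; apply exp_increasing; lra. }
  eapply Rle_trans; [apply (Cpow_diff_le _ _ m); auto|].
  assert (Hm1 : 1 <= m) by (unfold m; generalize (exp_ineq1_le (Cmod h)) (Cmod_ge_0 h); lra).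
  assert (Hmp : m ^ pred n <= exp (Cmod z)).
  { apply Rle_trans with (m ^ n); [apply Rle_pow; [auto|lia]|].
    unfold m. rewrite <- exp_INR_mult, Eh. right. f_equal. field; lra. }
  apply Rle_trans with (INR n * exp (Cmod z) * (20 * (Cmod h * Cmod h))).
  - apply Rmult_le_compat.
    + apply Rmult_le_pos; [lra|apply pow_le; lra].
    + apply Cmod_ge_0.
    + apply Rmult_le_compat_l; lra.
    + now apply Cexp_taylor1.
  - rewrite Eh. right. field. lra.
Qed.

(** [Cexp (a * v)] is on the disc the uniform limit of [(1 + a * v / n) ^ n], a product of affine factors. *)
Lemma has_residues_exp R a F B : 0 < R -> has_residues R F ->
  (forall v, Cmod v <= R -> Cmod (F v) <= B) ->
  has_residues R (fun v => Cexp (a * v) * F v)%C.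
Proof.
  intros HR HF HB. apply has_residues_unif; auto. intros eps He.
  assert (HB0 : 0 <= B).
  { eapply Rle_trans; [apply Cmod_ge_0|apply (HB 0%C)]. rewrite Cmod_0; lra. }
  set (r := Cmod a * R).
  assert (Hr : 0 <= r) by (apply Rmult_le_pos; [apply Cmod_ge_0|lra]).
  set (K := 20 * exp r * (r * r) * B).
  assert (HK : 0 <= K).
  { unfold K. generalize (exp_pos r); intros. assert (0 <= r * r) by nra.
    assert (0 <= 20 * exp r) by lra. apply Rmult_le_pos; auto. now apply Rmult_le_pos. }
  destruct (nfloor_ex (r + K / eps + 1)) as [n Hn].
  { assert (0 <= K / eps) by (apply Rmult_le_pos; auto; apply Rlt_le, Rinv_0_lt_compat; auto). lra. }
  assert (Hn1 : r + K / eps < INR n) by lra.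
  assert (HKe : 0 <= K / eps) by (apply Rmult_le_pos; auto; apply Rlt_le, Rinv_0_lt_compat; auto).
  assert (HN : 0 < INR n) by lra.
  assert (HNC : RtoC (INR n) <> 0%C) by (intros E; apply RtoC_inj in E; lra).
  exists (fun v => cprod (seq 0 n) (fun _ => 1 + a / INR n * v) * F v)%C.
  split; [apply (has_residues_prod R (seq 0 n) (fun _ => 1%C) (fun _ => (a / INR n)%C)); auto|].
  intros v Hv.
  replace (cprod (seq 0 n) (fun _ => 1 + a / INR n * v)%C) with ((1 + a * v / INR n) ^ n)%C.
  2:{ assert (G : forall (l : list nat) (c : C), cprod l (fun _ => c) = Cpow c (length l)).
      { induction l; intros; simpl; auto. now rewrite IHl. }
      rewrite G, length_seq. f_equal. field. auto. }
  replace (Cexp (a * v) * F v - (1 + a * v / INR n) ^ n * F v)%C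
    with ((Cexp (a * v) - (1 + a * v / INR n) ^ n) * F v)%C by ring.
  rewrite Cmod_mult.
  assert (Hav : Cmod (a * v) <= r).
  { rewrite Cmod_mult. apply Rmult_le_compat_l; auto. apply Cmod_ge_0. }
  assert (Hap := Cexp_approx (a * v) n ltac:(apply INR_lt; simpl; lra) ltac:(lra)).
  apply Rle_trans with (K / INR n).
  - unfold K. replace (20 * exp r * (r * r) * B / INR n) with ((20 * exp r * (r * r) / INR n) * B) by (field; lra).
    apply Rmult_le_compat; auto; try apply Cmod_ge_0.
    eapply Rle_trans; [exact Hap|].
    unfold Rdiv. apply Rmult_le_compat_r; [apply Rlt_le, Rinv_0_lt_compat; auto|].
    assert (exp (Cmod (a * v)) <= exp r).
    { now apply exp_le. }
    generalize (Cmod_ge_0 (a * v)) (exp_pos (Cmod (a * v))); intros.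
    apply Rmult_le_compat; try nra. 
  - apply Rle_div_l; [auto|].
    assert (K / eps * eps <= INR n * eps) by (apply Rmult_le_compat_r; lra).
    unfold Rdiv in H. rewrite Rmult_assoc, Rinv_l in H; lra.
Qed.

(** * Power series: re-expansion and uniqueness *)

(** Pascal's triangle, valued in [nat]; [bin n k = 0] for [n < k], so that sums over [k] need no upper bound. *)
Fixpoint bin (n k : nat) : nat :=
  match n, k with
  | _, O => 1
  | O, S _ => 0
  | S n, S k => bin n k + bin n (S k)
  end.

Lemma bin_0_r n : bin n 0 = 1%nat.
Proof. now destruct n. Qed.

Lemma bin_SS n k : bin (S n) (S k) = (bin n k + bin n (S k))%nat.
Proof. reflexivity. Qed.

Lemma bin_gt n k : (n < k)%nat -> bin n k = 0%nat.
Proof.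
  revert k. induction n as [|n IH]; intros [|k] H; try lia; auto.
  rewrite bin_SS, !IH; lia.
Qed.

Lemma binomial_C (x y : C) n K : (n < K)%nat ->
  csum (seq 0 K) (fun k => INR (bin n k) * x ^ (n - k) * y ^ k)%C = ((x + y) ^ n)%C.
Proof.
  revert K. induction n as [|n IH]; intros K HK.
  - destruct K as [|K]; [lia|]. simpl seq. cbn [csum]. rewrite csum_0.
    + simpl. ring.
    + intros k Hk. apply in_seq in Hk. rewrite (bin_gt 0 k) by lia. simpl. ring.
  - destruct K as [|K]; [lia|].
    rewrite <- cons_seq, <- seq_shift. cbn [csum]. rewrite csum_map.
    rewrite (csum_ext _ _ (fun k => y * (INR (bin n k) * x ^ (n - k) * y ^ k) +
                x * (INR (bin n (S k)) * x ^ (n - S k) * y ^ (S k)))%C).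
    2:{ intros k _. rewrite bin_SS, plus_INR, RtoC_plus. simpl (S n - S k)%nat.
        destruct (le_lt_dec (S k) n) as [H|H].
        - replace (n - k)%nat with (S (n - S k)) by lia. rewrite !Cpow_S. ring.
        - rewrite (bin_gt n (S k)) by lia. rewrite Cpow_S. simpl (INR 0). ring. }
    rewrite csum_plus, !csum_scal, IH by lia.
    rewrite Cpow_S. rewrite <- (IH (S K)) at 2 by lia.
    rewrite <- (cons_seq K 0), <- seq_shift. cbn [csum]. rewrite csum_map.
    rewrite <- (IH K) at 1 by lia. rewrite (IH K) by lia.
    rewrite Nat.sub_0_r, !bin_0_r. simpl (INR 1). rewrite Nat.sub_0_r.
    assert (E := IH (S K) ltac:(lia)).
    rewrite <- (cons_seq K 0), <- seq_shift in E. cbn [csum] in E. rewrite csum_map in E.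
    rewrite bin_0_r, Nat.sub_0_r in E. simpl (INR 1) in E. rewrite <- E.
    rewrite Cpow_S. simpl (y ^ 0)%C. ring.
Qed.

Lemma binomial_R (x y : R) n K : (n < K)%nat ->
  rsum (seq 0 K) (fun k => INR (bin n k) * x ^ (n - k) * y ^ k) = (x + y) ^ n.
Proof.
  intros H. apply RtoC_inj. rewrite RtoC_pow, RtoC_plus, <- (binomial_C _ _ n K H).
  generalize (seq 0 K). induction l as [|k l IH]; simpl; auto.
  rewrite RtoC_plus, IH, !RtoC_mult, !RtoC_pow. reflexivity.
Qed.

Lemma bin_term_le x y n k : 0 <= x -> 0 <= y -> INR (bin n k) * x ^ (n - k) * y ^ k <= (x + y) ^ n.
Proof.
  intros Hx Hy. rewrite <- (binomial_R x y n (n + k + 1)) by lia.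
  assert (Hp : forall j, 0 <= INR (bin n j) * x ^ (n - j) * y ^ j).
  { intros j. repeat apply Rmult_le_pos; auto using pos_INR, pow_le. }
  apply Rle_trans with (rsum (k :: nil) (fun j => INR (bin n j) * x ^ (n - j) * y ^ j)).
  - simpl. lra.
  - apply rsum_incl.
    + repeat constructor; auto.
    + intros j [<-|[]]. apply in_seq; lia.
    + auto.
Qed.

Definition taylor_coef (a : nat -> C) (z : C) (k : nat) (l : C) : Prop :=
  cseries (fun n => a n * (INR (bin n k) * z ^ (n - k)))%C l.

(** Absolute convergence at radius [s], with a bound [B] through which all later estimates depend on [a]. *)
Definition summable_at (a : nat -> C) (s B : R) : Prop :=
  summable (fun n => Cmod (a n) * s ^ n) B.

Lemma taylor_coef_ex a s B z k : summable_at a s B -> Cmod z < s ->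
  exists l, taylor_coef a z k l /\ Cmod l <= B * / (s - Cmod z) ^ k.
Proof.
  intros Hs Hz. generalize (Cmod_ge_0 z); intros Hz0.
  assert (Hd : 0 < (s - Cmod z) ^ k) by (apply pow_lt; lra).
  apply (summable_cseries _ (fun n => / (s - Cmod z) ^ k * (Cmod (a n) * s ^ n))).
  - rewrite Rmult_comm. apply summable_scal; auto. apply Rlt_le, Rinv_0_lt_compat; auto.
  - intros n. rewrite !Cmod_mult, Cmod_pow, Cmod_R, Rabs_pos_eq by apply pos_INR.
    replace (s ^ n) with ((Cmod z + (s - Cmod z)) ^ n) by (f_equal; ring).
    generalize (bin_term_le (Cmod z) (s - Cmod z) n k Hz0 ltac:(lra)); intros H.
    apply Rle_trans with (Cmod (a n) * (/ (s - Cmod z) ^ k * (Cmod z + (s - Cmod z)) ^ n)); [|lra].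
    apply Rmult_le_compat_l; [apply Cmod_ge_0|].
    apply Rmult_le_reg_r with ((s - Cmod z) ^ k); auto.
    eapply Rle_trans; [exact H|]. right. field. lra.
Qed.

(** Re-expansion about [z]: truncating the binomial expansion of [(z + u) ^ n]
   at order [K] leaves at most [q ^ - K * (|z| + q * |u|) ^ n] for any [q > 1],
   so that no rearrangement of a double series is needed. *)
Lemma taylor_expansion a s B z t u f : summable_at a s B -> Cmod z + Cmod u < s ->
  (forall k, taylor_coef a z k (t k)) ->
  cseries (fun n => a n * (z + u) ^ n)%C f -> cseries (fun k => t k * u ^ k)%C f.
Proof.
  intros Hs Hu Ht Hf.
  generalize (Cmod_ge_0 z) (Cmod_ge_0 u); intros Hz0 Hu0.
  assert (Hq : exists q, 1 < q /\ Cmod z + q * Cmod u <= s).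
  { destruct (Req_dec (Cmod u) 0) as [E|E].
    - exists 2. rewrite E in *. lra.
    - exists ((s - Cmod z) / Cmod u). split.
      + apply Rmult_lt_reg_r with (Cmod u); [lra|]. unfold Rdiv. rewrite Rmult_assoc, Rinv_l; lra.
      + right. field. auto. }
  destruct Hq as [q [Hq1 Hq]].
  assert (HB : 0 <= B) by (generalize (proj2 Hs 0%nat); simpl; auto).
  assert (Rem : forall K, Cmod (f - csum (seq 0 K) (fun k => t k * u ^ k)%C) <= / q ^ K * B).
  { intros K.
    assert (HqK : 0 < q ^ K) by (apply pow_lt; lra).
    assert (S1 : cseries (fun n => a n * ((z + u) ^ n - csum (seq 0 K) (fun k => INR (bin n k) * z ^ (n - k) * u ^ k)))%C
                  (f - csum (seq 0 K) (fun k => t k * u ^ k)%C)%C).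
    { assert (S2 := cseries_csum (seq 0 K) (fun k n => u ^ k * (a n * (INR (bin n k) * z ^ (n - k))))%C
                     (fun k => u ^ k * t k)%C
                     (fun k _ => cseries_scal (u ^ k)%C _ _ (Ht k))).
      assert (S3 := cseries_plus _ _ _ _ Hf (cseries_scal (-1)%C _ _ S2)).
      replace (f - csum (seq 0 K) (fun k => t k * u ^ k)%C)%C
        with (f + -1 * csum (seq 0 K) (fun k => u ^ k * t k)%C)%C.
      - eapply cseries_ext; [|exact S3]. intros n. simpl.
        rewrite (csum_ext _ (fun k => u ^ k * (a n * (INR (bin n k) * z ^ (n - k))))%C
          (fun k => a n * (INR (bin n k) * z ^ (n - k) * u ^ k))%C) by (intros; ring).
        rewrite csum_scal. ring.
      - rewrite (csum_ext _ (fun k => u ^ k * t k)%C (fun k => t k * u ^ k)%C) by (intros; ring). ring. }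
    destruct (summable_cseries (fun n => a n * ((z + u) ^ n - csum (seq 0 K) (fun k => INR (bin n k) * z ^ (n - k) * u ^ k)))%C
       (fun n => / q ^ K * (Cmod (a n) * s ^ n)) (/ q ^ K * B)) as [l [Hl Hlb]].
    - apply summable_scal; auto. apply Rlt_le, Rinv_0_lt_compat; auto.
    - intros n. rewrite Cmod_mult.
      apply Rle_trans with (Cmod (a n) * (/ q ^ K * s ^ n)); [|right; ring].
      apply Rmult_le_compat_l; [apply Cmod_ge_0|].
      rewrite <- (binomial_C z u n (K + (n + 1))) by lia.
      rewrite seq_app, csum_app. simpl (0 + K)%nat.
      replace (csum (seq 0 K) (fun k => INR (bin n k) * z ^ (n - k) * u ^ k) +
        csum (seq K (n + 1)) (fun k => INR (bin n k) * z ^ (n - k) * u ^ k) -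
        csum (seq 0 K) (fun k => INR (bin n k) * z ^ (n - k) * u ^ k))%C
        with (csum (seq K (n + 1)) (fun k => INR (bin n k) * z ^ (n - k) * u ^ k)%C) by ring.
      eapply Rle_trans; [apply Cmod_csum|].
      apply Rle_trans with (/ q ^ K * (Cmod z + q * Cmod u) ^ n).
      + rewrite <- (binomial_R (Cmod z) (q * Cmod u) n (K + (n + 1))) by lia.
        rewrite <- rsum_scal.
        apply Rle_trans with (rsum (seq K (n + 1))
          (fun k => / q ^ K * (INR (bin n k) * Cmod z ^ (n - k) * (q * Cmod u) ^ k))).
        * apply rsum_le. intros k Hk. apply in_seq in Hk.
          rewrite !Cmod_mult, !Cmod_pow, Cmod_R, Rabs_pos_eq by apply pos_INR.
          rewrite Rpow_mult_distr.
          replace (q ^ k) with (q ^ K * q ^ (k - K)) by (rewrite <- pow_add; f_equal; lia).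
          replace (/ q ^ K * (INR (bin n k) * Cmod z ^ (n - k) * (q ^ K * q ^ (k - K) * Cmod u ^ k)))
            with (INR (bin n k) * Cmod z ^ (n - k) * Cmod u ^ k * q ^ (k - K)) by (field; lra).
          rewrite <- (Rmult_1_r (INR (bin n k) * Cmod z ^ (n - k) * Cmod u ^ k)) at 1.
          apply Rmult_le_compat_l.
          -- repeat apply Rmult_le_pos; auto using pos_INR, pow_le.
          -- apply pow_R1_Rle; lra.
        * apply rsum_incl.
          -- apply seq_NoDup.
          -- intros k Hk. apply in_seq in Hk. apply in_seq. lia.
          -- intros k _. apply Rmult_le_pos; [apply Rlt_le, Rinv_0_lt_compat; auto|].
             repeat apply Rmult_le_pos; auto using pos_INR, pow_le.
             apply pow_le. apply Rmult_le_pos; lra.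
      + apply Rmult_le_compat_l; [apply Rlt_le, Rinv_0_lt_compat; auto|].
        apply pow_incr. split; auto. assert (0 <= q * Cmod u) by (apply Rmult_le_pos; lra). lra.
    - rewrite (clim_unique _ _ _ S1 Hl). exact Hlb. }
  intros eps He.
  assert (Hqi : 0 <= / q < 1).
  { split; [apply Rlt_le, Rinv_0_lt_compat; lra|]. rewrite <- Rinv_1. apply Rinv_lt_contravar; lra. }
  destruct (pow_lt_1_zero (/ q)) with (y := eps / (B + 1)) as [N HN].
  - rewrite Rabs_pos_eq; lra.
  - apply Rdiv_lt_0_compat; lra.
  - exists N. intros n Hn. rewrite Cmod_sym. eapply Rle_lt_trans; [apply Rem|].
    specialize (HN n Hn). rewrite Rabs_pos_eq in HN by (apply pow_le; lra).
    rewrite <- pow_inv.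
    apply Rle_lt_trans with (eps / (B + 1) * B); [apply Rmult_le_compat_r; lra|].
    apply Rlt_le_trans with (eps / (B + 1) * (B + 1)); [|right; field; lra].
    apply Rmult_lt_compat_l; [apply Rdiv_lt_0_compat|]; lra.
Qed.

(** Divide by [x ^ k], [k] the index of the first nonzero coefficient, and let [x] tend to [0]. Values on one segment
   suffice, which is what the arguments along a path or inside a disc provide. *)
Lemma cseries_unique_coef t s B d eps : summable_at t s B -> 0 < s -> Cmod d = 1 -> 0 < eps ->
  (forall x, 0 < x < eps -> cseries (fun k => t k * (x * d) ^ k)%C 0%C) ->
  forall k, t k = 0%C.
Proof.
  intros Hs Hs0 Hd He H k.
  assert (HB : 0 <= B) by (generalize (proj2 Hs 0%nat); simpl; auto).
  induction k as [k IH] using lt_wf_ind.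
  apply Cmod_eq_0. apply Rle_antisym; [|apply Cmod_ge_0].
  apply Rnot_lt_le; intros Hk.
  assert (Main : forall x, 0 < x < Rmin eps s -> Cmod (t k) <= x * (B / s ^ S k)).
  { intros x Hx. generalize (Rmin_l eps s) (Rmin_r eps s); intros.
    assert (Hxs : 0 < x / s) by (apply Rdiv_lt_0_compat; lra).
    assert (Hxs1 : x / s <= 1).
    { apply Rle_div_l; [auto|lra]. }
    assert (Hxk : 0 < x ^ k) by (apply pow_lt; lra).
    assert (Hl : Cmod (0 - t k * (x * d) ^ k) <= (x / s) ^ S k * B).
    { apply (clim_Cmod_le (fun n => csum (seq 0 n) (fun k => t k * (x * d) ^ k)%C + - (t k * (x * d) ^ k))%C).
      - apply (clim_plus _ (fun _ => - (t k * (x * d) ^ k))%C).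
        + apply H. lra.
        + apply clim_const.
      - intros N. exists (S k + N)%nat. split; [lia|].
        rewrite seq_app, csum_app. rewrite (csum_S k), csum_0.
        2:{ intros j Hj. apply in_seq in Hj. rewrite IH by lia. ring. }
        replace (0 + t k * (x * d) ^ k + csum (seq (0 + S k) N) (fun k0 => t k0 * (x * d) ^ k0) + - (t k * (x * d) ^ k))%C
          with (csum (seq (0 + S k) N) (fun k0 => t k0 * (x * d) ^ k0)%C) by ring.
        eapply Rle_trans; [apply Cmod_csum|].
        apply Rle_trans with (rsum (seq (0 + S k) N) (fun j => (x / s) ^ S k * (Cmod (t j) * s ^ j))).
        + apply rsum_le. intros j Hj. apply in_seq in Hj.
          rewrite Cmod_mult, Cmod_pow, Cmod_mult, Hd, Cmod_R, Rabs_pos_eq, Rmult_1_r by lra.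
          apply Rle_trans with (Cmod (t j) * ((x / s) ^ S k * s ^ j)); [|right; ring].
          apply Rmult_le_compat_l; [apply Cmod_ge_0|].
          replace (x ^ j) with ((x / s) ^ j * s ^ j) by (rewrite <- Rpow_mult_distr; f_equal; field; lra).
          apply Rmult_le_compat_r; [apply pow_le; lra|].
          replace j with (S k + (j - S k))%nat at 1 by lia. rewrite pow_add.
          rewrite <- (Rmult_1_r ((x / s) ^ S k)) at 2. apply Rmult_le_compat_l; [apply pow_le; lra|].
          rewrite <- (pow1 (j - S k)). apply pow_incr; lra.
        + rewrite rsum_scal. apply Rmult_le_compat_l; [apply pow_le; lra|].
          eapply Rle_trans; [|apply (proj2 Hs (S k + N)%nat)].
          apply rsum_incl; [apply seq_NoDup| |].
          * intros j Hj. apply in_seq in Hj. apply in_seq. lia.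
          * intros j _. apply (proj1 Hs). }
    replace (0 - t k * (x * d) ^ k)%C with (- (t k * (x * d) ^ k))%C in Hl by ring.
    rewrite Cmod_opp, Cmod_mult, Cmod_pow, Cmod_mult, Hd, Cmod_R, Rabs_pos_eq, Rmult_1_r in Hl by lra.
    apply Rmult_le_reg_r with (x ^ k); auto.
    eapply Rle_trans; [exact Hl|]. right. unfold Rdiv. rewrite Rpow_mult_distr, pow_inv.
    simpl (x ^ S k). ring. }
  assert (HK : 0 <= B / s ^ S k).
  { apply Rmult_le_pos; auto. apply Rlt_le, Rinv_0_lt_compat, pow_lt; auto. }
  set (K := B / s ^ S k) in *.
  assert (Hm : 0 < Rmin eps s) by (apply Rmin_pos; lra).
  set (x := Rmin (Rmin eps s / 2) (Cmod (t k) / (2 * (K + 1)))).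
  assert (0 < Cmod (t k) / (2 * (K + 1))) by (apply Rdiv_lt_0_compat; lra).
  assert (Hx0 : 0 < x) by (apply Rmin_pos; lra).
  generalize (Rmin_l (Rmin eps s / 2) (Cmod (t k) / (2 * (K + 1))))
    (Rmin_r (Rmin eps s / 2) (Cmod (t k) / (2 * (K + 1)))); fold x; intros.
  specialize (Main x ltac:(lra)).
  assert (x * K <= Cmod (t k) / (2 * (K + 1)) * (K + 1)) by (apply Rmult_le_compat; lra).
  assert (Cmod (t k) / (2 * (K + 1)) * (K + 1) = Cmod (t k) / 2) by (field; lra).
  lra.
Qed.

Lemma summable_at_of_bound a r s B : 0 <= s < r -> (forall n, Cmod (a n) * r ^ n <= B) ->
  summable_at a s (B * / (1 - s / r)).
Proof.
  intros Hs H.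
  assert (Hq : 0 <= s / r < 1).
  { split; [apply Rmult_le_pos; [lra|apply Rlt_le, Rinv_0_lt_compat; lra]|].
    apply Rlt_div_l; [lra|lra]. }
  assert (HB : 0 <= B).
  { eapply Rle_trans; [|apply (H 0%nat)]. simpl. generalize (Cmod_ge_0 (a 0%nat)); lra. }
  eapply summable_le; [apply (summable_scal B _ _ HB (summable_geom _ Hq))|].
  intros n. split; [apply Rmult_le_pos; [apply Cmod_ge_0|apply pow_le; lra]|].
  replace (s ^ n) with ((s / r) ^ n * r ^ n) by (rewrite <- Rpow_mult_distr; f_equal; field; lra).
  specialize (H n). generalize (pow_le (s / r) n (proj1 Hq)); intros. nra.
Qed.

Lemma cseries_bounded u l : cseries u l -> exists B, forall n, Cmod (u n) <= B.
Proof.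
  intros H. destruct (H 1 ltac:(lra)) as [N HN].
  exists (2 + rsum (seq 0 N) (fun n => Cmod (u n))). intros n.
  destruct (le_lt_dec N n) as [Hn|Hn].
  - assert (H1 := HN n Hn). assert (H2 := HN (S n) ltac:(lia)). rewrite csum_S in H2.
    replace (u n) with ((csum (seq 0 n) u + u n - l) - (csum (seq 0 n) u - l))%C by ring.
    eapply Rle_trans; [apply Cmod_triangle|]. rewrite Cmod_opp.
    assert (0 <= rsum (seq 0 N) (fun n => Cmod (u n))) by (apply rsum_ge0; intros; apply Cmod_ge_0). lra.
  - assert (Cmod (u n) <= rsum (seq 0 N) (fun n => Cmod (u n))); [|lra].
    apply Rle_trans with (rsum (n :: nil) (fun n => Cmod (u n))); [simpl; lra|].
    apply rsum_incl; [repeat constructor; auto| |intros; apply Cmod_ge_0].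
    intros j [<-|[]]. apply in_seq; lia.
Qed.

(** * Partial fractions and the residue formula *)

(** The residue at [b] of the reciprocal of the product of [v - c], [c] in [l]. *)
Definition weight (l : list C) (b : C) : C :=
  (/ cprod (remove Ceq_dec b l) (fun c => b - c))%C.

Lemma Csub_neq0 (x y : C) : x <> y -> (x - y)%C <> 0%C.
Proof.
  intros H E. apply H. replace x with (x - y + y)%C by ring. rewrite E. ring.
Qed.

Lemma partial_fractions l v : NoDup l -> ~ In v l ->
  (/ cprod l (fun b => v - b) = csum l (fun b => weight l b / (v - b)))%C \/ l = nil.
Proof.
  revert v. induction l as [|a l IH]; intros v Hn Hv; [now right|left].
  inversion Hn as [|? ? Ha Hl]; subst.
  assert (Hva : (v - a)%C <> 0%C) by (apply Csub_neq0; intros ->; apply Hv; simpl; auto).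
  assert (Hvl : forall b, In b l -> (v - b)%C <> 0%C).
  { intros b Hb. apply Csub_neq0; intros ->; apply Hv; simpl; auto. }
  assert (Hal : forall b, In b l -> (a - b)%C <> 0%C).
  { intros b Hb. apply Csub_neq0; intros ->; auto. }
  assert (Wa : weight (a :: l) a = (/ cprod l (fun c => a - c))%C).
  { unfold weight. simpl. destruct (Ceq_dec a a) as [_|]; [|congruence].
    now rewrite notin_remove. }
  cbn [csum cprod].
  destruct (IH v Hl ltac:(intros H; apply Hv; simpl; auto)) as [E1|E1];
  destruct (IH a Hl Ha) as [E2|E2]; subst; try discriminate.
  2:{ rewrite Wa. simpl. field. auto. }
  2:{ rewrite Wa. simpl. field. auto. }
  2:{ rewrite Wa. simpl. field. auto. }
  rewrite Wa, E2.
  rewrite (csum_ext l (fun b => weight (a :: l) b / (v - b))%C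
     (fun b => / (v - a) * (weight l b / (v - b)) + - / (v - a) * (weight l b / (a - b)))%C).
  - rewrite csum_plus, !csum_scal. rewrite <- E1.
    field. repeat split; auto; apply cprod_neq0; auto.
  - intros b Hb.
    assert (Hba : b <> a) by (intros ->; auto).
    unfold weight. simpl. destruct (Ceq_dec b a) as [|_]; [contradiction|].
    cbn [cprod].
    assert (cprod (remove Ceq_dec b l) (fun c => b - c)%C <> 0%C).
    { apply cprod_neq0. intros x Hx. apply in_remove in Hx. apply Csub_neq0. intros ->; tauto. }
    assert ((b - a)%C <> 0%C) by (apply Csub_neq0; auto).
    assert ((a - b)%C <> 0%C) by (apply Csub_neq0; auto).
    replace (/ ((b - a) * cprod (remove Ceq_dec b l) (fun c => b - c)) / (v - b))%C
      with (/ cprod (remove Ceq_dec b l) (fun c => b - c) * (/ ((b - a) * (v - b))))%C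
      by (field; repeat split; auto).
    field. repeat split; auto.
Qed.

(** The residue theorem for [F] divided by a product of distinct linear factors. *)
Lemma residue_formula R F l : 0 < R -> has_residues R F -> NoDup l -> l <> nil ->
  (forall b, In b l -> Cmod b <> R) ->
  clim (fun M => cavg M (fun t => R * cis t * F (R * cis t) * / cprod l (fun b => R * cis t - b))%C)
    (csum l (fun b => weight l b * (if Rlt_dec (Cmod b) R then F b else 0%C))%C).
Proof.
  intros HR [_ HF] Hn Hnil Hb.
  eapply clim_ext.
  2:{ apply (clim_csum l (fun b M => weight l b * cavg M (fun t => R * cis t * F (R * cis t) / (R * cis t - b)))%C).
      intros b Hbl. apply clim_scal. apply HF. auto. }
  exists 0%nat. intros M _. simpl.
  rewrite (csum_ext l _ (fun b => cavg M (fun t => weight l b * (R * cis t * F (R * cis t) / (R * cis t - b)))%C)).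
  2:{ intros b _. now rewrite cavg_scal. }
  rewrite <- cavg_csum. apply cavg_ext. intros j _. set (v := (R * cis (root_angle M j))%C).
  assert (Hv : ~ In v l).
  { intros H. apply (Hb _ H). unfold v. apply Cmod_circle. lra. }
  destruct (partial_fractions l v Hn Hv) as [E|E]; [|contradiction].
  rewrite E, <- csum_scal. apply csum_ext. intros b Hbl. field.
  apply Csub_neq0. intros <-. auto.
Qed.

(** * Comparison of the product of [1 + z / (k * tau)] with an integral *)

(** [ln |1 + z / t|] for [z = x + i * y]. *)
Definition log_factor (x y t : R) : R := / 2 * ln (((t + x) ^ 2 + y ^ 2) / t ^ 2).

(** The antiderivative in [t] of [log_factor x y t]. *)
Definition log_primitive (x y t : R) : R :=
  / 2 * (t + x) * ln ((t + x) ^ 2 + y ^ 2) + y * atan ((t + x) / y) - t * ln t.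

Lemma log_primitive_deriv x y t : 0 <= x -> 0 < y -> 0 < t ->
  derivable_pt_lim (log_primitive x y) t (log_factor x y t).
Proof.
  intros Hx Hy Ht. unfold log_factor, log_primitive. apply is_derive_Reals.
  assert (0 < (t + x) ^ 2 + y ^ 2) by nra.
  assert (0 < t ^ 2) by nra.
  unfold Rdiv at 2. rewrite ln_mult, ln_Rinv by (auto; apply Rinv_0_lt_compat; auto).
  replace (ln (t ^ 2)) with (2 * ln t) by (rewrite ln_pow by auto; simpl; ring).
  auto_derive.
  - simpl in *. repeat split; auto; lra.
  - simpl. unfold Rsqr. field. simpl in *. repeat split; nra.
Qed.

Lemma log_factor_decr x y s t : 0 <= x -> 0 < s <= t -> log_factor x y t <= log_factor x y s.
Proof.
  intros Hx Hs. unfold log_factor.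
  assert (E : forall u, 0 < u -> ((u + x) ^ 2 + y ^ 2) / u ^ 2 = (1 + x / u) ^ 2 + (y / u) ^ 2)
    by (intros; field; lra).
  rewrite !E by lra.
  assert (0 < / t <= / s) by (split; [apply Rinv_0_lt_compat; lra|apply Rinv_le_contravar; lra]).
  assert (0 <= x / t <= x / s) by (unfold Rdiv; split; [apply Rmult_le_pos; lra|apply Rmult_le_compat_l; lra]).
  apply Rmult_le_compat_l; [lra|]. apply ln_le; [nra|].
  assert ((y / t) ^ 2 <= (y / s) ^ 2).
  { unfold Rdiv. rewrite !Rpow_mult_distr. apply Rmult_le_compat_l; [nra|]. apply pow_incr; lra. }
  nra.
Qed.

Lemma atan_le_id u : 0 <= u -> atan u <= u.
Proof.
  intros Hu. destruct (Req_dec u 0) as [->|Hn]; [rewrite atan_0; lra|].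
  destruct (MVT_cor2 atan (fun t => / (1 + t ^ 2)) 0 u) as [c [E Hc]]; [lra| |].
  - intros t Ht. apply derivable_pt_lim_atan.
  - rewrite atan_0 in E. assert (/ (1 + c ^ 2) <= 1).
    { rewrite <- Rinv_1. apply Rinv_le_contravar; nra. }
    nra.
Qed.

Lemma rsum_seq1_S K f : rsum (seq 1 (S K)) f = rsum (seq 1 K) f + f (S K).
Proof. apply rsum_seq_S. Qed.

(** [log_factor] decreases in [t], so a sum over [tau, 2 * tau, ...] is at least the integral. *)
Lemma log_factor_sum tau x y K : 0 < tau -> 0 <= x -> 0 < y ->
  log_primitive x y (INR (S K) * tau) - log_primitive x y tau
  <= tau * rsum (seq 1 K) (fun k => log_factor x y (INR k * tau)).
Proof.
  intros Ht Hx Hy. induction K as [|K IH].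
  - simpl. rewrite Rmult_1_l. lra.
  - rewrite rsum_seq1_S, Rmult_plus_distr_l.
    assert (HK : 0 < INR (S K)) by (apply lt_0_INR; lia).
    assert (HK' : INR (S (S K)) = INR (S K) + 1) by apply S_INR.
    destruct (MVT_cor2 (log_primitive x y) (log_factor x y) (INR (S K) * tau) (INR (S (S K)) * tau)) as [c [E Hc]].
    + rewrite HK'. nra.
    + intros u Hu. apply log_primitive_deriv; auto. nra.
    + assert (log_factor x y c <= log_factor x y (INR (S K) * tau)) by (apply log_factor_decr; auto; nra).
      rewrite HK' in *. nra.
Qed.

(** The integral of [ln |1 + z / t|] over [0 < t < T] is [PI / 2 * y] up to terms that are
   explicit in [x = Re z] and [T]. *)
Lemma log_factor_lower tau x y K rho : 0 < tau -> 0 <= x -> 0 < y -> 0 <= rho ->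
  rho ^ 2 = x ^ 2 + y ^ 2 ->
  PI / 2 * y + x * (ln (INR (S K) * tau / (tau + rho)) - 1) - y ^ 2 / (INR (S K) * tau)
    - tau * (ln ((tau + rho) / tau) + 1)
  <= tau * rsum (seq 1 K) (fun k => log_factor x y (INR k * tau)).
Proof.
  intros Ht Hx Hy Hr Er. eapply Rle_trans; [|apply log_factor_sum; auto].
  assert (HK : 0 < INR (S K)) by (apply lt_0_INR; lia).
  set (T := INR (S K) * tau). assert (HT : 0 < T) by (unfold T; nra).
  assert (Up : log_primitive x y tau <= (tau + x) * ln (tau + rho) + (tau + x) - tau * ln tau).
  { unfold log_primitive.
    assert (ln ((tau + x) ^ 2 + y ^ 2) <= 2 * ln (tau + rho)).
    { replace (2 * ln (tau + rho)) with (ln ((tau + rho) ^ 2)) by (rewrite ln_pow by lra; simpl; ring).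
      apply ln_le; [nra|]. assert (x <= rho) by nra. nra. }
    assert (y * atan ((tau + x) / y) <= tau + x).
    { assert (atan ((tau + x) / y) <= (tau + x) / y).
      { apply atan_le_id. apply Rmult_le_pos; [lra|]. apply Rlt_le, Rinv_0_lt_compat; auto. }
      apply Rle_trans with (y * ((tau + x) / y)); [apply Rmult_le_compat_l; lra|right; field; lra]. }
    nra. }
  assert (Low : x * ln T + PI / 2 * y - y ^ 2 / T <= log_primitive x y T).
  { unfold log_primitive.
    assert (H1 : 2 * ln T <= ln ((T + x) ^ 2 + y ^ 2)).
    { replace (2 * ln T) with (ln (T ^ 2)) by (rewrite ln_pow by lra; simpl; ring).
      apply ln_le; nra. }
    assert (H2 : PI / 2 * y - y ^ 2 / T <= y * atan ((T + x) / y)).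
    { replace ((T + x) / y) with (/ (y / (T + x))) by (field; lra).
      rewrite atan_inv by (apply Rdiv_lt_0_compat; lra).
      assert (atan (y / (T + x)) <= y / T).
      { apply Rle_trans with (y / (T + x)); [apply atan_le_id; apply Rlt_le, Rdiv_lt_0_compat; lra|].
        unfold Rdiv. apply Rmult_le_compat_l; [lra|]. apply Rinv_le_contravar; lra. }
      replace (y ^ 2 / T) with (y * (y / T)) by (field; lra). nra. }
    nra. }
  rewrite (ln_div T), (ln_div (tau + rho)) by lra. nra.
Qed.

Lemma log_factor_nonneg x y t : 0 <= x -> 0 < t -> 0 <= log_factor x y t.
Proof.
  intros Hx Ht. unfold log_factor.
  apply Rmult_le_pos; [lra|]. rewrite <- ln_1 at 1. apply ln_le; [lra|].
  apply Rmult_le_reg_r with (t ^ 2); [nra|]. unfold Rdiv. rewrite Rmult_assoc, Rinv_l; nra.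
Qed.

(** On the circle of radius [R] tangent to the imaginary axis at [0], the logarithmic
   terms are absorbed because [|z| ^ 2 = 2 * R * x] there. *)
Lemma log_factor_circle tau x y K R : 0 < tau -> 0 < R -> x ^ 2 + y ^ 2 = 2 * R * x ->
  exp 2 * (2 * R + tau) <= INR (S K) * tau ->
  PI / (2 * tau) * Rabs y - ln (1 + 2 * R / tau) - 1
  <= rsum (seq 1 K) (fun k => log_factor x y (INR k * tau)).
Proof.
  intros Ht HR Exy HK.
  assert (Hx : 0 <= x) by nra. assert (Hx2 : x <= 2 * R) by nra.
  assert (Hs : rsum (seq 1 K) (fun k => log_factor x y (INR k * tau)) =
               rsum (seq 1 K) (fun k => log_factor x (Rabs y) (INR k * tau))).
  { apply rsum_ext. intros. unfold log_factor. now rewrite pow2_abs. }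
  assert (Hln : 0 <= ln (1 + 2 * R / tau)).
  { rewrite <- ln_1. apply ln_le; [lra|]. assert (0 < 2 * R / tau) by (apply Rdiv_lt_0_compat; lra). lra. }
  assert (Hpos : 0 <= rsum (seq 1 K) (fun k => log_factor x y (INR k * tau))).
  { apply rsum_ge0. intros k Hk. apply in_seq in Hk. apply log_factor_nonneg; auto.
    apply Rmult_lt_0_compat; auto. apply lt_0_INR; lia. }
  destruct (Req_dec y 0) as [->|Hy].
  { rewrite Rabs_R0. lra. }
  rewrite Hs. assert (Hy' : 0 < Rabs y) by now apply Rabs_pos_lt.
  set (rho := sqrt (2 * R * x)).
  assert (Er : rho ^ 2 = 2 * R * x) by (unfold rho; rewrite pow2_sqrt; nra).
  assert (Hr0 : 0 <= rho) by apply sqrt_pos.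
  assert (Hr2 : rho <= 2 * R) by nra.
  generalize (log_factor_lower tau x (Rabs y) K rho Ht Hx Hy' Hr0 ltac:(rewrite pow2_abs; lra)).
  rewrite pow2_abs. intros H.
  set (T := INR (S K) * tau) in *. set (Sm := rsum _ _) in *.
  assert (He : 1 < exp 2) by (generalize (exp_ineq1 2); lra).
  assert (HT : 0 < T) by nra.
  assert (L2 : 2 <= ln (T / (tau + rho))).
  { rewrite <- (ln_exp 2). apply ln_le; [apply exp_pos|].
    apply Rmult_le_reg_r with (tau + rho); [lra|]. unfold Rdiv. rewrite Rmult_assoc, Rinv_l by lra.
    rewrite Rmult_1_r. eapply Rle_trans; [|exact HK]. apply Rmult_le_compat_l; lra. }
  assert (Q : y ^ 2 / T <= x).
  { apply Rle_div_l; [auto|].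
    assert (2 * R <= T) by nra. nra. }
  assert (L3 : ln ((tau + rho) / tau) <= ln (1 + 2 * R / tau)).
  { apply ln_le; [apply Rdiv_lt_0_compat; lra|].
    replace ((tau + rho) / tau) with (1 + rho / tau) by (field; lra).
    apply Rplus_le_compat_l. unfold Rdiv. apply Rmult_le_compat_r; [apply Rlt_le, Rinv_0_lt_compat|]; lra. }
  assert (tau * (PI / (2 * tau) * Rabs y - ln (1 + 2 * R / tau) - 1) <= tau * Sm); [|nra].
  replace (tau * (PI / (2 * tau) * Rabs y - ln (1 + 2 * R / tau) - 1))
    with (PI / 2 * Rabs y - tau * (ln (1 + 2 * R / tau) + 1)) by (field; lra).
  assert (tau * (ln ((tau + rho) / tau) + 1) <= tau * (ln (1 + 2 * R / tau) + 1)) by (apply Rmult_le_compat_l; lra).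
  assert (0 <= x * (ln (T / (tau + rho)) - 2)) by (apply Rmult_le_pos; lra).
  nra.
Qed.

Lemma ln_le_sub u : 0 < u -> ln u <= u - 1.
Proof.
  intros H. apply Rnot_lt_le; intros Hc. apply exp_increasing in Hc.
  rewrite exp_ln in Hc by auto. generalize (exp_ineq1_le (u - 1)); lra.
Qed.

(** Compare with the integral of [ln (1 + r / t)] over [0 < t < K * tau]. *)
Lemma log_sum_upper tau r K : 0 < tau -> 0 < r -> (0 < K)%nat ->
  rsum (seq 1 K) (fun k => ln (1 + r / (INR k * tau)))
  <= r / tau * (1 + ln ((INR K * tau + r) / r)).
Proof.
  intros Ht Hr HK.
  assert (G : tau * rsum (seq 1 K) (fun k => ln (1 + r / (INR k * tau))) <=
    (INR K * tau + r) * ln (INR K * tau + r) - INR K * tau * ln (INR K * tau) - r * ln r).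
  { destruct K as [|K]; [lia|]. clear HK. induction K as [|K IH].
    - simpl. rewrite Rmult_1_l, Rplus_0_r.
      replace (1 + r / tau) with ((tau + r) / tau) by (field; lra).
      rewrite ln_div by lra.
      assert (ln r <= ln (tau + r)) by (apply ln_le; lra). nra.
    - rewrite rsum_seq1_S, Rmult_plus_distr_l.
      assert (HK : 0 < INR (S K)) by (apply lt_0_INR; lia).
      assert (HK' : INR (S (S K)) = INR (S K) + 1) by apply S_INR.
      destruct (MVT_cor2 (fun t => (t + r) * ln (t + r) - t * ln t) (fun t => ln (t + r) - ln t)
        (INR (S K) * tau) (INR (S (S K)) * tau)) as [c [E Hc]].
      + rewrite HK'; nra.
      + intros u Hu. assert (0 < u) by nra. apply is_derive_Reals. auto_derive; [lra|]. field. lra.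
      + assert (ln (1 + r / (INR (S (S K)) * tau)) <= ln (c + r) - ln c).
        { assert (0 < c) by nra. rewrite <- ln_div by lra. apply ln_le.
          - assert (0 < r / (INR (S (S K)) * tau)) by (apply Rdiv_lt_0_compat; rewrite ?HK'; nra). lra.
          - replace ((c + r) / c) with (1 + r / c) by (field; lra). apply Rplus_le_compat_l.
            unfold Rdiv. apply Rmult_le_compat_l; [lra|]. apply Rinv_le_contravar; lra. }
        rewrite HK' in *. nra. }
  apply Rmult_le_reg_l with tau; auto. eapply Rle_trans; [exact G|].
  assert (HKp : 0 < INR K) by (apply lt_0_INR; auto). set (T := INR K * tau) in *.
  assert (HT : 0 < T) by (unfold T; nra).
  replace (tau * (r / tau * (1 + ln ((T + r) / r)))) with (r * (1 + ln ((T + r) / r))) by (field; lra).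
  rewrite ln_div by lra.
  assert (T * (ln (T + r) - ln T) <= r).
  { rewrite <- ln_div by lra.
    assert (ln ((T + r) / T) <= r / T).
    { eapply Rle_trans; [apply ln_le_sub; apply Rdiv_lt_0_compat; lra|]. right; field; lra. }
    apply Rle_trans with (T * (r / T)); [apply Rmult_le_compat_l; lra|right; field; lra]. }
  nra.
Qed.

(** * Weights isolating one exponential *)

Lemma remove_map_inj {A B} (dA : forall x y : A, {x = y} + {x <> y})
  (dB : forall x y : B, {x = y} + {x <> y}) (f : A -> B) x l :
  (forall y, f y = f x -> y = x) -> remove dB (f x) (map f l) = map f (remove dA x l).
Proof.
  intros H. induction l as [|a l IH]; simpl; auto.
  destruct (dB (f x) (f a)) as [E|E], (dA x a) as [E'|E']; auto.
  - exfalso. apply E'. symmetry. now apply H.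
  - subst. congruence.
  - simpl. now rewrite IH.
Qed.

Lemma rprod_ge1 {A} (l : list A) f : (forall x, In x l -> 1 <= f x) -> 1 <= rprod l f.
Proof.
  induction l as [|a l IH]; intros H; simpl; [lra|].
  assert (1 <= f a) by (apply H; simpl; auto).
  assert (1 <= rprod l f) by (apply IH; intros; apply H; simpl; auto). nra.
Qed.

Lemma rprod_incl_ge1 {A} (l m : list A) f : NoDup l -> incl l m ->
  (forall x, In x m -> 1 <= f x) -> rprod l f <= rprod m f.
Proof.
  revert m. induction l as [|a l IH]; intros m Hn Hi Hf; simpl.
  - now apply rprod_ge1.
  - inversion Hn as [|? ? Hna Hnl]; subst.
    assert (Ha : In a m) by (apply Hi; simpl; auto).
    destruct (in_split _ _ Ha) as [m1 [m2 ->]].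
    rewrite rprod_app; simpl.
    assert (rprod l f <= rprod (m1 ++ m2) f).
    { apply IH; auto.
      - intros x Hx. assert (In x (m1 ++ a :: m2)) by (apply Hi; simpl; auto).
        apply in_app_iff in H. apply in_app_iff. simpl in H.
        destruct H as [H|[H|H]]; auto. subst; contradiction.
      - intros x Hx; apply Hf. apply in_app_iff in Hx. apply in_app_iff. simpl; tauto. }
    rewrite rprod_app in H. assert (1 <= f a) by (apply Hf, Ha). nra.
Qed.

Lemma pow_div_fact_le_exp R m : 0 <= R -> R ^ m / INR (Factorial.fact m) <= exp R.
Proof.
  intros HR. eapply Rle_trans; [|apply (exp_ge_taylor R m HR)].
  destruct m as [|m]; [simpl; lra|]. rewrite tech5.
  assert (0 <= sum_f_R0 (fun k => R ^ k / INR (Factorial.fact k)) m); [|lra].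
  apply cond_pos_sum. intros k. apply Rmult_le_pos; [now apply pow_le|].
  apply Rlt_le, Rinv_0_lt_compat, lt_0_INR, Factorial.lt_O_fact.
Qed.

Lemma rprod_seq_fact R m : rprod (seq 1 m) (fun k => R / INR k) = R ^ m / INR (Factorial.fact m).
Proof.
  induction m as [|m IH]; [simpl; field|].
  rewrite seq_S, rprod_app, IH. cbn [rprod]. replace (1 + m)%nat with (S m) by lia.
  replace (Factorial.fact (S m)) with (S m * Factorial.fact m)%nat by reflexivity.
  rewrite mult_INR. simpl (R ^ S m). field. split; apply not_0_INR.
  - generalize (Factorial.lt_O_fact m); lia.
  - lia.
Qed.

(** Distinct positive integers [d <= R] give at most [R ^ m / m! <= exp R]. *)
Lemma rprod_distances_le R (D : list nat) : 0 <= R -> NoDup D ->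
  (forall d, In d D -> (1 <= d)%nat /\ INR d <= R) -> rprod D (fun d => R / INR d) <= exp R.
Proof.
  intros HR Hn HD.
  destruct (nfloor_ex R HR) as [m Hm].
  eapply Rle_trans; [apply (rprod_incl_ge1 D (seq 1 m)); auto|].
  - intros d Hd. destruct (HD d Hd) as [H1 H2]. apply in_seq.
    assert (INR d < INR (m + 1)) by (rewrite plus_INR; simpl; lra). apply INR_lt in H. lia.
  - intros k Hk. apply in_seq in Hk.
    assert (0 < INR k) by (apply lt_0_INR; lia).
    assert (INR k <= INR m) by (apply le_INR; lia).
    apply Rmult_le_reg_r with (INR k); auto. unfold Rdiv. rewrite Rmult_assoc, Rinv_l; lra.
  - rewrite rprod_seq_fact. now apply pow_div_fact_le_exp.
Qed.

Lemma rprod_filter {A} (p : A -> bool) (l : list A) f :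
  rprod l f = rprod (filter p l) f * rprod (filter (fun x => negb (p x)) l) f.
Proof.
  induction l as [|a l IH]; simpl; [ring|].
  rewrite IH. destruct (p a); simpl; ring.
Qed.

(** The factors [y < x] and [y > x] are treated apart; the distances to [x] are distinct on either side. *)
Lemma rprod_ratio_le R (X : list nat) x : 0 <= R -> NoDup X ->
  (forall y, In y X -> (1 <= y)%nat /\ INR y <= R) -> INR x <= R ->
  rprod (remove Nat.eq_dec x X) (fun y => INR y / Rabs (INR x - INR y)) <= exp (2 * R).
Proof.
  intros HR Hn HX Hx.
  assert (Hn' : NoDup (remove Nat.eq_dec x X)) by now apply NoDup_remove_dec || (clear - Hn; induction Hn; simpl; [constructor|]; destruct (Nat.eq_dec x x0); auto; constructor; auto; intros Hi; apply in_remove in Hi; tauto).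
  set (Y := remove Nat.eq_dec x X) in *.
  assert (HY : forall y, In y Y -> (1 <= y)%nat /\ INR y <= R /\ y <> x).
  { intros y Hy. apply in_remove in Hy. destruct Hy. split; [|split]; auto; apply HX; auto. }
  rewrite (rprod_filter (fun y => Nat.ltb y x)).
  replace (2 * R) with (R + R) by ring. rewrite exp_plus.
  assert (Fin : forall p (g : nat -> nat), (forall y z, In y (filter p Y) -> In z (filter p Y) -> g y = g z -> y = z) ->
    (forall y, In y (filter p Y) -> (1 <= g y)%nat /\ INR (g y) <= R /\ Rabs (INR x - INR y) = INR (g y)) ->
    rprod (filter p Y) (fun y => INR y / Rabs (INR x - INR y)) <= exp R).
  { intros p g Hg Hgy.
    apply Rle_trans with (rprod (map g (filter p Y)) (fun d => R / INR d)).
    - rewrite rprod_map. apply rprod_le. intros y Hy. destruct (Hgy y Hy) as [G1 [G2 G3]].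
      rewrite G3. apply filter_In in Hy. destruct (HY y (proj1 Hy)) as [H1 [H2 _]].
      assert (0 < INR (g y)) by (apply lt_0_INR; lia).
      assert (0 < / INR (g y)) by (apply Rinv_0_lt_compat; auto).
      split; [apply Rmult_le_pos; [apply pos_INR|lra]|]. apply Rmult_le_compat_r; lra.
    - apply rprod_distances_le; auto.
      + apply NoDup_map_NoDup_ForallPairs; [|now apply NoDup_filter].
        intros y z Hy Hz. now apply Hg.
      + intros d Hd. apply in_map_iff in Hd. destruct Hd as [y [<- Hy]].
        destruct (Hgy y Hy) as [G1 [G2 G3]]. auto. }
  apply Rmult_le_compat.
  - apply rprod_ge0. intros y _. apply Rmult_le_pos; [apply pos_INR|].
    destruct (Req_dec (INR x - INR y) 0) as [E|E]; [rewrite E, Rabs_R0, Rinv_0; lra|].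
    apply Rlt_le, Rinv_0_lt_compat, Rabs_pos_lt; auto.
  - apply rprod_ge0. intros y _. apply Rmult_le_pos; [apply pos_INR|].
    destruct (Req_dec (INR x - INR y) 0) as [E|E]; [rewrite E, Rabs_R0, Rinv_0; lra|].
    apply Rlt_le, Rinv_0_lt_compat, Rabs_pos_lt; auto.
  - apply (Fin _ (fun y => x - y)%nat).
    + intros y z Hy Hz. apply filter_In in Hy, Hz.
      destruct Hy as [_ Hy], Hz as [_ Hz]. apply Nat.ltb_lt in Hy, Hz. lia.
    + intros y Hy. apply filter_In in Hy. destruct Hy as [_ Hy]. apply Nat.ltb_lt in Hy.
      rewrite minus_INR by lia. assert (INR y < INR x) by (apply lt_INR; auto).
      rewrite Rabs_pos_eq by lra. repeat split; try lia; generalize (pos_INR y); lra.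
  - apply (Fin _ (fun y => y - x)%nat).
    + intros y z Hy Hz. apply filter_In in Hy, Hz.
      destruct Hy as [Iy Hy], Hz as [Iz Hz]. destruct (HY y Iy) as [_ [_ N1]], (HY z Iz) as [_ [_ N2]].
      apply Bool.negb_true_iff, Nat.ltb_ge in Hy, Hz. lia.
    + intros y Hy. apply filter_In in Hy. destruct Hy as [Iy Hy]. destruct (HY y Iy) as [_ [H2 N]].
      apply Bool.negb_true_iff, Nat.ltb_ge in Hy.
      rewrite minus_INR by lia. assert (INR x < INR y) by (apply lt_INR; lia).
      rewrite Rabs_left by lra. generalize (pos_INR x). repeat split; [lia|lra|lra].
Qed.

(** [|R - a * v / R| = |v - a|] on the circle [|v| = R]: the mirrored factor. *)
Lemma mirror_factor R a (v : C) : 0 < R -> Cmod v = R ->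
  Cmod (R + - (RtoC a / R) * v)%C = Cmod (v - RtoC a).
Proof.
  intros HR Hv.
  assert (E : Cmod (R + - (RtoC a / R) * v)%C * Cmod (R + - (RtoC a / R) * v)%C = Cmod (v - RtoC a) * Cmod (v - RtoC a)).
  { rewrite !Cmod_sqr. assert (Hs := Cmod_sqr v). rewrite Hv in Hs.
    assert (Ed : (RtoC a / R)%C = RtoC (a / R)) by (rewrite RtoC_div; auto; lra).
    rewrite Ed. destruct v as [p q]. simpl in *.
    transitivity (R * R - 2 * a * p + (a / R) * (a / R) * (p * p + q * q)); [field; lra|].
    rewrite <- Hs. transitivity ((p * p + q * q) - 2 * a * p + a * a); [rewrite <- Hs; field; lra|ring]. }
  generalize (Cmod_ge_0 (R + - (RtoC a / R) * v)%C) (Cmod_ge_0 (v - RtoC a)). nra.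
Qed.

Lemma Cmod_log_factor x y t : 0 <= x -> 0 < t ->
  Cmod ((x, y) + RtoC t)%C = t * exp (log_factor x y t).
Proof.
  intros Hx Ht. unfold log_factor, Cmod. simpl.
  rewrite Rplus_0_r.
  replace ((x + t) * ((x + t) * 1) + y * (y * 1)) with ((t * t) * (((t + x) * ((t + x) * 1) + y * (y * 1)) / (t * (t * 1))))
    by (field; lra).
  assert (0 < ((t + x) * ((t + x) * 1) + y * (y * 1)) / (t * (t * 1))) by (apply Rdiv_lt_0_compat; nra).
  set (q := _ / _) in *.
  rewrite sqrt_mult by nra. rewrite sqrt_square by lra. f_equal.
  rewrite <- (sqrt_square (exp (/ 2 * ln q))) by (apply Rlt_le, exp_pos).
  f_equal. rewrite <- exp_plus. replace (/ 2 * ln q + / 2 * ln q) with (ln q) by field.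
  now rewrite exp_ln.
Qed.

(** Put [rho = eta * R] and integrate
   [e^(i theta w) * prod (mirrored factors) / (w * prod (w - x) * prod (w + rho + k tau))] over the circle of radius [R]
   about [R - rho]. The poles inside are [0] and the [x] in [X]; dividing by the residue at [0] gives
   [1 + csum X (fun x => w x * cis (theta * x))]. The mirrored factors have the modulus of [w - x] on the circle and cancel
   those; at [0] they are larger than [x], whence the last product in the bound. The factors [w + rho + k tau]
   outgrow [e^(c |Im w|)] on the circle and have their zeros outside. *)
Lemma isolating_weights c R eta (X : list nat) K :
  0 < c -> 1 <= R -> 0 < eta <= 1 / 2 -> NoDup X ->
  (forall x, In x X -> eta * R < INR x <= R) ->
  (0 < K)%nat -> exp 2 * (2 * R + PI / (2 * c)) <= INR (S K) * (PI / (2 * c)) ->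
  exists w : nat -> C,
    (forall x, In x X -> Cmod (w x) <= exp (2 * R) * (2 / eta) ^ length X) /\
    forall theta, Rabs theta <= c ->
      Cmod (1 + csum X (fun x => w x * cis (theta * INR x)))%C
      <= (1 / eta) * (exp 1 * (1 + 4 * c * R / PI)) *
         exp (2 * c * (eta * R) / PI * (1 + ln ((INR K * (PI / (2 * c)) + eta * R) / (eta * R)))) *
         rprod X (fun x => INR x / ((1 - eta) * INR x + (2 - eta) * (eta * R))).
Proof.
  intros Hc HR He Hn HX HK HKT.
  generalize PI_RGT_0; intros HPI.
  set (tau := PI / (2 * c)) in *. assert (Htau : 0 < tau) by (apply Rdiv_lt_0_compat; lra).
  set (rho := eta * R) in *. assert (Hrho : 0 < rho) by (unfold rho; nra).
  assert (HrhoR : rho <= R / 2) by (unfold rho; nra).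
  assert (HX1 : forall x, In x X -> (1 <= x)%nat).
  { intros x Hx. destruct (HX x Hx). apply INR_lt. simpl. destruct x; simpl in *; lra || lia. }
  (* In the variable [v = w - (R - rho)], centred at [0]: the exponent [0], the exponents [x], the extra poles. *)
  set (v0 := RtoC (- (R - rho))).
  set (vx := fun x : nat => RtoC (INR x - (R - rho))).
  set (ve := fun k : nat => RtoC (- R - INR k * tau)).
  set (l := v0 :: map vx X ++ map ve (seq 1 K)).
  set (P := fun v : C => cprod X (fun x => R + - (vx x / R) * v)%C).
  assert (Ivx : forall x y, vx y = vx x -> y = x).
  { intros x y E. apply RtoC_inj in E. apply INR_eq. lra. }
  assert (Ive : forall x y, ve y = ve x -> y = x).
  { intros x y E. apply RtoC_inj in E. apply INR_eq. nra. }
  assert (Hk0 : forall k, In k (seq 1 K) -> 1 <= INR k).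
  { intros k Hk. apply in_seq in Hk. apply INR_ge1; lia. }
  assert (N0x : ~ In v0 (map vx X)).
  { intros H. apply in_map_iff in H. destruct H as [x [E Hx]]. apply RtoC_inj in E.
    destruct (HX x Hx). lra. }
  assert (N0e : ~ In v0 (map ve (seq 1 K))).
  { intros H. apply in_map_iff in H. destruct H as [k [E Hk]]. apply RtoC_inj in E.
    specialize (Hk0 k Hk). nra. }
  assert (Nxe : forall x, In x X -> ~ In (vx x) (map ve (seq 1 K))).
  { intros x Hx H. apply in_map_iff in H. destruct H as [k [E Hk]]. apply RtoC_inj in E.
    specialize (Hk0 k Hk). destruct (HX x Hx). nra. }
  assert (Hl : NoDup l).
  { unfold l. constructor.
    - rewrite in_app_iff. tauto.
    - apply NoDup_app.
      + apply NoDup_map_NoDup_ForallPairs; auto. intros x y _ _ E. symmetry. auto.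
      + apply NoDup_map_NoDup_ForallPairs; [intros x y _ _ E; symmetry; auto|apply seq_NoDup].
      + intros z Hz Hz'. apply in_map_iff in Hz. destruct Hz as [x [<- Hx]]. apply (Nxe x Hx Hz'). }
  assert (Cv0 : Cmod v0 = R - rho).
  { unfold v0. rewrite Cmod_R, Rabs_left; lra. }
  assert (Cvx : forall x, In x X -> Cmod (vx x) < R).
  { intros x Hx. unfold vx. rewrite Cmod_R. destruct (HX x Hx). apply Rabs_def1; lra. }
  assert (Cve : forall k, In k (seq 1 K) -> R < Cmod (ve k)).
  { intros k Hk. unfold ve. rewrite Cmod_R. specialize (Hk0 k Hk).
    rewrite Rabs_left; nra. }
  assert (Cl : forall b, In b l -> Cmod b <> R).
  { intros b [<-|Hb]; [lra|]. apply in_app_iff in Hb. destruct Hb as [Hb|Hb];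
    apply in_map_iff in Hb; destruct Hb as [x [<- Hx]].
    - generalize (Cvx x Hx); lra.
    - generalize (Cve x Hx); lra. }
  assert (HPpos : forall x, In x X -> 0 < (1 - eta) * INR x + (2 - eta) * rho).
  { intros x Hx. destruct (HX x Hx). nra. }
  assert (HP0 : Cmod (P v0) = rprod X (fun x => (1 - eta) * INR x + (2 - eta) * rho)).
  { unfold P. rewrite Cmod_cprod. apply rprod_ext. intros x Hx.
    unfold vx, v0. rewrite <- RtoC_div, <- RtoC_opp, <- RtoC_mult, <- RtoC_plus by lra.
    rewrite Cmod_R. replace (R + - ((INR x - (R - rho)) / R) * - (R - rho)) with ((1 - eta) * INR x + (2 - eta) * rho).
    - apply Rabs_pos_eq. generalize (HPpos x Hx). lra.
    - unfold rho. field. lra. }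
  assert (HP0pos : 0 < Cmod (P v0)) by (rewrite HP0; apply rprod_pos; auto).
  assert (W0 : Cmod (weight l v0) = / (rprod X INR * (rprod (seq 1 K) (fun k => INR k * tau) *
      rprod (seq 1 K) (fun k => 1 + rho / (INR k * tau))))).
  { unfold weight, l. simpl. destruct (Ceq_dec v0 v0) as [_|]; [|congruence].
    rewrite notin_remove by (rewrite in_app_iff; tauto).
    rewrite Cmod_inv by (apply cprod_neq0; intros b Hb; apply Csub_neq0; intros <-; apply in_app_iff in Hb; tauto).
    f_equal. rewrite cprod_app, Cmod_mult, !Cmod_cprod, !rprod_map. f_equal.
    - apply rprod_ext. intros x _. unfold v0, vx. rewrite <- RtoC_minus, Cmod_R.
      replace (- (R - rho) - (INR x - (R - rho))) with (- INR x) by ring.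
      rewrite Rabs_Ropp. apply Rabs_pos_eq, pos_INR.
    - rewrite <- rprod_mult. apply rprod_ext. intros k Hk. unfold v0, ve. rewrite <- RtoC_minus, Cmod_R.
      specialize (Hk0 k Hk). rewrite Rabs_pos_eq by nra. field. split; lra. }
  assert (PX : 0 < rprod X INR).
  { apply rprod_pos. intros x Hx. apply lt_0_INR. generalize (HX1 x Hx); lia. }
  assert (PK : 0 < rprod (seq 1 K) (fun k => INR k * tau)).
  { apply rprod_pos. intros k Hk. specialize (Hk0 k Hk). nra. }
  assert (PK1 : 0 < rprod (seq 1 K) (fun k => 1 + rho / (INR k * tau))).
  { apply rprod_pos. intros k Hk. specialize (Hk0 k Hk).
    assert (0 < rho / (INR k * tau)) by (apply Rdiv_lt_0_compat; nra). lra. }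
  assert (W0pos : 0 < Cmod (weight l v0)).
  { rewrite W0. apply Rinv_0_lt_compat. repeat apply Rmult_lt_0_compat; auto. }
  assert (W0n : weight l v0 <> 0%C) by now apply Cmod_gt_0.
  assert (P0n : P v0 <> 0%C) by now apply Cmod_gt_0.
  exists (fun x => weight l (vx x) * P (vx x) / (weight l v0 * P v0))%C. split.
  - intros x Hx. rewrite Cmod_div, !Cmod_mult by (apply Cmult_neq_0; auto).
    assert (Wx : Cmod (weight l (vx x)) = / (INR x * (rprod (remove Nat.eq_dec x X) (fun y => Rabs (INR x - INR y)) *
       rprod (seq 1 K) (fun k => INR x + rho + INR k * tau)))).
    { unfold weight, l. simpl. destruct (Ceq_dec (vx x) v0) as [E|_].
      { exfalso. apply N0x. rewrite <- E. now apply in_map. }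
      rewrite remove_app, (remove_map_inj Nat.eq_dec) by (intros; auto).
      rewrite (notin_remove _ (map ve _)) by auto.
      rewrite Cmod_inv.
      2:{ apply cprod_neq0. intros b Hb. apply Csub_neq0. intros <-. destruct Hb as [Hb|Hb].
          - apply N0x. rewrite Hb. now apply in_map.
          - apply in_app_iff in Hb. destruct Hb as [Hb|Hb]; [|eapply Nxe; eauto].
            apply in_map_iff in Hb. destruct Hb as [y [E Hy]]. apply in_remove in Hy.
            apply Ivx in E. tauto. }
      f_equal. cbn [cprod]. rewrite Cmod_mult. f_equal.
      { unfold vx, v0. rewrite <- RtoC_minus, Cmod_R. rewrite Rabs_pos_eq; [ring|generalize (pos_INR x); lra]. }
      rewrite cprod_app, Cmod_mult, !Cmod_cprod, !rprod_map. f_equal.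
      - apply rprod_ext. intros y _. unfold vx. rewrite <- RtoC_minus, Cmod_R. f_equal. ring.
      - apply rprod_ext. intros k Hk. specialize (Hk0 k Hk). unfold vx, ve. rewrite <- RtoC_minus, Cmod_R.
        rewrite Rabs_pos_eq; [ring|]. generalize (pos_INR x). nra. }
    assert (Rx : Cmod (weight l (vx x)) / Cmod (weight l v0) <= exp (2 * R)).
    { eapply Rle_trans; [|apply (rprod_ratio_le R X x); auto; try lra].
      2:{ intros y Hy. split; [auto|apply HX; auto]. }
      2:{ apply HX; auto. }
      set (Y := remove Nat.eq_dec x X) in *.
      assert (Hd : forall y, In y Y -> 0 < Rabs (INR x - INR y)).
      { intros y Hy. apply in_remove in Hy. apply Rabs_pos_lt. intros E.
        apply (proj2 Hy). apply INR_eq. lra. }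
      assert (EX : rprod X INR = INR x * rprod Y INR).
      { unfold Y. clear - Hx Hn. induction X as [|a Z IH]; [destruct Hx|]. simpl.
        inversion Hn as [|? ? Ha Hz]; subst.
        destruct Hx as [->|Hx].
        - destruct (Nat.eq_dec x x) as [_|]; [|congruence]. now rewrite notin_remove.
        - destruct (Nat.eq_dec x a) as [->|E]; [contradiction|]. simpl. rewrite IH by auto. ring. }
      assert (Hxp : 0 < INR x) by (apply lt_0_INR; generalize (HX1 x Hx); lia).
      assert (PY : 0 < rprod Y (fun y => Rabs (INR x - INR y))) by (apply rprod_pos; auto).
      assert (PE : 0 < rprod (seq 1 K) (fun k => INR x + rho + INR k * tau)).
      { apply rprod_pos. intros k Hk. specialize (Hk0 k Hk). nra. }
      rewrite Wx, W0, EX.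
      unfold Rdiv at 1. rewrite Rinv_inv.
      replace (/ (INR x * (rprod Y (fun y => Rabs (INR x - INR y)) * rprod (seq 1 K) (fun k => INR x + rho + INR k * tau))) *
        (INR x * rprod Y INR * (rprod (seq 1 K) (fun k => INR k * tau) * rprod (seq 1 K) (fun k => 1 + rho / (INR k * tau)))))
      with ((rprod Y INR * / rprod Y (fun y => Rabs (INR x - INR y))) *
         ((rprod (seq 1 K) (fun k => INR k * tau) * rprod (seq 1 K) (fun k => 1 + rho / (INR k * tau))) / rprod (seq 1 K) (fun k => INR x + rho + INR k * tau)))
      by (field; repeat split; lra).
      rewrite <- rprod_inv, <- !rprod_mult.
      change (rprod Y (fun y => INR y / Rabs (INR x - INR y))) with (rprod Y (fun y => INR y * / Rabs (INR x - INR y))).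
      rewrite <- (Rmult_1_r (rprod Y (fun y => INR y * / Rabs (INR x - INR y)))) at 2.
      apply Rmult_le_compat_l.
      { apply rprod_ge0. intros y Hy. apply Rmult_le_pos; [apply pos_INR|].
        apply Rlt_le, Rinv_0_lt_compat; auto. }
      apply Rmult_le_reg_r with (rprod (seq 1 K) (fun k => INR x + rho + INR k * tau)); auto.
      unfold Rdiv. rewrite Rmult_assoc, Rinv_l, Rmult_1_r, Rmult_1_l by lra.
      apply rprod_le. intros k Hk. specialize (Hk0 k Hk).
      replace (INR k * tau * (1 + rho * / (INR k * tau))) with (INR k * tau + rho) by (field; split; lra).
      assert (0 < INR k * tau) by nra. lra. }
    assert (Px : Cmod (P (vx x)) / Cmod (P v0) <= (2 / eta) ^ length X).
    { rewrite HP0. unfold P. rewrite Cmod_cprod. unfold Rdiv at 1. rewrite <- rprod_inv, <- rprod_mult.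
      rewrite <- rprod_const. apply rprod_le. intros y Hy. split.
      - apply Rmult_le_pos; [apply Cmod_ge_0|]. apply Rlt_le, Rinv_0_lt_compat; auto.
      - specialize (HPpos y Hy). apply Rmult_le_reg_r with ((1 - eta) * INR y + (2 - eta) * rho); auto.
        rewrite Rmult_assoc, Rinv_l, Rmult_1_r by lra.
        apply Rle_trans with (2 * R).
        + eapply Rle_trans; [apply Cmod_triangle|]. rewrite Cmod_R, Rabs_pos_eq by lra.
          rewrite Cmod_mult, Cmod_opp, Cmod_div, Cmod_R, (Rabs_pos_eq R) by (try lra; intros E; apply RtoC_inj in E; lra).
          generalize (Cvx x Hx) (Cvx y Hy) (Cmod_ge_0 (vx x)) (Cmod_ge_0 (vx y)); intros.
          assert (Cmod (vx y) / R * Cmod (vx x) <= 1 * R); [|lra].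
          apply Rmult_le_compat; try lra.
          * apply Rmult_le_pos; auto. apply Rlt_le, Rinv_0_lt_compat; lra.
          * apply Rle_div_l; [lra|lra].
        + destruct (HX y Hy).
          apply Rle_trans with (2 / eta * rho); [unfold rho; right; field; lra|].
          apply Rmult_le_compat_l; [apply Rlt_le, Rdiv_lt_0_compat; lra|]. nra. }
    replace (Cmod (weight l (vx x)) * Cmod (P (vx x)) / (Cmod (weight l v0) * Cmod (P v0)))
      with ((Cmod (weight l (vx x)) / Cmod (weight l v0)) * (Cmod (P (vx x)) / Cmod (P v0)))
      by (field; split; lra).
    apply Rmult_le_compat; auto; (apply Rmult_le_pos; [apply Cmod_ge_0|apply Rlt_le, Rinv_0_lt_compat; auto]).
  - intros theta Hth.
    set (F := fun v : C => (cis (theta * (R - rho)) * (Cexp ((0, theta) * v) * P v))%C).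
    assert (HF : has_residues R F).
    { apply has_residues_scal; [lra|].
      assert (HPb : forall v, Cmod v <= R -> Cmod (P v) <= (2 * R) ^ length X).
      { intros v Hv. unfold P. rewrite Cmod_cprod, <- rprod_const. apply rprod_le. intros y Hy.
        split; [apply Cmod_ge_0|].
        eapply Rle_trans; [apply Cmod_triangle|]. rewrite Cmod_R, Rabs_pos_eq by lra.
        rewrite Cmod_mult, Cmod_opp, Cmod_div, Cmod_R, (Rabs_pos_eq R) by (try lra; intros E; apply RtoC_inj in E; lra).
        generalize (Cvx y Hy) (Cmod_ge_0 v) (Cmod_ge_0 (vx y)); intros.
        assert (Cmod (vx y) / R * Cmod v <= 1 * R); [|lra].
        apply Rmult_le_compat; try lra.
        * apply Rmult_le_pos; auto. apply Rlt_le, Rinv_0_lt_compat; lra.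
        * apply Rle_div_l; [lra|lra]. }
      apply (has_residues_exp R (0, theta) P ((2 * R) ^ length X)); auto; [lra|].
      eapply has_residues_ext; [|apply (has_residues_prod R X (fun _ => RtoC R) (fun x => - (vx x / R))%C (fun _ => 1%C));
        [lra|apply has_residues_1; lra]].
      intros v. unfold P. simpl. ring. }
    assert (HFr : forall a, F (RtoC a) = (cis (theta * (a + (R - rho))) * P (RtoC a))%C).
    { intros a. unfold F. rewrite Rmult_plus_distr_l, cis_plus.
      replace (Cexp ((0, theta) * RtoC a)) with (cis (theta * a)); [ring|].
      unfold Cexp. simpl. replace (0 * a - theta * 0) with 0 by ring.
      replace (0 * 0 + theta * a) with (theta * a) by ring. rewrite exp_0. ring. }
    assert (Lim := residue_formula R F l ltac:(lra) HF Hl ltac:(discriminate) Cl).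
    set (V := (1 + csum X (fun x => weight l (vx x) * P (vx x) / (weight l v0 * P v0) * cis (theta * INR x)))%C).
    assert (EV : csum l (fun b => weight l b * (if Rlt_dec (Cmod b) R then F b else 0%C))%C = (weight l v0 * P v0 * V)%C).
    { unfold l at 1. cbn [csum]. rewrite csum_app, !csum_map.
      rewrite (csum_0 (seq 1 K)).
      2:{ intros k Hk. specialize (Cve k Hk). destruct (Rlt_dec (Cmod (ve k)) R); [lra|ring]. }
      destruct (Rlt_dec (Cmod v0) R) as [_|H]; [|lra].
      unfold V. rewrite Cmult_plus_distr_l, <- csum_scal.
      replace (F v0) with (P v0).
      2:{ unfold v0 at 2. rewrite HFr. replace (theta * (- (R - rho) + (R - rho))) with 0 by ring.
          rewrite cis_0. fold v0. ring. }
      rewrite (csum_ext X _ (fun x => weight l v0 * P v0 * (weight l (vx x) * P (vx x) / (weight l v0 * P v0) * cis (theta * INR x)))%C); [ring|].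
      intros x Hx. specialize (Cvx x Hx). destruct (Rlt_dec (Cmod (vx x)) R) as [_|]; [|lra].
      unfold vx at 2. rewrite HFr. fold (vx x).
      replace (INR x - (R - rho) + (R - rho)) with (INR x) by ring. field. auto. }
    rewrite EV in Lim.
    set (Bd := (1 / eta) * (exp 1 * (1 + 4 * c * R / PI)) / rprod (seq 1 K) (fun k => INR k * tau)).
    assert (HBd : 0 <= Bd).
    { unfold Bd. apply Rmult_le_pos; [|apply Rlt_le, Rinv_0_lt_compat; auto].
      apply Rmult_le_pos; [apply Rlt_le, Rdiv_lt_0_compat; lra|].
      apply Rmult_le_pos; [apply Rlt_le, exp_pos|].
      assert (0 < 4 * c * R / PI) by (apply Rdiv_lt_0_compat; nra). lra. }
    assert (HV : Cmod (weight l v0 * P v0 * V) <= Bd).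
    { apply (clim_Cmod_le _ _ _ Lim). intros N. exists N. split; [lia|].
      apply cavg_le_const; auto. intros j _. set (t := root_angle N j).
      set (v := (R * cis t)%C).
      assert (Hv : Cmod v = R) by (apply Cmod_circle; lra).
      assert (Hvn : forall b, In b l -> (v - b)%C <> 0%C).
      { intros b Hb. apply Cneq_of_Cmod. rewrite Hv. auto using not_eq_sym. }
      rewrite !Cmod_mult, Hv, Cmod_inv by (apply cprod_neq0; auto).
      unfold F. rewrite !Cmod_mult, Cmod_cis, Cmod_Cexp. unfold l. cbn [cprod].
      rewrite cprod_app, !Cmod_mult, !cprod_map.
      replace (Cmod (P v)) with (Cmod (cprod X (fun x => v - vx x)%C)).
      2:{ unfold P. rewrite !Cmod_cprod. apply rprod_ext. intros x _. unfold vx.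
          symmetry. apply mirror_factor; auto. lra. }
      assert (HXn : 0 < Cmod (cprod X (fun x => v - vx x)%C)).
      { apply Cmod_gt_0. apply cprod_neq0. intros x Hx. apply Hvn. unfold l. right. apply in_app_iff. left.
        now apply in_map. }
      assert (H0n : rho <= Cmod (v - v0)).
      { generalize (Cmod_sub_le v v0). rewrite Hv, Cv0. lra. }
      destruct v as [vre vim] eqn:Ev.
      assert (Hsq : vre * vre + vim * vim = R * R).
      { assert (Q := Cmod_sqr (vre, vim)). rewrite Hv in Q. simpl in Q. lra. }
      assert (Hre : 0 <= vre + R) by nra.
      replace (Cmod (cprod (seq 1 K) (fun k => (vre, vim) - ve k)%C))
        with (rprod (seq 1 K) (fun k => INR k * tau) * exp (rsum (seq 1 K) (fun k => log_factor (vre + R) vim (INR k * tau)))).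
      2:{ rewrite Cmod_cprod, <- rprod_exp, <- rprod_mult. apply rprod_ext. intros k Hk. specialize (Hk0 k Hk).
          rewrite <- Cmod_log_factor by (auto; nra). f_equal.
          unfold ve. apply injective_projections; simpl; ring. }
      assert (LF := log_factor_circle tau (vre + R) vim K R Htau ltac:(lra) ltac:(simpl; nra) HKT).
      replace (PI / (2 * tau)) with c in LF by (unfold tau; field; lra).
      replace (2 * R / tau) with (4 * c * R / PI) in LF by (unfold tau; field; lra).
      set (S := rsum (seq 1 K) (fun k => log_factor (vre + R) vim (INR k * tau))) in *.
      set (PKK := rprod (seq 1 K) (fun k => INR k * tau)) in *.
      set (CX := Cmod (cprod X (fun x => (vre, vim) - vx x)%C)) in *.
      set (D0 := Cmod ((vre, vim) - v0)%C) in *.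
      set (G := 1 + 4 * c * R / PI) in *.
      assert (HG : 0 < G).
      { unfold G. assert (0 < 4 * c * R / PI) by (apply Rdiv_lt_0_compat; nra). lra. }
      simpl (fst ((0, theta) * (vre, vim))%C).
      assert (ES : exp (0 * vre - theta * vim) <= exp S * (exp 1 * G)).
      { rewrite <- (exp_ln G HG), <- !exp_plus. 
        assert (0 * vre - theta * vim <= S + (1 + ln G)).
        { assert (- (theta * vim) <= c * Rabs vim); [|lra].
          rewrite <- Rabs_Ropp. apply Rle_trans with (Rabs theta * Rabs (- vim)).
          - rewrite <- Rabs_mult. replace (- (theta * vim)) with (theta * - vim) by ring. apply Rle_abs.
          - apply Rmult_le_compat_r; auto. apply Rabs_pos. }
        now apply exp_le. }
      generalize (exp_pos S); intros HeS.
      assert (H1G : 0 < exp 1 * G) by (apply Rmult_lt_0_compat; auto; apply exp_pos).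
      replace (R * (1 * (exp (0 * vre - theta * vim) * CX)) * / (D0 * (CX * (PKK * exp S))))
        with ((R / D0) * (exp (0 * vre - theta * vim) / exp S) * / PKK) by (field; repeat split; lra).
      unfold Bd. fold PKK G. unfold Rdiv at 3. apply Rmult_le_compat_r; [apply Rlt_le, Rinv_0_lt_compat; auto|].
      apply Rmult_le_compat.
      - apply Rmult_le_pos; [lra|apply Rlt_le, Rinv_0_lt_compat; lra].
      - apply Rmult_le_pos; [apply Rlt_le, exp_pos|apply Rlt_le, Rinv_0_lt_compat; lra].
      - apply Rle_trans with (R / rho); [|unfold rho; right; field; lra].
        apply Rmult_le_compat_l; [lra|]. apply Rinv_le_contravar; lra.
      - apply Rle_div_l; [auto|]. lra. }
    rewrite !Cmod_mult in HV.
    apply Rmult_le_reg_l with (Cmod (weight l v0) * Cmod (P v0)); [apply Rmult_lt_0_compat; auto|].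
    eapply Rle_trans; [exact HV|].
    assert (LS := log_sum_upper tau rho K Htau Hrho HK).
    replace (rho / tau) with (2 * c * rho / PI) in LS by (unfold tau; field; lra).
    set (LK := 2 * c * rho / PI * (1 + ln ((INR K * tau + rho) / rho))) in *.
    assert (EK : rprod (seq 1 K) (fun k => 1 + rho / (INR k * tau)) <= exp LK).
    { rewrite <- (exp_ln (rprod _ _)) by auto. rewrite ln_rprod.
      - now apply exp_le.
      - intros k Hk. specialize (Hk0 k Hk).
        assert (0 < rho / (INR k * tau)) by (apply Rdiv_lt_0_compat; nra). lra. }
    rewrite W0, HP0.
    replace (rprod X (fun x => INR x / ((1 - eta) * INR x + (2 - eta) * rho)))
      with (rprod X INR * / rprod X (fun x => (1 - eta) * INR x + (2 - eta) * rho))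
      by (rewrite <- rprod_inv, <- rprod_mult; reflexivity).
    unfold Bd. set (G := 1 + 4 * c * R / PI) in *.
    assert (HG : 0 < G).
    { unfold G. assert (0 < 4 * c * R / PI) by (apply Rdiv_lt_0_compat; nra). lra. }
    assert (HPP : 0 < rprod X (fun x => (1 - eta) * INR x + (2 - eta) * rho)) by (rewrite <- HP0; auto).
    set (PP := rprod X (fun x => (1 - eta) * INR x + (2 - eta) * rho)) in *.
    set (EE := rprod (seq 1 K) (fun k => 1 + rho / (INR k * tau))) in *.
    set (PKK := rprod (seq 1 K) (fun k => INR k * tau)) in *.
    replace (/ (rprod X INR * (PKK * EE)) * PP * (1 / eta * (exp 1 * G) * exp LK * (rprod X INR * / PP)))
      with ((1 / eta * (exp 1 * G) / PKK) * (exp LK / EE)).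
    2:{ field. repeat split; lra. }
    rewrite <- (Rmult_1_r (1 / eta * (exp 1 * G) / PKK)) at 1.
    apply Rmult_le_compat_l; auto.
    apply Rmult_le_reg_r with EE; auto. unfold Rdiv. rewrite Rmult_assoc, Rinv_l; lra.
Qed.

(** * Isolating one exponent of a sparse set *)

Definition indic (Q : nat -> Prop) (k : nat) : R :=
  if excluded_middle_informative (Q k) then 1 else 0.

Lemma indic_bounds Q k : 0 <= indic Q k <= 1.
Proof. unfold indic. destruct (excluded_middle_informative (Q k)); lra. Qed.

Lemma rsum_filter {A} (p : A -> bool) (l : list A) f :
  rsum (filter p l) f = rsum l (fun x => if p x then f x else 0).
Proof.
  induction l as [|a l IH]; simpl; auto. destruct (p a); simpl; rewrite IH; ring.
Qed.

Lemma ln_1p_lower u : 0 <= u -> u - u * u / 2 <= ln (1 + u).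
Proof.
  intros Hu. destruct (Req_dec u 0) as [->|Hn]; [rewrite Rplus_0_r, ln_1; lra|].
  destruct (MVT_cor2 (fun t => ln (1 + t) - (t - t * t / 2)) (fun t => / (1 + t) - (1 - t)) 0 u) as [x [E Hx]]; [lra| |].
  - intros t Ht. apply is_derive_Reals. auto_derive; [lra|]. field. lra.
  - rewrite Rplus_0_r, ln_1 in E.
    assert (0 <= / (1 + x) - (1 - x)).
    { replace (/ (1 + x) - (1 - x)) with (x * x / (1 + x)) by (field; lra).
      apply Rmult_le_pos; [nra|]. apply Rlt_le, Rinv_0_lt_compat; lra. }
    nra.
Qed.

Lemma harmonic_ge j n : (0 < j)%nat ->
  ln (INR (j + n) / INR j) <= rsum (seq j n) (fun x => / INR x).
Proof.
  intros Hj. assert (Hj' : 0 < INR j) by (apply lt_0_INR; auto).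
  induction n as [|n IH].
  - rewrite Nat.add_0_r. unfold Rdiv. rewrite Rinv_r, ln_1 by lra. simpl. lra.
  - rewrite seq_S, rsum_app. simpl rsum at 2. rewrite Nat.add_succ_r, S_INR.
    assert (Hp : 0 < INR (j + n)) by (apply lt_0_INR; lia).
    rewrite ln_div in * by lra.
    assert (ln (INR (j + n) + 1) - ln (INR (j + n)) <= / INR (j + n)).
    { rewrite <- ln_div by lra. eapply Rle_trans; [apply ln_le_sub, Rdiv_lt_0_compat; lra|].
      right; field; lra. }
    lra.
Qed.

Lemma harmonic_le j n : (0 < j)%nat ->
  rsum (seq j n) (fun x => / (INR x + 1)) <= ln (INR (j + n) / INR j).
Proof.
  intros Hj. assert (Hj' : 0 < INR j) by (apply lt_0_INR; auto).
  induction n as [|n IH].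
  - rewrite Nat.add_0_r. unfold Rdiv. rewrite Rinv_r, ln_1 by lra. simpl. lra.
  - rewrite seq_S, rsum_app. simpl rsum at 2. rewrite Nat.add_succ_r, S_INR.
    assert (Hp : 0 < INR (j + n)) by (apply lt_0_INR; lia).
    rewrite ln_div in * by lra.
    assert (ln (INR (j + n)) - ln (INR (j + n) + 1) <= - / (INR (j + n) + 1)).
    { rewrite <- ln_div by lra. eapply Rle_trans; [apply ln_le_sub, Rdiv_lt_0_compat; lra|].
      right; field; lra. }
    lra.
Qed.

Lemma inverse_squares_le j n : (0 < j)%nat ->
  rsum (seq j n) (fun x => / (INR x * INR x)) <= 2 / INR j.
Proof.
  intros Hj. assert (Hj' : 0 < INR j) by (apply lt_0_INR; auto).
  assert (rsum (seq j n) (fun x => / (INR x * INR x)) <= 2 / INR j - 2 / INR (j + n)).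
  { induction n as [|n IH].
    - rewrite Nat.add_0_r. simpl. lra.
    - rewrite seq_S, rsum_app. simpl rsum at 2. rewrite Nat.add_succ_r, S_INR.
      assert (Hp : 1 <= INR (j + n)) by (apply INR_ge1; lia).
      assert (/ (INR (j + n) * INR (j + n)) <= 2 / INR (j + n) - 2 / (INR (j + n) + 1)).
      { set (y := INR (j + n)) in *. replace (2 / y - 2 / (y + 1)) with (2 / (y * (y + 1))) by (field; lra).
        apply Rmult_le_reg_r with (y * y * (y + 1)); [nra|].
        replace (/ (y * y) * (y * y * (y + 1))) with (y + 1) by (field; lra).
        replace (2 / (y * (y + 1)) * (y * y * (y + 1))) with (2 * y) by (field; lra). lra. }
      lra. }
  assert (0 < 2 / INR (j + n)) by (apply Rdiv_lt_0_compat; [lra|apply lt_0_INR; lia]). lra.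
Qed.

(** Summation by parts: a counting bound [A(x) <= d * x] bounds [sum q(x) / x]. *)
Lemma abel_harmonic (q : nat -> R) j n :
  (0 < j)%nat ->
  rsum (seq j n) (fun x => q x * / INR x) =
  rsum (seq j n) q / INR (j + n) +
  rsum (seq j n) (fun x => rsum (seq j (S x - j)) q * (/ INR x - / (INR x + 1))).
Proof.
  intros Hj. induction n as [|n IH].
  - simpl. unfold Rdiv. rewrite Rmult_0_l. ring.
  - rewrite !rsum_seq_S, IH.
    replace (S (j + n) - j)%nat with (S n) by lia. rewrite rsum_seq_S.
    rewrite Nat.add_succ_r, S_INR.
    assert (0 < INR (j + n)) by (apply lt_0_INR; lia).
    field. lra.
Qed.

(** Among the integers [x] with [eta * R < x <= R] the non-elements of [Q] have logarithmic density at
   least [1 - D2], so their mirrored factors gain [2 * (1 - D2) * ln (1 / eta)] per unit of [eta * R], against the cost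
   [2 * (1 - D1) * ln (1 / eta)] of the zero-free comparison product. For small [eta] the difference beats every bounded term. *)
Lemma sparse_isolation D1 D2 : 0 <= D2 < D1 -> D1 < 1 ->
  exists eta B, 0 < eta <= 1 /\ 0 < B /\ forall R Q, 1 <= R -> 1 <= eta * R -> / (2 * (1 - D1)) <= R ->
  (forall n, eta * R <= INR n <= R -> rsum (seq 1 n) (indic Q) <= D2 * INR n) ->
  exists (X : list nat) (w : nat -> C),
    (forall x, In x X -> ~ Q x /\ (1 <= x)%nat) /\
    rsum X (fun x => Cmod (w x)) <= exp (B * R) /\
    forall theta, Rabs theta <= PI * (1 - D1) ->
      Cmod (1 + csum X (fun x => w x * cis (theta * INR x)))%C <= 15 / eta * R * exp (- (eta * R)).
Proof.
  intros HD2 HD1.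
  (* [L = ln (1 / eta)]; the constant 70 absorbs the bounded losses below. *)
  set (L := 70 / (D1 - D2)).
  assert (HL : 70 <= L).
  { unfold L. apply Rmult_le_reg_r with (D1 - D2); [lra|]. unfold Rdiv. rewrite Rmult_assoc, Rinv_l; lra. }
  set (eta := exp (- L)). assert (He0 : 0 < eta) by apply exp_pos.
  assert (HeL : eta * L <= 1).
  { unfold eta. rewrite exp_Ropp. apply Rmult_le_reg_l with (exp L); [apply exp_pos|].
    rewrite <- Rmult_assoc, Rinv_r, Rmult_1_l, Rmult_1_r by (generalize (exp_pos L); lra).
    generalize (exp_ineq1_le L); lra. }
  assert (He : eta <= 1 / 2) by nra.
  assert (Hlne : ln (/ eta) = L) by (unfold eta; rewrite <- exp_Ropp, Ropp_involutive, ln_exp; reflexivity).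
  exists eta, (3 + ln (2 / eta)).
  assert (Hl2 : 0 <= ln (2 / eta)).
  { rewrite <- ln_1. apply ln_le; [lra|]. apply Rmult_le_reg_r with eta; auto.
    unfold Rdiv. rewrite Rmult_assoc, Rinv_l; lra. }
  split; [lra|]. split; [lra|].
  intros R Q HR HeR HtR HQ.
  generalize PI_RGT_0; intros HPI.
  set (c := PI * (1 - D1)). assert (Hc : 0 < c) by (unfold c; nra).
  set (tau := PI / (2 * c)).
  assert (Etau : tau = / (2 * (1 - D1))) by (unfold tau, c; field; lra).
  assert (Htau : 0 < tau) by (apply Rdiv_lt_0_compat; lra).
  set (rho := eta * R) in *.
  assert (HrR : rho <= R / 2) by (unfold rho; nra).
  destruct (nfloor_ex R) as [m Hm]; [lra|].
  destruct (nfloor_ex rho) as [j Hj]; [lra|].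
  assert (Hj1 : (1 <= j)%nat).
  { assert (INR 0 < INR j) by (simpl; lra). apply INR_lt in H. lia. }
  assert (Hjm : (j <= m)%nat).
  { assert (INR j < INR (S m)) by (rewrite S_INR; lra). apply INR_lt in H. lia. }
  set (nQ := fun x => if excluded_middle_informative (Q x) then false else true).
  set (X := filter nQ (seq (S j) (m - j))).
  assert (HXin : forall x, In x X -> ~ Q x /\ (S j <= x <= m)%nat).
  { intros x Hx. apply filter_In in Hx. destruct Hx as [H1 H2]. apply in_seq in H1. split; [|lia].
    unfold nQ in H2. destruct (excluded_middle_informative (Q x)); congruence. }
  assert (HX : forall x, In x X -> rho < INR x <= R).
  { intros x Hx. destruct (HXin x Hx) as [_ H].
    assert (INR (S j) <= INR x) by (apply le_INR; lia). rewrite S_INR in H0.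
    assert (INR x <= INR m) by (apply le_INR; lia). lra. }
  assert (HXn : NoDup X) by (apply NoDup_filter, seq_NoDup).
  assert (HXl : INR (length X) <= R).
  { apply Rle_trans with (INR (m - j)).
    - apply le_INR. unfold X. eapply Nat.le_trans; [apply filter_length_le|]. rewrite length_seq. lia.
    - rewrite minus_INR by lia. generalize (pos_INR j); lra. }
  assert (He2 : 1 < exp 2 <= 9).
  { split; [generalize (exp_ineq1 2); lra|]. replace 2 with (1 + 1) by ring. rewrite exp_plus.
    generalize exp_le_3 (exp_pos 1); nra. }
  set (T := exp 2 * (2 * R + tau)).
  assert (HTt : tau < T) by (unfold T; nra).
  destruct (nfloor_ex (T / tau)) as [K HK].
  { apply Rlt_le, Rdiv_lt_0_compat; lra. }
  assert (HT1 : 1 < T / tau).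
  { apply Rmult_lt_reg_r with tau; auto. unfold Rdiv. rewrite Rmult_assoc, Rinv_l; lra. }
  assert (HK0 : (0 < K)%nat).
  { assert (INR 0 < INR K) by (simpl; lra). apply INR_lt in H. lia. }
  assert (ETt : T / tau * tau = T) by (field; lra).
  assert (HKT : INR K * tau <= T) by (rewrite <- ETt; apply Rmult_le_compat_r; lra).
  assert (HKT2 : T <= INR (S K) * tau) by (rewrite <- ETt, S_INR; apply Rmult_le_compat_r; lra).
  destruct (isolating_weights c R eta X K Hc HR ltac:(lra) HXn HX HK0 HKT2) as [w [Hw HV]].
  exists X, w. split; [intros x Hx; destruct (HXin x Hx); split; [auto|lia]|]. split.
  - apply Rle_trans with (rsum X (fun _ => exp (2 * R) * (2 / eta) ^ length X)).
    + apply rsum_le. auto.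
    + rewrite rsum_const.
      assert (E2 : (2 / eta) ^ length X <= exp (R * ln (2 / eta))).
      { rewrite <- (exp_ln (2 / eta)) at 1 by (apply Rdiv_lt_0_compat; lra).
        rewrite <- exp_INR_mult. assert (INR (length X) * ln (2 / eta) <= R * ln (2 / eta)) by (apply Rmult_le_compat_r; lra).
        now apply exp_le. }
      replace ((3 + ln (2 / eta)) * R) with (R + (2 * R + R * ln (2 / eta))) by ring.
      rewrite exp_plus. apply Rmult_le_compat.
      * apply pos_INR.
      * apply Rmult_le_pos; [apply Rlt_le, exp_pos|apply pow_le, Rlt_le, Rdiv_lt_0_compat; lra].
      * generalize (exp_ineq1_le R); lra.
      * rewrite exp_plus. apply Rmult_le_compat_l; [apply Rlt_le, exp_pos|auto].
  - intros theta Hth. eapply Rle_trans; [apply HV; auto|].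
    fold tau rho.
    set (S := rsum X (fun x => / INR x)).
    assert (HP : rprod X (fun x => INR x / ((1 - eta) * INR x + (2 - eta) * rho)) <=
       exp (- ((2 - eta) * rho * S - 5 * rho))).
    { apply Rle_trans with (rprod X (fun x => exp (- (((2 - eta) * rho * / INR x - eta) - 2 * (rho * rho) * / (INR x * INR x))))).
      - apply rprod_le. intros x Hx. destruct (HX x Hx) as [Hx1 Hx2].
        assert (Hx0 : 0 < INR x) by lra.
        set (u := (2 - eta) * rho * / INR x - eta).
        assert (Hrx : rho * / INR x <= 1).
        { apply Rmult_le_reg_r with (INR x); auto. rewrite Rmult_assoc, Rinv_l; lra. }
        assert (HRx : eta <= rho * / INR x).
        { apply Rmult_le_reg_r with (INR x); auto. rewrite Rmult_assoc, Rinv_l by lra. unfold rho. nra. }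
        assert (Hu0 : 0 <= u) by (unfold u; nra).
        assert (Hu2 : u <= 2 * (rho * / INR x)) by (unfold u; nra).
        replace (INR x / ((1 - eta) * INR x + (2 - eta) * rho)) with (/ (1 + u)).
        2:{ assert (0 < (1 - eta) * INR x) by (apply Rmult_lt_0_compat; lra).
            assert (0 < (2 - eta) * rho) by (apply Rmult_lt_0_compat; lra).
            unfold u. field. repeat split; lra. }
        split; [apply Rlt_le, Rinv_0_lt_compat; lra|].
        rewrite exp_Ropp. apply Rinv_le_contravar; [apply exp_pos|].
        rewrite <- (exp_ln (1 + u)) by lra.
        assert (u - 2 * (rho * rho) * / (INR x * INR x) <= ln (1 + u)).
        { eapply Rle_trans; [|apply ln_1p_lower; auto].
          rewrite Rinv_mult. assert (u * u <= (2 * (rho * / INR x)) * (2 * (rho * / INR x))) by (apply Rmult_le_compat; lra). lra. }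
        now apply exp_le.
      - rewrite rprod_exp.
        assert (rsum X (fun x => - (((2 - eta) * rho * / INR x - eta) - 2 * (rho * rho) * / (INR x * INR x)))
          <= - ((2 - eta) * rho * S - 5 * rho)).
        { rewrite (rsum_ext X _ (fun x => (-1 * ((2 - eta) * rho)) * / INR x + (eta + 2 * (rho * rho) * / (INR x * INR x)))) by (intros; ring).
          rewrite !rsum_plus, !rsum_scal, rsum_const. fold S.
          assert (Hsq : rsum X (fun x => / (INR x * INR x)) <= 2 / rho).
          { apply Rle_trans with (rsum (seq (Datatypes.S j) (m - j)) (fun x => / (INR x * INR x))).
            - apply rsum_incl; auto.
              + intros x Hx. apply filter_In in Hx. tauto.
              + intros x Hx. apply in_seq in Hx. apply Rlt_le, Rinv_0_lt_compat.
                assert (0 < INR x) by (apply lt_0_INR; lia). nra.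
            - eapply Rle_trans; [apply inverse_squares_le; lia|]. rewrite S_INR.
              unfold Rdiv. apply Rmult_le_compat_l; [lra|]. apply Rinv_le_contravar; lra. }
          assert (2 * (rho * rho) * rsum X (fun x => / (INR x * INR x)) <= 2 * (rho * rho) * (2 / rho)) by (apply Rmult_le_compat_l; [nra|auto]).
          replace (2 * (rho * rho) * (2 / rho)) with (4 * rho) in H by (field; lra).
          assert (INR (length X) * eta <= rho) by (unfold rho; nra). lra. }
        now apply exp_le. }
    (* Total logarithmic mass [L], minus the part [D2 * L] that [Q] can carry. *)
    assert (HS : (1 - D2) * L - 3 <= S).
    { unfold S, X. rewrite rsum_filter.
      rewrite (rsum_ext _ _ (fun x => / INR x - indic Q x * / INR x)).
      2:{ intros x _. unfold indic, nQ. destruct (excluded_middle_informative (Q x)); ring. }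
      rewrite rsum_minus.
      assert (H1 := harmonic_ge (Datatypes.S j) (m - j) ltac:(lia)).
      assert (H2 := abel_harmonic (indic Q) (Datatypes.S j) (m - j) ltac:(lia)).
      assert (H3 := harmonic_le (Datatypes.S j) (m - j) ltac:(lia)).
      replace (Datatypes.S j + (m - j))%nat with (Datatypes.S m) in * by lia.
      rewrite !S_INR in *.
      assert (HA : forall x, (Datatypes.S j <= x <= m)%nat -> rsum (seq (Datatypes.S j) (Datatypes.S x - Datatypes.S j)) (indic Q) <= D2 * INR x).
      { intros x Hx. eapply Rle_trans; [|apply (HQ x)].
        - apply rsum_incl; [apply seq_NoDup| |intros; apply indic_bounds].
          intros y Hy. apply in_seq in Hy. apply in_seq. lia.
        - assert (INR (Datatypes.S j) <= INR x) by (apply le_INR; lia). rewrite S_INR in H.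
          assert (INR x <= INR m) by (apply le_INR; lia). lra. }
      assert (HB : rsum (seq (Datatypes.S j) (m - j)) (fun x => rsum (seq (Datatypes.S j) (Datatypes.S x - Datatypes.S j)) (indic Q) * (/ INR x - / (INR x + 1)))
         <= D2 * ln ((INR m + 1) / (INR j + 1))).
      { apply Rle_trans with (rsum (seq (Datatypes.S j) (m - j)) (fun x => D2 * / (INR x + 1))).
        - apply rsum_le. intros x Hx. apply in_seq in Hx. assert (Hx0 : 0 < INR x) by (apply lt_0_INR; lia).
          replace (D2 * / (INR x + 1)) with (D2 * INR x * (/ INR x - / (INR x + 1))) by (field; lra).
          apply Rmult_le_compat_r; [|apply HA; lia].
          assert (/ (INR x + 1) <= / INR x) by (apply Rinv_le_contravar; lra). lra.
        - rewrite rsum_scal. apply Rmult_le_compat_l; lra. }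
      assert (HC : rsum (seq (Datatypes.S j) (m - j)) (indic Q) / (INR m + 1) <= 1).
      { assert (H0 : 0 <= INR m) by apply pos_INR.
        apply Rmult_le_reg_r with (INR m + 1); [lra|]. unfold Rdiv. rewrite Rmult_assoc, Rinv_l by lra.
        apply Rle_trans with (rsum (seq (Datatypes.S j) (m - j)) (fun _ => 1)); [rewrite Rmult_1_r; apply rsum_le; intros; apply indic_bounds|].
        rewrite rsum_const, length_seq, minus_INR by lia. generalize (pos_INR j). lra. }
      assert (HLn : L - 1 <= ln ((INR m + 1) / (INR j + 1)) <= L + 1).
      { assert (H0 : 0 <= INR j) by apply pos_INR.
        assert (Hl1 : ln (rho + 1) <= ln rho + 1).
        { assert (ln ((rho + 1) / rho) <= 1).
          { eapply Rle_trans; [apply ln_le_sub, Rdiv_lt_0_compat; lra|].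
            replace ((rho + 1) / rho - 1) with (/ rho) by (field; lra). rewrite <- Rinv_1. apply Rinv_le_contravar; lra. }
          rewrite ln_div in H by lra. lra. }
        assert (Hl3 : ln (R + 1) <= ln R + 1).
        { assert (ln ((R + 1) / R) <= 1).
          { eapply Rle_trans; [apply ln_le_sub, Rdiv_lt_0_compat; lra|].
            replace ((R + 1) / R - 1) with (/ R) by (field; lra). rewrite <- Rinv_1. apply Rinv_le_contravar; lra. }
          rewrite ln_div in H by lra. lra. }
        assert (ELn : L = ln R - ln rho).
        { rewrite <- Hlne. unfold rho. rewrite ln_mult, ln_Rinv by lra. ring. }
        rewrite ln_div by (generalize (pos_INR m); lra).
        assert (ln R <= ln (INR m + 1)) by (apply ln_le; lra).
        assert (ln (INR m + 1) <= ln (R + 1)) by (apply ln_le; lra).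
        assert (ln rho <= ln (INR j + 1)) by (apply ln_le; lra).
        assert (ln (INR j + 1) <= ln (rho + 1)) by (apply ln_le; lra). lra. }
      nra. }
    assert (HLK : ln ((INR K * tau + rho) / rho) <= L + 27).
    { assert (H28 : INR K * tau + rho <= 28 * R).
      { assert (T <= 9 * (3 * R)); [|lra]. unfold T. apply Rmult_le_compat; lra. }
      assert (0 <= INR K * tau) by (apply Rmult_le_pos; [apply pos_INR|lra]).
      apply Rle_trans with (ln (28 * / eta)).
      - apply ln_le; [apply Rdiv_lt_0_compat; lra|].
        apply Rle_div_l; [lra|].
        replace (28 * / eta * rho) with (28 * R) by (unfold rho; field; lra). lra.
      - rewrite ln_mult, Hlne by (try apply Rinv_0_lt_compat; lra). generalize (ln_le_sub 28 ltac:(lra)). lra. }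
    replace (2 * c * rho / PI) with (2 * (1 - D1) * rho) by (unfold c; field; lra).
    replace (4 * c * R / PI) with (4 * (1 - D1) * R) by (unfold c; field; lra).
    apply Rle_trans with (1 / eta * (exp 1 * (1 + 4 * (1 - D1) * R)) *
      (exp (2 * (1 - D1) * rho * (1 + (L + 27))) * exp (- ((2 - eta) * rho * S - 5 * rho)))).
    + rewrite (Rmult_assoc (1 / eta * (exp 1 * (1 + 4 * (1 - D1) * R)))).
      apply Rmult_le_compat_l.
      { apply Rmult_le_pos; [apply Rlt_le, Rdiv_lt_0_compat; lra|].
        apply Rmult_le_pos; [apply Rlt_le, exp_pos|].
        assert (0 <= (1 - D1) * R) by (apply Rmult_le_pos; lra). lra. }
      apply Rmult_le_compat; auto.
      * apply Rlt_le, exp_pos.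
      * apply rprod_ge0. intros x Hx. destruct (HX x Hx). apply Rmult_le_pos; [lra|].
        apply Rlt_le, Rinv_0_lt_compat.
        assert (0 < (1 - eta) * INR x) by (apply Rmult_lt_0_compat; lra).
        assert (0 < (2 - eta) * rho) by (apply Rmult_lt_0_compat; lra). lra.
      * assert (2 * (1 - D1) * rho * (1 + ln ((INR K * tau + rho) / rho)) <= 2 * (1 - D1) * rho * (1 + (L + 27))).
        { apply Rmult_le_compat_l; [|lra]. apply Rmult_le_pos; lra. }
        now apply exp_le.
    + rewrite <- exp_plus.
      apply Rmult_le_compat.
      * apply Rmult_le_pos; [apply Rlt_le, Rdiv_lt_0_compat; lra|].
        apply Rmult_le_pos; [apply Rlt_le, exp_pos|nra].
      * apply Rlt_le, exp_pos.
      * replace (15 / eta * R) with (1 / eta * (15 * R)) by (field; lra).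
        apply Rmult_le_compat_l; [apply Rlt_le, Rdiv_lt_0_compat; lra|].
        replace (15 * R) with (3 * (5 * R)) by ring.
        apply Rmult_le_compat; [apply Rlt_le, exp_pos|nra|apply exp_le_3|nra].
      * assert (HE : 2 * (1 - D1) * rho * (1 + (L + 27)) + - ((2 - eta) * rho * S - 5 * rho) <= - rho).
        { assert (HS2 : (2 - eta) * ((1 - D2) * L - 3) <= (2 - eta) * S) by (apply Rmult_le_compat_l; lra).
          assert (HL2 : L * (D1 - D2) = 70) by (unfold L; field; lra).
          assert (HH : 2 * (1 - D1) * (1 + (L + 27)) - ((2 - eta) * S - 5) <= -1).
          { assert (0 <= eta * L * D2) by (apply Rmult_le_pos; nra).
            assert (2 * (1 - D1) * 28 <= 56) by nra.
            assert ((2 - eta) * ((1 - D2) * L - 3) >= 2 * (1 - D2) * L - eta * L - 6) by nra.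
            nra. }
          replace (2 * (1 - D1) * rho * (1 + (L + 27)) + - ((2 - eta) * rho * S - 5 * rho))
            with (rho * (2 * (1 - D1) * (1 + (L + 27)) - ((2 - eta) * S - 5))) by ring.
          nra. }
        now apply exp_le.
Qed.

(** * Taylor coefficients near an arc of regular points *)

(** Sums of two power series agree where both make sense: the part of a continuation that the estimates use. *)
Definition regular_at (a : nat -> C) (zeta : C) : Prop :=
  exists rho c, 0 < rho /\ forall z, Cmod z < 1 -> Cmod (z - zeta) < rho ->
    exists s, cseries (fun n => a n * z ^ n)%C s /\ cseries (fun l => c l * (z - zeta) ^ l)%C s.

Lemma regular_at_of_continuation a zeta :
  has_immediate_continuation a zeta -> regular_at a zeta.
Proof.
  intros [V [g [HV [Hg Hs]]]].
  assert (HVz : V zeta).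
  { destruct (proj1 (locally_Cmod zeta V) HV) as [r [Hr H]]. apply H. rewrite Cminus_diag, Cmod_0; auto. }
  destruct (Hg zeta (or_intror HVz)) as [c Hc].
  destruct (proj1 (locally_Cmod zeta _) Hc) as [r [Hr H]].
  exists r, c. split; auto. intros z Hz1 Hz2. exists (g z).
  split; apply (proj1 (is_Cpseries_cseries _ _ _)); auto.
Qed.

Lemma Cmod_cis_sub s t : Cmod (cis s - cis t) <= Rabs (s - t).
Proof.
  replace s with (t + (s - t)) at 1 by ring. rewrite cis_plus.
  replace (cis t * cis (s - t) - cis t)%C with (cis t * (cis (s - t) - 1))%C by ring.
  rewrite Cmod_mult, Cmod_cis, Rmult_1_l.
  apply Rsqr_incr_0; [|apply Cmod_ge_0|apply Rabs_pos].
  rewrite <- Rsqr_abs. unfold Rsqr. rewrite Cmod_sqr. simpl.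
  generalize (one_minus_cos (s - t)) (sin2_cos2 (s - t)). unfold Rsqr. nra.
Qed.

(** The series at [zeta] and the series at [0] have the same expansion at [(1 - p) * xi], by uniqueness of coefficients;
   the former converges in a disc about [(1 - p) * xi] of radius more than [2 * p]. *)
Lemma regular_taylor_bound a zeta : Cmod zeta = 1 ->
  (forall s, 0 <= s < 1 -> exists B, summable_at a s B) -> regular_at a zeta ->
  exists delta, 0 < delta < 1 /\ forall p xi k t, 0 < p <= delta -> Cmod xi = 1 -> Cmod (xi - zeta) <= delta ->
    taylor_coef a (RtoC (1 - p) * xi)%C k t -> Cmod t <= / delta * / (2 * p) ^ k.
Proof.
  intros Hz Ha [rho [c [Hrho Hc]]].
  set (r := Rmin (rho / 2) (1 / 2)).
  assert (Hr : 0 < r) by (apply Rmin_pos; lra).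
  assert (Hr1 : r <= rho / 2) by apply Rmin_l. assert (Hr2 : r <= 1 / 2) by apply Rmin_r.
  assert (HB : exists B, 0 < B /\ forall l, Cmod (c l) * r ^ l <= B).
  { destruct (Hc (RtoC (1 - r) * zeta)%C) as [s [_ Hs]].
    - rewrite Cmod_mult, Hz, Cmod_R, Rabs_pos_eq; lra.
    - replace (RtoC (1 - r) * zeta - zeta)%C with (RtoC (- r) * zeta)%C
        by (rewrite RtoC_minus, RtoC_opp; ring).
      rewrite Cmod_mult, Hz, Cmod_R, Rabs_left; lra.
    - destruct (cseries_bounded _ _ Hs) as [B HB]. exists (Rmax B 1). split; [generalize (Rmax_r B 1); lra|].
      intros l. eapply Rle_trans; [|apply Rmax_l]. eapply Rle_trans; [|apply (HB l)].
      replace (RtoC (1 - r) * zeta - zeta)%C with (RtoC (- r) * zeta)%C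
        by (rewrite RtoC_minus, RtoC_opp; ring).
      rewrite Cmod_mult, Cmod_pow, Cmod_mult, Hz, Cmod_R, Rabs_left by lra.
      rewrite Rmult_1_r, Ropp_involutive. lra. }
  destruct HB as [B [HB0 HB]].
  assert (Sc := summable_at_of_bound c r (r / 2) B ltac:(lra) HB).
  replace (B * / (1 - r / 2 / r)) with (2 * B) in Sc by (field; lra).
  set (delta := Rmin (r / 8) (/ (2 * B))).
  assert (Hd : 0 < delta) by (apply Rmin_pos; [lra|apply Rinv_0_lt_compat; lra]).
  assert (Hd1 : delta <= r / 8) by apply Rmin_l.
  assert (Hd2 : 2 * B <= / delta).
  { rewrite <- (Rinv_inv (2 * B)). apply Rinv_le_contravar; auto. apply Rmin_r. }
  exists delta. split; [lra|].
  intros p xi k t Hp Hxi Hxz Ht.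
  set (z := (RtoC (1 - p) * xi)%C) in *.
  assert (Cz : Cmod z = 1 - p) by (unfold z; rewrite Cmod_mult, Hxi, Cmod_R, Rabs_pos_eq; lra).
  assert (Cu : Cmod (z - zeta) <= r / 4).
  { replace (z - zeta)%C with (RtoC (- p) * xi + (xi - zeta))%C
      by (unfold z; rewrite RtoC_minus, RtoC_opp; ring).
    eapply Rle_trans; [apply Cmod_triangle|].
    rewrite Cmod_mult, Hxi, Cmod_R, Rabs_left; lra. }
  destruct (Ha (1 - p / 2) ltac:(lra)) as [Ba HBa].
  assert (X1 : forall k, exists l, taylor_coef a z k l /\ Cmod l <= Ba * / (1 - p / 2 - Cmod z) ^ k)
    by (intros; apply taylor_coef_ex; auto; lra).
  assert (X2 : forall k, exists l, taylor_coef c (z - zeta) k l /\ Cmod l <= 2 * B * / (r / 2 - Cmod (z - zeta)) ^ k)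
    by (intros; apply taylor_coef_ex; auto; lra).
  set (ta := fun k => proj1_sig (constructive_indefinite_description _ (X1 k))).
  set (tc := fun k => proj1_sig (constructive_indefinite_description _ (X2 k))).
  assert (Hta : forall k, taylor_coef a z k (ta k) /\ Cmod (ta k) <= Ba * / (1 - p / 2 - Cmod z) ^ k)
    by (intros j; unfold ta; apply proj2_sig).
  assert (Htc : forall k, taylor_coef c (z - zeta) k (tc k) /\ Cmod (tc k) <= 2 * B * / (r / 2 - Cmod (z - zeta)) ^ k)
    by (intros j; unfold tc; apply proj2_sig).
  assert (E : forall k, (ta k + (-1) * tc k)%C = 0%C).
  { set (s1 := Rmin (1 - p / 2 - Cmod z) (r / 2 - Cmod (z - zeta))).
    assert (Hs1 : 0 < s1) by (apply Rmin_pos; lra).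
    assert (Hs1a : s1 <= 1 - p / 2 - Cmod z) by apply Rmin_l.
    assert (Hs1b : s1 <= r / 2 - Cmod (z - zeta)) by apply Rmin_r.
    assert (Hb : forall k, Cmod (ta k + (-1) * tc k)%C * s1 ^ k <= Ba + 2 * B).
    { intros j. destruct (Hta j) as [_ H1]. destruct (Htc j) as [_ H2].
      assert (Hpow : forall A s2, 0 < s2 -> s1 <= s2 -> 0 <= A -> A * / s2 ^ j * s1 ^ j <= A).
      { intros A s2 Hs2 Hs12 HA. rewrite Rmult_assoc. rewrite <- (Rmult_1_r A) at 2.
        apply Rmult_le_compat_l; auto. apply Rmult_le_reg_l with (s2 ^ j); [apply pow_lt; auto|].
        rewrite <- Rmult_assoc, Rinv_r, Rmult_1_l, Rmult_1_r by (apply Rgt_not_eq, pow_lt; auto).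
        apply pow_incr; lra. }
      assert (HBa0 : 0 <= Ba) by (generalize (proj2 HBa 0%nat); simpl; auto).
      generalize (Hpow Ba (1 - p / 2 - Cmod z) ltac:(lra) Hs1a HBa0)
        (Hpow (2 * B) (r / 2 - Cmod (z - zeta)) ltac:(lra) Hs1b ltac:(lra)).
      assert (0 < s1 ^ j) by (apply pow_lt; auto).
      generalize (Cmod_triangle (ta j) ((-1) * tc j)). rewrite Cmod_mult, Cmod_R, Rabs_left by lra.
      nra. }
    apply (cseries_unique_coef _ (s1 / 2) _ 1%C (s1 / 2) (summable_at_of_bound _ s1 (s1 / 2) _ ltac:(lra) Hb)).
    - lra.
    - apply Cmod_1.
    - lra.
    - intros x Hx.
      assert (Cx : Cmod (x * 1)%C = x) by (rewrite Cmult_1_r, Cmod_R, Rabs_pos_eq; lra).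
      destruct (Hc (z + x * 1)%C) as [s [Sa Ss]].
      + generalize (Cmod_triangle z (x * 1)%C). lra.
      + replace (z + x * 1 - zeta)%C with ((z - zeta) + x * 1)%C by ring.
        generalize (Cmod_triangle (z - zeta) (x * 1)%C). lra.
      + replace (z + x * 1 - zeta)%C with ((z - zeta) + x * 1)%C in Ss by ring.
        assert (Y1 := taylor_expansion a (1 - p / 2) Ba z ta (x * 1)%C s HBa ltac:(lra) (fun k => proj1 (Hta k)) Sa).
        assert (Y2 := taylor_expansion c (r / 2) (2 * B) (z - zeta)%C tc (x * 1)%C s Sc ltac:(lra) (fun k => proj1 (Htc k)) Ss).
        replace (RtoC 0) with (s + -1 * s)%C by ring.
        eapply cseries_ext; [|apply (cseries_plus _ _ _ _ Y1 (cseries_scal (-1)%C _ _ Y2))].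
        intros n. simpl. ring. }
  rewrite (clim_unique _ _ _ Ht (proj1 (Hta k))).
  replace (ta k) with (tc k).
  2:{ specialize (E k). replace (tc k) with (ta k - (ta k + -1 * tc k))%C by ring. rewrite E. ring. }
  eapply Rle_trans; [apply Htc|].
  apply Rmult_le_compat; auto; [lra|apply Rlt_le, Rinv_0_lt_compat, pow_lt; lra|].
  apply Rinv_le_contravar; [apply pow_lt; lra|]. apply pow_incr; lra.
Qed.

(** Compactness makes the radius uniform, and also extends the arc by [p] at both ends. *)
Lemma arc_taylor_bound a alpha beta : alpha <= beta ->
  (forall s, 0 <= s < 1 -> exists B, summable_at a s B) ->
  (forall theta, alpha <= theta <= beta -> regular_at a (cis theta)) ->
  exists p, 0 < p < 1 /\ forall theta k t, alpha - p <= theta <= beta + p ->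
    taylor_coef a (RtoC (1 - p) * cis theta)%C k t -> Cmod t <= / p * / (2 * p) ^ k.
Proof.
  intros Hab Ha Hreg.
  assert (H : forall theta, exists delta : posreal, delta < 1 /\ (alpha <= theta <= beta ->
     forall p xi k t, 0 < p <= delta -> Cmod xi = 1 -> Cmod (xi - cis theta) <= delta ->
    taylor_coef a (RtoC (1 - p) * xi)%C k t -> Cmod t <= / delta * / (2 * p) ^ k)).
  { intros theta. destruct (classic (alpha <= theta <= beta)) as [Hi|Hi].
    - destruct (regular_taylor_bound a (cis theta) (Cmod_cis theta) Ha (Hreg theta Hi)) as [d [Hd Hb]].
      exists (mkposreal d (proj1 Hd)). simpl. split; [lra|]. intros _. exact Hb.
    - assert (Hh : 0 < 1 / 2) by lra. exists (mkposreal _ Hh). simpl. split; [lra|tauto]. }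
  set (dl := fun theta => proj1_sig (constructive_indefinite_description _ (H theta))).
  assert (Hdl : forall theta, dl theta < 1 /\ (alpha <= theta <= beta ->
     forall p xi k t, 0 < p <= dl theta -> Cmod xi = 1 -> Cmod (xi - cis theta) <= dl theta ->
    taylor_coef a (RtoC (1 - p) * xi)%C k t -> Cmod t <= / dl theta * / (2 * p) ^ k))
    by (intros theta; unfold dl; apply proj2_sig).
  assert (Hhalf : forall theta, 0 < dl theta / 2) by (intros th; generalize (cond_pos (dl th)); lra).
  destruct (compactness_value_1d alpha beta (fun theta => mkposreal _ (Hhalf theta))) as [d Hd].
  simpl in Hd. exists d. split.
  { split; [apply cond_pos|]. apply Rnot_le_lt; intros Hd1.
    apply (Hd alpha ltac:(lra)). intros [t [_ [_ Ht]]]. generalize (proj1 (Hdl t)); lra. }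
  intros theta k t Hth Ht.
  set (x := Rmax alpha (Rmin theta beta)).
  assert (Hx : alpha <= x <= beta).
  { unfold x. split; [apply Rmax_l|]. apply Rmax_lub; auto. apply Rmin_r. }
  assert (Hxt : Rabs (theta - x) <= d).
  { unfold x, Rmax, Rmin. apply Rabs_le. generalize (cond_pos d); intros.
    destruct (Rle_dec theta beta); destruct (Rle_dec alpha _); lra. }
  apply NNPP. intros Hno. apply (Hd x Hx). intros [t0 [Ht0 [Hxt0 Hdt0]]]. apply Hno.
  destruct (Hdl t0) as [_ Hb]. specialize (Hb Ht0 d (cis theta) k t).
  assert (Hpd := cond_pos d). assert (Hpdl := cond_pos (dl t0)).
  eapply Rle_trans; [apply Hb; auto|].
  - lra.
  - apply Cmod_cis.
  - eapply Rle_trans; [apply Cmod_cis_sub|]. replace (theta - t0) with ((theta - x) + (x - t0)) by ring.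
    eapply Rle_trans; [apply Rabs_triang|]. lra.
  - apply Rmult_le_compat_r; [apply Rlt_le, Rinv_0_lt_compat, pow_lt; lra|].
    apply Rinv_le_contravar; lra.
Qed.

(** * The binomial distribution at its mode *)

Lemma bin_absorb n k : (k <= n)%nat -> (S k * bin n (S k) = (n - k) * bin n k)%nat.
Proof.
  revert k. induction n as [|n IH]; intros k Hk.
  - replace k with 0%nat by lia. reflexivity.
  - destruct k as [|k].
    + rewrite bin_SS, !bin_0_r. specialize (IH 0%nat ltac:(lia)). rewrite bin_0_r in IH. lia.
    + rewrite (bin_SS n (S k)). destruct (le_lt_dec (S k) n) as [H|H].
      * assert (E1 := IH k ltac:(lia)). assert (E2 := IH (S k) H).
        rewrite (bin_SS n k). replace (S n - S k)%nat with (n - k)%nat by lia.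
        nia.
      * rewrite (bin_gt n (S k)), (bin_gt n (S (S k))) by lia. replace (S n - S k)%nat with 0%nat by lia. lia.
Qed.

(** The largest of the [n + 1] binomial probabilities is at least their mean, and [k] is the mode. *)
Lemma binomial_mode n p k : 0 < p < 1 -> INR k <= INR (S n) * p < INR (S k) ->
  / INR (S n) <= INR (bin n k) * (1 - p) ^ (n - k) * p ^ k.
Proof.
  intros Hp Hk. set (T := fun j => INR (bin n j) * (1 - p) ^ (n - j) * p ^ j).
  assert (Hkn : (k <= n)%nat).
  { assert (INR k < INR (S n)).
    { assert (0 < INR (S n)) by (apply lt_0_INR; lia). nra. }
    apply INR_lt in H. lia. }
  assert (Step : forall j, (S j <= n)%nat ->
     INR (S j) * (1 - p) * T (S j) = INR (n - j) * p * T j).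
  { intros j Hj. unfold T.
    assert (E : INR (S j) * INR (bin n (S j)) = INR (n - j) * INR (bin n j)).
    { rewrite <- !mult_INR. f_equal. apply bin_absorb. lia. }
    replace ((1 - p) ^ (n - j)) with ((1 - p) ^ (n - S j) * (1 - p))
      by (replace (n - j)%nat with (S (n - S j)) by lia; simpl; ring).
    simpl (p ^ S j).
    replace (INR (S j) * (1 - p) * (INR (bin n (S j)) * (1 - p) ^ (n - S j) * (p * p ^ j)))
      with ((INR (S j) * INR (bin n (S j))) * ((1 - p) * (1 - p) ^ (n - S j) * (p * p ^ j))) by ring.
    rewrite E. ring. }
  assert (Tpos : forall j, 0 <= T j).
  { intros j. unfold T. repeat apply Rmult_le_pos; [apply pos_INR|apply pow_le; lra|apply pow_le; lra]. }
  assert (Up : forall j, (S j <= n)%nat -> (S j <= k)%nat -> T j <= T (S j)).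
  { intros j Hj Hjk. specialize (Step j Hj). specialize (Tpos j). generalize (Tpos) .
    assert (INR (S j) <= INR k) by (apply le_INR; auto).
    rewrite minus_INR in Step by lia. rewrite S_INR in *. intros _.
    assert (0 < INR j + 1) by (generalize (pos_INR j); lra).
    assert ((INR j + 1) * (1 - p) <= (INR n - INR j) * p) by lra.
    assert (0 < (INR j + 1) * (1 - p)) by nra. nra. }
  assert (Down : forall j, (S j <= n)%nat -> (k <= j)%nat -> T (S j) <= T j).
  { intros j Hj Hjk. specialize (Step j Hj). assert (T0 := Tpos (S j)).
    assert (INR k <= INR j) by (apply le_INR; auto).
    rewrite minus_INR in Step by lia. rewrite !S_INR in *.
    assert (0 <= INR j) by apply pos_INR.
    assert ((INR n - INR j) * p <= (INR j + 1) * (1 - p)) by lra.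
    assert (0 < (INR j + 1) * (1 - p)) by nra. specialize (Tpos j). nra. }
  assert (Max : forall j, (j <= n)%nat -> T j <= T k).
  { intros j Hj. destruct (le_lt_dec j k) as [H|H].
    - clear - Up H Hkn. induction H as [|m H IH]; [lra|]. specialize (IH ltac:(lia) ltac:(intros; apply Up; lia)).
      specialize (Up m ltac:(lia) ltac:(lia)). lra.
    - assert (H' : (k <= j)%nat) by lia. clear H. induction H' as [|m H IH]; [lra|].
      specialize (IH ltac:(lia)). specialize (Down m ltac:(lia) ltac:(lia)). lra. }
  assert (Sum := binomial_R (1 - p) p n (S n) ltac:(lia)).
  replace (1 - p + p) with 1 in Sum by ring. rewrite pow1 in Sum.
  assert (HN : 0 < INR (S n)) by (apply lt_0_INR; lia).
  apply Rmult_le_reg_l with (INR (S n)); auto. rewrite Rinv_r by lra.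
  rewrite <- Sum at 1. rewrite <- (length_seq (S n) 0) at 2. rewrite <- rsum_const.
  apply rsum_le. intros j Hj. apply in_seq in Hj. apply Max. lia.
Qed.

(** * Averaging the smoothed coefficients *)

(** [N] is the exponent to isolate; the weights [bin m k * (1 - p) ^ (m - k) * p ^ k] will be largest near
   [m = N]. The sum of the [a m] against these weights and [cis (m * t)] is [p ^ k] times the [k]-th Taylor coefficient at
   [(1 - p) * cis t], hence small where [a] is regular; elsewhere the factor [1 + csum X _] has to be small. This factor
   does not change the [N]-th Fourier coefficient, as it only adds coefficients of index [N + x]. *)
Lemma coefficient_estimate a p k psi N (X : list nat) (w : nat -> C) W G B v s :
  0 < p < 1 ->
  1 - p < s -> summable_at a s B ->
  (forall x, In x X -> a (N + x)%nat = 0%C) ->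
  1 + rsum X (fun x => Cmod (w x)) <= W -> 0 <= G -> 0 <= v ->
  (forall t, 0 <= t <= 2 * PI ->
     (forall l, taylor_coef a (RtoC (1 - p) * cis (t + psi))%C k l -> Cmod l <= G * / p ^ k) \/
     Cmod (1 + csum X (fun x => w x * cis (- (t * INR x))))%C <= v) ->
  Cmod (a N) * (INR (bin N k) * (1 - p) ^ (N - k) * p ^ k) <=
    G * W + B * (p / (s - (1 - p))) ^ k * v.
Proof.
  intros Hp Hs HB HX HW HG Hv Hgood.
  set (u := fun m => (a m * (INR (bin m k) * (1 - p) ^ (m - k) * p ^ k)%R * cis (INR m * psi))%C).
  assert (Hz : forall t, Cmod (RtoC (1 - p) * cis t)%C = 1 - p).
  { intros t. rewrite Cmod_mult, Cmod_cis, Cmod_R, Rabs_pos_eq; lra. }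
  assert (HT : forall t, exists l, taylor_coef a (RtoC (1 - p) * cis t)%C k l /\ Cmod l <= B * / (s - (1 - p)) ^ k).
  { intros t. assert (Q := taylor_coef_ex a s B (RtoC (1 - p) * cis t)%C k HB ltac:(rewrite Hz; auto)).
    rewrite Hz in Q. exact Q. }
  set (T := fun t => proj1_sig (constructive_indefinite_description _ (HT t))).
  assert (HTt : forall t, taylor_coef a (RtoC (1 - p) * cis t)%C k (T t) /\ Cmod (T t) <= B * / (s - (1 - p)) ^ k)
    by (intros t; unfold T; apply proj2_sig).
  set (F := fun t => (p ^ k * cis (INR k * (t + psi)) * T (t + psi)%R)%C).
  assert (HF : forall t, cseries (fun m => u m * cis (INR m * t))%C (F t)).
  { intros t. unfold F. eapply cseries_ext; [|apply cseries_scal; apply (proj1 (HTt (t + psi)))].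
    intros m. simpl. unfold u. destruct (le_lt_dec k m) as [Hkm|Hkm].
    - rewrite !RtoC_mult, !RtoC_pow, Cpow_mult_l, cis_pow, minus_INR by auto.
      replace (cis (INR m * psi)) with (cis (INR m * (t + psi)) * cis (- (INR m * t)))%C
        by (rewrite <- cis_plus; f_equal; ring).
      replace (cis (INR m * (t + psi))) with (cis (INR k * (t + psi)) * cis ((INR m - INR k) * (t + psi)))%C
        by (rewrite <- cis_plus; f_equal; ring).
      replace (a m * (INR (bin m k) * (RtoC (1 - p)) ^ (m - k) * p ^ k) *
        (cis (INR k * (t + psi)) * cis ((INR m - INR k) * (t + psi)) * cis (- (INR m * t))) * cis (INR m * t))%C
        with (a m * (INR (bin m k) * (RtoC (1 - p)) ^ (m - k) * p ^ k) *
        (cis (INR k * (t + psi)) * cis ((INR m - INR k) * (t + psi))) * (cis (- (INR m * t)) * cis (INR m * t)))%C by ring.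
      rewrite <- (cis_plus (- (INR m * t))). replace (- (INR m * t) + INR m * t) with 0 by ring.
      rewrite cis_0. ring.
    - rewrite (bin_gt m k) by auto. simpl (INR 0). rewrite !Rmult_0_l. ring. }
  assert (HB0 : 0 <= B) by (generalize (proj2 HB 0%nat); simpl; auto).
  assert (Hsum : summable (fun m => Cmod (a m) * (INR (bin m k) * (1 - p) ^ (m - k) * p ^ k))
     ((p / (s - (1 - p))) ^ k * B)).
  { eapply summable_le; [apply (summable_scal ((p / (s - (1 - p))) ^ k)); [|exact HB]|].
    - apply pow_le. apply Rlt_le, Rdiv_lt_0_compat; lra.
    - intros m. split.
      + apply Rmult_le_pos; [apply Cmod_ge_0|]. repeat apply Rmult_le_pos; [apply pos_INR|apply pow_le; lra|apply pow_le; lra].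
      + assert (Hb := bin_term_le (1 - p) (s - (1 - p)) m k ltac:(lra) ltac:(lra)).
        replace (1 - p + (s - (1 - p))) with s in Hb by ring.
        apply Rle_trans with (Cmod (a m) * ((p / (s - (1 - p))) ^ k * s ^ m)); [|right; ring].
        apply Rmult_le_compat_l; [apply Cmod_ge_0|].
        apply Rle_trans with ((p / (s - (1 - p))) ^ k * (INR (bin m k) * (1 - p) ^ (m - k) * (s - (1 - p)) ^ k)).
        * right. unfold Rdiv. rewrite Rpow_mult_distr, pow_inv. field. apply pow_nonzero; lra.
        * apply Rmult_le_compat_l; auto. apply pow_le. apply Rlt_le, Rdiv_lt_0_compat; lra. }
  replace (B * (p / (s - (1 - p))) ^ k) with ((p / (s - (1 - p))) ^ k * B) in * by ring.
  assert (Hub : forall m, Cmod (u m) <= Cmod (a m) * (INR (bin m k) * (1 - p) ^ (m - k) * p ^ k)).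
  { intros m. unfold u. rewrite !Cmod_mult, Cmod_cis, Cmod_R, Rmult_1_r, Rabs_pos_eq; [lra|].
    repeat apply Rmult_le_pos; [apply pos_INR|apply pow_le; lra|apply pow_le; lra]. }
  assert (Lim : clim (fun M => cavg M (fun t => F t * cis (- (INR N * t)) * (1 + csum X (fun x => w x * cis (- (t * INR x)))))%C) (u N)).
  { replace (u N) with (u N + csum X (fun x => w x * u (N + x)%nat))%C.
    2:{ rewrite csum_0; [ring|]. intros x Hx. unfold u. rewrite HX by auto. ring. }
    eapply clim_ext; [|apply clim_plus; [apply (cavg_fourier u _ _ F N Hsum Hub HF)|
      apply (clim_csum X (fun x M => w x * cavg M (fun t => F t * cis (- (INR (N + x) * t))))%C (fun x => w x * u (N + x)%nat)%C)]].
    - exists 0%nat. intros M _. simpl.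
      rewrite (csum_ext X _ (fun x => cavg M (fun t => w x * (F t * cis (- (INR (N + x) * t))))%C)) by (intros; now rewrite cavg_scal).
      rewrite <- cavg_csum, <- cavg_plus. apply cavg_ext. intros j _.
      set (t := root_angle M j). rewrite Cmult_plus_distr_l, Cmult_1_r. f_equal.
      rewrite <- csum_scal. apply csum_ext. intros x _.
      rewrite plus_INR. replace (- ((INR N + INR x) * t)) with (- (INR N * t) + - (t * INR x)) by ring.
      rewrite cis_plus. ring.
    - intros x _. apply clim_scal. apply (cavg_fourier u _ _ F (N + x) Hsum Hub HF). }
  replace (Cmod (a N) * (INR (bin N k) * (1 - p) ^ (N - k) * p ^ k)) with (Cmod (u N)).
  2:{ unfold u. rewrite !Cmod_mult, Cmod_cis, Cmod_R, Rmult_1_r, Rabs_pos_eq; [lra|].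
      repeat apply Rmult_le_pos; [apply pos_INR|apply pow_le; lra|apply pow_le; lra]. }
  assert (Hpk : 0 < p ^ k) by (apply pow_lt; lra).
  assert (Hsk : 0 < (s - (1 - p)) ^ k) by (apply pow_lt; lra).
  assert (HW1 : 1 <= W).
  { assert (0 <= rsum X (fun x => Cmod (w x))) by (apply rsum_ge0; intros; apply Cmod_ge_0). lra. }
  assert (Hqk : 0 <= (p / (s - (1 - p))) ^ k) by (apply pow_le, Rlt_le, Rdiv_lt_0_compat; lra).
  assert (HGW : 0 <= G * W) by (apply Rmult_le_pos; lra).
  assert (HBv : 0 <= (p / (s - (1 - p))) ^ k * B * v) by (repeat apply Rmult_le_pos; auto).
  apply (clim_Cmod_le _ _ _ Lim). intros N0. exists (S N0). split; [lia|].
  apply cavg_le_const; [lra|].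
  intros j Hj. set (t := root_angle (S N0) j).
  assert (Ht : 0 <= t <= 2 * PI).
  { unfold t, root_angle. generalize PI_RGT_0; intros HPI.
    assert (0 < INR (S N0)) by (apply lt_0_INR; lia).
    assert (INR j <= INR (S N0)) by (apply le_INR; lia). generalize (pos_INR j); intros. split.
    - apply Rmult_le_pos; [nra|]. apply Rlt_le, Rinv_0_lt_compat; auto.
    - apply Rle_div_l; [auto|nra]. }
  rewrite !Cmod_mult, Cmod_cis, Rmult_1_r.
  assert (CF : Cmod (F t) = p ^ k * Cmod (T (t + psi))).
  { unfold F. rewrite !Cmod_mult, Cmod_cis, Cmod_pow, Cmod_R, (Rabs_pos_eq p) by lra. ring. }
  assert (CV : Cmod (1 + csum X (fun x => w x * cis (- (t * INR x))))%C <= W).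
  { eapply Rle_trans; [apply Cmod_triangle|]. rewrite Cmod_1.
    eapply Rle_trans; [|apply HW]. apply Rplus_le_compat_l.
    eapply Rle_trans; [apply Cmod_csum|]. apply rsum_le. intros x _. rewrite Cmod_mult, Cmod_cis. lra. }
  rewrite CF. destruct (HTt (t + psi)) as [HT1 HT2].
  destruct (Hgood t Ht) as [Hg|Hg].
  - apply Rle_trans with (G * W); [|lra].
    apply Rmult_le_compat; auto; [apply Rmult_le_pos; [lra|apply Cmod_ge_0]|apply Cmod_ge_0|].
    specialize (Hg _ HT1). apply Rle_trans with (p ^ k * (G * / p ^ k)); [apply Rmult_le_compat_l; lra|].
    right; field; lra.
  - apply Rle_trans with ((p / (s - (1 - p))) ^ k * B * v); [|lra].
    apply Rmult_le_compat; auto; [apply Rmult_le_pos; [lra|apply Cmod_ge_0]|apply Cmod_ge_0|].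
    apply Rle_trans with (p ^ k * (B * / (s - (1 - p)) ^ k)); [apply Rmult_le_compat_l; lra|].
    right. unfold Rdiv. rewrite Rpow_mult_distr, pow_inv. ring.
Qed.

(** * From regularity on an arc to density *)

Lemma eventually_poly_exp K kappa : 0 < kappa ->
  exists N0, forall N, (N0 <= N)%nat -> K * (INR N + 1) ^ 2 * exp (- (kappa * INR N)) < 1.
Proof.
  intros Hk. set (c := Rmin (kappa / 3) 1).
  assert (Hc : 0 < c) by (apply Rmin_pos; lra).
  assert (Hc1 : c <= kappa / 3) by apply Rmin_l. assert (Hc2 : c <= 1) by apply Rmin_r.
  assert (Hc3 : 0 < c ^ 3) by (apply pow_lt; auto).
  destruct (nfloor_ex (Rmax 0 (K / c ^ 3))) as [n Hn]; [apply Rmax_l|].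
  exists (S n). intros N HN. assert (HNr : INR n + 1 <= INR N) by (rewrite <- S_INR; apply le_INR; auto).
  assert (HK : K / c ^ 3 < INR N + 1) by (generalize (Rmax_r 0 (K / c ^ 3)); lra).
  assert (HK2 : K < (INR N + 1) * c ^ 3).
  { apply Rmult_lt_reg_r with (/ c ^ 3); [apply Rinv_0_lt_compat; auto|].
    rewrite Rmult_assoc, Rinv_r by lra. unfold Rdiv in HK. lra. }
  assert (HN0 : 0 <= INR N) by apply pos_INR.
  assert (HE : c ^ 3 * (INR N + 1) ^ 3 <= exp (kappa * INR N)).
  { replace (kappa * INR N) with (INR 3 * (kappa * INR N / 3)) by (simpl; field).
    rewrite exp_INR_mult, <- Rpow_mult_distr. apply pow_incr.
    generalize (exp_ineq1_le (kappa * INR N / 3)); intros. split; [nra|]. nra. }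
  rewrite exp_Ropp. apply Rmult_lt_reg_r with (exp (kappa * INR N)); [apply exp_pos|].
  rewrite Rmult_assoc, Rinv_l, Rmult_1_r, Rmult_1_l by (generalize (exp_pos (kappa * INR N)); lra).
  eapply Rlt_le_trans; [|exact HE].
  replace (c ^ 3 * (INR N + 1) ^ 3) with ((INR N + 1) * c ^ 3 * (INR N + 1) ^ 2) by ring.
  apply Rmult_lt_compat_r; auto. nra.
Qed.

Definition subexponential (a : nat -> C) : Prop :=
  forall eps, 0 < eps -> exists A, forall m, Cmod (a m) <= A * exp (eps * INR m).

Definition not_too_small (a : nat -> C) : Prop :=
  forall eps, 0 < eps -> exists N, forall m, (N <= m)%nat -> a m <> 0%C -> exp (- (eps * INR m)) <= Cmod (a m).

Lemma subexponential_summable a : subexponential a -> forall s, 0 <= s < 1 -> exists B, summable_at a s B.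
Proof.
  intros Ha s Hs. set (r := (s + 1) / 2).
  assert (Hr : s < r < 1) by (unfold r; lra).
  assert (Hl : ln r < 0) by (rewrite <- ln_1; apply ln_increasing; lra).
  destruct (Ha (- ln r) ltac:(lra)) as [A HA].
  exists (A * / (1 - s / r)). apply summable_at_of_bound; [lra|].
  intros n. specialize (HA n).
  apply Rle_trans with (A * exp (- ln r * INR n) * r ^ n).
  - apply Rmult_le_compat_r; auto. apply pow_le; lra.
  - replace (r ^ n) with (exp (INR n * ln r)) by (rewrite exp_INR_mult, exp_ln; lra).
    rewrite Rmult_assoc, <- exp_plus. replace (- ln r * INR n + INR n * ln r) with 0 by ring.
    rewrite exp_0. lra.
Qed.

(** With [k] close to [N * p], the gain [2 ^ - k] on the regular arc is exponential in [N]. *)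
Lemma inv_pow2_mode N p k : 0 < p -> INR (S N) * p < INR (S k) -> / 2 ^ k <= 2 * exp (- (p / 2 * INR N)).
Proof.
  intros Hp Hk. rewrite (S_INR N) in Hk. assert (HN0 : 0 <= INR N) by apply pos_INR.
  assert (H2k : 0 < 2 ^ k) by (apply pow_lt; lra).
  assert (Hln2 : 1 / 2 <= ln 2).
  { generalize (ln_1p_lower 1 ltac:(lra)). replace (1 + 1) with 2 by ring. lra. }
  apply Rmult_le_reg_l with (2 ^ k); auto. rewrite Rinv_r by lra.
  replace (2 ^ k * (2 * exp (- (p / 2 * INR N)))) with (2 ^ S k * exp (- (p / 2 * INR N))) by (simpl; ring).
  rewrite <- (exp_ln 2) at 1 by lra. rewrite <- exp_INR_mult, <- exp_plus. rewrite <- exp_0 at 1. apply exp_le.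
  assert (INR (S k) * (1 / 2) <= INR (S k) * ln 2) by (apply Rmult_le_compat_l; [apply pos_INR|auto]). nra.
Qed.

(** Otherwise the support of [a] is sparse in every window [(N, N + t]], [t <= s * N], and [sparse_isolation] provides
   the factor that [coefficient_estimate] needs on the complementary arc. Its weights are of size [exp (B * s * N)], which for
   small [s] is less than the gain [2 ^ - k] on the regular arc; so [a N] would decay exponentially. *)
Lemma dense_window a psi p D1 D2 : 0 < p < 1 -> 0 <= D2 < D1 -> D1 < 1 ->
  subexponential a -> not_too_small a ->
  (forall phi k t, PI - PI * D1 <= phi <= PI + PI * D1 ->
     taylor_coef a (RtoC (1 - p) * cis (phi + psi))%C k t -> Cmod t <= / p * / (2 * p) ^ k) ->
  exists s0, 0 < s0 /\ forall s, 0 < s <= s0 -> exists N0, forall N, (N0 <= N)%nat -> a N <> 0%C ->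
    exists t, (1 <= t)%nat /\ INR t <= s * INR N /\
      D2 * INR t < rsum (seq 1 t) (indic (fun x => a (N + x)%nat <> 0%C)).
Proof.
  intros Hp HD HD1 Hup Hlow Hreg.
  destruct (sparse_isolation D1 D2 HD HD1) as [eta [B [Heta [HB Hiso]]]].
  exists (p / (8 * B)). split; [apply Rdiv_lt_0_compat; lra|]. intros s [Hs0 Hs].
  assert (HBs : B * s <= p / 8).
  { apply Rle_trans with (B * (p / (8 * B))); [apply Rmult_le_compat_l; lra|right; field; lra]. }
  assert (Hes : 0 < eta * s) by (apply Rmult_lt_0_compat; lra).
  set (e := Rmin (p / 8) (eta * s / 16)).
  assert (He : 0 < e) by (apply Rmin_pos; lra).
  assert (He1 : e <= p / 8) by apply Rmin_l. assert (He2 : e <= eta * s / 16) by apply Rmin_r.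
  destruct (Hup e He) as [A HA].
  set (Be := A * / (1 - exp (- (2 * e)) / exp (- e))).
  assert (Hexpe : exp (- (2 * e)) < exp (- e)) by (apply exp_increasing; lra).
  assert (HBe : summable_at a (exp (- (2 * e))) Be).
  { apply summable_at_of_bound; [split; [apply Rlt_le, exp_pos|auto]|].
    intros n. apply Rle_trans with (A * exp (e * INR n) * exp (- e) ^ n).
    - apply Rmult_le_compat_r; auto. apply pow_le, Rlt_le, exp_pos.
    - rewrite <- exp_INR_mult, Rmult_assoc, <- exp_plus. replace (e * INR n + INR n * - e) with 0 by ring.
      rewrite exp_0. lra. }
  assert (HBe0 : 0 <= Be) by (generalize (proj2 HBe 0%nat); simpl; auto).
  destruct (Hlow e He) as [N1 HN1].
  set (kappa := Rmin (p / 4) (eta * s / 2)).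
  assert (Hkap : 0 < kappa) by (apply Rmin_pos; lra).
  assert (Hkap1 : kappa <= p / 4) by apply Rmin_l. assert (Hkap2 : kappa <= eta * s / 2) by apply Rmin_r.
  set (Kc := 4 / p + Be * exp (4 * e) * (15 / eta * s)).
  destruct (eventually_poly_exp Kc kappa Hkap) as [N2 HN2].
  (* [R = s * N] has to satisfy the three size conditions of [sparse_isolation]. *)
  set (big := Rmax (/ s) (Rmax (/ (eta * s)) (/ (2 * (1 - D1)) / s))).
  destruct (nfloor_ex (Rmax 0 big)) as [N3 HN3]; [apply Rmax_l|].
  exists (N1 + N2 + S N3)%nat. intros N HN HaN.
  assert (HNbig : big <= INR N).
  { assert (INR N3 + 1 <= INR N) by (rewrite <- S_INR; apply le_INR; lia).
    generalize (Rmax_r 0 big); lra. }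
  assert (Hmul : forall x y, 0 < y -> x / y <= INR N -> x <= y * INR N).
  { intros x y Hy H. apply Rmult_le_reg_r with (/ y); [apply Rinv_0_lt_compat; auto|].
    replace (y * INR N * / y) with (INR N) by (field; lra). exact H. }
  assert (HR1 : 1 <= s * INR N).
  { apply Hmul; auto. eapply Rle_trans; [|exact HNbig]. unfold Rdiv. rewrite Rmult_1_l. apply Rmax_l. }
  assert (HR2 : 1 <= eta * (s * INR N)).
  { rewrite <- Rmult_assoc. apply Hmul; auto. eapply Rle_trans; [|exact HNbig]. unfold Rdiv. rewrite Rmult_1_l.
    eapply Rle_trans; [|apply Rmax_r]. apply Rmax_l. }
  assert (HR3 : / (2 * (1 - D1)) <= s * INR N).
  { apply Hmul; auto. eapply Rle_trans; [|exact HNbig]. eapply Rle_trans; [|apply Rmax_r]. apply Rmax_r. }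
  apply NNPP. intros Hno.
  destruct (Hiso (s * INR N) (fun x => a (N + x)%nat <> 0%C) HR1 HR2 HR3) as [X [w [HX [Hw HV]]]].
  { intros n Hn. apply Rnot_lt_le. intros Hlt. apply Hno. exists n. split; [|split; [apply Hn|exact Hlt]].
    assert (INR 0 < INR n) by (simpl; lra). apply INR_lt in H. lia. }
  assert (HN0 : 0 <= INR N) by apply pos_INR.
  assert (HSN : INR (S N) = INR N + 1) by apply S_INR.
  destruct (nfloor_ex (INR (S N) * p)) as [k Hk]; [apply Rmult_le_pos; lra|].
  rewrite <- S_INR in Hk.
  assert (Hmode := binomial_mode N p k Hp Hk).
  assert (Hsrad : p - 2 * e <= exp (- (2 * e)) - (1 - p)) by (generalize (exp_ineq1_le (- (2 * e))); lra).
  set (v := 15 / eta * (s * INR N) * exp (- (eta * (s * INR N)))) in *.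
  assert (Hv0 : 0 <= v).
  { unfold v. apply Rmult_le_pos; [apply Rmult_le_pos; [apply Rlt_le, Rdiv_lt_0_compat; lra|lra]|apply Rlt_le, exp_pos]. }
  assert (H2k : 0 < 2 ^ k) by (apply pow_lt; lra).
  assert (Est := coefficient_estimate a p k psi N X w (1 + exp (B * (s * INR N))) (/ p * / 2 ^ k) Be v (exp (- (2 * e)))
     Hp ltac:(lra) HBe).
  (* Angles are measured from the centre of the complementary arc, which is [|phi| <= PI * (1 - D1)] modulo [2 * PI]. *)
  assert (Est2 : Cmod (a N) * (INR (bin N k) * (1 - p) ^ (N - k) * p ^ k) <=
     / p * / 2 ^ k * (1 + exp (B * (s * INR N))) + Be * (p / (exp (- (2 * e)) - (1 - p))) ^ k * v).
  { apply Est; auto.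
    - intros x Hx. apply NNPP. apply (HX x Hx).
    - lra.
    - apply Rmult_le_pos; apply Rlt_le, Rinv_0_lt_compat; lra.
    - intros t Ht.
      destruct (Rlt_le_dec t (PI - PI * D1)) as [Hl|Hl]; [right|destruct (Rlt_le_dec (PI + PI * D1) t) as [Hr|Hr]; [right|left]].
      + erewrite csum_ext; [apply (HV (- t))|].
        * rewrite Rabs_Ropp, Rabs_pos_eq; lra.
        * intros x _. simpl. f_equal. f_equal. ring.
      + erewrite csum_ext; [apply (HV (2 * PI - t))|].
        * rewrite Rabs_pos_eq; lra.
        * intros x _. simpl. f_equal. rewrite <- (Cmult_1_l (cis _)), <- (cis_2PI x), <- cis_plus. f_equal. ring.
      + intros l Hl'. eapply Rle_trans; [apply (Hreg t k l); auto; lra|].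
        right. rewrite Rpow_mult_distr. field. split; [apply pow_nonzero; lra|split; lra]. }
  clear Est.
  assert (Hratio : (p / (exp (- (2 * e)) - (1 - p))) ^ k <= exp (4 * e * (INR N + 1))).
  { apply Rle_trans with (exp (4 * e / p) ^ k).
    - apply pow_incr. split; [apply Rlt_le, Rdiv_lt_0_compat; lra|].
      apply Rle_trans with (1 + 4 * e / p); [|apply exp_ineq1_le].
      apply Rle_trans with (p / (p - 2 * e)).
      + unfold Rdiv. apply Rmult_le_compat_l; [lra|]. apply Rinv_le_contravar; lra.
      + apply Rmult_le_reg_r with (p - 2 * e); [lra|]. unfold Rdiv at 1. rewrite Rmult_assoc, Rinv_l by lra.
        replace ((1 + 4 * e / p) * (p - 2 * e)) with (p + 2 * e * (1 - 4 * e / p)) by (field; lra).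
        assert (4 * e / p <= 1 / 2).
        { apply Rle_div_l; [lra|lra]. }
        nra.
    - rewrite <- exp_INR_mult. apply exp_le.
      apply Rle_trans with (INR (S N) * p * (4 * e / p)).
      + apply Rmult_le_compat_r; [|lra]. apply Rlt_le, Rdiv_lt_0_compat; lra.
      + rewrite HSN. right. field. lra. }
  assert (H2kb := inv_pow2_mode N p k ltac:(lra) (proj2 Hk)).
  assert (Hexp1 : exp (B * (s * INR N)) <= exp (p / 8 * INR N)).
  { apply exp_le. rewrite <- Rmult_assoc. apply Rmult_le_compat_r; auto. }
  assert (Hexp1' : 1 <= exp (p / 8 * INR N)).
  { rewrite <- exp_0. apply exp_le. apply Rmult_le_pos; lra. }
  specialize (HN1 N ltac:(lia) HaN). specialize (HN2 N ltac:(lia)).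
  set (T := INR (bin N k) * (1 - p) ^ (N - k) * p ^ k) in *.
  assert (Lft : exp (- (e * INR N)) * / (INR N + 1) <= Cmod (a N) * T).
  { apply Rmult_le_compat; auto; [apply Rlt_le, exp_pos|apply Rlt_le, Rinv_0_lt_compat; lra|rewrite <- HSN; auto]. }
  assert (Rg1 : / p * / 2 ^ k * (1 + exp (B * (s * INR N))) <= 4 / p * exp (- (3 * p / 8 * INR N))).
  { replace (4 / p * exp (- (3 * p / 8 * INR N))) with (/ p * (2 * exp (- (p / 2 * INR N))) * (2 * exp (p / 8 * INR N))).
    - apply Rmult_le_compat.
      + apply Rmult_le_pos; apply Rlt_le, Rinv_0_lt_compat; lra.
      + generalize (exp_pos (B * (s * INR N))); lra.
      + apply Rmult_le_compat_l; auto. apply Rlt_le, Rinv_0_lt_compat; lra.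
      + lra.
    - replace (- (3 * p / 8 * INR N)) with (- (p / 2 * INR N) + p / 8 * INR N) by field.
      rewrite exp_plus. field. lra. }
  assert (Rg2 : Be * (p / (exp (- (2 * e)) - (1 - p))) ^ k * v <=
     Be * exp (4 * e) * (15 / eta * s) * INR N * exp (4 * e * INR N - eta * s * INR N)).
  { unfold v.
    replace (Be * exp (4 * e) * (15 / eta * s) * INR N * exp (4 * e * INR N - eta * s * INR N))
      with (Be * (exp (4 * e * (INR N + 1))) * (15 / eta * (s * INR N) * exp (- (eta * (s * INR N))))).
    - fold v. apply Rmult_le_compat_r; auto. apply Rmult_le_compat_l; auto.
    - replace (4 * e * (INR N + 1)) with (4 * e + 4 * e * INR N) by ring.
      replace (4 * e * INR N - eta * s * INR N) with (4 * e * INR N + - (eta * (s * INR N))) by ring.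
      rewrite !exp_plus. ring. }
  assert (Fin : 1 <= Kc * (INR N + 1) ^ 2 * exp (- (kappa * INR N))); [|lra].
  assert (Hfac : exp (- (e * INR N)) * / (INR N + 1) <=
    4 / p * exp (- (3 * p / 8 * INR N)) + Be * exp (4 * e) * (15 / eta * s) * INR N * exp (4 * e * INR N - eta * s * INR N)) by lra.
  apply (Rmult_le_compat_l (exp (e * INR N) * (INR N + 1))) in Hfac.
  2:{ apply Rmult_le_pos; [apply Rlt_le, exp_pos|lra]. }
  replace (exp (e * INR N) * (INR N + 1) * (exp (- (e * INR N)) * / (INR N + 1))) with 1 in Hfac.
  2:{ rewrite exp_Ropp. field. split; [lra|]. generalize (exp_pos (e * INR N)); lra. }
  eapply Rle_trans; [exact Hfac|].
  replace (exp (e * INR N) * (INR N + 1) *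
     (4 / p * exp (- (3 * p / 8 * INR N)) + Be * exp (4 * e) * (15 / eta * s) * INR N * exp (4 * e * INR N - eta * s * INR N)))
    with (4 / p * (INR N + 1) * exp (e * INR N - 3 * p / 8 * INR N) +
      Be * exp (4 * e) * (15 / eta * s) * (INR N * (INR N + 1)) * exp (5 * e * INR N - eta * s * INR N)).
  2:{ replace (e * INR N - 3 * p / 8 * INR N) with (e * INR N + - (3 * p / 8 * INR N)) by ring.
      replace (5 * e * INR N - eta * s * INR N) with (e * INR N + (4 * e * INR N - eta * s * INR N)) by ring.
      rewrite !(exp_plus (e * INR N)). ring. }
  unfold Kc. rewrite !Rmult_plus_distr_r.
  assert (HK2 : 0 <= Be * exp (4 * e) * (15 / eta * s)).
  { apply Rmult_le_pos; [apply Rmult_le_pos; [auto|apply Rlt_le, exp_pos]|].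
    apply Rmult_le_pos; [apply Rlt_le, Rdiv_lt_0_compat; lra|lra]. }
  assert (H4p : 0 <= 4 / p) by (apply Rlt_le, Rdiv_lt_0_compat; lra).
  apply Rplus_le_compat.
  - apply Rmult_le_compat.
    + apply Rmult_le_pos; lra.
    + apply Rlt_le, exp_pos.
    + apply Rmult_le_compat_l; auto; nra.
    + apply exp_le. nra.
  - apply Rmult_le_compat.
    + apply Rmult_le_pos; auto. apply Rmult_le_pos; lra.
    + apply Rlt_le, exp_pos.
    + apply Rmult_le_compat_l; auto; nra.
    + apply exp_le. nra.
Qed.

(** With no complementary arc, no isolating factor is needed, and the coefficients decay exponentially. *)
Lemma regular_circle_absurd a psi p : 0 < p < 1 ->
  subexponential a -> not_too_small a -> (forall N, exists n, (N <= n)%nat /\ a n <> 0%C) ->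
  (forall phi k t, 0 <= phi <= 2 * PI ->
     taylor_coef a (RtoC (1 - p) * cis (phi + psi))%C k t -> Cmod t <= / p * / (2 * p) ^ k) -> False.
Proof.
  intros Hp Hup Hlow Hinf Hreg.
  set (e := p / 8). assert (He : 0 < e) by (unfold e; lra).
  destruct (Hlow e He) as [N1 HN1].
  assert (Hkap : 0 < p / 4) by lra.
  destruct (eventually_poly_exp (2 / p) (p / 4) Hkap) as [N2 HN2].
  destruct (Hinf (N1 + N2)%nat) as [N [HN HaN]].
  specialize (HN1 N ltac:(lia) HaN). specialize (HN2 N ltac:(lia)).
  assert (HN0 : 0 <= INR N) by apply pos_INR.
  assert (HSN : INR (S N) = INR N + 1) by apply S_INR.
  destruct (nfloor_ex (INR (S N) * p)) as [k Hk]; [apply Rmult_le_pos; lra|].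
  rewrite <- S_INR in Hk.
  assert (Hmode := binomial_mode N p k Hp Hk).
  destruct (subexponential_summable a Hup (1 - p / 2) ltac:(lra)) as [B HB].
  assert (H2k : 0 < 2 ^ k) by (apply pow_lt; lra).
  assert (Est := coefficient_estimate a p k psi N nil (fun _ => 0%C) 1 (/ p * / 2 ^ k) B 0 (1 - p / 2)
     Hp ltac:(lra) HB ltac:(intros x []) ltac:(simpl; lra) ltac:(apply Rmult_le_pos; apply Rlt_le, Rinv_0_lt_compat; lra) ltac:(lra)).
  rewrite Rmult_0_r, Rplus_0_r, Rmult_1_r in Est.
  assert (H2kb := inv_pow2_mode N p k ltac:(lra) (proj2 Hk)).
  assert (Est2 : Cmod (a N) * (INR (bin N k) * (1 - p) ^ (N - k) * p ^ k) <= / p * / 2 ^ k).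
  { apply Est. intros t Ht. left. intros l Hl.
    eapply Rle_trans; [apply (Hreg t k l); auto|].
    right. rewrite Rpow_mult_distr. field. split; [apply pow_nonzero; lra|split; lra]. }
  set (T := INR (bin N k) * (1 - p) ^ (N - k) * p ^ k) in *.
  assert (Lft : exp (- (e * INR N)) * / (INR N + 1) <= Cmod (a N) * T).
  { apply Rmult_le_compat; auto; [apply Rlt_le, exp_pos|apply Rlt_le, Rinv_0_lt_compat; lra|rewrite <- HSN; auto]. }
  assert (Hfac : exp (- (e * INR N)) * / (INR N + 1) <= 2 / p * exp (- (p / 2 * INR N))).
  { eapply Rle_trans; [exact Lft|]. eapply Rle_trans; [exact Est2|].
    replace (2 / p * exp (- (p / 2 * INR N))) with (/ p * (2 * exp (- (p / 2 * INR N)))) by (field; lra).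
    apply Rmult_le_compat_l; auto. apply Rlt_le, Rinv_0_lt_compat; lra. }
  apply (Rmult_le_compat_l (exp (e * INR N) * (INR N + 1))) in Hfac.
  2:{ apply Rmult_le_pos; [apply Rlt_le, exp_pos|lra]. }
  replace (exp (e * INR N) * (INR N + 1) * (exp (- (e * INR N)) * / (INR N + 1))) with 1 in Hfac.
  2:{ rewrite exp_Ropp. field. split; [lra|]. generalize (exp_pos (e * INR N)); lra. }
  replace (exp (e * INR N) * (INR N + 1) * (2 / p * exp (- (p / 2 * INR N))))
    with (2 / p * (INR N + 1) * exp (e * INR N + - (p / 2 * INR N))) in Hfac by (rewrite exp_plus; ring).
  assert (2 / p * (INR N + 1) * exp (e * INR N + - (p / 2 * INR N)) <= 2 / p * (INR N + 1) ^ 2 * exp (- (p / 4 * INR N))); [|lra].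
  assert (H4p : 0 <= 2 / p) by (apply Rlt_le, Rdiv_lt_0_compat; lra).
  apply Rmult_le_compat.
  - apply Rmult_le_pos; lra.
  - apply Rlt_le, exp_pos.
  - apply Rmult_le_compat_l; auto. nra.
  - apply exp_le. unfold e. nra.
Qed.

(** * Chaining windows *)

Definition cnt (P : nat -> Prop) (n : nat) : R := rsum (seq 0 (S n)) (indic P).

(** Every long window has density at least [b], with an error measured against its right end; this is the condition on
   [b] whose supremum is the minimum density. *)
Definition density_ge (P : nat -> Prop) (b : R) : Prop :=
  forall eps, 0 < eps -> exists X : nat, forall m n, (X <= m <= n)%nat ->
    b * (INR n - INR m) - eps * INR n <= cnt P n - cnt P m.

Lemma cnt_S P n : cnt P (S n) = cnt P n + indic P (S n).
Proof. unfold cnt. now rewrite rsum_S. Qed.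

Lemma cnt_shift P N t : cnt P (N + t) - cnt P N = rsum (seq 1 t) (indic (fun x => P (N + x)%nat)).
Proof.
  induction t as [|t IH].
  - rewrite Nat.add_0_r. simpl. ring.
  - rewrite Nat.add_succ_r, cnt_S, rsum_seq_S, <- IH.
    unfold indic. simpl. rewrite Nat.add_succ_r.
    destruct (excluded_middle_informative (P (S (N + t)))); ring.
Qed.

Lemma cnt_mono P m n : (m <= n)%nat -> cnt P m <= cnt P n.
Proof.
  intros H. induction H as [|n H IH]; [lra|]. rewrite cnt_S. generalize (indic_bounds P (S n)); lra.
Qed.

Lemma last_element P m n : (m <= n)%nat -> P m ->
  exists q, (m <= q <= n)%nat /\ P q /\ cnt P q = cnt P n.
Proof.
  intros H Hm. induction H as [|n H IH].
  - exists m. auto.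
  - destruct IH as [q [Hq [Pq E]]]. destruct (classic (P (S n))) as [Hn|Hn].
    + exists (S n). split; [lia|auto].
    + exists q. split; [lia|]. split; auto. rewrite cnt_S, E.
      unfold indic. destruct (excluded_middle_informative (P (S n))); [contradiction|ring].
Qed.

(** Jump from an element to the last element of its dense window, and so on; the last, incomplete window has
   length at most [s * n]. *)
Lemma density_of_windows P D : 0 <= D ->
  (forall N, exists n, (N <= n)%nat /\ P n) ->
  (exists s0, 0 < s0 /\ forall s, 0 < s <= s0 -> exists N0, forall N, (N0 <= N)%nat -> P N ->
    exists t, (1 <= t)%nat /\ INR t <= s * INR N /\
      D * INR t < rsum (seq 1 t) (indic (fun x => P (N + x)%nat))) ->
  density_ge P D.
Proof.
  intros HD Hinf [s0 [Hs0 Hw]] eps He.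
  set (s := Rmin s0 (eps / (D + 1))).
  assert (Hs : 0 < s) by (apply Rmin_pos; [auto|apply Rdiv_lt_0_compat; lra]).
  assert (HDs : D * s <= eps).
  { apply Rle_trans with ((D + 1) * (eps / (D + 1))); [|right; field; lra].
    apply Rmult_le_compat; try lra. apply Rmin_r. }
  destruct (Hw s ltac:(split; [auto|apply Rmin_l])) as [N0 HN0].
  assert (Chain : forall d N n, (n - N <= d)%nat -> (N0 <= N)%nat -> (N <= n)%nat -> P N ->
     D * (INR n - INR N) - eps * INR n <= cnt P n - cnt P N).
  { induction d as [|d IH]; intros N n Hd HN Hn HP.
    - replace n with N by lia. assert (0 <= eps * INR N) by (apply Rmult_le_pos; [lra|apply pos_INR]). lra.
    - destruct (HN0 N HN HP) as [t [Ht1 [Ht2 Ht3]]].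
      destruct (le_lt_dec (N + t) n) as [Hle|Hgt].
      + destruct (last_element P N (N + t) ltac:(lia) HP) as [q [Hq [Pq Eq]]].
        rewrite <- cnt_shift, <- Eq in Ht3.
        assert (Hqt : INR q - INR N <= INR t).
        { assert (INR q <= INR (N + t)) by (apply le_INR; lia). rewrite plus_INR in H. lra. }
        assert (N <> q).
        { intros ->. assert (0 <= D * INR t) by (apply Rmult_le_pos; [lra|apply pos_INR]). lra. }
        assert (Hrec := IH q n ltac:(lia) ltac:(lia) ltac:(lia) Pq). nra.
      + assert (INR n - INR N <= INR t).
        { assert (INR n <= INR (N + t)) by (apply le_INR; lia). rewrite plus_INR in H. lra. }
        assert (INR N <= INR n) by (apply le_INR; auto).
        assert (Hm := cnt_mono P N n Hn). assert (0 <= INR N) by apply pos_INR. nra. }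
  destruct (Hinf N0) as [p0 [Hp0 Pp0]]. exists p0. intros m n Hmn.
  destruct (last_element P p0 m ltac:(lia) Pp0) as [q [Hq [Pq Eq]]].
  rewrite <- Eq. assert (H := Chain (n - q)%nat q n ltac:(lia) ltac:(lia) ltac:(lia) Pq).
  assert (INR q <= INR m) by (apply le_INR; lia). nra.
Qed.

Lemma density_ge_mono P Q b : (forall n, P n -> Q n) -> density_ge P b -> density_ge Q b.
Proof.
  intros H HP eps He. destruct (HP eps He) as [X HX]. exists X. intros m n Hmn.
  eapply Rle_trans; [apply HX; auto|].
  replace n with (m + (n - m))%nat by lia. rewrite !cnt_shift. apply rsum_le. intros x _.
  unfold indic. destruct (excluded_middle_informative (P _)) as [HPx|]; destruct (excluded_middle_informative (Q _)) as [|HQx]; try lra.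
  exfalso. apply HQx. auto.
Qed.

(** * The minimum density *)

Lemma count_cnt Lam x n : INR n <= x < INR n + 1 -> INR (count Lam x) = cnt Lam n.
Proof.
  intros Hx. unfold count, cnt.
  assert (Eup : up x = (Z.of_nat n + 1)%Z).
  { symmetry. apply tech_up; rewrite plus_IZR, <- INR_IZR_INZ; lra. }
  rewrite Eup. replace (Z.to_nat (Z.of_nat n + 1)) with (S n) by lia.
  assert (G : forall l, (forall k, In k l -> (k <= n)%nat) ->
    INR (length (filter (fun k => if excluded_middle_informative (Lam k /\ INR k <= x) then true else false) l)) = rsum l (indic Lam)).
  { induction l as [|k l IH]; intros Hl; [reflexivity|].
    assert (Hk : INR k <= x).
    { assert (INR k <= INR n) by (apply le_INR, Hl; simpl; auto). lra. }
    cbn [filter rsum]. unfold indic at 1.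
    destruct (excluded_middle_informative (Lam k /\ INR k <= x)) as [H|H];
    destruct (excluded_middle_informative (Lam k)) as [H'|H']; try tauto.
    - cbn [length]. rewrite S_INR, IH; [ring|intros; apply Hl; simpl; auto].
    - rewrite IH; [ring|intros; apply Hl; simpl; auto]. }
  apply G. intros k Hk. apply in_seq in Hk. lia.
Qed.

Lemma liminf_ge f y : (exists M, forall x, M <= x -> y <= f x) -> Rbar_le y (liminf_pinfty f).
Proof.
  intros [M HM]. unfold liminf_pinfty, Rbar_lub.
  destruct (Rbar_ex_lub _) as [l [Hub Hl]]. cbn [proj1_sig].
  apply Rbar_le_trans with (Glb_Rbar (fun y => exists x, M <= x /\ y = f x)).
  - apply (proj2 (Glb_Rbar_correct _)). intros z [x [Hx ->]]. apply HM, Hx.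
  - apply Hub. now exists M.
Qed.

Lemma liminf_le f U : (forall M, exists x, M <= x /\ f x <= U) -> Rbar_le (liminf_pinfty f) U.
Proof.
  intros H. unfold liminf_pinfty, Rbar_lub.
  destruct (Rbar_ex_lub _) as [l [Hub Hl]]. cbn [proj1_sig]. apply Hl.
  intros z [M ->]. destruct (H M) as [x [Hx HU]].
  apply Rbar_le_trans with (Finite (f x)); [|exact HU].
  apply (proj1 (Glb_Rbar_correct _)). now exists x.
Qed.

Definition window_density (Lam : nat -> Prop) (r x : R) : R :=
  (INR (count Lam ((r + 1) * x)) - INR (count Lam x)) / (r * x).

Lemma cnt_diff_le P m n : (m <= n)%nat -> cnt P n - cnt P m <= INR n - INR m.
Proof.
  intros H. replace n with (m + (n - m))%nat by lia. rewrite cnt_shift, plus_INR.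
  apply Rle_trans with (rsum (seq 1 (n - m)) (fun _ => 1)).
  - apply rsum_le; intros; apply indic_bounds.
  - rewrite rsum_const, length_seq. lra.
Qed.

Lemma window_bounds Lam r x : 0 < r -> 1 <= r * x -> 0 <= x -> 0 <= window_density Lam r x <= 2.
Proof.
  intros Hr Hrx Hx. unfold window_density.
  destruct (nfloor_ex x Hx) as [m Hm].
  destruct (nfloor_ex ((r + 1) * x)) as [n Hn]; [nra|].
  rewrite (count_cnt _ _ m Hm), (count_cnt _ _ n Hn).
  assert (Hmn : (m <= n)%nat).
  { assert (INR m < INR (S n)) by (rewrite S_INR; nra). apply INR_lt in H. lia. }
  assert (H1 := cnt_mono Lam m n Hmn). assert (H2 := cnt_diff_le Lam m n Hmn).
  split.
  - apply Rmult_le_pos; [lra|]. apply Rlt_le, Rinv_0_lt_compat; lra.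
  - apply Rle_div_l; [lra|]. nra.
Qed.

Definition lower_window_density (Lam : nat -> Prop) (r : R) : R :=
  real (liminf_pinfty (window_density Lam r)).

Lemma lower_window_finite Lam r : 0 < r ->
  liminf_pinfty (window_density Lam r) = Finite (lower_window_density Lam r).
Proof.
  intros Hr.
  assert (L1 : Rbar_le 0 (liminf_pinfty (window_density Lam r))).
  { apply liminf_ge. exists (/ r). intros x Hx.
    assert (0 < / r) by (apply Rinv_0_lt_compat; auto).
    apply window_bounds; auto; [|lra]. rewrite <- (Rinv_r r) by lra. apply Rmult_le_compat_l; lra. }
  assert (L2 : Rbar_le (liminf_pinfty (window_density Lam r)) 2).
  { apply liminf_le. intros M. exists (Rmax M (/ r)). split; [apply Rmax_l|].
    assert (0 < / r) by (apply Rinv_0_lt_compat; auto). assert (/ r <= Rmax M (/ r)) by apply Rmax_r.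
    apply window_bounds; auto; [|lra]. rewrite <- (Rinv_r r) at 1 by lra. apply Rmult_le_compat_l; lra. }
  unfold lower_window_density. destruct (liminf_pinfty (window_density Lam r)); simpl in *; tauto.
Qed.

Lemma density_lower_window Lam b r : 0 <= b -> 0 < r -> density_ge Lam b -> b <= lower_window_density Lam r.
Proof.
  intros Hb Hr HW. apply Rnot_lt_le. intros Hlt.
  set (g := lower_window_density Lam r) in *. set (d := (b - g) / 2).
  assert (Hd : 0 < d) by (unfold d; lra).
  assert (He : 0 < d * r / (2 * (r + 1))) by (apply Rdiv_lt_0_compat; nra).
  destruct (HW _ He) as [X HX].
  assert (Rbar_le (b - d) (liminf_pinfty (window_density Lam r))).
  { apply liminf_ge. exists (Rmax (INR X + 1) (Rmax (/ r) (2 * b / (d * r)))). intros x Hx.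
    assert (Hx1 : INR X + 1 <= x) by (eapply Rle_trans; [apply Rmax_l|exact Hx]).
    assert (Hx2 : / r <= x) by (eapply Rle_trans; [|exact Hx]; eapply Rle_trans; [|apply Rmax_r]; apply Rmax_l).
    assert (Hx3 : 2 * b / (d * r) <= x) by (eapply Rle_trans; [|exact Hx]; eapply Rle_trans; [|apply Rmax_r]; apply Rmax_r).
    assert (Hx0 : 0 < x) by (generalize (pos_INR X); lra).
    assert (Hb2 : b <= d * r * x / 2).
    { assert (Hdr : 0 < d * r) by nra. apply (Rmult_le_compat_r (d * r / 2)) in Hx3; [|lra].
      replace (2 * b / (d * r) * (d * r / 2)) with b in Hx3 by (field; lra). lra. }
    unfold window_density.
    destruct (nfloor_ex x) as [m Hm]; [lra|]. destruct (nfloor_ex ((r + 1) * x)) as [n Hn]; [nra|].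
    rewrite (count_cnt _ _ m Hm), (count_cnt _ _ n Hn).
    assert (Hmn : (m <= n)%nat).
    { assert (INR m < INR (S n)) by (rewrite S_INR; nra). apply INR_lt in H. lia. }
    assert (HXm : (X <= m)%nat).
    { assert (INR X < INR m) by lra. apply INR_lt in H. lia. }
    specialize (HX m n ltac:(lia)).
    assert (Hrx : 0 < r * x) by nra.
    apply Rmult_le_reg_r with (r * x); auto. unfold Rdiv at 1. rewrite Rmult_assoc, Rinv_l, Rmult_1_r by lra.
    assert (d * r / (2 * (r + 1)) * INR n <= d * r * x / 2).
    { apply Rle_trans with (d * r / (2 * (r + 1)) * ((r + 1) * x)); [apply Rmult_le_compat_l; lra|right; field; lra]. }
    assert (b * (INR n - INR m) >= b * (r * x - 1)) by nra.
    lra. }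
  rewrite lower_window_finite in H by auto. simpl in H. fold g in H. unfold d in H. lra.
Qed.

(** Windows of the fixed ratio [1 + r], with [b' * r <= eps], are chained up to [n]; the incomplete last one costs [eps * n]. *)
Lemma density_of_lower_window Lam b b' : 0 < b' < b ->
  (forall delta, 0 < delta -> exists r, 0 < r < delta /\ b <= lower_window_density Lam r) ->
  density_ge Lam b'.
Proof.
  intros Hb H eps He.
  destruct (H (eps / b')) as [r [Hr Hg]]; [apply Rdiv_lt_0_compat; lra|].
  assert (Hbr : b' * r <= eps).
  { apply Rle_trans with (b' * (eps / b')); [apply Rmult_le_compat_l; lra|right; field; lra]. }
  assert (HM : exists M, forall x, M <= x -> b' <= window_density Lam r x).
  { apply NNPP. intros Hno.
    assert (Rbar_le (liminf_pinfty (window_density Lam r)) b').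
    { apply liminf_le. intros M. apply NNPP. intros Hno2. apply Hno. exists M. intros x Hx.
      apply Rnot_lt_le. intros Hlt. apply Hno2. exists x. split; auto. lra. }
    rewrite lower_window_finite in H0 by lra. simpl in H0. lra. }
  destruct HM as [M HM].
  assert (Step : forall k x y, Rmax M 1 <= x -> x <= y -> y <= (r + 1) ^ k * x ->
     b' * (y - x) - b' * r * y <= INR (count Lam y) - INR (count Lam x)).
  { assert (Mono : forall x y, 0 <= x <= y -> INR (count Lam x) <= INR (count Lam y)).
    { intros x y Hxy. destruct (nfloor_ex x) as [m Hm]; [lra|]. destruct (nfloor_ex y) as [n Hn]; [lra|].
      rewrite (count_cnt _ _ m Hm), (count_cnt _ _ n Hn). apply cnt_mono.
      assert (INR m < INR (S n)) by (rewrite S_INR; lra). apply INR_lt in H0. lia. }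
    induction k as [|k IH]; intros x y Hx Hxy Hy.
    - generalize (Rmax_r M 1); intros. assert (E : y = x) by (simpl in Hy; lra). subst y.
      assert (0 <= b' * r * x) by (apply Rmult_le_pos; nra). lra.
    - generalize (Rmax_r M 1) (Rmax_l M 1); intros.
      destruct (Rle_lt_dec ((r + 1) * x) y) as [Hle|Hgt].
      + assert (0 < r * x) by (apply Rmult_lt_0_compat; lra).
        assert (Hrec := IH ((r + 1) * x) y ltac:(lra) Hle ltac:(simpl in Hy; lra)).
        specialize (HM x ltac:(lra)). unfold window_density in HM.
        assert (Hrx : 0 < r * x) by nra.
        apply (Rmult_le_compat_r (r * x)) in HM; [|lra]. unfold Rdiv in HM.
        rewrite Rmult_assoc, Rinv_l, Rmult_1_r in HM by lra. nra.
      + assert (Hm := Mono x y ltac:(lra)).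
        assert (r * x <= r * y) by (apply Rmult_le_compat_l; lra).
        assert (b' * (y - x) <= b' * (r * y)) by (apply Rmult_le_compat_l; lra). lra. }
  destruct (nfloor_ex (Rmax M 1)) as [X HX]; [generalize (Rmax_r M 1); lra|].
  exists (S X). intros m n Hmn.
  assert (Hm1 : Rmax M 1 <= INR m).
  { assert (INR (S X) <= INR m) by (apply le_INR; lia). rewrite S_INR in H0. lra. }
  assert (Hmn' : INR m <= INR n) by (apply le_INR; lia).
  assert (Hk : exists k, INR n <= (r + 1) ^ k * INR m).
  { destruct (Pow_x_infinity (r + 1) ltac:(rewrite Rabs_pos_eq; lra) (INR n)) as [k Hk].
    exists k. specialize (Hk k (le_n _)). rewrite Rabs_pos_eq in Hk by (apply pow_le; lra).
    generalize (Rmax_r M 1); intros. assert (0 < (r + 1) ^ k) by (apply pow_lt; lra). nra. }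
  destruct Hk as [k Hk].
  assert (Hs := Step k (INR m) (INR n) Hm1 Hmn' Hk).
  rewrite (count_cnt Lam (INR m) m), (count_cnt Lam (INR n) n) in Hs by lra.
  assert (b' * r * INR n <= eps * INR n) by (apply Rmult_le_compat_r; [apply pos_INR|auto]). lra.
Qed.

Lemma density_ge_0 Lam : density_ge Lam 0.
Proof.
  intros eps He. exists 0%nat. intros m n Hmn.
  assert (H := cnt_mono Lam m n ltac:(lia)).
  assert (0 <= eps * INR n) by (apply Rmult_le_pos; [lra|apply pos_INR]). lra.
Qed.

Lemma density_ge_le1 Lam b : density_ge Lam b -> b <= 1.
Proof.
  intros H. apply Rnot_lt_le. intros Hb.
  destruct (H ((b - 1) / 2)) as [X HX]; [lra|].
  destruct (nfloor_ex (2 * (INR X) + 1)) as [k Hk]; [generalize (pos_INR X); lra|].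
  set (n := (X + S k)%nat).
  assert (HX2 := HX X n ltac:(unfold n; lia)). assert (H2 := cnt_diff_le Lam X n ltac:(unfold n; lia)).
  assert (En : INR n = INR X + (INR k + 1)) by (unfold n; rewrite plus_INR, S_INR; ring).
  rewrite En in *. generalize (pos_INR X) (pos_INR k); intros. nra.
Qed.

(** The limit exists because a lower bound on windows of ratio [1 + r] for arbitrarily small [r]
   propagates, by chaining windows, to all longer windows. *)
Lemma minimum_density_spec Lam :
  (forall b, 0 <= b -> density_ge Lam b -> b <= minimum_density Lam) /\
  (forall c, c < minimum_density Lam -> exists b, c < b /\ 0 <= b /\ density_ge Lam b).
Proof.
  destruct (completeness (fun b => 0 <= b /\ density_ge Lam b)) as [D [Hub Hl]].
  { exists 1. intros b [_ Hb]. eapply density_ge_le1; eauto. }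
  { exists 0. split; [lra|apply density_ge_0]. }
  assert (Lim : filterlim (lower_window_density Lam) (at_right 0) (locally D)).
  { apply filterlim_locally. intros eps.
    assert (Hx : exists delta, 0 < delta /\ forall r, 0 < r < delta -> lower_window_density Lam r < D + eps).
    { apply NNPP. intros Hno.
      assert (HD : 0 <= D) by (apply Hub; split; [lra|apply density_ge_0]).
      assert (density_ge Lam (D + eps / 2)).
      { apply (density_of_lower_window Lam (D + eps)); [generalize (cond_pos eps); lra|].
        intros delta Hd. apply NNPP. intros Hno2. apply Hno. exists delta. split; auto.
        intros r Hr. apply Rnot_le_lt. intros Hle. apply Hno2. exists r. auto. }
      assert (D + eps / 2 <= D); [|generalize (cond_pos eps); lra].
      apply Hub. split; auto. generalize (cond_pos eps); lra. }
    destruct Hx as [delta [Hd Hr]].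
    exists (mkposreal delta Hd). intros r Hball Hr0.
    assert (Hrd : 0 < r < delta).
    { unfold ball in Hball; simpl in Hball; unfold AbsRing_ball, abs, minus, plus, opp in Hball; simpl in Hball.
      apply Rabs_def2 in Hball. lra. }
    specialize (Hr r Hrd).
    assert (D <= lower_window_density Lam r).
    { apply Hl. intros b [Hb HW]. apply density_lower_window; auto; lra. }
    unfold ball; simpl; unfold AbsRing_ball, abs, minus, plus, opp; simpl.
    apply Rabs_def1; generalize (cond_pos eps); lra. }
  assert (E : minimum_density Lam = D).
  { unfold minimum_density.
    apply (filterlim_locally_unique (F := at_right 0) (lower_window_density Lam)); auto.
    apply (iota_correct (V := R_CompleteNormedModule)). exists D. split; [exact Lim|].
    intros D' HD'. apply (filterlim_locally_unique (F := at_right 0) (lower_window_density Lam)); auto. }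
  rewrite E. split.
  - intros b Hb HW. apply Hub. auto.
  - intros c Hc. apply NNPP. intros Hno.
    assert (D <= c); [|lra]. apply Hl. intros b [Hb HW]. apply Rnot_lt_le. intros Hlt.
    apply Hno. exists b. auto.
Qed.

(** * Small density forces a singularity *)

Lemma root_condition_eventually Lam a eps : series_on Lam a -> root_condition Lam a -> 0 < eps ->
  exists N, forall m, (N <= m)%nat -> a m <> 0%C ->
    exp (- (eps * INR m)) <= Cmod (a m) <= exp (eps * INR m).
Proof.
  intros [Hs _] H He.
  assert (L : locally 1 (fun x => exp (- eps) < x < exp eps)).
  { assert (Hd : 0 < Rmin (1 - exp (- eps)) (exp eps - 1)).
    { apply Rmin_pos.
      - assert (exp (- eps) < exp 0) by (apply exp_increasing; lra). rewrite exp_0 in H0. lra.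
      - assert (exp 0 < exp eps) by (apply exp_increasing; lra). rewrite exp_0 in H0. lra. }
    exists (mkposreal _ Hd). intros x Hx.
    unfold ball in Hx; simpl in Hx; unfold AbsRing_ball, abs, minus, plus, opp in Hx; simpl in Hx.
    apply Rabs_def2 in Hx. generalize (Rmin_l (1 - exp (- eps)) (exp eps - 1)) (Rmin_r (1 - exp (- eps)) (exp eps - 1)). lra. }
  destruct (H _ L) as [N HN]. exists (S N). intros m Hm Ham.
  assert (HL : Lam m) by (apply NNPP; intros HL; apply Ham, Hs, HL).
  specialize (HN m ltac:(lia) (conj HL Ham)). unfold Rpower in HN.
  assert (Hmp : 0 < INR m) by (apply lt_0_INR; lia).
  assert (Hc : 0 < Cmod (a m)) by now apply Cmod_gt_0.
  destruct HN as [H1 H2]. apply exp_lt_inv in H1, H2.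
  assert (E : ln (Cmod (a m)) = INR m * (/ INR m * ln (Cmod (a m)))) by (field; lra).
  rewrite <- (exp_ln (Cmod (a m))) by auto. rewrite E. split; apply exp_le; nra.
Qed.

Lemma root_condition_subexponential Lam a : series_on Lam a -> root_condition Lam a -> subexponential a.
Proof.
  intros Hs Hr eps He. destruct (root_condition_eventually Lam a eps Hs Hr He) as [N HN].
  exists (1 + rsum (seq 0 N) (fun m => Cmod (a m))). intros m.
  assert (H0 : 0 <= rsum (seq 0 N) (fun m => Cmod (a m))) by (apply rsum_ge0; intros; apply Cmod_ge_0).
  assert (H1 : 1 <= exp (eps * INR m)).
  { rewrite <- exp_0. apply exp_le. apply Rmult_le_pos; [lra|apply pos_INR]. }
  destruct (le_lt_dec N m) as [Hm|Hm].
  - destruct (Ceq_dec (a m) 0) as [E|E].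
    + rewrite E, Cmod_0. nra.
    + destruct (HN m Hm E). nra.
  - assert (Cmod (a m) <= rsum (seq 0 N) (fun m => Cmod (a m))).
    { apply Rle_trans with (rsum (m :: nil) (fun n => Cmod (a n))); [simpl; lra|].
      apply rsum_incl; [repeat constructor; auto| |intros; apply Cmod_ge_0].
      intros j [<-|[]]. apply in_seq; lia. }
    nra.
Qed.

Lemma series_on_infinite Lam a : series_on Lam a -> forall N, exists n, (N <= n)%nat /\ a n <> 0%C.
Proof.
  intros [_ HR] N. apply NNPP. intros Hno.
  assert (Hz : forall n, (N <= n)%nat -> a n = 0%C).
  { intros n Hn. apply NNPP. intros Ha. apply Hno. exists n. auto. }
  assert (Rbar_le 2 (CV_radius (fun m => Cmod (a m)))).
  { apply (proj1 (CV_radius_bounded _)). exists (rsum (seq 0 N) (fun n => Cmod (a n) * 2 ^ n)).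
    assert (Hp : forall k, 0 <= Cmod (a k) * 2 ^ k) by (intros; apply Rmult_le_pos; [apply Cmod_ge_0|apply pow_le; lra]).
    intros n. rewrite Rabs_pos_eq by auto.
    destruct (le_lt_dec N n) as [Hn|Hn].
    - rewrite Hz, Cmod_0, Rmult_0_l by auto. now apply rsum_ge0.
    - apply Rle_trans with (rsum (n :: nil) (fun n => Cmod (a n) * 2 ^ n)); [simpl; lra|].
      apply rsum_incl; [repeat constructor; auto| |auto].
      intros j [<-|[]]. apply in_seq; lia. }
  rewrite HR in H. simpl in H. lra.
Qed.

(** If all points of the arc were regular, the support of [a] would have windows of density [(Delta + D1) / 2 > Delta] for some
   [D1 > Delta]. The bound on the Taylor coefficients holds on an arc longer by [p] at both ends, which leaves room for [D1]. *)
Lemma singularity_of_small_density Delta Lam a alpha beta : 0 <= Delta <= 1 ->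
  minimum_density Lam <= Delta -> series_on Lam a -> root_condition Lam a ->
  beta - alpha = 2 * PI * Delta -> has_singularity_on a (closed_arc alpha beta).
Proof.
  intros HD HB Hs Hr Hab. apply NNPP. intros Hno.
  generalize PI_RGT_0; intros HPI.
  assert (Hreg : forall theta, alpha <= theta <= beta -> regular_at a (cis theta)).
  { intros theta Hth. apply regular_at_of_continuation. apply NNPP. intros Hc.
    apply Hno. exists (cis theta). split; [exists theta; auto|auto]. }
  assert (Hsub := root_condition_subexponential Lam a Hs Hr).
  assert (Hlow : not_too_small a).
  { intros eps He. destruct (root_condition_eventually Lam a eps Hs Hr He) as [N HN].
    exists N. intros m Hm Ham. apply HN; auto. }
  assert (Hinf := series_on_infinite Lam a Hs).
  destruct (arc_taylor_bound a alpha beta ltac:(nra) (subexponential_summable a Hsub) Hreg) as [p [Hp Hb]].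
  destruct (Req_dec Delta 1) as [->|HD1].
  - apply (regular_circle_absurd a alpha p Hp Hsub Hlow Hinf).
    intros phi k t Hphi. apply Hb. lra.
  - set (D1 := Rmin ((Delta + 1) / 2) (Delta + p / PI)).
    assert (Hpp : 0 < p / PI) by (apply Rdiv_lt_0_compat; lra).
    assert (HD1a : D1 <= (Delta + 1) / 2) by apply Rmin_l.
    assert (HD1b : D1 <= Delta + p / PI) by apply Rmin_r.
    assert (HD1c : Delta < D1) by (unfold D1, Rmin; destruct (Rle_dec _ _); lra).
    assert (HPD : PI * D1 <= PI * Delta + p).
    { apply Rle_trans with (PI * (Delta + p / PI)); [apply Rmult_le_compat_l; lra|right; field; lra]. }
    assert (Hden : density_ge (fun n => a n <> 0%C) ((Delta + D1) / 2)).
    { apply density_of_windows; [lra|exact Hinf|].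
      apply (dense_window a ((alpha + beta) / 2 - PI) p D1); auto; try lra.
      intros phi k t Hphi. apply Hb. lra. }
    assert (HL : density_ge Lam ((Delta + D1) / 2)).
    { eapply density_ge_mono; [|exact Hden]. intros n Hn. apply NNPP. intros HLn. apply Hn, Hs, HLn. }
    apply (proj1 (minimum_density_spec Lam)) in HL; lra.
Qed.

(** * A regularly distributed subset *)

(** [P] has density [d]; the error is split into [eps * n + A] so that it also covers small [n]. *)
Definition balanced (P : nat -> Prop) (d : R) : Prop :=
  ~ P 0%nat /\ forall eps, 0 < eps -> exists A, 0 <= A /\ forall n, Rabs (cnt P n - d * INR n) <= eps * INR n + A.

Fixpoint greedy_count (Lam : nat -> Prop) (d : R) (n : nat) : nat :=
  match n with
  | O => O
  | S m => if excluded_middle_informative (Lam (S m) /\ INR (greedy_count Lam d m) + 1 <= d * INR (S m))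
           then S (greedy_count Lam d m) else greedy_count Lam d m
  end.

Lemma greedy_count_S Lam d m : greedy_count Lam d (S m) =
  if excluded_middle_informative (Lam (S m) /\ INR (greedy_count Lam d m) + 1 <= d * INR (S m))
  then S (greedy_count Lam d m) else greedy_count Lam d m.
Proof. reflexivity. Qed.

(** [n] is taken whenever this keeps the count at most [d * n]. *)
Definition greedy (Lam : nat -> Prop) (d : R) (n : nat) : Prop :=
  (0 < n)%nat /\ Lam n /\ INR (greedy_count Lam d (pred n)) + 1 <= d * INR n.

Lemma cnt_greedy Lam d n : cnt (greedy Lam d) n = INR (greedy_count Lam d n).
Proof.
  induction n as [|n IH].
  - unfold cnt. simpl. unfold indic. destruct (excluded_middle_informative (greedy Lam d 0)) as [[H _]|]; [lia|ring].
  - rewrite cnt_S, IH. rewrite greedy_count_S. unfold indic, greedy. cbn [pred].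
    destruct (excluded_middle_informative ((0 < S n)%nat /\ _)) as [H|H];
    destruct (excluded_middle_informative (Lam (S n) /\ _)) as [H'|H']; try tauto.
    + now rewrite S_INR.
    + exfalso. apply H. split; [lia|auto].
    + ring.
Qed.

(** Once the count falls behind [d * n], every further element of [Lam] is taken, and [Lam] has enough of them. *)
Lemma greedy_balanced Lam d : 0 <= d -> density_ge Lam d -> balanced (greedy Lam d) d.
Proof.
  intros Hd HL. split; [intros [H _]; lia|].
  intros eps He. destruct (HL eps He) as [X HX].
  assert (Up : forall n, INR (greedy_count Lam d n) <= d * INR n).
  { induction n as [|n IH]; [simpl; lra|]. rewrite greedy_count_S.
    destruct (excluded_middle_informative _) as [[_ H]|H].
    - rewrite S_INR. exact H.
    - eapply Rle_trans; [exact IH|]. rewrite S_INR. nra. }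
  assert (Low : forall n, (X <= n)%nat -> exists m, (X <= m <= n)%nat /\
     (m = X \/ d * INR m - 1 < INR (greedy_count Lam d m)) /\
     cnt Lam n - cnt Lam m <= INR (greedy_count Lam d n) - INR (greedy_count Lam d m)).
  { intros n Hn. induction Hn as [|n Hn IH].
    - exists X. split; [lia|]. split; [auto|lra].
    - destruct (classic (Lam (S n) /\ d * INR (S n) < INR (greedy_count Lam d n) + 1)) as [[H1 H2]|H].
      + exists (S n). split; [lia|]. split; [right|lra]. rewrite greedy_count_S.
        destruct (excluded_middle_informative _) as [[_ H3]|H3]; [lra|lra].
      + destruct IH as [m [Hm [Hmc Hle]]]. exists m. split; [lia|]. split; auto.
        rewrite cnt_S. rewrite greedy_count_S. unfold indic.
        destruct (excluded_middle_informative (Lam (S n))) as [HLn|HLn];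
        destruct (excluded_middle_informative (Lam (S n) /\ _)) as [H3|H3].
        * rewrite S_INR. lra.
        * exfalso. apply H. split; auto. apply Rnot_le_lt. intros Hc. apply H3. auto.
        * tauto.
        * lra. }
  exists (d * INR X + 1). split; [assert (0 <= d * INR X) by (apply Rmult_le_pos; [lra|apply pos_INR]); lra|].
  intros n. rewrite cnt_greedy.
  assert (Hen : 0 <= eps * INR n) by (apply Rmult_le_pos; [lra|apply pos_INR]).
  assert (HdX : 0 <= d * INR X) by (apply Rmult_le_pos; [lra|apply pos_INR]).
  assert (Hup := Up n). assert (Hg := pos_INR (greedy_count Lam d n)).
  apply Rabs_le. split; [|lra].
  destruct (le_lt_dec X n) as [Hn|Hn].
  - destruct (Low n Hn) as [m [Hm [Hmc Hle]]]. specialize (HX m n ltac:(lia)).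
    assert (Hgm := pos_INR (greedy_count Lam d m)). destruct Hmc as [->|Hmc]; nra.
  - assert (INR n <= INR X) by (apply le_INR; lia). nra.
Qed.

(** * The product over the selected integers, at integers *)

(** The factor [n = m] is left out, since [m] will be a zero of the product. *)
Definition log_term (m n : nat) : R :=
  if Nat.eq_dec n m then 0 else ln (Rabs (1 - (INR m / INR n) ^ 2)).

Lemma abel_sum (E ell : nat -> R) u n :
  rsum (seq (S u) (S n)) (fun k => (E k - E (pred k)) * ell k) =
  E (S u + n)%nat * ell (S u + n)%nat - E u * ell (S u) +
  rsum (seq (S u) n) (fun k => E k * (ell k - ell (S k))).
Proof.
  induction n as [|n IH].
  - simpl. rewrite Nat.add_0_r. ring.
  - rewrite rsum_seq_S, IH, (rsum_seq_S (S u) n).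
    replace (pred (S u + S n)) with (S u + n)%nat by lia.
    replace (S u + S n)%nat with (S (S u + n)) by lia. ring.
Qed.

Lemma abel_bound (E ell : nat -> R) u n B (b : nat -> R) :
  Rabs (E (S u + n)%nat * ell (S u + n)%nat) + Rabs (E u * ell (S u)) <= B ->
  (forall k, In k (seq (S u) n) -> Rabs (E k) * Rabs (ell k - ell (S k)) <= b k) ->
  Rabs (rsum (seq (S u) (S n)) (fun k => (E k - E (pred k)) * ell k)) <= B + rsum (seq (S u) n) b.
Proof.
  intros HB Hb. rewrite abel_sum.
  eapply Rle_trans; [apply Rabs_triang|]. apply Rplus_le_compat.
  - eapply Rle_trans; [apply Rabs_triang|]. rewrite Rabs_Ropp. exact HB.
  - eapply Rle_trans; [apply rsum_abs|]. apply rsum_le. intros k Hk. rewrite Rabs_mult. auto.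
Qed.

Lemma ln_1p_le u : -1 < u -> ln (1 + u) <= u.
Proof. intros H. generalize (ln_le_sub (1 + u) ltac:(lra)). lra. Qed.

Lemma ln_ratio_le x y : 0 < x <= y -> 0 <= ln y - ln x <= (y - x) / x.
Proof.
  intros H. split.
  - assert (ln x <= ln y) by (apply ln_le; lra). lra.
  - rewrite <- ln_div by lra. eapply Rle_trans; [apply ln_le_sub, Rdiv_lt_0_compat; lra|].
    right. field. lra.
Qed.

(** [log_term m n] in terms of the distances [|n - m|]. *)
Lemma log_term_left m n : (0 < n < m)%nat ->
  log_term m n = ln (INR m - INR n) + ln (INR m + INR n) - 2 * ln (INR n).
Proof.
  intros H. unfold log_term. destruct (Nat.eq_dec n m); [lia|].
  assert (0 < INR n) by (apply lt_0_INR; lia).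
  assert (INR n < INR m) by (apply lt_INR; lia).
  replace (1 - (INR m / INR n) ^ 2) with (- ((INR m - INR n) * (INR m + INR n) / (INR n * INR n))) by (field; lra).
  rewrite Rabs_Ropp, Rabs_pos_eq.
  - rewrite ln_div, !ln_mult by nra. ring.
  - apply Rmult_le_pos; [nra|]. apply Rlt_le, Rinv_0_lt_compat. nra.
Qed.

Lemma log_term_right m n : (m < n)%nat ->
  log_term m n = ln (INR n - INR m) + ln (INR n + INR m) - 2 * ln (INR n).
Proof.
  intros H. unfold log_term. destruct (Nat.eq_dec n m); [lia|].
  assert (0 < INR n) by (apply lt_0_INR; lia).
  assert (INR m < INR n) by (apply lt_INR; lia). assert (0 <= INR m) by apply pos_INR.
  replace (1 - (INR m / INR n) ^ 2) with ((INR n - INR m) * (INR n + INR m) / (INR n * INR n)) by (field; lra).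
  rewrite Rabs_pos_eq.
  - rewrite ln_div, !ln_mult by nra. ring.
  - apply Rmult_le_pos; [nra|]. apply Rlt_le, Rinv_0_lt_compat. nra.
Qed.

Lemma log_term_diff_left m n : (0 < n)%nat -> (S n < m)%nat ->
  Rabs (log_term m n - log_term m (S n)) <= / (INR m - INR (S n)) + / INR m + 2 / INR n.
Proof.
  intros H1 H2. rewrite !log_term_left by lia.
  assert (Hn : 0 < INR n) by (apply lt_0_INR; lia).
  assert (Hm : INR (S n) < INR m) by (apply lt_INR; lia). rewrite S_INR in *.
  generalize (ln_ratio_le (INR m - (INR n + 1)) (INR m - INR n) ltac:(lra))
    (ln_ratio_le (INR m + INR n) (INR m + (INR n + 1)) ltac:(lra)) (ln_ratio_le (INR n) (INR n + 1) ltac:(lra)).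
  replace ((INR m - INR n - (INR m - (INR n + 1))) / (INR m - (INR n + 1))) with (/ (INR m - (INR n + 1))) by (field; lra).
  replace ((INR m + (INR n + 1) - (INR m + INR n)) / (INR m + INR n)) with (/ (INR m + INR n)) by (field; lra).
  replace ((INR n + 1 - INR n) / INR n) with (/ INR n) by (field; lra).
  assert (/ (INR m + INR n) <= / INR m) by (apply Rinv_le_contravar; lra).
  intros. unfold Rdiv. apply Rabs_le. lra.
Qed.

Lemma log_term_diff_right m n : (0 < m < n)%nat ->
  Rabs (log_term m n - log_term m (S n)) <= / (INR n - INR m) + 3 / INR m.
Proof.
  intros H1. rewrite !log_term_right by lia.
  assert (Hn : 0 < INR m) by (apply lt_0_INR; lia).
  assert (Hm : INR m < INR n) by (apply lt_INR; lia). rewrite S_INR in *.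
  generalize (ln_ratio_le (INR n - INR m) (INR n + 1 - INR m) ltac:(lra))
    (ln_ratio_le (INR n + INR m) (INR n + 1 + INR m) ltac:(lra)) (ln_ratio_le (INR n) (INR n + 1) ltac:(lra)).
  replace ((INR n + 1 - INR m - (INR n - INR m)) / (INR n - INR m)) with (/ (INR n - INR m)) by (field; lra).
  replace ((INR n + 1 + INR m - (INR n + INR m)) / (INR n + INR m)) with (/ (INR n + INR m)) by (field; lra).
  replace ((INR n + 1 - INR n) / INR n) with (/ INR n) by (field; lra).
  assert (/ (INR n + INR m) <= / INR m) by (apply Rinv_le_contravar; lra).
  assert (/ INR n <= / INR m) by (apply Rinv_le_contravar; lra).
  intros. unfold Rdiv. apply Rabs_le. lra.
Qed.

Lemma log_term_far m n : (2 * m <= n)%nat -> (0 < n)%nat ->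
  Rabs (log_term m n) <= 2 * (INR m * INR m) / (INR n * INR n) /\
  Rabs (log_term m n - log_term m (S n)) <= 4 * (INR m * INR m) / (INR n * INR n * INR n).
Proof.
  intros H Hn0.
  assert (Hn : 1 <= INR n) by (apply INR_ge1; lia).
  assert (Hm0 : 0 <= INR m) by apply pos_INR.
  assert (Hmn : 2 * INR m <= INR n).
  { replace (2 * INR m) with (INR (2 * m)) by (rewrite mult_INR; simpl; ring). apply le_INR; auto. }
  assert (E : forall k, (m < k)%nat -> log_term m k = ln (1 - (INR m / INR k) ^ 2)).
  { intros k Hk. unfold log_term. destruct (Nat.eq_dec k m); [lia|]. f_equal. apply Rabs_pos_eq.
    assert (0 < INR k) by (apply lt_0_INR; lia). assert (INR m <= INR k) by (apply le_INR; lia).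
    assert (0 <= INR m / INR k <= 1).
    { split; [apply Rmult_le_pos; [lra|apply Rlt_le, Rinv_0_lt_compat; lra]|].
      apply Rle_div_l; [auto|lra]. }
    nra. }
  assert (Hq : forall k, (n <= k)%nat -> 0 <= (INR m / INR k) ^ 2 <= 1 / 4).
  { intros k Hk. assert (INR n <= INR k) by (apply le_INR; auto).
    assert (0 <= INR m / INR k <= 1 / 2); [|nra].
    split; [apply Rmult_le_pos; [lra|apply Rlt_le, Rinv_0_lt_compat; lra]|].
    apply Rmult_le_reg_r with (INR k); [lra|]. unfold Rdiv. rewrite !Rmult_assoc, Rinv_l; lra. }
  assert (Hq1 := Hq n (le_n _)). assert (Hq2 := Hq (S n) ltac:(lia)).
  assert (Eq1 : (INR m / INR n) ^ 2 = INR m * INR m / (INR n * INR n)) by (field; lra).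
  rewrite !E by lia. split.
  - generalize (ln_ratio_le (1 - (INR m / INR n) ^ 2) 1 ltac:(lra)). rewrite ln_1. intros [L1 L2].
    rewrite Rabs_left1 by lra.
    assert ((1 - (1 - (INR m / INR n) ^ 2)) / (1 - (INR m / INR n) ^ 2) <= 2 * (INR m / INR n) ^ 2).
    { apply Rmult_le_reg_r with (1 - (INR m / INR n) ^ 2); [lra|]. unfold Rdiv at 1. rewrite Rmult_assoc, Rinv_l by lra. nra. }
    rewrite Eq1 in *. replace (2 * (INR m * INR m) / (INR n * INR n)) with (2 * (INR m * INR m / (INR n * INR n))) by (field; lra). lra.
  - assert (Hd : 0 <= (INR m / INR n) ^ 2 - (INR m / INR (S n)) ^ 2 <= 2 * (INR m * INR m) / (INR n * INR n * INR n)).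
    { rewrite S_INR. replace ((INR m / INR n) ^ 2 - (INR m / (INR n + 1)) ^ 2)
        with (INR m * INR m * ((2 * INR n + 1) / (INR n * INR n * ((INR n + 1) * (INR n + 1))))) by (field; lra).
      assert (0 < INR n * INR n) by nra. assert (0 < INR n * INR n * INR n) by nra.
      assert (0 < (INR n + 1) * (INR n + 1)) by nra.
      assert (0 <= (2 * INR n + 1) / (INR n * INR n * ((INR n + 1) * (INR n + 1))) <= 2 / (INR n * INR n * INR n)).
      { split; [apply Rlt_le, Rdiv_lt_0_compat; nra|].
        apply Rmult_le_reg_r with (INR n * INR n * INR n * ((INR n + 1) * (INR n + 1))); [nra|].
        replace ((2 * INR n + 1) / (INR n * INR n * ((INR n + 1) * (INR n + 1))) * (INR n * INR n * INR n * ((INR n + 1) * (INR n + 1))))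
          with ((2 * INR n + 1) * INR n) by (field; lra).
        replace (2 / (INR n * INR n * INR n) * (INR n * INR n * INR n * ((INR n + 1) * (INR n + 1))))
          with (2 * ((INR n + 1) * (INR n + 1))) by (field; lra). nra. }
      replace (2 * (INR m * INR m) / (INR n * INR n * INR n)) with (INR m * INR m * (2 / (INR n * INR n * INR n))) by (field; lra).
      assert (0 <= INR m * INR m) by nra.
      split; [apply Rmult_le_pos; lra|apply Rmult_le_compat_l; lra]. }
    generalize (ln_ratio_le (1 - (INR m / INR n) ^ 2) (1 - (INR m / INR (S n)) ^ 2) ltac:(lra)). intros [L1 L2].
    rewrite Rabs_left1 by lra.
    set (q1 := (INR m / INR n) ^ 2) in *. set (q2 := (INR m / INR (S n)) ^ 2) in *.
    assert ((1 - q2 - (1 - q1)) / (1 - q1) <= 2 * (q1 - q2)).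
    { apply Rmult_le_reg_r with (1 - q1); [lra|]. unfold Rdiv at 1. rewrite Rmult_assoc, Rinv_l by lra. nra. }
    replace (4 * (INR m * INR m) / (INR n * INR n * INR n)) with (2 * (2 * (INR m * INR m) / (INR n * INR n * INR n))) by (field; lra).
    lra.
Qed.

Lemma log_term_mid m n : n <> m -> 1 / 8 <= Rabs (1 - (INR m / INR n) ^ 2) <= 8 -> Rabs (log_term m n) <= 7.
Proof.
  intros Hn H. unfold log_term. destruct (Nat.eq_dec n m); [contradiction|].
  set (r := Rabs (1 - (INR m / INR n) ^ 2)) in *. apply Rabs_le. split.
  - assert (ln (/ r) <= 7).
    { eapply Rle_trans; [apply ln_le_sub, Rinv_0_lt_compat; lra|].
      assert (/ r <= / (1 / 8)) by (apply Rinv_le_contravar; lra). lra. }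
    rewrite ln_Rinv in H0 by lra. lra.
  - eapply Rle_trans; [apply ln_le_sub; lra|lra].
Qed.

Lemma ln_small_slope x delta : 0 < x -> 0 < delta -> ln x <= delta * x + ln (/ delta).
Proof.
  intros Hx Hd. assert (ln (delta * x) <= delta * x) by (eapply Rle_trans; [apply ln_le_sub; nra|lra]).
  rewrite ln_mult in H by auto. rewrite ln_Rinv by auto. lra.
Qed.

Lemma harmonic_upper n : rsum (seq 1 n) (fun k => / INR k) <= 2 * ln (INR n + 1).
Proof.
  assert (H := harmonic_le 1 n ltac:(lia)).
  replace (INR (1 + n) / INR 1) with (INR n + 1) in H by (rewrite plus_INR; simpl; field).
  apply Rle_trans with (rsum (seq 1 n) (fun k => 2 * / (INR k + 1))).
  - apply rsum_le. intros k Hk. apply in_seq in Hk.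
    assert (1 <= INR k) by (apply INR_ge1; lia).
    apply Rmult_le_reg_r with (INR k * (INR k + 1)); [nra|].
    replace (/ INR k * (INR k * (INR k + 1))) with (INR k + 1) by (field; lra).
    replace (2 * / (INR k + 1) * (INR k * (INR k + 1))) with (2 * INR k) by (field; lra). lra.
  - rewrite rsum_scal. lra.
Qed.

Lemma count_near_left a n T : 0 <= T ->
  rsum (seq a n) (fun k => if Rle_dec (INR (a + n - k)) T then 1 else 0) <= T.
Proof.
  intros HT. revert a. induction n as [|n IH]; intros a; [simpl; lra|].
  cbn [seq rsum]. destruct (Rle_dec (INR (a + S n - a)) T) as [H|H].
  - replace (a + S n - a)%nat with (S n) in H by lia. rewrite S_INR in H.
    assert (rsum (seq (S a) n) (fun k => if Rle_dec (INR (a + S n - k)) T then 1 else 0) <= rsum (seq (S a) n) (fun _ => 1)).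
    { apply rsum_le. intros k _. destruct (Rle_dec _ T); lra. }
    rewrite rsum_const, length_seq in H0. lra.
  - specialize (IH (S a)). rewrite Rplus_0_l. replace (a + S n)%nat with (S a + n)%nat by lia. exact IH.
Qed.

Lemma count_near_right a n T : 0 <= T ->
  rsum (seq (S a) n) (fun k => if Rle_dec (INR (k - a)) T then 1 else 0) <= T.
Proof.
  intros HT. induction n as [|n IH]; [simpl; lra|].
  rewrite rsum_seq_S. destruct (Rle_dec (INR (S a + n - a)) T) as [H|H]; [|lra].
  replace (S a + n - a)%nat with (S n) in H by lia. rewrite S_INR in H.
  assert (rsum (seq (S a) n) (fun k => if Rle_dec (INR (k - a)) T then 1 else 0) <= rsum (seq (S a) n) (fun _ => 1)).
  { apply rsum_le. intros k _. destruct (Rle_dec _ T); lra. }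
  rewrite rsum_const, length_seq in H0. lra.
Qed.

Definition discrepancy (P : nat -> Prop) (d : R) (n : nat) : R := cnt P n - d * INR n.

Definition discrepancy_bound (P : nat -> Prop) (d eps A : R) : Prop :=
  0 < eps <= 1 /\ 0 <= A /\ forall n, Rabs (discrepancy P d n) <= eps * INR n + A.

Lemma discrepancy_step P d k : (0 < k)%nat -> discrepancy P d k - discrepancy P d (pred k) = indic P k - d.
Proof.
  intros Hk. destruct k as [|k]; [lia|]. unfold discrepancy. cbn [pred]. rewrite cnt_S, S_INR. ring.
Qed.

Lemma discrepancy_lipschitz P d m n : 0 <= d <= 1 -> (m <= n)%nat -> Rabs (discrepancy P d n - discrepancy P d m) <= INR n - INR m.
Proof.
  intros Hd H. unfold discrepancy. assert (H1 := cnt_mono P m n H). assert (H2 := cnt_diff_le P m n H).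
  assert (INR m <= INR n) by (apply le_INR; auto). apply Rabs_le. nra.
Qed.

Lemma discrepancy_le P d eps A n T : discrepancy_bound P d eps A -> INR n <= T ->
  Rabs (discrepancy P d n) <= eps * T + A.
Proof. intros [Heps [HA HE]] H. eapply Rle_trans; [apply HE|]. nra. Qed.

(** Summation by parts is unaffected by a constant [s], which is chosen to make a boundary term vanish. *)
Lemma discrepancy_sum_shift P d s u n ell : (0 < u)%nat ->
  rsum (seq u n) (fun k => (indic P k - d) * ell k) =
  rsum (seq u n) (fun k => ((discrepancy P d k - s) - (discrepancy P d (pred k) - s)) * ell k).
Proof.
  intros Hu. apply rsum_ext. intros k Hk. apply in_seq in Hk.
  rewrite <- discrepancy_step by lia. ring.
Qed.

(** Far below [m] the differences of [log_term m] are [O (1 / k)], against a discrepancy [eps * k + A]. *)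
Lemma discrepancy_low P d eps A m : discrepancy_bound P d eps A -> ~ P 0%nat -> (4 <= m)%nat ->
  Rabs (rsum (seq 1 (m / 2)) (fun n => (indic P n - d) * log_term m n))
  <= 11 * (eps * INR m) + 7 * A + 8 * A * ln (INR m + 1).
Proof.
  intros HB HP0 Hm. assert (Heps := proj1 HB). assert (HA := proj1 (proj2 HB)).
  set (E := discrepancy P d).
  assert (Hh := Nat.div_mod_eq m 2). assert (Hr := Nat.mod_upper_bound m 2 ltac:(lia)).
  set (h := (m / 2)%nat) in *. set (rr := (m mod 2)%nat) in *. clearbody h rr.
  assert (Hh1 : (2 <= h)%nat) by lia.
  assert (Hmr : 4 <= INR m) by (replace 4 with (INR 4) by (simpl; ring); apply le_INR; auto).
  assert (Hhr : 2 * INR h <= INR m <= 3 * INR h).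
  { replace (2 * INR h) with (INR (2 * h)) by (rewrite mult_INR; simpl; ring).
    replace (3 * INR h) with (INR (3 * h)) by (rewrite mult_INR; simpl; ring).
    split; apply le_INR; lia. }
  assert (Hh0 : 0 < INR h) by lra.
  rewrite (discrepancy_sum_shift P d 0) by lia.
  destruct h as [|h']; [lia|].
  eapply Rle_trans; [apply (abel_bound (fun k => E k - 0) (log_term m) 0 h' (7 * (eps * INR m + A)) (fun k => 4 * eps + 4 * A * / INR k))|].
  - replace (E 0%nat - 0) with 0.
    2:{ unfold E, discrepancy, cnt. simpl. unfold indic. destruct (excluded_middle_informative (P 0%nat)); [contradiction|ring]. }
    rewrite Rmult_0_l, Rabs_R0, Rplus_0_r, Rminus_0_r, Rabs_mult.
    replace (1 + h')%nat with (S h') by lia.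
    assert (Rabs (log_term m (S h')) <= 7).
    { apply log_term_mid; [lia|].
      assert (2 <= INR m / INR (S h') <= 3).
      { split; apply Rmult_le_reg_r with (INR (S h')); auto; unfold Rdiv; rewrite Rmult_assoc, Rinv_l by lra; lra. }
      rewrite Rabs_left1 by nra. nra. }
    assert (Rabs (E (S h')) <= eps * INR m + A) by (apply (discrepancy_le P d eps A); auto; lra).
    rewrite Rmult_comm. apply Rmult_le_compat; auto using Rabs_pos.
  - intros k Hk. apply in_seq in Hk. rewrite Rminus_0_r.
    assert (Hk1 : 1 <= INR k) by (apply INR_ge1; lia).
    assert (Hkh : INR (S k) <= INR (S h')) by (apply le_INR; lia). rewrite (S_INR k) in Hkh.
    assert (D := log_term_diff_left m k ltac:(lia) ltac:(lia)). rewrite S_INR in D.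
    assert (/ (INR m - (INR k + 1)) <= / INR k) by (apply Rinv_le_contravar; lra).
    assert (/ INR m <= / INR k) by (apply Rinv_le_contravar; lra).
    replace (4 * eps + 4 * A * / INR k) with ((eps * INR k + A) * (4 * / INR k)) by (field; lra).
    apply Rmult_le_compat; auto using Rabs_pos; [apply (discrepancy_le P d eps A); auto; lra|]. unfold Rdiv in D. lra.
  - rewrite rsum_plus, rsum_const, rsum_scal, length_seq.
    assert (Hu := harmonic_upper h').
    assert (INR h' <= INR m) by (rewrite S_INR in Hhr; lra).
    assert (ln (INR h' + 1) <= ln (INR m + 1)) by (apply ln_le; generalize (pos_INR h'); lra).
    assert (INR h' * (4 * eps) <= 4 * (eps * INR m)) by nra.
    assert (4 * A * rsum (seq 1 h') (fun k => / INR k) <= 4 * A * (2 * ln (INR m + 1))) by (apply Rmult_le_compat_l; lra).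
    lra.
Qed.

(** Near [m] the differences of [log_term m] are [O (1 / j)] at distance [j]. The discrepancy relative to its value next to
   [m] is at most [j], and at most [M]; the first bound is used for [j <= M / kappa], the second beyond, so that no
   factor [ln m] appears. *)
Lemma discrepancy_left P d eps A m kappa : 0 <= d <= 1 -> discrepancy_bound P d eps A -> (4 <= m)%nat -> 0 < kappa ->
  Rabs (rsum (seq (S (m / 2)) (m - 1 - m / 2)) (fun n => (indic P n - d) * log_term m n))
  <= 7 * (3 * eps * INR m + 2 * A) + 6 * ((3 * eps * INR m + 2 * A) / kappa) + 6 * (kappa * INR m).
Proof.
  intros Hd HB Hm Hk0. assert (Heps := proj1 HB). assert (HA := proj1 (proj2 HB)).
  set (E := discrepancy P d).
  assert (Hh := Nat.div_mod_eq m 2). assert (Hr := Nat.mod_upper_bound m 2 ltac:(lia)).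
  set (h := (m / 2)%nat) in *. set (rr := (m mod 2)%nat) in *. clearbody h rr.
  assert (Hmr : 4 <= INR m) by (replace 4 with (INR 4) by (simpl; ring); apply le_INR; auto).
  set (M := 3 * eps * INR m + 2 * A).
  assert (HM0 : 0 < M) by (unfold M; nra).
  rewrite (discrepancy_sum_shift P d (E (m - 1)%nat)) by lia.
  replace (m - 1 - h)%nat with (S (m - 2 - h)) by lia.
  assert (HEM : forall k, (k <= m)%nat -> Rabs (E k - E (m - 1)%nat) <= M).
  { intros k Hk. eapply Rle_trans; [apply Rabs_triang|]. rewrite Rabs_Ropp.
    assert (Rabs (E k) <= eps * INR m + A) by (apply (discrepancy_le P d eps A); auto; apply le_INR; auto).
    assert (Rabs (E (m - 1)%nat) <= eps * INR m + A) by (apply (discrepancy_le P d eps A); auto; apply le_INR; lia).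
    unfold M. nra. }
  eapply Rle_trans; [apply (abel_bound (fun k => E k - E (m - 1)%nat) (log_term m) h (m - 2 - h) (7 * M)
    (fun k => 6 * (if Rle_dec (INR (S h + (m - 2 - h) - k)) (M / kappa) then 1 else 0) + 6 * kappa))|].
  - replace (S h + (m - 2 - h))%nat with (m - 1)%nat by lia.
    replace (E (m - 1)%nat - E (m - 1)%nat) with 0 by ring. rewrite Rmult_0_l, Rabs_R0, Rplus_0_l, Rabs_mult.
    assert (Rabs (log_term m (S h)) <= 7).
    { apply log_term_mid; [lia|].
      assert (H4 : INR m < 2 * INR (S h) /\ 4 * INR (S h) <= 3 * INR m).
      { replace (2 * INR (S h)) with (INR (2 * S h)) by (rewrite mult_INR; simpl; ring).
        replace (4 * INR (S h)) with (INR (4 * S h)) by (rewrite mult_INR; replace (INR 4) with 4 by (simpl; ring); ring).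
        replace (3 * INR m) with (INR (3 * m)) by (rewrite mult_INR; replace (INR 3) with 3 by (simpl; ring); ring).
        split; [apply lt_INR; lia|apply le_INR; lia]. }
      assert (Hs0 : 0 < INR (S h)) by (apply lt_0_INR; lia).
      assert (4 / 3 <= INR m / INR (S h) <= 2).
      { assert (Hq : INR m = INR m / INR (S h) * INR (S h)) by (field; lra).
        split; apply Rmult_le_reg_r with (INR (S h)); auto; lra. }
      rewrite Rabs_left1 by nra. nra. }
    rewrite Rmult_comm. apply Rmult_le_compat; auto using Rabs_pos. apply HEM. lia.
  - intros k Hk. apply in_seq in Hk.
    replace (S h + (m - 2 - h) - k)%nat with (m - 1 - k)%nat by lia.
    set (j := (m - 1 - k)%nat).
    assert (Hj : INR j = INR m - (INR k + 1)).
    { unfold j. replace (m - 1 - k)%nat with (m - S k)%nat by lia. rewrite minus_INR, S_INR by lia. ring. }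
    assert (Hj1 : 1 <= INR j) by (apply INR_ge1; lia).
    assert (Hkm : INR m < 2 * INR k).
    { replace (2 * INR k) with (INR (2 * k)) by (rewrite mult_INR; simpl; ring). apply lt_INR; lia. }
    assert (D := log_term_diff_left m k ltac:(lia) ltac:(lia)). rewrite S_INR in D. rewrite <- Hj in D.
    assert (I1 : / INR m <= / INR j) by (apply Rinv_le_contravar; lra).
    assert (I2 : / INR k <= / (INR m / 2)) by (apply Rinv_le_contravar; lra).
    replace (/ (INR m / 2)) with (2 * / INR m) in I2 by (field; lra).
    assert (D' : Rabs (log_term m k - log_term m (S k)) <= 6 * / INR j) by (unfold Rdiv in D; lra).
    assert (E1 : Rabs (E k - E (m - 1)%nat) <= INR j).
    { rewrite Rabs_minus_sym. eapply Rle_trans; [apply discrepancy_lipschitz; auto; lia|].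
      rewrite minus_INR by lia. simpl. lra. }
    assert (E2 := HEM k ltac:(lia)).
    assert (Hji : 0 < / INR j) by (apply Rinv_0_lt_compat; lra).
    destruct (Rle_dec (INR j) (M / kappa)) as [Hle|Hgt].
    + apply Rle_trans with (INR j * (6 * / INR j)); [apply Rmult_le_compat; auto using Rabs_pos|].
      replace (INR j * (6 * / INR j)) with 6 by (field; lra). lra.
    + apply Rle_trans with (M * (6 * / INR j)); [apply Rmult_le_compat; auto using Rabs_pos|].
      assert (M * / INR j <= kappa); [|lra].
      apply Rmult_le_reg_r with (INR j); [lra|]. rewrite Rmult_assoc, Rinv_l, Rmult_1_r by lra.
      apply Rnot_le_lt in Hgt. apply (Rmult_lt_compat_r kappa) in Hgt; auto.
      unfold Rdiv in Hgt. rewrite Rmult_assoc, Rinv_l in Hgt; lra.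
  - rewrite rsum_plus, rsum_scal, rsum_const, length_seq.
    assert (C := count_near_left (S h) (m - 2 - h) (M / kappa) ltac:(apply Rlt_le, Rdiv_lt_0_compat; auto)).
    assert (INR (m - 2 - h) <= INR m) by (apply le_INR; lia). nra.
Qed.

(** The mirror image of [discrepancy_left]. *)
Lemma discrepancy_right P d eps A m kappa : 0 <= d <= 1 -> discrepancy_bound P d eps A -> (1 <= m)%nat -> 0 < kappa ->
  Rabs (rsum (seq (S m) m) (fun n => (indic P n - d) * log_term m n))
  <= 7 * (3 * eps * INR m + 2 * A) + 6 * ((3 * eps * INR m + 2 * A) / kappa) + 6 * (kappa * INR m).
Proof.
  intros Hd HB Hm Hk0. assert (Heps := proj1 HB). assert (HA := proj1 (proj2 HB)).
  set (E := discrepancy P d).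
  destruct m as [|m']; [lia|]. set (m := S m') in *.
  assert (Hmr : 1 <= INR m) by (now apply INR_ge1).
  set (M := 3 * eps * INR m + 2 * A).
  assert (HM0 : 0 < M) by (unfold M; nra).
  rewrite (discrepancy_sum_shift P d (E m)) by lia.
  assert (HEM : forall k, (k <= 2 * m)%nat -> Rabs (E k - E m) <= M).
  { intros k Hk. eapply Rle_trans; [apply Rabs_triang|]. rewrite Rabs_Ropp.
    assert (Rabs (E k) <= eps * (2 * INR m) + A).
    { apply (discrepancy_le P d eps A); auto. replace (2 * INR m) with (INR (2 * m)) by (rewrite mult_INR; simpl; ring). apply le_INR; auto. }
    assert (Rabs (E m) <= eps * INR m + A) by (apply (discrepancy_le P d eps A); auto; lra).
    unfold M. nra. }
  eapply Rle_trans; [apply (abel_bound (fun k => E k - E m) (log_term m) m m' (7 * M)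
    (fun k => 6 * (if Rle_dec (INR (k - m)) (M / kappa) then 1 else 0) + 6 * kappa))|].
  - replace (S m + m')%nat with (2 * m)%nat by (unfold m; lia).
    replace (E m - E m) with 0 by ring. rewrite Rmult_0_l, Rabs_R0, Rplus_0_r, Rabs_mult.
    assert (Rabs (log_term m (2 * m)) <= 7).
    { apply log_term_mid; [unfold m; lia|]. rewrite mult_INR.
      replace ((INR m / (INR 2 * INR m)) ^ 2) with (1 / 4) by (simpl (INR 2); field; lra).
      rewrite Rabs_pos_eq; lra. }
    rewrite Rmult_comm. apply Rmult_le_compat; auto using Rabs_pos.
  - intros k Hk. apply in_seq in Hk. set (j := (k - m)%nat).
    assert (Hj : INR j = INR k - INR m) by (unfold j; rewrite minus_INR by lia; ring).
    assert (Hj1 : 1 <= INR j) by (apply INR_ge1; unfold j; lia).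
    assert (Hkm : INR k <= 2 * INR m).
    { replace (2 * INR m) with (INR (2 * m)) by (rewrite mult_INR; simpl; ring). apply le_INR; unfold m in *; lia. }
    assert (D := log_term_diff_right m k ltac:(unfold m in *; lia)). rewrite <- Hj in D.
    assert (I1 : / INR m <= / INR j) by (apply Rinv_le_contravar; lra).
    assert (D' : Rabs (log_term m k - log_term m (S k)) <= 6 * / INR j).
    { assert (0 < / INR j) by (apply Rinv_0_lt_compat; lra). unfold Rdiv in D; lra. }
    assert (E1 : Rabs (E k - E m) <= INR j).
    { eapply Rle_trans; [apply discrepancy_lipschitz; auto; lia|]. lra. }
    assert (E2 := HEM k ltac:(unfold m in *; lia)).
    assert (Hji : 0 < / INR j) by (apply Rinv_0_lt_compat; lra).
    destruct (Rle_dec (INR j) (M / kappa)) as [Hle|Hgt].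
    + apply Rle_trans with (INR j * (6 * / INR j)); [apply Rmult_le_compat; auto using Rabs_pos|].
      replace (INR j * (6 * / INR j)) with 6 by (field; lra). lra.
    + apply Rle_trans with (M * (6 * / INR j)); [apply Rmult_le_compat; auto using Rabs_pos|].
      assert (M * / INR j <= kappa); [|lra].
      apply Rmult_le_reg_r with (INR j); [lra|]. rewrite Rmult_assoc, Rinv_l, Rmult_1_r by lra.
      apply Rnot_le_lt in Hgt. apply (Rmult_lt_compat_r kappa) in Hgt; auto.
      unfold Rdiv in Hgt. rewrite Rmult_assoc, Rinv_l in Hgt; lra.
  - rewrite rsum_plus, rsum_scal, rsum_const, length_seq.
    assert (C := count_near_right m m' (M / kappa) ltac:(apply Rlt_le, Rdiv_lt_0_compat; auto)).
    assert (INR m' <= INR m) by (apply le_INR; unfold m; lia). nra.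
Qed.

(** Beyond [2 * m] the differences of [log_term m] are [O (m ^ 2 / k ^ 3)], which is summable against [eps * k + A]. *)
Lemma discrepancy_high P d eps A m X : discrepancy_bound P d eps A -> (2 * m < X)%nat -> 2 * (1 + A) * (INR m * INR m + 1) <= INR X ->
  Rabs (rsum (seq (S (2 * m)) (X - 2 * m)) (fun n => (indic P n - d) * log_term m n))
  <= 1 + 6 * (eps * INR m) + 3 * A.
Proof.
  intros HB HX HXr. assert (Heps := proj1 HB). assert (HA := proj1 (proj2 HB)).
  set (E := discrepancy P d).
  assert (Hm0 : 0 <= INR m) by apply pos_INR.
  rewrite (discrepancy_sum_shift P d 0) by lia.
  replace (X - 2 * m)%nat with (S (X - 2 * m - 1)) by lia.
  assert (HE' : forall k, Rabs (E k) <= eps * INR k + A) by (intros; apply (discrepancy_le P d eps A); auto; lra).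
  assert (H2m : INR (2 * m) = 2 * INR m) by (rewrite mult_INR; simpl; ring).
  assert (H2m1 : INR (S (2 * m)) = 2 * INR m + 1) by (rewrite S_INR, H2m; ring).
  set (mm := INR m * INR m) in *. assert (Hmm : 0 <= mm) by (unfold mm; nra).
  eapply Rle_trans; [apply (abel_bound (fun k => E k - 0) (log_term m) (2 * m) (X - 2 * m - 1) (1 + (2 * eps * INR m + A))
    (fun k => 4 * mm * (eps + A / (2 * INR m + 1)) * / (INR k * INR k)))|].
  - replace (S (2 * m) + (X - 2 * m - 1))%nat with X by lia.
    rewrite !Rminus_0_r, !Rabs_mult.
    destruct (log_term_far m X ltac:(lia) ltac:(lia)) as [F1 _].
    destruct (log_term_far m (S (2 * m)) ltac:(lia) ltac:(lia)) as [F2 _].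
    fold mm in F1, F2.
    assert (HXp : 1 <= INR X) by (apply INR_ge1; lia).
    apply Rplus_le_compat.
    + apply Rle_trans with ((INR X * (1 + A)) * (2 * mm / (INR X * INR X))).
      * apply Rmult_le_compat; auto using Rabs_pos. eapply Rle_trans; [apply HE'|]. nra.
      * replace (INR X * (1 + A) * (2 * mm / (INR X * INR X))) with (2 * (1 + A) * mm / INR X) by (field; lra).
        apply Rle_div_l; [lra|]. nra.
    + assert (Rabs (log_term m (S (2 * m))) <= 1).
      { eapply Rle_trans; [exact F2|]. rewrite H2m1. apply Rle_div_l; [nra|]. unfold mm. nra. }
      specialize (HE' (2 * m)%nat). rewrite H2m in HE'.
      generalize (Rabs_pos (E (2 * m)%nat)) (Rabs_pos (log_term m (S (2 * m)))). nra.
  - intros k Hk. apply in_seq in Hk. rewrite Rminus_0_r.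
    destruct (log_term_far m k ltac:(lia) ltac:(lia)) as [_ F]. fold mm in F.
    assert (Hk1 : 2 * INR m + 1 <= INR k) by (rewrite <- H2m1; apply le_INR; lia).
    apply Rle_trans with ((eps * INR k + A) * (4 * mm / (INR k * INR k * INR k))).
    + apply Rmult_le_compat; auto using Rabs_pos.
    + replace ((eps * INR k + A) * (4 * mm / (INR k * INR k * INR k)))
        with (4 * mm * (eps + A * / INR k) * / (INR k * INR k)) by (field; lra).
      apply Rmult_le_compat_r; [apply Rlt_le, Rinv_0_lt_compat; nra|].
      apply Rmult_le_compat_l; [lra|]. apply Rplus_le_compat_l. unfold Rdiv. apply Rmult_le_compat_l; auto.
      apply Rinv_le_contravar; lra.
  - rewrite rsum_scal.
    assert (Q := inverse_squares_le (S (2 * m)) (X - 2 * m - 1) ltac:(lia)). rewrite H2m1 in Q.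
    assert (HAm : 0 <= A / (2 * INR m + 1)).
    { apply Rmult_le_pos; auto. apply Rlt_le, Rinv_0_lt_compat; lra. }
    assert (4 * mm * (eps + A / (2 * INR m + 1)) * rsum (seq (S (2 * m)) (X - 2 * m - 1)) (fun k => / (INR k * INR k))
      <= 4 * mm * (eps + A / (2 * INR m + 1)) * (2 / (2 * INR m + 1))).
    { apply Rmult_le_compat_l; auto. apply Rmult_le_pos; lra. }
    assert (4 * mm * (eps + A / (2 * INR m + 1)) * (2 / (2 * INR m + 1)) <= 4 * (eps * INR m) + 2 * A).
    { replace (4 * mm * (eps + A / (2 * INR m + 1)) * (2 / (2 * INR m + 1)))
        with (4 * eps * (2 * mm / (2 * INR m + 1)) + 2 * A * (4 * mm / ((2 * INR m + 1) * (2 * INR m + 1)))) by (field; lra).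
      assert (2 * mm / (2 * INR m + 1) <= INR m).
      { apply Rle_div_l; [lra|]. unfold mm; nra. }
      assert (4 * mm / ((2 * INR m + 1) * (2 * INR m + 1)) <= 1).
      { apply Rle_div_l; [nra|]. unfold mm; nra. }
      assert (4 * eps * (2 * mm / (2 * INR m + 1)) <= 4 * eps * INR m) by (apply Rmult_le_compat_l; lra).
      assert (2 * A * (4 * mm / ((2 * INR m + 1) * (2 * INR m + 1))) <= 2 * A * 1) by (apply Rmult_le_compat_l; lra). lra. }
    lra.
Qed.

Lemma log_term_self m : log_term m m = 0.
Proof. unfold log_term. destruct (Nat.eq_dec m m); [auto|congruence]. Qed.

Lemma indic_minus_le P d k : 0 <= d <= 1 -> Rabs (indic P k - d) <= 1.
Proof. intros Hd. generalize (indic_bounds P k); intros. apply Rabs_le. lra. Qed.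

(** Summation by parts on four ranges of [n]: below [m / 2], on either side of [m], and beyond [2 * m]. *)
Lemma discrepancy_total P d : 0 <= d <= 1 -> balanced P d -> forall e, 0 < e ->
  exists A, 0 <= A /\ forall m X, A * (INR m * INR m + 1) <= INR X ->
    Rabs (rsum (seq 1 X) (fun n => (indic P n - d) * log_term m n)) <= e * INR m + A.
Proof.
  intros Hd [HP0 HB] e He.
  set (kappa := Rmin 1 (e / 1000)).
  assert (Hk : 0 < kappa) by (apply Rmin_pos; lra).
  assert (Hk1 : kappa <= 1) by apply Rmin_l. assert (Hke : kappa <= e / 1000) by apply Rmin_r.
  (* The discrepancy [eps * m] is divided by [kappa] near [m]; with [eps = kappa ^ 2] both costs are [kappa * m]. *)
  set (eps := kappa * kappa).
  assert (Heps : 0 < eps <= kappa) by (unfold eps; nra).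
  destruct (HB eps ltac:(lra)) as [A [HA HE]].
  assert (HBd : discrepancy_bound P d eps A) by (split; [lra|split; auto]).
  set (delta := e / (100 * (A + 1))).
  assert (Hdel : 0 < delta) by (apply Rdiv_lt_0_compat; lra).
  set (K0 := rsum (seq 0 4) (fun m => rsum (seq 1 (2 * m)) (fun n => Rabs (log_term m n)))).
  assert (HK0 : 0 <= K0) by (apply rsum_ge0; intros; apply rsum_ge0; intros; apply Rabs_pos).
  set (LD := Rabs (ln (/ delta))). assert (HLD : 0 <= LD) by apply Rabs_pos.
  set (A1 := 8 * A * (delta + LD) + 40 * A + 24 * (A / kappa) + K0 + 4 + 2 * (1 + A)).
  assert (HAk : 0 <= A / kappa) by (apply Rmult_le_pos; [auto|apply Rlt_le, Rinv_0_lt_compat; auto]).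
  assert (H8 : 0 <= 8 * A * (delta + LD)) by (apply Rmult_le_pos; lra).
  exists A1. split; [unfold A1; lra|].
  intros m X HX.
  assert (Hm0 : 0 <= INR m) by apply pos_INR.
  assert (HX2 : 2 * (1 + A) * (INR m * INR m + 1) <= INR X).
  { eapply Rle_trans; [|exact HX]. apply Rmult_le_compat_r; [nra|]. unfold A1. lra. }
  assert (HXm : (2 * m < X)%nat).
  { apply INR_lt. rewrite mult_INR. simpl (INR 2).
    assert (4 * (INR m * INR m + 1) <= INR X).
    { eapply Rle_trans; [|exact HX]. apply Rmult_le_compat_r; [nra|]. unfold A1. lra. }
    nra. }
  assert (High := discrepancy_high P d eps A m X HBd HXm HX2).
  replace X with (2 * m + (X - 2 * m))%nat by lia.
  rewrite seq_app, rsum_app. replace (1 + 2 * m)%nat with (S (2 * m)) by lia.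
  eapply Rle_trans; [apply Rabs_triang|].
  assert (Hem : eps * INR m <= e / 1000 * INR m) by (apply Rmult_le_compat_r; lra).
  assert (Hkm : kappa * INR m <= e / 1000 * INR m) by (apply Rmult_le_compat_r; lra).
  assert (0 <= e * INR m) by (apply Rmult_le_pos; lra).
  destruct (le_lt_dec 4 m) as [Hm4|Hm4].
  - assert (Low := discrepancy_low P d eps A m HBd HP0 Hm4).
    assert (Left := discrepancy_left P d eps A m kappa Hd HBd Hm4 Hk).
    assert (Right := discrepancy_right P d eps A m kappa Hd HBd ltac:(lia) Hk).
    set (f := fun n => (indic P n - d) * log_term m n) in *.
    assert (Hh : (m / 2 < m)%nat) by (apply Nat.div_lt; lia).
    assert (Split : rsum (seq 1 (2 * m)) f = rsum (seq 1 (m / 2)) f + rsum (seq (S (m / 2)) (m - 1 - m / 2)) f + rsum (seq (S m) m) f).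
    { replace (2 * m)%nat with (m / 2 + ((m - 1 - m / 2) + (1 + m)))%nat by lia.
      rewrite !seq_app, !rsum_app. replace (1 + m / 2)%nat with (S (m / 2)) by lia.
      replace (S (m / 2) + (m - 1 - m / 2))%nat with m by lia. replace (m + 1)%nat with (S m) by lia.
      simpl (rsum (seq m 1) f). unfold f at 3. rewrite log_term_self. ring. }
    rewrite Split.
    assert (Hln : ln (INR m + 1) <= delta * (INR m + 1) + LD).
    { eapply Rle_trans; [apply (ln_small_slope _ delta); lra|]. apply Rplus_le_compat_l. apply Rle_abs. }
    assert (Hln2 : 8 * A * ln (INR m + 1) <= 8 * A * (delta * (INR m + 1) + LD)) by (apply Rmult_le_compat_l; lra).
    assert (HAd : A * delta * INR m <= e / 100 * INR m).
    { apply Rmult_le_compat_r; auto. unfold delta. apply Rmult_le_reg_r with (100 * (A + 1)); [lra|].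
      replace (A * (e / (100 * (A + 1))) * (100 * (A + 1))) with (A * e) by (field; lra).
      replace (e / 100 * (100 * (A + 1))) with (e * (A + 1)) by field. nra. }
    assert (HMk : (3 * eps * INR m + 2 * A) / kappa = 3 * (kappa * INR m) + 2 * (A / kappa)) by (unfold eps; field; lra).
    rewrite HMk in *.
    generalize (Rabs_triang (rsum (seq 1 (m / 2)) f + rsum (seq (S (m / 2)) (m - 1 - m / 2)) f) (rsum (seq (S m) m) f))
     (Rabs_triang (rsum (seq 1 (m / 2)) f) (rsum (seq (S (m / 2)) (m - 1 - m / 2)) f)).
    unfold A1. lra.
  - assert (Rabs (rsum (seq 1 (2 * m)) (fun n => (indic P n - d) * log_term m n)) <= K0).
    { eapply Rle_trans; [apply rsum_abs|].
      apply Rle_trans with (rsum (seq 1 (2 * m)) (fun n => Rabs (log_term m n))).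
      - apply rsum_le. intros n _. rewrite Rabs_mult. rewrite <- (Rmult_1_l (Rabs (log_term m n))) at 2.
        apply Rmult_le_compat_r; [apply Rabs_pos|]. now apply indic_minus_le.
      - unfold K0. apply Rle_trans with (rsum (m :: nil) (fun m => rsum (seq 1 (2 * m)) (fun n => Rabs (log_term m n)))).
        + simpl. lra.
        + apply rsum_incl; [repeat constructor; auto| |].
          * intros x [<-|[]]. apply in_seq. lia.
          * intros; apply rsum_ge0; intros; apply Rabs_pos. }
    unfold A1. lra.
Qed.

(** * All integers: the product of [|1 - (m / n) ^ 2|] over [n <> m] is [1 / 2] *)

Definition log_fact (n : nat) : R := rsum (seq 1 n) (fun k => ln (INR k)).

Lemma log_fact_S n : log_fact (S n) = log_fact n + ln (INR (S n)).
Proof. unfold log_fact. now rewrite rsum_seq_S. Qed.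

Lemma log_fact_0 : log_fact 0 = 0.
Proof. reflexivity. Qed.

Lemma log_term_sum_below m j : (j < m)%nat ->
  rsum (seq 1 j) (log_term m) =
  log_fact (m - 1) - log_fact (m - 1 - j) + log_fact (m + j) - log_fact m - 2 * log_fact j.
Proof.
  induction j as [|j IH]; intros Hj.
  - rewrite Nat.sub_0_r, Nat.add_0_r, log_fact_0. change (rsum (seq 1 0) (log_term m)) with 0. ring.
  - rewrite rsum_seq_S, IH by lia. rewrite log_term_left by lia. replace (1 + j)%nat with (S j) by lia.
    replace (m - 1 - j)%nat with (S (m - 1 - S j)) by lia. rewrite (log_fact_S (m - 1 - S j)).
    rewrite Nat.add_succ_r, (log_fact_S (m + j)), (log_fact_S j).
    replace (S (m - 1 - S j)) with (m - S j)%nat by lia. rewrite minus_INR by lia.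
    replace (S (m + j)) with (m + S j)%nat by lia. rewrite plus_INR. ring.
Qed.

(** The factors [n - m], [n + m] and [n] telescope into factorials. *)
Lemma log_term_sum_all m X : (0 < m <= X)%nat ->
  rsum (seq 1 X) (log_term m) = - ln 2 + log_fact (X - m) + log_fact (X + m) - 2 * log_fact X.
Proof.
  intros [Hm HX]. induction HX as [|X HX IH].
  - destruct m as [|m']; [lia|]. rewrite rsum_seq_S.
    replace (1 + m')%nat with (S m') by lia. rewrite log_term_self.
    rewrite log_term_sum_below by lia.
    replace (S m' - 1)%nat with m' by lia. replace (m' - m')%nat with 0%nat by lia.
    replace (S m' - S m')%nat with 0%nat by lia.
    replace (S m' + S m')%nat with (S (S m' + m')) by lia. rewrite (log_fact_S (S m' + m')), (log_fact_S m').
    replace (S (S m' + m')) with (2 * S m')%nat by lia. rewrite mult_INR, ln_mult by (try apply lt_0_INR; simpl; lia || lra).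
    rewrite log_fact_0. simpl (INR 2). replace (1 + 1) with 2 by ring. ring.
  - rewrite rsum_seq_S, IH. replace (1 + X)%nat with (S X) by lia. rewrite log_term_right by lia.
    replace (S X - m)%nat with (S (X - m)) by lia. replace (S X + m)%nat with (S (X + m)) by lia.
    rewrite !log_fact_S.
    replace (S (X - m)) with (S X - m)%nat by lia. rewrite minus_INR by lia.
    replace (S (X + m)) with (S X + m)%nat by lia. rewrite plus_INR. ring.
Qed.

(** The ratio [(X - m)! * (X + m)! / X! ^ 2] tends to [1] as [X] grows. *)
Lemma log_fact_second_difference m X : (m <= X)%nat ->
  0 <= log_fact (X - m) + log_fact (X + m) - 2 * log_fact X <= INR m * (INR m / (INR X - INR m + 1)).
Proof.
  intros HX. assert (HmX : INR m <= INR X) by (apply le_INR; auto).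
  assert (G : forall i, (i <= m)%nat -> 0 <= (log_fact (X + i) - log_fact X) - (log_fact (X - m + i) - log_fact (X - m)) <= INR i * (INR m / (INR X - INR m + 1))).
  { induction i as [|i IH]; intros Hi.
    - rewrite !Nat.add_0_r. simpl. lra.
    - specialize (IH ltac:(lia)). rewrite !Nat.add_succ_r, !log_fact_S.
      assert (E1 : INR (S (X - m + i)) = INR X - INR m + 1 + INR i).
      { rewrite S_INR, plus_INR, minus_INR by auto. ring. }
      assert (E2 : INR (S (X + i)) = INR X + 1 + INR i) by (rewrite S_INR, plus_INR; ring).
      assert (Hi0 : 0 <= INR i) by apply pos_INR. assert (Hm0 : 0 <= INR m) by apply pos_INR.
      generalize (ln_ratio_le (INR (S (X - m + i))) (INR (S (X + i))) ltac:(lra)). intros [L1 L2].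
      rewrite (S_INR i).
      assert ((INR (S (X + i)) - INR (S (X - m + i))) / INR (S (X - m + i)) <= INR m / (INR X - INR m + 1)).
      { rewrite E1, E2. replace (INR X + 1 + INR i - (INR X - INR m + 1 + INR i)) with (INR m) by ring.
        unfold Rdiv. apply Rmult_le_compat_l; auto. apply Rinv_le_contravar; lra. }
      lra. }
  specialize (G m (le_n _)). replace (X - m + m)%nat with X in G by lia. lra.
Qed.

Lemma ln2_bounds : 0 <= ln 2 <= 1.
Proof.
  split; [rewrite <- ln_1; apply ln_le; lra|]. eapply Rle_trans; [apply ln_le_sub; lra|lra].
Qed.

Lemma log_term_0 n : (0 < n)%nat -> log_term 0 n = 0.
Proof.
  intros Hn. unfold log_term. destruct (Nat.eq_dec n 0); [lia|].
  simpl (INR 0). unfold Rdiv. rewrite Rmult_0_l. replace (1 - 0 ^ 2) with 1 by ring. now rewrite Rabs_R1, ln_1.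
Qed.

Lemma log_term_sum_bound m X : 2 * (INR m * INR m + 1) <= INR X ->
  Rabs (rsum (seq 1 X) (log_term m)) <= 2.
Proof.
  intros HX. destruct m as [|m'].
  - rewrite (rsum_ext _ _ (fun _ => 0)).
    + rewrite rsum_const, Rmult_0_r, Rabs_R0. lra.
    + intros n Hn. apply in_seq in Hn. apply log_term_0. lia.
  - set (m := S m') in *.
    assert (Hm : 1 <= INR m) by (apply INR_ge1; unfold m; lia).
    assert (HmX : (m <= X)%nat) by (apply INR_le; nra).
    rewrite log_term_sum_all by (unfold m in *; lia).
    assert (H := log_fact_second_difference m X HmX). assert (L := ln2_bounds).
    assert (INR m * (INR m / (INR X - INR m + 1)) <= 1).
    { replace (INR m * (INR m / (INR X - INR m + 1))) with (INR m * INR m / (INR X - INR m + 1)) by (field; nra).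
      apply Rle_div_l; [nra|nra]. }
    apply Rabs_le. lra.
Qed.

(** Compare with [d] times the sum over all integers, which stays bounded; so the product of [|1 - (m / n) ^ 2|] over
   [n] in [P], [n <> m], is [exp (o (m))]. *)
Lemma selected_log_sum P d : 0 <= d <= 1 -> balanced P d -> forall e, 0 < e ->
  exists A, 0 <= A /\ forall m X, A * (INR m * INR m + 1) <= INR X ->
    Rabs (rsum (seq 1 X) (fun n => indic P n * log_term m n)) <= e * INR m + A.
Proof.
  intros Hd HB e He. destruct (discrepancy_total P d Hd HB e He) as [A [HA H]].
  exists (A + 2). split; [lra|]. intros m X HX.
  assert (Hmm : 0 <= INR m * INR m) by (generalize (pos_INR m); nra).
  specialize (H m X ltac:(nra)). assert (H2 := log_term_sum_bound m X ltac:(nra)).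
  rewrite (rsum_ext _ _ (fun n => (indic P n - d) * log_term m n + d * log_term m n)) by (intros; ring).
  rewrite rsum_plus, rsum_scal. eapply Rle_trans; [apply Rabs_triang|].
  rewrite Rabs_mult, (Rabs_pos_eq d) by lra. generalize (Rabs_pos (rsum (seq 1 X) (log_term m))). nra.
Qed.

(** * From the nearest integer to a real point *)

Lemma harmonic_left a n : rsum (seq a n) (fun k => / INR (a + n - k)) = rsum (seq 1 n) (fun k => / INR k).
Proof.
  revert a. induction n as [|n IH]; intros a; [reflexivity|].
  rewrite (rsum_seq_S 1 n). cbn [seq rsum]. replace (a + S n - a)%nat with (S n) by lia.
  rewrite <- (IH (S a)). rewrite Rplus_comm. f_equal.
  apply rsum_ext. intros k _. do 2 f_equal. lia.
Qed.

Lemma harmonic_right a n : rsum (seq (S a) n) (fun k => / INR (k - a)) = rsum (seq 1 n) (fun k => / INR k).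
Proof.
  induction n as [|n IH]; [reflexivity|]. rewrite !rsum_seq_S, IH. do 3 f_equal. lia.
Qed.

(** The change of [log_term m n] when the integer [m] is replaced by a nearby real [x]. *)
Definition shift_term (m : nat) (x : R) (n : nat) : R :=
  if Nat.eq_dec n m then 0 else ln (Rabs ((INR n ^ 2 - x ^ 2) / (INR n ^ 2 - INR m ^ 2))).

(** An upper bound of [|x ^ 2 - m ^ 2| / |n ^ 2 - m ^ 2|] when [|x - m| <= 1 / 2]. *)
Definition shift_ratio (m n : nat) : R :=
  if Nat.eq_dec n m then 0 else (INR m + 1 / 4) / (Rabs (INR n - INR m) * (INR n + INR m)).

Lemma shift_term_lower m x n : (0 < n)%nat -> Rabs (x - INR m) <= 1 / 2 -> 0 <= x ->
  - (4 * shift_ratio m n) <= shift_term m x n.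
Proof.
  intros Hn Hx Hx0. unfold shift_term, shift_ratio. destruct (Nat.eq_dec n m) as [|Hnm]; [lra|].
  assert (Hn1 : 1 <= INR n) by (apply INR_ge1; lia).
  assert (Hm0 : 0 <= INR m) by apply pos_INR.
  assert (Hdist : 1 <= Rabs (INR n - INR m)).
  { destruct (lt_eq_lt_dec n m) as [[H|H]|H]; [|lia|].
    - assert (INR (S n) <= INR m) by (apply le_INR; lia). rewrite S_INR in H0. rewrite Rabs_left; lra.
    - assert (INR (S m) <= INR n) by (apply le_INR; lia). rewrite S_INR in H0. rewrite Rabs_pos_eq; lra. }
  set (D := Rabs (INR n - INR m) * (INR n + INR m)).
  assert (HD : INR m + 1 / 4 <= 3 / 4 * D).
  { unfold D. destruct (lt_eq_lt_dec n m) as [[H|H]|H]; [|lia|].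
    - assert (INR (S n) <= INR m) by (apply le_INR; lia). rewrite S_INR in H0. rewrite Rabs_left by lra.
      assert (2 * INR m - 1 <= - (INR n - INR m) * (INR n + INR m)) by nra. lra.
    - assert (INR (S m) <= INR n) by (apply le_INR; lia). rewrite S_INR in H0. rewrite Rabs_pos_eq in * by lra. nra. }
  assert (HD0 : 0 < D) by lra.
  set (q := (INR m + 1 / 4) / D).
  assert (Hq : 0 < q <= 3 / 4).
  { unfold q. split; [apply Rdiv_lt_0_compat; lra|]. apply Rle_div_l; [auto|lra]. }
  assert (HDn : Rabs (INR n ^ 2 - INR m ^ 2) = D).
  { unfold D. rewrite <- (Rabs_pos_eq (INR n + INR m)) at 1 by lra. rewrite <- Rabs_mult. f_equal. ring. }
  assert (Hnz : INR n ^ 2 - INR m ^ 2 <> 0) by (intros E; rewrite E, Rabs_R0 in HDn; lra).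
  assert (Hxm : Rabs (x ^ 2 - INR m ^ 2) <= INR m + 1 / 4).
  { apply Rabs_def2b in Hx || apply Rabs_le_inv in Hx || idtac.
    assert (Hb : - (1/2) <= x - INR m <= 1/2) by (generalize (Rle_abs (x - INR m)) (Rle_abs (- (x - INR m))); rewrite ?Rabs_Ropp; lra).
    apply Rabs_le. nra. }
  assert (Hr : 1 - q <= Rabs ((INR n ^ 2 - x ^ 2) / (INR n ^ 2 - INR m ^ 2))).
  { unfold Rdiv at 1. rewrite Rabs_mult, Rabs_inv, HDn.
    assert (D - (INR m + 1 / 4) <= Rabs (INR n ^ 2 - x ^ 2)).
    { generalize (Rabs_triang (INR n ^ 2 - x ^ 2) (x ^ 2 - INR m ^ 2)).
      replace (INR n ^ 2 - x ^ 2 + (x ^ 2 - INR m ^ 2)) with (INR n ^ 2 - INR m ^ 2) by ring. lra. }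
    replace (1 - q) with ((D - (INR m + 1 / 4)) * / D) by (unfold q; field; lra).
    apply Rmult_le_compat_r; auto. apply Rlt_le, Rinv_0_lt_compat; auto. }
  apply Rle_trans with (ln (1 - q)); [|apply ln_le; lra].
  assert (ln (/ (1 - q)) <= 4 * q).
  { eapply Rle_trans; [apply ln_le_sub, Rinv_0_lt_compat; lra|].
    apply Rmult_le_reg_r with (1 - q); [lra|]. rewrite Rmult_minus_distr_r, Rinv_l by lra. nra. }
  rewrite ln_Rinv in H by lra. lra.
Qed.

(** Two harmonic sums around [m] and the tail of a series of inverse squares. *)
Lemma shift_ratio_sum m X : rsum (seq 1 X) (shift_ratio m) <= 5 * ln (INR m + 2) + 2.
Proof.
  assert (Hm0 : 0 <= INR m) by apply pos_INR.
  assert (Hpos : forall n, 0 <= shift_ratio m n).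
  { intros n. unfold shift_ratio. destruct (Nat.eq_dec n m); [lra|].
    assert (0 < Rabs (INR n - INR m)) by (apply Rabs_pos_lt; intros E; apply n0, INR_eq; lra).
    assert (0 < INR n + INR m).
    { assert (0 <= INR n) by apply pos_INR.
      destruct (Req_dec (INR n + INR m) 0); [|lra]. exfalso. apply n0, INR_eq. lra. }
    apply Rlt_le, Rdiv_lt_0_compat; nra. }
  set (Y := (2 * m + 1 + X)%nat).
  apply Rle_trans with (rsum (seq 1 Y) (shift_ratio m)).
  { apply rsum_incl; [apply seq_NoDup| |auto]. intros n Hn. apply in_seq in Hn. apply in_seq. unfold Y. lia. }
  assert (Hln : 0 <= ln (INR m + 2)) by (rewrite <- ln_1; apply ln_le; lra).
  assert (Low : rsum (seq 1 (m - 1)) (shift_ratio m) <= 5 / 2 * ln (INR m + 2)).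
  { apply Rle_trans with (rsum (seq 1 (m - 1)) (fun n => 5 / 4 * / INR (1 + (m - 1) - n))).
    - apply rsum_le. intros n Hn. apply in_seq in Hn.
      unfold shift_ratio. destruct (Nat.eq_dec n m); [lia|].
      replace (1 + (m - 1) - n)%nat with (m - n)%nat by lia. rewrite minus_INR by lia.
      assert (INR n < INR m) by (apply lt_INR; lia).
      assert (1 <= INR n) by (apply INR_ge1; lia).
      rewrite Rabs_left by lra.
      apply Rmult_le_reg_r with ((INR m - INR n) * (INR n + INR m)); [nra|].
      replace ((INR m + 1 / 4) / (- (INR n - INR m) * (INR n + INR m)) * ((INR m - INR n) * (INR n + INR m))) with (INR m + 1 / 4) by (field; nra).
      replace (5 / 4 * / (INR m - INR n) * ((INR m - INR n) * (INR n + INR m))) with (5 / 4 * (INR n + INR m)) by (field; lra). lra.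
    - rewrite rsum_scal, harmonic_left. assert (H := harmonic_upper (m - 1)).
      assert (ln (INR (m - 1) + 1) <= ln (INR m + 2)).
      { apply ln_le; [generalize (pos_INR (m - 1)); lra|]. assert (INR (m - 1) <= INR m) by (apply le_INR; lia). lra. }
      lra. }
  assert (Mid : rsum (seq (S m) (m + 1)) (shift_ratio m) <= 2 * ln (INR m + 2)).
  { apply Rle_trans with (rsum (seq (S m) (m + 1)) (fun n => / INR (n - m))).
    - apply rsum_le. intros n Hn. apply in_seq in Hn.
      unfold shift_ratio. destruct (Nat.eq_dec n m); [lia|]. rewrite minus_INR by lia.
      assert (INR (S m) <= INR n) by (apply le_INR; lia). rewrite S_INR in H. rewrite Rabs_pos_eq by lra.
      apply Rmult_le_reg_r with ((INR n - INR m) * (INR n + INR m)); [nra|].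
      replace ((INR m + 1 / 4) / ((INR n - INR m) * (INR n + INR m)) * ((INR n - INR m) * (INR n + INR m))) with (INR m + 1 / 4) by (field; nra).
      replace (/ (INR n - INR m) * ((INR n - INR m) * (INR n + INR m))) with (INR n + INR m) by (field; lra). lra.
    - rewrite harmonic_right. assert (H := harmonic_upper (m + 1)). rewrite plus_INR in H. simpl (INR 1) in H.
      replace (INR m + 1 + 1) with (INR m + 2) in H by ring. lra. }
  assert (High : rsum (seq (2 * m + 2) X) (shift_ratio m) <= 2).
  { apply Rle_trans with (rsum (seq (2 * m + 2) X) (fun n => 2 * (INR m + 1 / 4) * / (INR n * INR n))).
    - apply rsum_le. intros n Hn. apply in_seq in Hn.
      unfold shift_ratio. destruct (Nat.eq_dec n m); [lia|].
      assert (2 * INR m + 2 <= INR n).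
      { replace (2 * INR m + 2) with (INR (2 * m + 2)) by (rewrite plus_INR, mult_INR; simpl; ring). apply le_INR; lia. }
      rewrite Rabs_pos_eq by lra. unfold Rdiv at 1. rewrite Rmult_comm, (Rmult_comm 2), Rmult_assoc, Rmult_comm.
      apply Rmult_le_compat_l; [lra|].
      apply Rmult_le_reg_r with ((INR n - INR m) * (INR n + INR m) * (INR n * INR n)); [apply Rmult_lt_0_compat; nra|].
      replace (/ ((INR n - INR m) * (INR n + INR m)) * ((INR n - INR m) * (INR n + INR m) * (INR n * INR n))) with (INR n * INR n) by (field; nra).
      replace (2 * / (INR n * INR n) * ((INR n - INR m) * (INR n + INR m) * (INR n * INR n))) with (2 * ((INR n - INR m) * (INR n + INR m))) by (field; lra).
      nra.
    - rewrite rsum_scal. assert (Q := inverse_squares_le (2 * m + 2) X ltac:(lia)).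
      assert (E : INR (2 * m + 2) = 2 * INR m + 2) by (rewrite plus_INR, mult_INR; simpl; ring). rewrite E in Q.
      apply Rle_trans with (2 * (INR m + 1 / 4) * (2 / (2 * INR m + 2))); [apply Rmult_le_compat_l; lra|].
      apply Rmult_le_reg_r with (2 * INR m + 2); [lra|].
      replace (2 * (INR m + 1 / 4) * (2 / (2 * INR m + 2)) * (2 * INR m + 2)) with (4 * (INR m + 1 / 4)) by (field; lra). lra. }
  assert (Split : rsum (seq 1 Y) (shift_ratio m) = rsum (seq 1 (m - 1)) (shift_ratio m) + rsum (seq (S m) (m + 1)) (shift_ratio m)
     + rsum (seq (2 * m + 2) X) (shift_ratio m)).
  { assert (Hself : shift_ratio m m = 0) by (unfold shift_ratio; destruct (Nat.eq_dec m m); congruence).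
    unfold Y. destruct m as [|m'].
    - replace (2 * 0 + 1 + X)%nat with (S X) by lia. cbn [seq rsum Nat.sub Nat.mul Nat.add]. ring.
    - set (m := S m') in *. replace (2 * m + 1 + X)%nat with ((m - 1) + (1 + ((m + 1) + X)))%nat by (unfold m; lia).
      remember (m + 1)%nat as q eqn:Hq. rewrite !seq_app, !rsum_app. replace (1 + (m - 1))%nat with m by (unfold m; lia).
      rewrite <- Hq. replace (q + q)%nat with (2 * m + 2)%nat by lia. replace (S m) with q by lia.
      simpl (rsum (seq m 1) _). rewrite Hself. ring. }
  rewrite Split. lra.
Qed.

(** * The gain off the real axis *)

(** [ln |t + i * y| - ln |t|]. *)
Definition height_gain (y t : R) : R := log_factor 0 y t.

Lemma height_gain_eq y t : 0 < t -> height_gain y t = / 2 * ln (1 + (y / t) ^ 2).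
Proof. intros Ht. unfold height_gain, log_factor. do 2 f_equal. field. lra. Qed.

Lemma height_gain_decr y s t : 0 < s <= t -> height_gain y t <= height_gain y s.
Proof. intros H. apply log_factor_decr; lra. Qed.

Lemma height_gain_nonneg y t : 0 < t -> 0 <= height_gain y t.
Proof. intros H. apply log_factor_nonneg; lra. Qed.

(** Counts [t] among the distances at most [j]; a real-valued indicator. *)
Definition below (t : R) (j : nat) : R := if Rle_dec t (INR j) then 1 else 0.

Lemma below_bounds t j : 0 <= below t j <= 1.
Proof. unfold below. destruct (Rle_dec t (INR j)); lra. Qed.

(** The decrements of [height_gain y] over the layers [j >= t] add up to at most its value at [t], since it decreases to [0]. *)
Lemma layer_cake y t J : 0 < t ->
  rsum (seq 1 J) (fun j => (height_gain y (INR j) - height_gain y (INR (S j))) * below t j) <= height_gain y t.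
Proof.
  intros Ht.
  assert (G : (t <= INR J -> rsum (seq 1 J) (fun j => (height_gain y (INR j) - height_gain y (INR (S j))) * below t j)
       <= height_gain y t - height_gain y (INR (S J))) /\
     (INR J < t -> rsum (seq 1 J) (fun j => (height_gain y (INR j) - height_gain y (INR (S j))) * below t j) = 0)).
  { induction J as [|J [IH1 IH2]].
    - simpl. split; [lra|auto].
    - rewrite rsum_seq_S. replace (1 + J)%nat with (S J) by lia.
      unfold below at 2 4. destruct (Rle_dec t (INR (S J))) as [H|H]; split; intros H'; try lra.
      + destruct (Rle_lt_dec t (INR J)) as [H2|H2].
        * specialize (IH1 H2). lra.
        * rewrite (IH2 H2). assert (height_gain y (INR (S J)) <= height_gain y t) by (apply height_gain_decr; lra). lra.
      + rewrite IH2; [ring|]. rewrite S_INR in H'. lra. }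
  destruct (Rle_lt_dec t (INR J)) as [H|H].
  - assert (0 <= height_gain y (INR (S J))) by (apply height_gain_nonneg, lt_0_INR; lia).
    generalize (proj1 G H). lra.
  - rewrite (proj2 G H). now apply height_gain_nonneg.
Qed.

(** [INR (j - j0)] is the truncated difference: the first [j0] layers are given up, where the count may fall short. *)
Lemma abel_tail (phi : nat -> R) j0 J :
  rsum (seq 1 J) (fun j => (phi j - phi (S j)) * INR (j - j0)) =
  rsum (seq 1 J) phi - rsum (seq 1 (Nat.min j0 J)) phi - INR (J - j0) * phi (S J).
Proof.
  induction J as [|J IH].
  - rewrite Nat.min_0_r. simpl. ring.
  - rewrite !rsum_seq_S, IH. replace (1 + J)%nat with (S J) by lia.
    destruct (le_lt_dec j0 J) as [H|H].
    + rewrite !Nat.min_l by lia. replace (S J - j0)%nat with (S (J - j0)) by lia. rewrite S_INR. ring.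
    + rewrite !Nat.min_r by lia. replace (S J - j0)%nat with 0%nat by lia. replace (J - j0)%nat with 0%nat by lia.
      rewrite rsum_seq_S. replace (1 + J)%nat with (S J) by lia. simpl (INR 0). ring.
Qed.

Lemma cnt_as_sum P m n : (m <= n)%nat -> rsum (seq (S m) (n - m)) (indic P) = cnt P n - cnt P m.
Proof.
  intros H. unfold cnt. replace (S n) with (S m + (n - m))%nat by lia. rewrite seq_app, rsum_app. simpl (0 + S m)%nat. ring.
Qed.

Lemma rsum_single_le m l : NoDup l -> rsum l (fun n => if Nat.eq_dec n m then 1 else 0) <= 1.
Proof.
  assert (G : forall l, NoDup l -> rsum l (fun n => if Nat.eq_dec n m then 1 else 0) <= 1 /\
     (~ In m l -> rsum l (fun n => if Nat.eq_dec n m then 1 else 0) = 0)).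
  { induction l0 as [|a l' IH]; intros Hn; [simpl; split; [lra|auto]|].
    inversion Hn as [|? ? Ha Hl]; subst. destruct (IH Hl) as [I1 I2]. cbn [rsum].
    destruct (Nat.eq_dec a m) as [->|Hne].
    - split; [rewrite I2; auto; lra|]. intros Hc. exfalso. apply Hc. simpl; auto.
    - split; [lra|]. intros Hc. rewrite I2; [ring|]. intros Hi. apply Hc. simpl; auto. }
  intros Hl. now apply G.
Qed.

(** Reflecting [P] makes the two-sided window about [x] work even when it contains [0]. The point [m] costs at most one in
   each of the two counts. *)
Lemma symmetric_count P d eps A m x j X : ~ P 0%nat -> 0 <= d <= 1 -> discrepancy_bound P d eps A ->
  0 <= x -> x + INR j <= INR X ->
  2 * (d - eps) * INR j - (2 * eps * x + 2 * A + 6) <=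
  rsum (seq 1 X) (fun n => (if Nat.eq_dec n m then 0 else indic P n) *
     (below (Rabs (INR n - x)) j + below (INR n + x) j)).
Proof.
  intros HP0 Hd [Heps [HA HE]] Hx HX.
  assert (Hj0 : 0 <= INR j) by apply pos_INR.
  assert (E0 : cnt P 0 = 0).
  { unfold cnt. simpl. unfold indic. destruct (excluded_middle_informative (P 0%nat)); [contradiction|ring]. }
  assert (HE2 : forall n T, INR n <= T -> 0 <= T -> d * INR n - eps * T - A <= cnt P n <= d * INR n + eps * T + A).
  { intros n T HT HT0. specialize (HE n). unfold discrepancy in HE.
    generalize (Rle_abs (cnt P n - d * INR n)) (Rle_abs (- (cnt P n - d * INR n))). rewrite Rabs_Ropp. nra. }
  assert (One : forall (f : nat -> R), (forall n, 0 <= f n <= 1) -> rsum (seq 1 X) (fun n => indic P n * f n) - 1 <=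
     rsum (seq 1 X) (fun n => (if Nat.eq_dec n m then 0 else indic P n) * f n)).
  { intros f Hf. assert (rsum (seq 1 X) (fun n => indic P n * f n) - rsum (seq 1 X) (fun n => (if Nat.eq_dec n m then 0 else indic P n) * f n) <= 1); [|lra].
    rewrite <- rsum_minus. apply Rle_trans with (rsum (seq 1 X) (fun n => if Nat.eq_dec n m then 1 else 0)).
    - apply rsum_le. intros n _. generalize (Hf n) (indic_bounds P n); intros. destruct (Nat.eq_dec n m); nra.
    - apply rsum_single_le, seq_NoDup. }
  rewrite (rsum_ext _ _ (fun n => (if Nat.eq_dec n m then 0 else indic P n) * below (Rabs (INR n - x)) j +
     (if Nat.eq_dec n m then 0 else indic P n) * below (INR n + x) j)) by (intros; ring).
  rewrite rsum_plus.
  assert (O1 := One (fun n => below (Rabs (INR n - x)) j) (fun n => below_bounds _ _)).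
  assert (O2 := One (fun n => below (INR n + x) j) (fun n => below_bounds _ _)).
  assert (Sub : forall u v f, (u <= v)%nat -> (v <= X)%nat -> (forall n, 0 <= f n) -> (forall n, (u < n <= v)%nat -> f n = 1) ->
     cnt P v - cnt P u <= rsum (seq 1 X) (fun n => indic P n * f n)).
  { intros u v f Huv HvX Hf0 Hf. rewrite <- cnt_as_sum by auto.
    apply Rle_trans with (rsum (seq (S u) (v - u)) (fun n => indic P n * f n)).
    - apply rsum_le. intros n Hn. apply in_seq in Hn. rewrite Hf by lia. lra.
    - apply rsum_incl; [apply seq_NoDup| |].
      + intros n Hn. apply in_seq in Hn. apply in_seq. lia.
      + intros n _. apply Rmult_le_pos; [apply indic_bounds|auto]. }
  destruct (nfloor_ex (x + INR j)) as [n1 Hn1]; [lra|].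
  assert (Hn1X : (n1 <= X)%nat) by (apply INR_le; lra).
  assert (C1 := HE2 n1 (x + INR j) ltac:(lra) ltac:(lra)).
  assert (B2pos : 0 <= rsum (seq 1 X) (fun n => (if Nat.eq_dec n m then 0 else indic P n) * below (INR n + x) j)).
  { apply rsum_ge0. intros n _. apply Rmult_le_pos; [destruct (Nat.eq_dec n m); [lra|apply indic_bounds]|apply below_bounds]. }
  destruct (Rle_lt_dec (INR j) x) as [Hjx|Hjx].
  - destruct (nfloor_ex (x - INR j)) as [n0 Hn0]; [lra|].
    assert (C0 := HE2 n0 x ltac:(lra) Hx).
    assert (Hn01 : (n0 <= n1)%nat).
    { assert (INR n0 < INR (S n1)) by (rewrite S_INR; lra). apply INR_lt in H. lia. }
    assert (S1 := Sub n0 n1 (fun n => below (Rabs (INR n - x)) j) Hn01 Hn1X (fun n => proj1 (below_bounds _ _))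
       ltac:(intros n Hn; unfold below; destruct (Rle_dec (Rabs (INR n - x)) (INR j)) as [|Hc]; [auto|exfalso; apply Hc;
         assert (INR (S n0) <= INR n) by (apply le_INR; lia); assert (INR n <= INR n1) by (apply le_INR; lia);
         rewrite S_INR in *; apply Rabs_le; lra])).
    nra.
  - destruct (nfloor_ex (INR j - x)) as [n2 Hn2]; [lra|].
    assert (C2 := HE2 n2 (INR j) ltac:(lra) Hj0).
    assert (Hn2X : (n2 <= X)%nat) by (apply INR_le; lra).
    assert (S1 := Sub 0%nat n1 (fun n => below (Rabs (INR n - x)) j) ltac:(lia) Hn1X (fun n => proj1 (below_bounds _ _))
       ltac:(intros n Hn; unfold below; destruct (Rle_dec (Rabs (INR n - x)) (INR j)) as [|Hc]; [auto|exfalso; apply Hc;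
         assert (INR n <= INR n1) by (apply le_INR; lia); assert (0 <= INR n) by apply pos_INR;
         apply Rabs_le; lra])).
    assert (S2 := Sub 0%nat n2 (fun n => below (INR n + x) j) ltac:(lia) Hn2X (fun n => proj1 (below_bounds _ _))
       ltac:(intros n Hn; unfold below; destruct (Rle_dec (INR n + x) (INR j)) as [|Hc]; [auto|exfalso; apply Hc;
         assert (INR n <= INR n2) by (apply le_INR; lia); lra])).
    rewrite E0 in *. nra.
Qed.

Lemma stirling_lower n : rsum (seq 1 n) (fun j => ln (INR n) - ln (INR j)) <= INR n.
Proof.
  induction n as [|n IH]; [simpl; lra|].
  rewrite rsum_seq_S. replace (1 + n)%nat with (S n) by lia. rewrite Rminus_diag.
  destruct n as [|n']; [simpl; lra|]. set (n := S n') in *.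
  assert (Hn : 1 <= INR n) by (apply INR_ge1; unfold n; lia).
  rewrite (rsum_ext _ _ (fun j => (ln (INR n) - ln (INR j)) + (ln (INR (S n)) - ln (INR n)))) by (intros; ring).
  rewrite rsum_plus, rsum_const, length_seq. rewrite (S_INR n) at 2.
  assert (H := ln_ratio_le (INR n) (INR (S n)) ltac:(rewrite S_INR; lra)).
  assert (INR n * (ln (INR (S n)) - ln (INR n)) <= 1).
  { apply Rle_trans with (INR n * ((INR (S n) - INR n) / INR n)); [apply Rmult_le_compat_l; lra|].
    rewrite S_INR. right. field. lra. }
  lra.
Qed.

Lemma height_gain_le_ln Y t : 0 <= Y -> 0 < t -> height_gain Y t <= ln (1 + Y / t).
Proof.
  intros HY Ht. rewrite height_gain_eq by auto.
  assert (Hq : 0 <= Y / t) by (apply Rmult_le_pos; [auto|apply Rlt_le, Rinv_0_lt_compat; auto]).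
  replace (ln (1 + Y / t)) with (/ 2 * ln ((1 + Y / t) * (1 + Y / t))).
  - apply Rmult_le_compat_l; [lra|]. apply ln_le; nra.
  - rewrite ln_mult by lra. field.
Qed.

(** The nearest [n] points cost little, even though each of them may gain about [ln Y]. *)
Lemma height_gain_head Y n kappa : 0 <= Y -> 0 < kappa ->
  rsum (seq 1 n) (fun j => height_gain Y (INR j)) <= kappa * Y + INR n * (kappa + ln (/ kappa) + 1).
Proof.
  intros HY Hk. destruct n as [|n']; [simpl; nra|]. set (n := S n').
  assert (Hn : 1 <= INR n) by (apply INR_ge1; unfold n; lia).
  apply Rle_trans with (rsum (seq 1 n) (fun j => ln (1 + Y / INR n) + (ln (INR n) - ln (INR j)))).
  - apply rsum_le. intros j Hj. apply in_seq in Hj.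
    assert (1 <= INR j) by (apply INR_ge1; lia).
    assert (INR j <= INR n) by (apply le_INR; unfold n in *; lia).
    eapply Rle_trans; [apply height_gain_le_ln; lra|].
    rewrite <- ln_div, <- ln_mult by (try lra; try (apply Rdiv_lt_0_compat; lra); assert (0 <= Y / INR n) by (apply Rmult_le_pos; [auto|apply Rlt_le, Rinv_0_lt_compat; lra]); lra).
    apply ln_le; [assert (0 <= Y / INR j) by (apply Rmult_le_pos; [auto|apply Rlt_le, Rinv_0_lt_compat; lra]); lra|].
    replace ((1 + Y / INR n) * (INR n / INR j)) with (INR n / INR j + Y / INR j) by (field; lra).
    apply Rplus_le_compat_r. apply Rmult_le_reg_r with (INR j); [lra|]. unfold Rdiv. rewrite Rmult_assoc, Rinv_l; lra.
  - rewrite rsum_plus, rsum_const, length_seq. assert (H := stirling_lower n).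
    assert (Hq : 0 <= Y / INR n) by (apply Rmult_le_pos; [auto|apply Rlt_le, Rinv_0_lt_compat; lra]).
    assert (L := ln_small_slope (1 + Y / INR n) kappa ltac:(lra) Hk).
    assert (INR n * ln (1 + Y / INR n) <= INR n * (kappa * (1 + Y / INR n) + ln (/ kappa))) by (apply Rmult_le_compat_l; lra).
    replace (INR n * (kappa * (1 + Y / INR n) + ln (/ kappa))) with (kappa * Y + INR n * (kappa + ln (/ kappa))) in H0 by (field; lra).
    lra.
Qed.

Lemma height_gain_abs y t : height_gain (Rabs y) t = height_gain y t.
Proof. unfold height_gain, log_factor. now rewrite pow2_abs. Qed.

(** The sum of [1/2 * ln (1 + (Y / j) ^ 2)] over [j] is close to the integral, [PI / 2 * Y]. *)
Lemma height_gain_total Y J : 0 < Y -> Y * Y <= INR J ->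
  PI / 2 * Y - ln (1 + Y) - 2 <= rsum (seq 1 J) (fun j => height_gain Y (INR j)).
Proof.
  intros HY HJ. assert (H := log_factor_lower 1 0 Y J Y ltac:(lra) ltac:(lra) HY ltac:(lra) ltac:(ring)).
  rewrite Rmult_0_l, Rmult_1_l in H. replace ((1 + Y) / 1) with (1 + Y) in H by field.
  rewrite (rsum_ext _ (fun k => log_factor 0 Y (INR k * 1)) (fun j => height_gain Y (INR j))) in H
    by (intros; rewrite Rmult_1_r; reflexivity).
  assert (HS : INR (S J) = INR J + 1) by apply S_INR.
  assert (Y ^ 2 / (INR (S J) * 1) <= 1).
  { apply Rmult_le_reg_r with (INR (S J)); [nra|]. unfold Rdiv. rewrite Rmult_1_r, Rmult_assoc, Rinv_l by nra. nra. }
  rewrite Rmult_1_l in H. lra.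
Qed.

Lemma height_gain_last Y J k : Y * Y <= INR J -> INR k <= INR J -> INR k * height_gain Y (INR (S J)) <= 1 / 2.
Proof.
  intros HJ Hk. assert (Hp : 0 < INR (S J)) by (apply lt_0_INR; lia).
  assert (Hk0 := pos_INR k). rewrite height_gain_eq by auto.
  assert (HY0 : 0 <= (Y / INR (S J)) ^ 2) by nra.
  assert (ln (1 + (Y / INR (S J)) ^ 2) <= (Y / INR (S J)) ^ 2) by (apply ln_1p_le; lra).
  assert (0 <= ln (1 + (Y / INR (S J)) ^ 2)) by (rewrite <- ln_1; apply ln_le; lra).
  assert (INR (S J) * (Y / INR (S J)) ^ 2 <= 1).
  { replace (INR (S J) * (Y / INR (S J)) ^ 2) with (Y * Y / INR (S J)) by (field; lra).
    apply Rmult_le_reg_r with (INR (S J)); auto. unfold Rdiv. rewrite Rmult_assoc, Rinv_l, S_INR by lra. nra. }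
  rewrite S_INR in *. nra.
Qed.

(** Off the real axis each point of [P] contributes [1/2 * ln (1 + (y / (n - x)) ^ 2)]. The count of points within distance
   [j] is about [2 * d * j], and the layers [height_gain y j] sum to [PI / 2 * |y|]; so the total is about [PI * d * |y|]. *)
Lemma gain_lower P d c e : balanced P d -> 0 < d <= 1 -> 0 <= c < PI * d -> 0 < e ->
  exists A, 0 <= A /\ forall R, exists X0, forall X m x y, X0 <= INR X -> 0 <= x <= R -> Rabs y <= R ->
    Rabs (x - INR m) <= 1 / 2 ->
    c * Rabs y - e * x - A <= rsum (seq 1 X) (fun n => (if Nat.eq_dec n m then 0 else indic P n) *
       (height_gain y (Rabs (INR n - x)) + height_gain y (INR n + x))).
Proof.
  intros [HP0 HB] Hd Hc He. assert (HPI := PI_RGT_0). assert (HPI4 := PI_4).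
  set (gap := PI * d - c). set (kappa := gap / 8).
  assert (Hgap : 0 < gap <= 4) by (unfold gap; nra).
  assert (Hk : 0 < kappa <= 1 / 2) by (unfold kappa; lra).
  assert (Hlk : 0 <= ln (/ kappa)).
  { rewrite <- ln_1. apply ln_le; [lra|]. rewrite <- Rinv_1. apply Rinv_le_contravar; lra. }
  set (K := kappa + ln (/ kappa) + 1). assert (HK : 1 <= K) by (unfold K; lra).
  (* [K] is the cost of a layer that is given up, and [2 * d' * j0] will be about [2 * eps * x]. *)
  set (eps := Rmin (Rmin (d / 2) (gap / (2 * PI))) (e / (2 * K))).
  assert (Heps : 0 < eps).
  { unfold eps. repeat apply Rmin_pos; [lra| |]; apply Rdiv_lt_0_compat; lra. }
  assert (He1 : eps <= d / 2) by (unfold eps; eapply Rle_trans; [apply Rmin_l|apply Rmin_l]).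
  assert (He2 : eps * PI <= gap / 2).
  { assert (eps <= gap / (2 * PI)) by (unfold eps; eapply Rle_trans; [apply Rmin_l|apply Rmin_r]).
    apply Rle_trans with (gap / (2 * PI) * PI); [apply Rmult_le_compat_r; lra|]. right. field. lra. }
  assert (He3 : 2 * eps * K <= e).
  { assert (eps <= e / (2 * K)) by (unfold eps; apply Rmin_r).
    apply Rle_trans with (2 * (e / (2 * K)) * K); [nra|]. right. field. lra. }
  clearbody eps. destruct (HB eps Heps) as [A0 [HA0 HE]].
  set (d' := d - eps). assert (Hd' : 0 < d' <= 1) by (unfold d'; lra).
  exists (2 * (3 + kappa + ln (/ kappa)) + K * (2 * A0 + 8)). split; [nra|].
  intros R. destruct (INR_unbounded (R * R)) as [J HJ]. exists (R + INR J).
  intros X m x y HX Hx Hy Hm.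
  assert (HDB : discrepancy_bound P d eps A0) by (split; [lra|split; auto]).
  assert (Ht : forall n, n <> m -> 0 < Rabs (INR n - x)).
  { intros n Hn. apply Rabs_pos_lt. intros E.
    assert (Hlt : Rabs (INR n - INR m) < 1) by (replace (INR n - INR m) with (x - INR m) by lra; lra).
    apply Rabs_def2 in Hlt. destruct Hlt as [H1 H2].
    assert (INR n < INR (S m)) by (rewrite S_INR; lra). assert (INR m < INR (S n)) by (rewrite S_INR; lra).
    apply INR_lt in H, H0. lia. }
  set (w := fun n => if Nat.eq_dec n m then 0 else indic P n).
  assert (Hw : forall n, 0 <= w n <= 1) by (intros n; unfold w; destruct (Nat.eq_dec n m); [lra|apply indic_bounds]).
  set (Y := Rabs y) in *. assert (HY0 : 0 <= Y) by apply Rabs_pos.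
  assert (HYY : Y * Y <= INR J) by nra.
  set (phi := fun j => height_gain Y (INR j)).
  assert (Hphi : forall j, (0 < j)%nat -> 0 <= phi j - phi (S j)).
  { intros j Hj. unfold phi. assert (height_gain Y (INR (S j)) <= height_gain Y (INR j)); [|lra].
    apply height_gain_decr. split; [apply lt_0_INR; auto|apply le_INR; lia]. }
  assert (G0 : 0 <= rsum (seq 1 X) (fun n => w n * (height_gain y (Rabs (INR n - x)) + height_gain y (INR n + x)))).
  { apply rsum_ge0. intros n Hn. apply in_seq in Hn. unfold w. destruct (Nat.eq_dec n m) as [|Hnm]; [lra|].
    apply Rmult_le_pos; [apply indic_bounds|]. apply Rplus_le_le_0_compat; apply height_gain_nonneg; auto.
    assert (1 <= INR n) by (apply INR_ge1; lia). lra. }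
  destruct (Req_dec Y 0) as [HYz|HYz].
  { rewrite HYz. assert (0 <= e * x) by nra. assert (0 <= K * (2 * A0 + 8)) by nra.
    eapply Rle_trans; [|exact G0]. lra. }
  assert (HY : 0 < Y) by lra.
  set (cc := fun j => rsum (seq 1 X) (fun n => w n * (below (Rabs (INR n - x)) j + below (INR n + x) j))).
  assert (G1 : rsum (seq 1 J) (fun j => (phi j - phi (S j)) * cc j) <=
     rsum (seq 1 X) (fun n => w n * (height_gain y (Rabs (INR n - x)) + height_gain y (INR n + x)))).
  { apply Rle_trans with (rsum (seq 1 X) (fun n => w n *
      (rsum (seq 1 J) (fun j => (phi j - phi (S j)) * below (Rabs (INR n - x)) j) + rsum (seq 1 J) (fun j => (phi j - phi (S j)) * below (INR n + x) j)))).
    - right. unfold cc.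
      rewrite (rsum_ext (seq 1 X) _ (fun n => rsum (seq 1 J) (fun j => (phi j - phi (S j)) * (w n * (below (Rabs (INR n - x)) j + below (INR n + x) j))))).
      2:{ intros n _. rewrite <- rsum_plus, <- rsum_scal. apply rsum_ext. intros; ring. }
      generalize (seq 1 J) as l. induction l as [|j l IH]; [cbn [rsum]; rewrite rsum_const; ring|].
      cbn [rsum]. rewrite IH, rsum_plus, rsum_scal. reflexivity.
    - apply rsum_le. intros n Hn. apply in_seq in Hn. destruct (Nat.eq_dec n m) as [E|Hnm].
      + unfold w. destruct (Nat.eq_dec n m); [lra|contradiction].
      + apply Rmult_le_compat_l; [apply Hw|].
        rewrite <- (height_gain_abs y (Rabs (INR n - x))), <- (height_gain_abs y (INR n + x)).
        apply Rplus_le_compat; apply layer_cake; auto.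
        assert (1 <= INR n) by (apply INR_ge1; lia). lra. }
  (* From the layer [j0] on, the lower bound of [symmetric_count] is nonnegative. *)
  set (B0 := 2 * eps * x + 2 * A0 + 6). assert (HB0 : 0 <= B0) by (unfold B0; nra).
  destruct (nfloor_ex (B0 / (2 * d'))) as [j1 Hj1].
  { apply Rmult_le_pos; [auto|]. apply Rlt_le, Rinv_0_lt_compat; lra. }
  set (j0 := S j1). assert (Hj0 : B0 <= 2 * d' * INR j0 <= B0 + 2 * d').
  { unfold j0. rewrite S_INR. destruct Hj1 as [H1 H2].
    assert (E : B0 = 2 * d' * (B0 / (2 * d'))) by (field; lra). split; [rewrite E at 1; nra|].
    assert (2 * d' * INR j1 <= 2 * d' * (B0 / (2 * d'))) by (apply Rmult_le_compat_l; lra). lra. }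
  assert (G2 : 2 * d' * rsum (seq 1 J) (fun j => (phi j - phi (S j)) * INR (j - j0)) <= rsum (seq 1 J) (fun j => (phi j - phi (S j)) * cc j)).
  { rewrite <- rsum_scal. apply rsum_le. intros j Hj. apply in_seq in Hj.
    replace (2 * d' * ((phi j - phi (S j)) * INR (j - j0))) with ((phi j - phi (S j)) * (2 * d' * INR (j - j0))) by ring.
    apply Rmult_le_compat_l; [apply Hphi; lia|].
    destruct (le_lt_dec j j0) as [H|H].
    - replace (j - j0)%nat with 0%nat by lia. simpl (INR 0). rewrite Rmult_0_r. unfold cc.
      apply rsum_ge0. intros n _. apply Rmult_le_pos; [apply Hw|]. apply Rplus_le_le_0_compat; apply below_bounds.
    - rewrite minus_INR by lia. assert (HjJ : INR j <= INR J) by (apply le_INR; lia).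
      assert (S := symmetric_count P d eps A0 m x j X HP0 ltac:(lra) HDB ltac:(lra) ltac:(lra)).
      fold B0 in S. fold w in S. change (2 * d' * INR j - B0 <= cc j) in S. lra. }
  rewrite abel_tail in G2.
  assert (T1 := height_gain_total Y J HY HYY). fold phi in T1.
  assert (T2 : rsum (seq 1 (Nat.min j0 J)) phi <= kappa * Y + INR j0 * K).
  { apply Rle_trans with (rsum (seq 1 j0) phi).
    - apply rsum_incl; [apply seq_NoDup| |].
      + intros n Hn. apply in_seq in Hn. apply in_seq. lia.
      + intros n Hn. apply in_seq in Hn. apply height_gain_nonneg. apply lt_0_INR; lia.
    - apply height_gain_head; lra. }
  assert (T3 := height_gain_last Y J (J - j0) HYY ltac:(apply le_INR; lia)). fold (phi (S J)) in T3.
  assert (T4 := ln_small_slope (1 + Y) kappa ltac:(lra) ltac:(lra)).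
  fold w. eapply Rle_trans; [|exact G1]. eapply Rle_trans; [|exact G2].
  assert (HYk : 0 <= kappa * Y) by nra.
  apply Rle_trans with (2 * d' * ((PI / 2 * Y - (kappa * (1 + Y) + ln (/ kappa)) - 2) - (kappa * Y + INR j0 * K) - 1 / 2));
    [|apply Rmult_le_compat_l; lra].
  assert (U1 : c * Y <= d' * (PI - 4 * kappa) * Y).
  { apply Rmult_le_compat_r; [lra|]. unfold d', kappa. unfold d' in Hd'. unfold gap in *. nra. }
  assert (U2 : 2 * d' * INR j0 * K <= e * x + K * (2 * A0 + 8)).
  { apply Rle_trans with ((B0 + 2) * K); [apply Rmult_le_compat_r; lra|]. unfold B0.
    assert (2 * eps * K * x <= e * x) by (apply Rmult_le_compat_r; lra). nra. }
  assert (U3 : 2 * d' * (kappa + ln (/ kappa) + 5 / 2) <= 2 * (3 + kappa + ln (/ kappa))) by nra.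
  nra.
Qed.

(** * Lower bound for the canonical product away from its zeros *)

(** The finite part [1 <= n <= X] of [P]: all products over [P] are limits of products over these lists. *)
Definition members (P : nat -> Prop) (X : nat) : list nat :=
  filter (fun n => if excluded_middle_informative (P n) then true else false) (seq 1 X).

Lemma in_members P X n : In n (members P X) <-> (1 <= n <= X)%nat /\ P n.
Proof.
  unfold members. rewrite filter_In, in_seq.
  destruct (excluded_middle_informative (P n)); split; intros [H1 H2]; split; auto; try lia; discriminate || contradiction.
Qed.

Lemma NoDup_members P X : NoDup (members P X).
Proof. apply NoDup_filter, seq_NoDup. Qed.

Lemma rsum_members P X f : rsum (members P X) f = rsum (seq 1 X) (fun n => indic P n * f n).
Proof.
  unfold members. rewrite rsum_filter. apply rsum_ext. intros n _. unfold indic.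
  destruct (excluded_middle_informative (P n)); ring.
Qed.

Definition even_product (P : nat -> Prop) (X : nat) (z : C) : C :=
  cprod (members P X) (fun n => 1 - (z / INR n) ^ 2)%C.

Lemma ln_Cmod (a b : R) : a <> 0 -> ln (Cmod (a, b)) = ln (Rabs a) + height_gain b (Rabs a).
Proof.
  intros Ha. assert (Hp : 0 < Rabs a) by (apply Rabs_pos_lt; auto).
  assert (Hm : 0 < Cmod (a, b)).
  { apply Cmod_gt_0. intros E. apply Ha. now apply (f_equal fst) in E. }
  assert (E : 2 * ln (Cmod (a, b)) = 2 * (ln (Rabs a) + height_gain b (Rabs a))); [|lra].
  replace (2 * ln (Cmod (a, b))) with (ln (Cmod (a, b) * Cmod (a, b))) by (rewrite ln_mult by auto; ring).
  rewrite Cmod_sqr. simpl fst. simpl snd. rewrite height_gain_eq by auto.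
  assert (Hq : 0 <= (b / Rabs a) ^ 2) by nra.
  replace (2 * (ln (Rabs a) + / 2 * ln (1 + (b / Rabs a) ^ 2))) with (ln (Rabs a) + ln (Rabs a) + ln (1 + (b / Rabs a) ^ 2)) by field.
  rewrite <- !ln_mult by nra. f_equal.
  replace (a * a) with (Rabs a * Rabs a) by (rewrite <- Rabs_mult; apply Rabs_pos_eq; nra). field. lra.
Qed.

Lemma even_factor (z : C) n : (0 < n)%nat ->
  Cmod (1 - (z / INR n) ^ 2)%C = Cmod (INR n - z)%C * Cmod (INR n + z)%C / (INR n * INR n).
Proof.
  intros Hn. assert (Hp : 0 < INR n) by (apply lt_0_INR; auto).
  assert (Hz : RtoC (INR n) <> 0%C) by (intros E; apply RtoC_inj in E; lra).
  replace (1 - (z / INR n) ^ 2)%C with ((INR n - z) * (INR n + z) / (INR n * INR n))%C by (field; auto).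
  unfold Cdiv. rewrite <- RtoC_mult, <- RtoC_inv by nra. rewrite !Cmod_mult, Cmod_R, Rabs_pos_eq; [reflexivity|].
  apply Rlt_le, Rinv_0_lt_compat. nra.
Qed.

Lemma ln_even_factor m n (x y : R) : (0 < n)%nat -> n <> m -> 0 <= x -> Rabs (x - INR m) <= 1 / 2 ->
  ln (Cmod (1 - ((x, y) / INR n) ^ 2)%C) =
  log_term m n + shift_term m x n + (height_gain y (Rabs (INR n - x)) + height_gain y (INR n + x)).
Proof.
  intros Hn Hnm Hx Hxm. assert (Hp : 0 < INR n) by (apply lt_0_INR; auto).
  assert (Hnx : INR n - x <> 0).
  { intros E. assert (Hlt : Rabs (INR n - INR m) < 1) by (replace (INR n - INR m) with (x - INR m) by lra; lra).
    apply Rabs_def2 in Hlt. destruct Hlt as [H1 H2].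
    assert (INR n < INR (S m)) by (rewrite S_INR; lra). assert (INR m < INR (S n)) by (rewrite S_INR; lra).
    apply INR_lt in H, H0. lia. }
  assert (Hnm' : INR n <> INR m) by (intros E; apply Hnm, INR_eq, E).
  assert (Hm0 := pos_INR m).
  assert (Ha : 0 < Rabs (INR n - x)) by (apply Rabs_pos_lt; auto).
  rewrite even_factor by auto.
  replace (INR n - (x, y))%C with ((INR n - x, - y) : C) by (unfold RtoC, Cminus, Cplus, Copp; simpl; f_equal; ring).
  replace (INR n + (x, y))%C with ((INR n + x, y) : C) by (unfold RtoC, Cplus; simpl; f_equal; ring).
  assert (C1 : 0 < Cmod (INR n - x, - y)) by (apply Cmod_gt_0; intros E; apply (f_equal fst) in E; simpl in E; auto).
  assert (C2 : 0 < Cmod (INR n + x, y)) by (apply Cmod_gt_0; intros E; apply (f_equal fst) in E; simpl in E; lra).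
  rewrite ln_div, ln_mult, !ln_Cmod by (auto; nra).
  rewrite <- (height_gain_abs (- y)), Rabs_Ropp, height_gain_abs, (Rabs_pos_eq (INR n + x)) by lra.
  unfold log_term, shift_term. destruct (Nat.eq_dec n m) as [|_]; [contradiction|].
  assert (E1 : INR n ^ 2 - INR m ^ 2 <> 0).
  { intros E. apply Hnm'. nra. }
  assert (E2 : INR n ^ 2 - x ^ 2 <> 0).
  { replace (INR n ^ 2 - x ^ 2) with ((INR n - x) * (INR n + x)) by ring. apply Rmult_integral_contrapositive. split; [auto|lra]. }
  assert (E : ln (Rabs (1 - (INR m / INR n) ^ 2)) + ln (Rabs ((INR n ^ 2 - x ^ 2) / (INR n ^ 2 - INR m ^ 2)))
     = ln (Rabs (INR n - x)) + ln (INR n + x) - ln (INR n * INR n)).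
  { assert (F1 : 0 < Rabs (1 - (INR m / INR n) ^ 2)).
    { apply Rabs_pos_lt. intros E. apply E1.
      replace (INR n ^ 2 - INR m ^ 2) with (INR n ^ 2 * (1 - (INR m / INR n) ^ 2)) by (field; lra). rewrite E; ring. }
    assert (F2 : 0 < Rabs ((INR n ^ 2 - x ^ 2) / (INR n ^ 2 - INR m ^ 2))).
    { apply Rabs_pos_lt. unfold Rdiv. apply Rmult_integral_contrapositive. split; [auto|apply Rinv_neq_0_compat; auto]. }
    rewrite <- (ln_mult _ _ F1 F2), <- (ln_mult (Rabs (INR n - x))) by lra.
    rewrite <- ln_div by (try nra; apply Rmult_lt_0_compat; lra).
    f_equal. rewrite <- Rabs_mult.
    replace ((1 - (INR m / INR n) ^ 2) * ((INR n ^ 2 - x ^ 2) / (INR n ^ 2 - INR m ^ 2))) with ((INR n - x) * ((INR n + x) * / (INR n * INR n))).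
    2:{ field. split; [lra|]. replace (INR n ^ 2 - INR m ^ 2) with ((INR n - INR m) * (INR n + INR m)) in E1 by ring. nra || exact E1. }
    rewrite Rabs_mult, (Rabs_pos_eq ((INR n + x) * / (INR n * INR n))).
    - unfold Rdiv. ring.
    - apply Rmult_le_pos; [lra|]. apply Rlt_le, Rinv_0_lt_compat. nra. }
  lra.
Qed.

Lemma rsum_members_except P X m f b : 0 <= b -> - b <= indic P m * f m ->
  rsum (seq 1 X) (fun n => (if Nat.eq_dec n m then 0 else indic P n) * f n) - b <= rsum (seq 1 X) (fun n => indic P n * f n).
Proof.
  intros Hb Hm.
  assert (- b <= rsum (seq 1 X) (fun n => (- b) * (if Nat.eq_dec n m then 1 else 0))).
  { rewrite rsum_scal. assert (H := rsum_single_le m (seq 1 X) (seq_NoDup _ _)). nra. }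
  assert (rsum (seq 1 X) (fun n => (if Nat.eq_dec n m then 0 else indic P n) * f n) + rsum (seq 1 X) (fun n => (- b) * (if Nat.eq_dec n m then 1 else 0))
     <= rsum (seq 1 X) (fun n => indic P n * f n)).
  { rewrite <- rsum_plus. apply rsum_le. intros n _. destruct (Nat.eq_dec n m) as [->|]; lra. }
  lra.
Qed.

(** With [m] the integer nearest to [x = Re z], the logarithm of the product splits into [log_term m], the change
   [shift_term m x], and the gain [height_gain] due to [Im z]. The factor [n = m] is only bounded below by
   [1 / (4 * m)]. All errors are at most [e * x] plus a constant. *)
Lemma even_product_lower P d c e : balanced P d -> 0 < d <= 1 -> 0 <= c < PI * d -> 0 < e ->
  exists A, 0 <= A /\ forall R, exists X0, forall X z, X0 <= INR X -> 0 <= fst z <= R -> Rabs (snd z) <= R ->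
    (forall m, P m -> 1 / 4 <= Cmod (z - INR m)%C) ->
    exp (c * Rabs (snd z) - e * fst z - A) <= Cmod (even_product P X z).
Proof.
  intros HB Hd Hc He. assert (HP0 := proj1 HB).
  destruct (selected_log_sum P d ltac:(lra) HB (e / 4) ltac:(lra)) as [A1 [HA1 L1]].
  destruct (gain_lower P d c (e / 4) HB Hd Hc ltac:(lra)) as [A3 [HA3 L3]].
  set (del := e / 100). assert (Hdel : 0 < del) by (unfold del; lra).
  set (q := Rabs (ln (/ del))).
  exists (e + A1 + A3 + 21 * (3 * del + q) + 8 + ln 4). split.
  { assert (0 <= q) by apply Rabs_pos. assert (0 <= ln 4) by (rewrite <- ln_1; apply ln_le; lra). nra. }
  intros R. destruct (L3 R) as [X1 HX1]. exists (Rmax X1 (A1 * ((R + 1) * (R + 1) + 1))).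
  intros X [x y] HX Hx Hy Hz. simpl fst in *. simpl snd in *.
  assert (HX2 : X1 <= INR X) by (eapply Rle_trans; [apply Rmax_l|exact HX]).
  assert (HX3 : A1 * ((R + 1) * (R + 1) + 1) <= INR X) by (eapply Rle_trans; [apply Rmax_r|exact HX]).
  destruct (nfloor_ex (x + 1 / 2)) as [m Hm]; [lra|].
  assert (Hm0 := pos_INR m).
  assert (Hxm : Rabs (x - INR m) <= 1 / 2) by (apply Rabs_le; lra).
  specialize (L1 m X). specialize (HX1 X m x y HX2 Hx Hy Hxm).
  assert (L1' : Rabs (rsum (seq 1 X) (fun n => indic P n * log_term m n)) <= e / 4 * INR m + A1).
  { apply L1. eapply Rle_trans; [|exact HX3]. apply Rmult_le_compat_l; [auto|]. nra. }
  assert (L1'' := Rle_trans _ _ _ (Rle_abs _) (eq_ind _ (fun v => v <= _) L1' _ (eq_sym (Rabs_Ropp _)))). clear L1 L1'.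
  assert (Hpos : forall n, (0 < n)%nat -> P n -> 0 < Cmod (1 - ((x, y) / INR n) ^ 2)%C).
  { intros n Hn HPn. assert (0 < INR n) by (apply lt_0_INR; auto). rewrite even_factor by auto.
    assert (1 / 4 <= Cmod (INR n - (x, y))%C) by (rewrite Cmod_sym; auto).
    assert (0 < Cmod (INR n + (x, y))%C).
    { apply Cmod_gt_0. intros E. apply (f_equal fst) in E. simpl in E. lra. }
    apply Rdiv_lt_0_compat; nra. }
  unfold even_product. rewrite Cmod_cprod.
  assert (Hprod : forall n, In n (members P X) -> 0 < Cmod (1 - ((x, y) / INR n) ^ 2)%C).
  { intros n Hn. apply in_members in Hn. apply Hpos; [lia|tauto]. }
  rewrite <- (exp_ln (rprod _ _)) by (apply rprod_pos; exact Hprod).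
  apply exp_le. rewrite ln_rprod by exact Hprod. rewrite rsum_members.
  set (b := ln 4 + ln (INR m + 3)).
  assert (Hl4 : 0 <= ln 4) by (rewrite <- ln_1; apply ln_le; lra).
  assert (Hlm : 0 <= ln (INR m + 3)) by (rewrite <- ln_1; apply ln_le; lra).
  eapply Rle_trans; [|apply (rsum_members_except P X m _ b)]; [|unfold b; lra|].
  2:{ unfold indic. destruct (excluded_middle_informative (P m)) as [HPm|]; [|unfold b; lra].
      assert (Hm1 : (0 < m)%nat) by (destruct m; [contradiction|lia]).
      assert (Hmp : 1 <= INR m) by (apply INR_ge1; lia).
      rewrite Rmult_1_l. unfold b. rewrite <- ln_mult, <- ln_Rinv by lra. apply ln_le; [apply Rinv_0_lt_compat; lra|].
      rewrite even_factor by auto.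
      assert (B1 : 1 / 4 <= Cmod (INR m - (x, y))%C) by (rewrite Cmod_sym; auto).
      assert (B2 : INR m <= Cmod (INR m + (x, y))%C).
      { eapply Rle_trans; [|apply Rabs_fst_le]. simpl. rewrite Rabs_pos_eq; lra. }
      apply Rle_trans with (1 / 4 * INR m / (INR m * INR m)).
      - replace (1 / 4 * INR m / (INR m * INR m)) with (/ (4 * INR m)) by (field; lra). apply Rinv_le_contravar; lra.
      - unfold Rdiv. apply Rmult_le_compat_r; [apply Rlt_le, Rinv_0_lt_compat; nra|]. apply Rmult_le_compat; lra. }
  rewrite (rsum_ext _ _ (fun n => (indic P n * log_term m n + (if Nat.eq_dec n m then 0 else indic P n) * shift_term m x n)
     + (if Nat.eq_dec n m then 0 else indic P n) * (height_gain y (Rabs (INR n - x)) + height_gain y (INR n + x)))).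
  2:{ intros n Hn. apply in_seq in Hn. destruct (Nat.eq_dec n m) as [->|Hnm].
      - rewrite log_term_self. ring.
      - rewrite (ln_even_factor m n x y) by (auto; lia || lra). ring. }
  rewrite !rsum_plus.
  assert (L2 : - (20 * ln (INR m + 2) + 8) <= rsum (seq 1 X) (fun n => (if Nat.eq_dec n m then 0 else indic P n) * shift_term m x n)).
  { apply Rle_trans with (rsum (seq 1 X) (fun n => (- 4) * shift_ratio m n)).
    - rewrite rsum_scal. generalize (shift_ratio_sum m X). lra.
    - apply rsum_le. intros n Hn. apply in_seq in Hn.
      assert (S := shift_term_lower m x n ltac:(lia) Hxm ltac:(lra)).
      assert (S0 : 0 <= shift_ratio m n).
      { unfold shift_ratio. destruct (Nat.eq_dec n m) as [|Hnm]; [lra|].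
        assert (1 <= INR n) by (apply INR_ge1; lia).
        apply Rmult_le_pos; [lra|]. apply Rlt_le, Rinv_0_lt_compat, Rmult_lt_0_compat; [|lra].
        apply Rabs_pos_lt. intros E. apply Hnm, INR_eq. lra. }
      destruct (Nat.eq_dec n m); [lra|]. generalize (indic_bounds P n). nra. }
  assert (Q2 : ln (INR m + 2) <= ln (INR m + 3)) by (apply ln_le; lra).
  assert (Q3 := ln_small_slope (INR m + 3) del ltac:(lra) Hdel).
  assert (Q4 : ln (/ del) <= q) by apply Rle_abs.
  unfold b, del in *. assert (INR m <= x + 1 / 2) by lra. nra.
Qed.

(** * The residues as coefficients of a power series *)

Lemma root_condition_of_bounds Lam a : subexponential a -> not_too_small a -> root_condition Lam a.
Proof.
  intros Hs Hn. apply filterlim_locally. intros eps.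
  set (kappa := ln (1 + eps / 2)). assert (Hep := cond_pos eps).
  assert (Hk : 0 < kappa) by (unfold kappa; rewrite <- ln_1; apply ln_increasing; lra).
  destruct (Hs (kappa / 2) ltac:(lra)) as [A HA]. destruct (Hn kappa Hk) as [N1 HN1].
  destruct (INR_unbounded (2 * Rabs A / kappa)) as [N2 HN2].
  exists (S (N1 + N2)). intros m Hm [_ Ham].
  assert (Hmp : 0 < INR m) by (apply lt_0_INR; lia).
  assert (Hm2 : INR N2 <= INR m) by (apply le_INR; lia).
  assert (Hpos : 0 < Cmod (a m)) by (apply Cmod_gt_0; auto).
  assert (Up : ln (Cmod (a m)) <= kappa * INR m).
  { rewrite <- (ln_exp (kappa * INR m)). apply ln_le; auto. eapply Rle_trans; [apply HA|].
    assert (A <= exp (kappa / 2 * INR m)).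
    { apply Rle_trans with (1 + kappa / 2 * INR m); [|apply exp_ineq1_le].
      assert (Rabs A <= kappa / 2 * INR m).
      { apply Rle_trans with (kappa / 2 * (2 * Rabs A / kappa)); [right; field; lra|]. apply Rmult_le_compat_l; lra. }
      generalize (Rle_abs A). lra. }
    replace (kappa * INR m) with (kappa / 2 * INR m + kappa / 2 * INR m) by field. rewrite exp_plus.
    apply Rmult_le_compat_r; [apply Rlt_le, exp_pos|auto]. }
  assert (Lo : - (kappa * INR m) <= ln (Cmod (a m))).
  { rewrite <- (ln_exp (- (kappa * INR m))). apply ln_le; [apply exp_pos|]. apply HN1; auto; lia. }
  unfold Rpower.
  assert (Hq : - kappa <= / INR m * ln (Cmod (a m)) <= kappa).
  { split; apply Rmult_le_reg_l with (INR m); auto; rewrite <- Rmult_assoc, Rinv_r, Rmult_1_l by lra; lra. }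
  change (Rabs (exp (/ INR m * ln (Cmod (a m))) - 1) < eps).
  assert (E1 : exp kappa = 1 + eps / 2) by (unfold kappa; rewrite exp_ln; lra).
  assert (E2 : 1 - kappa <= exp (- kappa)) by (generalize (exp_ineq1_le (- kappa)); lra).
  assert (E3 : kappa <= eps / 2) by (generalize (exp_ineq1_le kappa); lra).
  assert (exp (- kappa) <= exp (/ INR m * ln (Cmod (a m)))) by (apply exp_le; lra).
  assert (exp (/ INR m * ln (Cmod (a m))) <= exp kappa) by (apply exp_le; lra).
  apply Rabs_def1; lra.
Qed.

Lemma series_on_of_bounds (Lam : nat -> Prop) (a : nat -> C) :
  (forall m, ~ Lam m -> a m = 0%C) -> subexponential a -> not_too_small a ->
  (forall N, exists n, (N <= n)%nat /\ a n <> 0%C) -> series_on Lam a.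
Proof.
  intros H0 Hs Hn Hinf. split; [exact H0|].
  destruct (CV_radius_bounded (fun m => Cmod (a m))) as [Hub Hlub].
  apply Rbar_le_antisym.
  - apply Hlub. intros r [M HM]. simpl. apply Rnot_lt_le. intros Hr.
    assert (Hl : 0 < ln r) by (rewrite <- ln_1; apply ln_increasing; lra).
    destruct (Hn (ln r / 2) ltac:(lra)) as [N HN].
    destruct (INR_unbounded (M / (ln r / 2))) as [N2 HN2].
    destruct (Hinf (N + N2)%nat) as [m [Hm Ham]].
    specialize (HN m ltac:(lia) Ham). specialize (HM m).
    assert (Hm2 : INR N2 <= INR m) by (apply le_INR; lia).
    rewrite Rabs_pos_eq in HM by (apply Rmult_le_pos; [apply Cmod_ge_0|apply pow_le; lra]).
    assert (E : r ^ m = exp (ln r * INR m)).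
    { rewrite Rmult_comm, exp_INR_mult, exp_ln by lra. reflexivity. }
    assert (exp (ln r / 2 * INR m) <= Cmod (a m) * r ^ m).
    { replace (ln r / 2 * INR m) with (- (ln r / 2 * INR m) + ln r * INR m) by field. rewrite exp_plus, <- E.
      apply Rmult_le_compat_r; [apply pow_le; lra|auto]. }
    assert (M < ln r / 2 * INR m).
    { apply Rmult_lt_reg_r with (/ (ln r / 2)); [apply Rinv_0_lt_compat; lra|].
      replace (ln r / 2 * INR m * / (ln r / 2)) with (INR m) by (field; lra). unfold Rdiv at 1 in HN2. lra. }
    generalize (exp_ineq1_le (ln r / 2 * INR m)). lra.
  - apply Rbar_not_lt_le. intros Hlt.
    destruct (CV_radius (fun m => Cmod (a m))) as [r| |]; simpl in Hlt; try contradiction.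
    + set (s := (Rmax r 0 + 1) / 2).
      assert (Hs1 : 0 <= s < 1 /\ r < s).
      { unfold s. generalize (Rmax_l r 0) (Rmax_r r 0) (Rmax_lub_lt r 0 1 Hlt ltac:(lra)). lra. }
      destruct (subexponential_summable a Hs s ltac:(lra)) as [B [HB1 HB2]].
      assert (Hc := Hub s). simpl in Hc. assert (s <= r); [|lra]. apply Hc. exists B. intros n.
      rewrite Rabs_pos_eq by apply HB1. eapply Rle_trans; [|apply (HB2 (S n))].
      rewrite rsum_S. generalize (rsum_ge0 (seq 0 n) (fun n => Cmod (a n) * s ^ n) (fun k _ => HB1 k)). lra.
    + assert (Hc := Hub 0). simpl in Hc. apply Hc. exists (Cmod (a 0%nat)). intros [|n].
      * simpl. rewrite Rmult_1_r, Rabs_pos_eq; [lra|apply Cmod_ge_0].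
      * rewrite pow_ne_zero by lia. rewrite Rmult_0_r, Rabs_R0. apply Cmod_ge_0.
Qed.

Lemma balanced_infinite P d : 0 < d -> balanced P d -> forall N, exists n, (N <= n)%nat /\ P n.
Proof.
  intros Hd [_ HB] N. apply NNPP. intros Hno.
  assert (HC : forall n, (N <= n)%nat -> cnt P n = cnt P N).
  { intros n Hn. induction Hn as [|n Hn IH]; auto. rewrite cnt_S, IH. unfold indic.
    destruct (excluded_middle_informative (P (S n))) as [H|]; [|ring]. exfalso. apply Hno. exists (S n). split; [lia|auto]. }
  destruct (HB (d / 2) ltac:(lra)) as [A [HA HE]].
  destruct (INR_unbounded ((cnt P N + A) / (d / 2))) as [n Hn].
  specialize (HE (N + n)%nat). rewrite HC in HE by lia.
  assert (INR n <= INR (N + n)) by (apply le_INR; lia).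
  apply Rabs_def2b in HE || (assert (HE2 := Rle_trans _ _ _ (Rle_abs _) (eq_ind _ (fun v => v <= _) HE _ (eq_sym (Rabs_Ropp _))))).
  assert (cnt P N + A < d / 2 * INR (N + n)); [|lra].
  apply Rlt_le_trans with (d / 2 * INR n); [|apply Rmult_le_compat_l; lra].
  apply Rmult_lt_reg_r with (/ (d / 2)); [apply Rinv_0_lt_compat; lra|].
  replace (d / 2 * INR n * / (d / 2)) with (INR n) by (field; lra). unfold Rdiv at 1 in Hn. lra.
Qed.

(** [other_factors P X m] tends to [- m / 2] times the derivative at [m] of the canonical product. *)
Definition other_factors (P : nat -> Prop) (X m : nat) : R :=
  rprod (members P X) (fun n => if Nat.eq_dec n m then 1 else 1 - (INR m / INR n) ^ 2).

Lemma factor_nonzero m n : (0 < n)%nat -> n <> m -> 1 - (INR m / INR n) ^ 2 <> 0.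
Proof.
  intros Hn Hnm E. assert (Hp : 0 < INR n) by (apply lt_0_INR; auto). assert (Hm := pos_INR m).
  apply Hnm, INR_eq. assert (INR n ^ 2 - INR m ^ 2 = 0); [|nra].
  replace (INR n ^ 2 - INR m ^ 2) with (INR n ^ 2 * (1 - (INR m / INR n) ^ 2)) by (field; lra). rewrite E; ring.
Qed.

Lemma rprod_abs {A} (l : list A) f : Rabs (rprod l f) = rprod l (fun x => Rabs (f x)).
Proof. induction l as [|x l IH]; simpl; [apply Rabs_R1|]. now rewrite Rabs_mult, IH. Qed.

Lemma other_factors_abs P X m : Rabs (other_factors P X m) = exp (rsum (seq 1 X) (fun n => indic P n * log_term m n)).
Proof.
  unfold other_factors. rewrite rprod_abs, <- rsum_members, <- rprod_exp.
  apply rprod_ext. intros n Hn. apply in_members in Hn. unfold log_term.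
  destruct (Nat.eq_dec n m) as [|Hnm]; [rewrite exp_0; apply Rabs_R1|].
  rewrite exp_ln; auto. apply Rabs_pos_lt, factor_nonzero; [lia|auto].
Qed.

Lemma members_S P X : members P (S X) = members P X ++ (if excluded_middle_informative (P (S X)) then S X :: nil else nil).
Proof.
  unfold members. rewrite seq_S, filter_app. f_equal. cbn [filter Nat.add].
  destruct (excluded_middle_informative (P (S X))); reflexivity.
Qed.

Lemma other_factors_S P X m : exists q, other_factors P (S X) m = other_factors P X m * q /\ ((m <= X)%nat -> 0 <= q <= 1).
Proof.
  unfold other_factors. rewrite members_S, rprod_app. eexists. split; [reflexivity|]. intros Hm.
  destruct (excluded_middle_informative (P (S X))); cbn [rprod]; [|lra].
  destruct (Nat.eq_dec (S X) m); [lia|]. rewrite Rmult_1_r.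
  assert (H : INR m <= INR (S X)) by (apply le_INR; lia). assert (Hm0 := pos_INR m).
  assert (Hp : 0 < INR (S X)) by (apply lt_0_INR; lia).
  assert (0 <= INR m / INR (S X) <= 1).
  { split; [apply Rmult_le_pos; [auto|apply Rlt_le, Rinv_0_lt_compat; auto]|].
    apply Rle_div_l; [auto|lra]. }
  nra.
Qed.

(** From [X = m] on, every further factor lies in [0, 1]. *)
Lemma other_factors_limit P m : exists L, Un_cv (fun X => other_factors P X m) L.
Proof.
  assert (G : forall k, exists q, other_factors P (m + k) m = other_factors P m m * q /\ 0 <= q <= 1 /\
     exists r, other_factors P (m + S k) m = other_factors P m m * (q * r) /\ 0 <= r <= 1).
  { induction k as [|k [q [E [Hq [r [E2 Hr]]]]]].
    - exists 1. rewrite Nat.add_0_r. split; [ring|]. split; [lra|].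
      destruct (other_factors_S P m m) as [r [E Hr]]. exists r. replace (m + 1)%nat with (S m) by lia.
      split; [rewrite E; ring|auto].
    - exists (q * r). split; [auto|]. split; [nra|].
      destruct (other_factors_S P (m + S k) m) as [r' [E' Hr']]. exists r'.
      replace (m + S (S k))%nat with (S (m + S k)) by lia. split; [rewrite E', E2; ring|apply Hr'; lia]. }
  assert (Cv : exists L, Un_cv (fun k => other_factors P (m + k) m) L).
  { destruct (Rle_lt_dec 0 (other_factors P m m)) as [H|H].
    - destruct (decreasing_cv (fun k => other_factors P (m + k) m)) as [L HL]; [| |now exists L].
      + intros k. destruct (G k) as [q [E [Hq [r [E2 Hr]]]]]. cbn beta. rewrite E, E2.
        apply Rmult_le_compat_l; nra.
      + exists 0. intros z [k ->]. unfold opp_seq. destruct (G k) as [q [E [Hq _]]]. rewrite E. assert (T := Rmult_le_pos _ _ H (proj1 Hq)). lra.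
    - destruct (growing_cv (fun k => other_factors P (m + k) m)) as [L HL]; [| |now exists L].
      + intros k. destruct (G k) as [q [E [Hq [r [E2 Hr]]]]]. cbn beta. rewrite E, E2.
        apply Rmult_le_compat_neg_l; nra.
      + exists 0. intros z [k ->]. destruct (G k) as [q [E [Hq _]]]. rewrite E. assert (T := Rmult_le_compat_neg_l _ _ _ (Rlt_le _ _ H) (proj1 Hq)). lra. }
  destruct Cv as [L HL]. exists L. intros eps He. destruct (HL eps He) as [N HN]. exists (m + N)%nat.
  intros n Hn. replace n with (m + (n - m))%nat by lia. apply HN. lia.
Qed.

Lemma Un_cv_abs_bounds u L lo hi : Un_cv u L -> (exists N, forall n, (N <= n)%nat -> lo <= Rabs (u n) <= hi) ->
  lo <= Rabs L <= hi.
Proof.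
  intros HL [N HN]. split; apply Rnot_lt_le; intros Hlt.
  - destruct (HL (lo - Rabs L) ltac:(lra)) as [M HM]. specialize (HM (N + M)%nat ltac:(lia)). specialize (HN (N + M)%nat ltac:(lia)).
    unfold Rdist in HM. generalize (Rabs_triang (u (N + M)%nat - L) L). replace (u (N + M)%nat - L + L) with (u (N + M)%nat) by ring. lra.
  - destruct (HL (Rabs L - hi) ltac:(lra)) as [M HM]. specialize (HM (N + M)%nat ltac:(lia)). specialize (HN (N + M)%nat ltac:(lia)).
    unfold Rdist in HM. rewrite Rabs_minus_sym in HM.
    generalize (Rabs_triang (L - u (N + M)%nat) (u (N + M)%nat)). replace (L - u (N + M)%nat + u (N + M)%nat) with L by ring. lra.
Qed.

Lemma other_factors_limit_bounds P d L : 0 <= d <= 1 -> balanced P d ->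
  (forall m, Un_cv (fun X => other_factors P X m) (L m)) -> forall e, 0 < e ->
  exists A, 0 <= A /\ forall m, exp (- (e * INR m + A)) <= Rabs (L m) <= exp (e * INR m + A).
Proof.
  intros Hd HB HL e He. destruct (selected_log_sum P d Hd HB e He) as [A [HA H]]. exists A. split; auto.
  intros m. apply (Un_cv_abs_bounds _ _ _ _ (HL m)).
  destruct (INR_unbounded (A * (INR m * INR m + 1))) as [N HN]. exists N. intros n Hn.
  assert (INR N <= INR n) by (apply le_INR; auto).
  rewrite other_factors_abs. specialize (H m n ltac:(lra)).
  assert (H1 := Rle_abs (rsum (seq 1 n) (fun n => indic P n * log_term m n))).
  assert (H2 := Rle_abs (- rsum (seq 1 n) (fun n => indic P n * log_term m n))). rewrite Rabs_Ropp in H2.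
  split; apply exp_le; lra.
Qed.

(** [- 2] times the residue at [m] of the reciprocal of the canonical product. *)
Definition reciprocal_coef (P : nat -> Prop) (L : nat -> R) (m : nat) : C :=
  if excluded_middle_informative (P m) then RtoC (INR m / L m) else 0%C.

(** [L m] is [exp (o (m))] in both directions by [selected_log_sum]. *)
Lemma reciprocal_coef_bounds P d L : 0 < d <= 1 -> balanced P d ->
  (forall m, Un_cv (fun X => other_factors P X m) (L m)) ->
  let a := reciprocal_coef P L in
  subexponential a /\ not_too_small a /\ forall m, P m -> a m <> 0%C.
Proof.
  intros Hd HB HL a.
  assert (HBd := other_factors_limit_bounds P d L ltac:(lra) HB HL).
  assert (Nz : forall m, L m <> 0).
  { intros m E. destruct (HBd 1 ltac:(lra)) as [A [_ HA]]. specialize (HA m). rewrite E, Rabs_R0 in HA.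
    generalize (exp_pos (- (1 * INR m + A))). lra. }
  assert (Ha : forall m, P m -> Cmod (a m) = INR m / Rabs (L m) /\ 1 <= INR m).
  { intros m Hm. unfold a, reciprocal_coef. destruct (excluded_middle_informative (P m)); [|contradiction].
    assert (m <> 0%nat) by (intros ->; apply (proj1 HB Hm)).
    assert (1 <= INR m) by (apply INR_ge1; lia).
    split; auto. rewrite Cmod_R. unfold Rdiv. rewrite Rabs_mult, Rabs_inv, (Rabs_pos_eq (INR m)) by lra. reflexivity. }
  assert (Hexp : forall x, exp (- x) = / exp x) by (intros; apply exp_Ropp).
  split; [|split].
  - intros eps Heps. destruct (HBd (eps / 2) ltac:(lra)) as [A [HA H]].
    exists (exp A * (2 / eps)). intros m. specialize (H m).
    assert (0 < exp A) by apply exp_pos. assert (0 < exp (eps * INR m)) by apply exp_pos.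
    assert (0 < 2 / eps) by (apply Rdiv_lt_0_compat; lra).
    unfold a, reciprocal_coef. destruct (excluded_middle_informative (P m)) as [Hm|Hm].
    2:{ rewrite Cmod_0. repeat apply Rmult_le_pos; lra. }
    fold (a m). destruct (Ha m Hm) as [E Hm1]. unfold a, reciprocal_coef in E. destruct (excluded_middle_informative (P m)); [|contradiction].
    rewrite E. apply Rle_trans with (INR m * exp (eps / 2 * INR m + A)).
    { unfold Rdiv at 1. apply Rmult_le_compat_l; [lra|]. rewrite <- (Rinv_inv (exp _)), <- Hexp.
      apply Rinv_le_contravar; [apply exp_pos|tauto]. }
    assert (INR m <= 2 / eps * exp (eps / 2 * INR m)).
    { assert (G := exp_ineq1_le (eps / 2 * INR m)). apply Rle_trans with (2 / eps * (eps / 2 * INR m)); [right; field; lra|].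
      apply Rmult_le_compat_l; lra. }
    rewrite exp_plus. replace (eps * INR m) with (eps / 2 * INR m + eps / 2 * INR m) by field. rewrite exp_plus.
    assert (0 < exp (eps / 2 * INR m)) by apply exp_pos.
    apply Rle_trans with (2 / eps * exp (eps / 2 * INR m) * (exp (eps / 2 * INR m) * exp A)); [|right; ring].
    apply Rmult_le_compat_r; [nra|auto].
  - intros eps Heps. destruct (HBd (eps / 2) ltac:(lra)) as [A [HA H]].
    destruct (INR_unbounded (2 * A / eps)) as [N HN]. exists N. intros m Hm Ham.
    destruct (classic (P m)) as [HPm|HPm].
    2:{ exfalso. apply Ham. unfold a, reciprocal_coef. destruct (excluded_middle_informative (P m)); [contradiction|reflexivity]. }
    destruct (Ha m HPm) as [E Hm1]. rewrite E. specialize (H m).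
    assert (INR N <= INR m) by (apply le_INR; auto).
    assert (A <= eps / 2 * INR m).
    { apply Rle_trans with (eps / 2 * (2 * A / eps)); [right; field; lra|]. apply Rmult_le_compat_l; lra. }
    apply Rle_trans with (1 * / exp (eps / 2 * INR m + A)).
    + rewrite Rmult_1_l, <- Hexp. apply exp_le. lra.
    + unfold Rdiv. apply Rmult_le_compat; [lra|apply Rlt_le, Rinv_0_lt_compat, exp_pos|auto|].
      apply Rinv_le_contravar; [|tauto]. apply Rabs_pos_lt, Nz.
  - intros m Hm. destruct (Ha m Hm) as [E Hm1]. intros Hc. rewrite Hc, Cmod_0 in E.
    assert (0 < INR m / Rabs (L m)) by (apply Rdiv_lt_0_compat; [lra|apply Rabs_pos_lt, Nz]). lra.
Qed.

(** * Residues at the zeros of the canonical product *)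

Lemma cprod_remove (l : list nat) m (h : nat -> C) : NoDup l -> In m l ->
  cprod l h = (h m * cprod (remove Nat.eq_dec m l) h)%C.
Proof.
  induction l as [|a l IH]; intros Hn Hm; [contradiction|]. inversion Hn as [|? ? Ha Hl]; subst.
  cbn [cprod remove]. destruct (Nat.eq_dec m a) as [->|Hne].
  - now rewrite notin_remove.
  - destruct Hm as [->|Hm]; [congruence|]. cbn [cprod]. rewrite IH by auto. ring.
Qed.

Lemma other_factors_remove P X m : RtoC (other_factors P X m) =
  cprod (remove Nat.eq_dec m (members P X)) (fun n => 1 - (INR m / INR n) ^ 2)%C.
Proof.
  unfold other_factors.
  rewrite (cprod_ext _ _ (fun n => RtoC (1 - (INR m / INR n) ^ 2))).
  2:{ intros n Hn. apply in_remove in Hn. destruct Hn as [Hn _]. apply in_members in Hn.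
      assert (INR n <> 0) by (apply not_0_INR; lia).
      unfold Rdiv. rewrite RtoC_minus, RtoC_pow, RtoC_mult, RtoC_inv by auto. reflexivity. }
  rewrite cprod_RtoC. f_equal. induction (members P X) as [|a l IH]; [reflexivity|].
  cbn [rprod remove]. destruct (Nat.eq_dec a m) as [->|Hne].
  - destruct (Nat.eq_dec m m); [|congruence]. rewrite IH. ring.
  - destruct (Nat.eq_dec m a); [congruence|]. cbn [rprod]. now rewrite IH.
Qed.

Lemma other_factors_neq0 P X m : other_factors P X m <> 0.
Proof.
  intros E. assert (H := other_factors_abs P X m). rewrite E, Rabs_R0 in H.
  generalize (exp_pos (rsum (seq 1 X) (fun n => indic P n * log_term m n))). lra.
Qed.

Lemma INR_C_neq0 n : (0 < n)%nat -> RtoC (INR n) <> 0%C.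
Proof. intros Hn E. apply RtoC_inj in E. generalize (lt_0_INR n Hn). lra. Qed.

(** The factors of the even product [G] vanish at [n] and at [- n]; only the former lie inside the circle, if they are
   less than [2 * R]. The residue of [1 / G] at [m] is [- 1/2 * m / other_factors P X m]. *)
Lemma contour_sum P X F R : 0 < R -> has_residues R F -> (forall m, INR m <> 2 * R) ->
  clim (fun M => cavg M (fun t => R * cis t * F (R * cis t) / even_product P X (R + R * cis t)))%C
    (- / 2 * csum (members P X) (fun m => if Rlt_dec (INR m) (2 * R) then INR m / other_factors P X m * F (INR m - R) else 0))%C.
Proof.
  intros HR HF H2R. set (mem := members P X).
  assert (Hmem : forall m, In m mem -> (0 < m)%nat) by (intros m Hm; apply in_members in Hm; lia).
  destruct (list_eq_dec Nat.eq_dec mem nil) as [Hnil|Hnil].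
  { unfold even_product. fold mem. rewrite Hnil. cbn [csum cprod].
    replace (- / 2 * 0)%C with (RtoC 0) by ring.
    eapply clim_ext; [|apply (proj1 HF 1%nat (le_n _))]. exists 0%nat. intros M _. apply cavg_ext. intros j _.
    simpl Cpow. field. }
  set (f := fun m => (INR m - R)%C). set (g := fun m => (- INR m - R)%C).
  set (l := map f mem ++ map g mem).
  assert (Hf : forall m n, f m = f n -> m = n).
  { intros m n E. unfold f in E. apply INR_eq, RtoC_inj.
    replace (RtoC (INR m)) with (INR m - R + R)%C by ring. rewrite E. ring. }
  assert (Hg : forall m n, g m = g n -> m = n).
  { intros m n E. unfold g in E. apply INR_eq, RtoC_inj.
    replace (RtoC (INR m)) with (- (- INR m - R + R))%C by ring. rewrite E. ring. }
  assert (Hfg : forall m n, (0 < m)%nat -> f m <> g n).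
  { intros m n Hm E. unfold f, g in E. apply (f_equal fst) in E. simpl in E.
    generalize (lt_0_INR m Hm) (pos_INR n). lra. }
  assert (Hnd : NoDup mem) by apply NoDup_members.
  assert (Hndl : NoDup l).
  { unfold l. apply NoDup_app; try (apply Injective_map_NoDup; [exact Hf || exact Hg|exact Hnd]).
    intros b Hb Hc. apply in_map_iff in Hb, Hc. destruct Hb as [m [<- Hm]]. destruct Hc as [n [E Hn]].
    symmetry in E. apply Hfg in E; auto. }
  assert (Hmodf : forall m, Cmod (f m) = Rabs (INR m - R)) by (intros; unfold f; rewrite <- RtoC_minus; apply Cmod_R).
  assert (Hmodg : forall m, Cmod (g m) = INR m + R).
  { intros. unfold g. rewrite <- RtoC_opp, <- RtoC_minus, Cmod_R.
    replace (- INR m - R) with (- (INR m + R)) by ring. rewrite Rabs_Ropp. apply Rabs_pos_eq. generalize (pos_INR m); lra. }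
  assert (Hl : forall b, In b l -> Cmod b <> R).
  { intros b Hb. unfold l in Hb. apply in_app_or in Hb. destruct Hb as [Hb|Hb]; apply in_map_iff in Hb; destruct Hb as [m [<- Hm]].
    - rewrite Hmodf. assert (0 < INR m) by (apply lt_0_INR; auto). specialize (H2R m).
      unfold Rabs. destruct (Rcase_abs (INR m - R)); lra.
    - rewrite Hmodg. assert (0 < INR m) by (apply lt_0_INR; auto). lra. }
  set (Q := cprod mem (fun n => - (INR n * INR n))%C).
  assert (HQ : Q <> 0%C).
  { apply cprod_neq0. intros n Hn E. apply (Cmult_neq_0 (INR n) (INR n)); try (now apply INR_C_neq0, Hmem).
    replace (INR n * INR n)%C with (- - (INR n * INR n))%C by ring. rewrite E. ring. }
  assert (HE : forall v, cprod l (fun b => v - b)%C = (Q * even_product P X (R + v))%C).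
  { intros v. unfold l, Q, even_product. fold mem. rewrite cprod_app, !cprod_map, <- !cprod_mult.
    apply cprod_ext. intros n Hn. unfold f, g. field. now apply INR_C_neq0, Hmem. }
  assert (Hlnil : l <> nil) by (unfold l; destruct mem; [congruence|discriminate]).
  assert (RF := clim_scal Q _ _ (residue_formula R F l HR HF Hndl Hlnil Hl)).
  replace (- / 2 * csum mem (fun m => if Rlt_dec (INR m) (2 * R) then INR m / other_factors P X m * F (INR m - R) else 0))%C
    with (Q * csum l (fun b => weight l b * (if Rlt_dec (Cmod b) R then F b else 0)))%C.
  - eapply clim_ext; [|exact RF]. exists 0%nat. intros M _. rewrite <- cavg_scal. apply cavg_ext. intros j _.
    assert (Hz : cprod l (fun b => R * cis (root_angle M j) - b)%C <> 0%C).
    { apply cprod_neq0. intros b Hb. apply Cneq_of_Cmod. rewrite Cmod_circle by lra. intros E. now apply (Hl b). }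
    rewrite HE in *. field. split; [|exact HQ]. intros E. apply Hz. rewrite E. ring.
  - unfold l at 1. rewrite csum_app, !csum_map.
    rewrite (csum_0 mem (fun x => weight l (g x) * (if Rlt_dec (Cmod (g x)) R then F (g x) else 0))%C).
    2:{ intros m Hm. destruct (Rlt_dec (Cmod (g m)) R) as [H|]; [|ring]. rewrite Hmodg in H. generalize (pos_INR m). lra. }
    rewrite Cplus_0_r, <- !csum_scal. apply csum_ext. intros m Hm.
    assert (Hm0 := Hmem m Hm). assert (Hmp : 0 < INR m) by (apply lt_0_INR; auto).
    destruct (Rlt_dec (Cmod (f m)) R) as [H1|H1]; rewrite Hmodf in H1;
      destruct (Rlt_dec (INR m) (2 * R)) as [H2|H2]; try ring;
      try (exfalso; unfold Rabs in H1; destruct (Rcase_abs (INR m - R)); lra).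
    fold (f m). rewrite !Cmult_assoc. f_equal.
    unfold weight, l. rewrite remove_app, (remove_map_inj Nat.eq_dec) by (intros; auto).
    rewrite (notin_remove _ (map g mem)) by (intros Hc; apply in_map_iff in Hc; destruct Hc as [n [E Hn]]; symmetry in E; apply Hfg in E; auto).
    rewrite cprod_app, !cprod_map. unfold Q. rewrite (cprod_remove mem m) by auto.
    rewrite (cprod_remove mem m (fun n => f m - g n)%C) by auto.
    set (rem := remove Nat.eq_dec m mem).
    assert (Hrem : forall n, In n rem -> (0 < n)%nat /\ n <> m) by (intros n Hn; apply in_remove in Hn; destruct Hn; auto).
    assert (EO := other_factors_remove P X m). fold mem in EO. fold rem in EO.
    assert (NO : RtoC (other_factors P X m) <> 0%C) by (intros E; apply RtoC_inj in E; now apply (other_factors_neq0 P X m)).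
    set (Qr := cprod rem (fun n => - (INR n * INR n))%C).
    assert (HQr : Qr <> 0%C).
    { apply cprod_neq0. intros n Hn E. apply (Cmult_neq_0 (INR n) (INR n)); try (now apply INR_C_neq0, Hrem).
      replace (INR n * INR n)%C with (- - (INR n * INR n))%C by ring. rewrite E. ring. }
    assert (EP : (cprod rem (fun n => f m - f n) * cprod rem (fun n => f m - g n) = Qr * other_factors P X m)%C).
    { rewrite EO. unfold Qr. rewrite <- !cprod_mult. apply cprod_ext. intros n Hn. unfold f, g. field. now apply INR_C_neq0, Hrem. }
    assert (Eg : (f m - g m = 2 * INR m)%C) by (unfold f, g; ring). rewrite Eg.
    replace (cprod rem (fun n => f m - f n) * (2 * INR m * cprod rem (fun n => f m - g n)))%C with (2 * INR m * (Qr * other_factors P X m))%C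
      by (rewrite <- EP; ring).
    field. repeat split; auto; try (now apply INR_C_neq0).
Qed.

(** * Binomial coefficients at complex arguments, and a mean over the circle *)

(** [(r + j) / (j + 1) <= 1 + r / k] with [k = j + 1], and [u * (1 + r / k) <= max 1 (J / k)] for [J = u / (1 - u) * r];
   the product of the [J / k] over [k <= J] is a term of the series of [exp J]. *)
Lemma rising_product_bound u r n : 0 < u < 1 -> 0 <= r ->
  rprod (seq 0 n) (fun j => (r + INR j) / (INR j + 1)) <= (/ u) ^ n * exp (u / (1 - u) * r).
Proof.
  intros Hu Hr. set (J := u / (1 - u) * r).
  assert (Hk : 0 < u / (1 - u)) by (apply Rdiv_lt_0_compat; lra).
  assert (HJ : 0 <= J) by (unfold J; nra).
  assert (Hiu : 0 < / u) by (apply Rinv_0_lt_compat; lra).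
  assert (Fact : forall j, 0 <= (r + INR j) / (INR j + 1) <= / u * Rmax 1 (J / (INR j + 1))).
  { intros j. assert (Hj := pos_INR j). split.
    - apply Rmult_le_pos; [lra|]. apply Rlt_le, Rinv_0_lt_compat; lra.
    - apply Rmult_le_reg_l with (u * (INR j + 1)); [nra|].
      replace (u * (INR j + 1) * ((r + INR j) / (INR j + 1))) with (u * (r + INR j)) by (field; lra).
      replace (u * (INR j + 1) * (/ u * Rmax 1 (J / (INR j + 1)))) with ((INR j + 1) * Rmax 1 (J / (INR j + 1))) by (field; lra).
      assert (EJ : u * r = (1 - u) * J) by (unfold J; field; lra).
      destruct (Rle_lt_dec J (INR j + 1)).
      + assert (1 <= Rmax 1 (J / (INR j + 1))) by apply Rmax_l. nra.
      + assert (J / (INR j + 1) <= Rmax 1 (J / (INR j + 1))) by apply Rmax_r.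
        assert (J = (INR j + 1) * (J / (INR j + 1))) by (field; lra).
        assert (J <= (INR j + 1) * Rmax 1 (J / (INR j + 1))) by (rewrite H0 at 1; apply Rmult_le_compat_l; lra). nra. }
  assert (G : forall n, (INR n <= J -> rprod (seq 0 n) (fun j => Rmax 1 (J / (INR j + 1))) = J ^ n / INR (Factorial.fact n)) /\
     0 < rprod (seq 0 n) (fun j => Rmax 1 (J / (INR j + 1))) <= exp J).
  { induction n0 as [|k [IH1 IH2]].
    - simpl. split; [intros; field|]. split; [lra|]. rewrite <- exp_0. now apply exp_le.
    - rewrite seq_S, rprod_app. cbn [rprod Nat.add]. rewrite Rmult_1_r.
      assert (Hk0 := pos_INR k). assert (HF : 0 < INR (Factorial.fact k)) by (apply lt_0_INR, Factorial.lt_O_fact).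
      assert (Emax : forall b, 1 <= b -> Rmax 1 b = b) by (intros; apply Rmax_right; auto).
      destruct (Rle_lt_dec (INR k + 1) J) as [H|H].
      + rewrite IH1 by lra. rewrite Emax.
        2:{ apply Rmult_le_reg_r with (INR k + 1); [lra|]. unfold Rdiv. rewrite Rmult_assoc, Rinv_l; lra. }
        assert (E : J ^ k / INR (Factorial.fact k) * (J / (INR k + 1)) = J ^ S k / INR (Factorial.fact (S k))).
        { rewrite fact_simpl, mult_INR, S_INR. simpl pow. field. split; lra. }
        rewrite E. split; [auto|]. split; [|now apply pow_div_fact_le_exp].
        apply Rdiv_lt_0_compat; [apply pow_lt; lra|]. apply lt_0_INR, Factorial.lt_O_fact.
      + split; [rewrite S_INR; lra|]. rewrite Rmax_left; [now rewrite Rmult_1_r|].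
        apply Rle_div_l; [lra|lra]. }
  eapply Rle_trans; [apply rprod_le; intros j _; apply Fact|].
  rewrite rprod_mult, rprod_const, length_seq. apply Rmult_le_compat_l; [apply pow_le; lra|]. apply G.
Qed.

(** The binomial coefficient as a polynomial in its upper argument. *)
Definition cbinom (w : C) (n : nat) : C := cprod (seq 0 n) (fun j => (w - INR j) / (INR j + 1))%C.

Lemma INR_p1_neq0 j : (RtoC (INR j) + 1)%C <> 0%C.
Proof. rewrite <- RtoC_plus. intros E. apply RtoC_inj in E. generalize (pos_INR j). lra. Qed.

Lemma cbinom_INR m n : cbinom (INR m) n = RtoC (INR (bin m n)).
Proof.
  induction n as [|n IH].
  - rewrite bin_0_r. reflexivity.
  - unfold cbinom in *. rewrite seq_S, cprod_app, IH. cbn [cprod Nat.add]. rewrite Cmult_1_r.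
    destruct (le_lt_dec n m) as [H|H].
    + assert (E := f_equal INR (bin_absorb m n H)). rewrite !mult_INR, minus_INR, S_INR in E by auto.
      assert (Hn := pos_INR n).
      rewrite <- RtoC_minus, <- RtoC_plus, <- RtoC_div, <- RtoC_mult by lra. f_equal.
      apply Rmult_eq_reg_l with (INR n + 1); [|lra]. rewrite E. field. lra.
    + rewrite !bin_gt by lia. simpl (INR 0). ring.
Qed.

(** With [u] close to [0] the exponential factor is mild and [u ^ - n] large: the parameter trades one for the other. *)
Lemma Cmod_cbinom u w n : 0 < u < 1 -> Cmod (cbinom w n) <= (/ u) ^ n * exp (u / (1 - u) * Cmod w).
Proof.
  intros Hu. unfold cbinom. rewrite Cmod_cprod. eapply Rle_trans; [|apply rising_product_bound; [auto|apply Cmod_ge_0]].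
  apply rprod_le. intros j _. split; [apply Cmod_ge_0|]. assert (Hj := pos_INR j).
  rewrite Cmod_div by apply INR_p1_neq0. rewrite <- RtoC_plus, (Cmod_R (INR j + 1)), Rabs_pos_eq by lra.
  unfold Rdiv. apply Rmult_le_compat_r; [apply Rlt_le, Rinv_0_lt_compat; lra|].
  eapply Rle_trans; [apply Cmod_triangle|]. rewrite Cmod_opp, Cmod_R, Rabs_pos_eq by auto. lra.
Qed.

Lemma has_residues_binomial_exp R al n : 0 < R ->
  has_residues R (fun v => cbinom (R + v) n * Cexp (al * (R + v - INR n)))%C.
Proof.
  intros HR.
  assert (H1 := has_residues_exp R al (fun _ => 1%C) 1 HR (has_residues_1 R HR) (fun v _ => Req_le _ _ Cmod_1)).
  assert (H2 := has_residues_scal R (Cexp (al * (R - INR n))) _ HR H1).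
  assert (H3 := has_residues_prod R (seq 0 n) (fun j => (R - INR j) / (INR j + 1))%C (fun j => / (INR j + 1))%C _ HR H2).
  eapply has_residues_ext; [|exact H3]. intros v. cbn beta. unfold cbinom. f_equal.
  - apply cprod_ext. intros j _. field. apply INR_p1_neq0.
  - rewrite Cmult_1_r, <- Cexp_plus. f_equal. ring.
Qed.

(** [R / |v + R + 1| ^ 2] is a multiple of a Poisson kernel: on the circle it is a combination of [b / (v + b)] and
   [R ^ 2 / (R ^ 2 + b * v)], [b = R + 1], and its mean is [R / (b ^ 2 - R ^ 2) = R / (2 * R + 1)]. *)
Lemma circle_mean_bound R : 0 < R -> exists M0, forall M, (M0 <= M)%nat ->
  / INR M * rsum (seq 0 M) (fun j => R / Cmod (R * cis (root_angle M j) + R + 1)%C ^ 2) <= 1.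
Proof.
  intros HR. set (b := R + 1).
  assert (Hres := proj2 (has_residues_1 R HR)).
  assert (L1 := Hres (- b)%C). assert (L2 := Hres (RtoC (- (R ^ 2 / b)))).
  assert (Hq : R ^ 2 / b < R).
  { apply Rlt_div_l; [unfold b; lra|]. unfold b. nra. }
  assert (Hq0 : 0 < R ^ 2 / b) by (apply Rdiv_lt_0_compat; [nra|unfold b; lra]).
  assert (M1 : Cmod (- b)%C = b) by (rewrite Cmod_opp, Cmod_R, Rabs_pos_eq by (unfold b; lra); reflexivity).
  assert (M2 : Cmod (RtoC (- (R ^ 2 / b))) = R ^ 2 / b) by (rewrite Cmod_R, Rabs_Ropp, Rabs_pos_eq by lra; reflexivity).
  rewrite M1 in L1. rewrite M2 in L2. specialize (L1 ltac:(unfold b; lra)). specialize (L2 ltac:(lra)).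
  destruct (Rlt_dec b R) as [Hc|_]; [unfold b in Hc; lra|]. destruct (Rlt_dec (R ^ 2 / b) R) as [_|Hc]; [|lra].
  assert (L3 := clim_plus _ _ _ _ L2 (clim_scal (-1) _ _ L1)).
  assert (L4 := clim_scal (R / (b ^ 2 - R ^ 2)) _ _ L3).
  replace (R / (b ^ 2 - R ^ 2) * (1 + -1 * 0))%C with (RtoC (R / (2 * R + 1))) in L4.
  2:{ replace (b ^ 2 - R ^ 2)%C with (RtoC (2 * R + 1)).
      - rewrite RtoC_div by lra. ring.
      - rewrite <- !RtoC_pow, <- RtoC_minus. f_equal. unfold b. ring. }
  destruct (L4 (1 / 2) ltac:(lra)) as [M0 HM]. exists (S M0). intros M HMM. specialize (HM M ltac:(lia)).
  set (s := rsum (seq 0 M) (fun j => R / Cmod (R * cis (root_angle M j) + R + 1)%C ^ 2)).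
  assert (E : (R / (b ^ 2 - R ^ 2) * (cavg M (fun t => R * cis t * 1 / (R * cis t - RtoC (- (R ^ 2 / b)))) +
      -1 * cavg M (fun t => R * cis t * 1 / (R * cis t - - b))))%C = RtoC (/ INR M * s)).
  { rewrite <- cavg_scal, <- cavg_plus, <- cavg_scal. unfold cavg, s.
    assert (HMp : INR M <> 0) by (apply not_0_INR; lia).
    rewrite RtoC_mult, RtoC_inv by auto. f_equal.
    assert (Real : forall l f, RtoC (rsum l f) = csum l (fun j : nat => RtoC (f j))).
    { induction l as [|x l IH]; intros h; [reflexivity|]. cbn [rsum csum]. now rewrite RtoC_plus, IH. }
    rewrite Real. apply csum_ext. intros j _. set (v := (R * cis (root_angle M j))%C).
    assert (Hv : Cmod v = R) by (apply Cmod_circle; lra).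
    assert (Nb : (v + b)%C <> 0%C).
    { intros E. assert (Cmod (v + b) = 0) by (rewrite E; apply Cmod_0). generalize (Cmod_sub_le (RtoC b) (- v)).
      replace (b - - v)%C with (v + b)%C by ring. rewrite Cmod_opp, Hv, Cmod_R, Rabs_pos_eq by (unfold b; lra). unfold b in *. lra. }
    assert (Nc : (b * v + R ^ 2)%C <> 0%C).
    { intros E. assert (E2 : Cmod (b * v) = Cmod (- (R ^ 2))%C).
      { f_equal. replace (b * v)%C with (b * v + R ^ 2 - R ^ 2)%C by ring. rewrite E. ring. }
      rewrite Cmod_opp, Cmod_mult, Hv, <- RtoC_pow, !Cmod_R, !Rabs_pos_eq in E2 by (unfold b; nra). unfold b in E2. nra. }
    assert (Bn : RtoC b <> 0%C) by (intros E; apply RtoC_inj in E; unfold b in E; lra).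
    assert (Dn : (b ^ 2 - R ^ 2)%C <> 0%C).
    { rewrite <- !RtoC_pow, <- RtoC_minus. intros E. apply RtoC_inj in E. unfold b in E. nra. }
    (* [|v + b| ^ 2 = (v + b) * (R ^ 2 / v + b)] on the circle. *)
    assert (Sq : (RtoC (Cmod (v + R + 1) ^ 2) * v = (v + b) * (R ^ 2 + b * v))%C).
    { replace (v + R + 1)%C with (v + b)%C by (unfold b; rewrite RtoC_plus; ring).
      assert (HS := Cmod_sqr v). rewrite Hv in HS. assert (HS2 := Cmod_sqr (v + b)%C).
      replace (Cmod (v + b) ^ 2) with (Cmod (v + b) * Cmod (v + b)) by ring. rewrite HS2, <- RtoC_pow.
      replace (R ^ 2) with (R * R) by ring. rewrite HS. destruct v as [v1 v2]. unfold RtoC, Cmult, Cplus; simpl. f_equal; ring. }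
    assert (Nv : v <> 0%C) by (intros E; rewrite E, Cmod_0 in Hv; lra).
    assert (Nm : RtoC (Cmod (v + R + 1) ^ 2) <> 0%C).
    { intros E. rewrite E, Cmult_0_l in Sq. symmetry in Sq. apply Cmult_neq_0 in Sq; auto.
      replace (R ^ 2 + b * v)%C with (b * v + R ^ 2)%C by ring. auto. }
    rewrite RtoC_div by (intros E; apply Nm; now rewrite E).
    replace (RtoC (Cmod (v + R + 1) ^ 2)) with ((v + b) * (R ^ 2 + b * v) / v)%C by (rewrite <- Sq; field; auto).
    rewrite RtoC_opp, RtoC_div, RtoC_pow by (unfold b; lra).
    field. repeat split; auto. replace (R ^ 2 + b * v)%C with (b * v + R ^ 2)%C by ring. auto. }
  rewrite E in HM. rewrite <- RtoC_minus, Cmod_R in HM. apply Rabs_def2 in HM.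
  assert (R / (2 * R + 1) <= 1 / 2).
  { apply Rle_div_l; [lra|]. lra. }
  lra.
Qed.

(** * Growth of the Taylor coefficients at an interior point *)

Lemma exp_neg_le_square del s : 0 < del -> 0 <= s ->
  exp (- (del * s)) <= / (Rmin (1 / 2) (del / 2) ^ 2) * / (2 + s) ^ 2.
Proof.
  intros Hd Hs. set (mu := Rmin (1 / 2) (del / 2)).
  assert (Hmu : 0 < mu) by (apply Rmin_pos; lra).
  assert (H1 : mu <= 1 / 2) by apply Rmin_l. assert (H2 : mu <= del / 2) by apply Rmin_r.
  rewrite <- Rinv_mult, exp_Ropp. apply Rinv_le_contravar; [apply Rmult_lt_0_compat; apply pow_lt; lra|].
  rewrite <- Rpow_mult_distr. replace (del * s) with (INR 2 * (del * s / 2)) by (simpl; field). rewrite exp_INR_mult.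
  apply pow_incr. split; [nra|]. eapply Rle_trans; [|apply exp_ineq1_le]. nra.
Qed.

(** The circle [|w - R| = R] crosses the real axis at [0] and at the half-integer [2 * R]. *)
Lemma separated_from_integers R N m (v : C) : 2 * R = INR N + 1 / 2 -> Cmod v = R -> (0 < m)%nat ->
  1 / 4 <= Cmod (R + v - INR m)%C.
Proof.
  intros HR Hv Hm. assert (HN := pos_INR N). assert (Hm1 : 1 <= INR m) by (apply INR_ge1; lia).
  assert (E : Cmod (INR m - R)%C = Rabs (INR m - R)) by (rewrite <- RtoC_minus; apply Cmod_R).
  assert (S1 := Cmod_sub_le v (INR m - R)%C). assert (S2 := Cmod_sub_le (INR m - R)%C v).
  rewrite (Cmod_sym (INR m - R) v) in S2. replace (v - (INR m - R))%C with (R + v - INR m)%C in S1, S2 by ring.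
  rewrite Hv, E in S1, S2.
  destruct (le_lt_dec m N) as [H|H].
  - assert (INR m <= INR N) by (apply le_INR; auto).
    assert (Rabs (INR m - R) <= R - 1 / 2); [|lra]. apply Rabs_le. lra.
  - assert (INR (S N) <= INR m) by (apply le_INR; lia). rewrite S_INR in H0.
    generalize (Rle_abs (INR m - R)). lra.
Qed.

(** [1 / G] contributes [exp (- c * |y| + p / 2 * x)] and [z0 ^ w] contributes [exp (|theta| * |y| - p * x)]. For [x <= 1] the
   bound on [cbinom] with the given [u] leaves a decay in [|y|], which is integrable along the circle with a constant
   independent of [n]. For [x > 1] a much smaller [u'] is used: its power [u' ^ - n] is harmless because
   [|w| >= sqrt (2 * R)] there, so that this part tends to [0] as [R] grows. *)
Lemma integrand_bound P d c theta p u : balanced P d -> 0 < d <= 1 -> 0 <= c < PI * d -> Rabs theta < c -> 0 < p ->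
  0 < u < 1 -> u / (1 - u) < c - Rabs theta ->
  exists C1, 0 <= C1 /\ forall n, exists K del, 0 <= K /\ 0 < del /\ forall R N, 2 * R = INR N + 1 / 2 ->
    exists X0, forall X v, X0 <= INR X -> Cmod v = R ->
      Cmod (v * (cbinom (R + v) n * Cexp (((- p)%R, theta) * (R + v - INR n))) / even_product P X (R + v))%C
      <= C1 * (/ (u * exp (- p))) ^ n * (R / Cmod (v + R + 1)%C ^ 2) + R * K * exp (- (del * sqrt (2 * R))).
Proof.
  intros HB Hd Hc Hth Hp Hu Hku. set (sg := c - Rabs theta) in *. set (ka := u / (1 - u)) in *.
  assert (Hka : 0 < ka) by (apply Rdiv_lt_0_compat; lra).
  destruct (even_product_lower P d c (p / 2) HB Hd Hc ltac:(lra)) as [A [HA HG]].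
  set (mu := Rmin (1 / 2) ((sg - ka) / 2)). assert (Hmu : 0 < mu) by (apply Rmin_pos; lra).
  exists (exp (A + ka) * / mu ^ 2).
  assert (Him : 0 < / mu ^ 2) by (apply Rinv_0_lt_compat, pow_lt; auto).
  split. { apply Rmult_le_pos; [apply Rlt_le, exp_pos|lra]. }
  intros n. set (del := Rmin (p / 4) (sg / 2)). assert (Hdel : 0 < del) by (apply Rmin_pos; lra).
  assert (Hd1 : del <= p / 4) by apply Rmin_l. assert (Hd2 : del <= sg / 2) by apply Rmin_r.
  (* Chosen so that [u' / (1 - u') = del]. *)
  set (u' := del / (1 + del)).
  assert (Hu' : 0 < u' < 1).
  { unfold u'. split; [apply Rdiv_lt_0_compat; lra|]. apply Rlt_div_l; [lra|lra]. }
  assert (Eu' : u' / (1 - u') = del) by (unfold u'; field; lra).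
  assert (Hiu' : 0 < / u') by (apply Rinv_0_lt_compat; lra). assert (Hiu : 0 < / u) by (apply Rinv_0_lt_compat; lra).
  exists (exp (p * INR n + A) * (/ u') ^ n), del.
  split; [apply Rmult_le_pos; [apply Rlt_le, exp_pos|apply pow_le; lra]|]. split; [auto|].
  intros R N HR. assert (HR0 : 0 < R) by (generalize (pos_INR N); lra).
  destruct (HG (2 * R)) as [X0 HX0]. exists X0. intros X v HX Hv.
  set (w := (R + v)%C). set (x := fst w). set (y := snd w).
  assert (Hvx : Rabs (fst v) <= R) by (rewrite <- Hv; apply Rabs_fst_le).
  assert (Hvy : Rabs (snd v) <= R) by (rewrite <- Hv; apply Rabs_snd_le).
  assert (Ex : x = R + fst v) by reflexivity. assert (Ey : y = snd v) by (unfold y, w; simpl; ring).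
  assert (Hx : 0 <= x <= 2 * R) by (apply Rabs_le_between in Hvx; lra).
  assert (Hy : Rabs y <= 2 * R) by (rewrite Ey; lra).
  assert (HGl := HX0 X w HX Hx Hy). fold x y in HGl.
  assert (HGl' : exp (c * Rabs y - p / 2 * x - A) <= Cmod (even_product P X w)).
  { apply HGl. intros m Hm. apply (separated_from_integers R N); auto.
    destruct m; [exfalso; now apply (proj1 HB)|lia]. }
  clear HGl. set (G := even_product P X w) in *.
  assert (HG0 : 0 < Cmod G) by (eapply Rlt_le_trans; [apply exp_pos|exact HGl']).
  assert (Gnz : G <> 0%C) by (intros E; rewrite E, Cmod_0 in HG0; lra).
  assert (HE : Cmod (Cexp (((- p)%R, theta) * (w - INR n))) <= exp (p * INR n - p * x + Rabs theta * Rabs y)).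
  { rewrite Cmod_Cexp. apply exp_le.
    replace (fst (((- p)%R, theta) * (w - INR n))%C) with (p * INR n - p * x - theta * y) by (unfold x, y; destruct w; simpl; ring).
    rewrite <- Rabs_mult. generalize (Rle_abs (- (theta * y))). rewrite Rabs_Ropp. lra. }
  assert (Core : Cmod (Cexp (((- p)%R, theta) * (w - INR n))) * / Cmod G <= exp (p * INR n + A) * exp (- (p / 2 * x) - sg * Rabs y)).
  { apply Rle_trans with (exp (p * INR n - p * x + Rabs theta * Rabs y) * / exp (c * Rabs y - p / 2 * x - A)).
    - apply Rmult_le_compat; [apply Cmod_ge_0|apply Rlt_le, Rinv_0_lt_compat; auto|auto|].
      apply Rinv_le_contravar; [apply exp_pos|auto].
    - rewrite <- exp_Ropp, <- !exp_plus. apply exp_le. unfold sg. lra. }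
  assert (Ew : Cmod (v * (cbinom w n * Cexp (((- p)%R, theta) * (w - INR n))) / G)%C
     = R * Cmod (cbinom w n) * (Cmod (Cexp (((- p)%R, theta) * (w - INR n))) * / Cmod G)).
  { rewrite Cmod_div by auto. rewrite !Cmod_mult, Hv. unfold Rdiv. ring. }
  rewrite Ew. clear Ew.
  assert (Hw1 : Cmod w <= x + Rabs y).
  { generalize (Cmod_le_abs w). fold x y. rewrite (Rabs_pos_eq x); lra. }
  assert (HB0 : 0 <= R * Cmod (cbinom w n)) by (apply Rmult_le_pos; [lra|apply Cmod_ge_0]).
  assert (Hy0 := Rabs_pos y).
  assert (T1 : 0 <= exp (A + ka) * / mu ^ 2 * (/ (u * exp (- p))) ^ n * (R / Cmod (v + R + 1)%C ^ 2)).
  { repeat apply Rmult_le_pos; try lra; try (apply Rlt_le, exp_pos).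
    - apply pow_le, Rlt_le, Rinv_0_lt_compat, Rmult_lt_0_compat; [lra|apply exp_pos].
    - apply Rlt_le, Rinv_0_lt_compat, pow_lt, Cmod_gt_0. intros E. apply (f_equal fst) in E. simpl in E. lra. }
  assert (T2 : 0 <= R * (exp (p * INR n + A) * (/ u') ^ n) * exp (- (del * sqrt (2 * R)))).
  { repeat apply Rmult_le_pos; try lra; try (apply Rlt_le, exp_pos). apply pow_le; lra. }
  destruct (Rle_lt_dec x 1) as [Hx1|Hx1].
  - apply Rle_trans with (exp (A + ka) * / mu ^ 2 * (/ (u * exp (- p))) ^ n * (R / Cmod (v + R + 1)%C ^ 2)); [|lra].
    apply Rle_trans with (R * ((/ u) ^ n * exp (ka * Cmod w)) * (exp (p * INR n + A) * exp (- (p / 2 * x) - sg * Rabs y))).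
    + apply Rmult_le_compat; auto.
      * apply Rmult_le_pos; [apply Cmod_ge_0|apply Rlt_le, Rinv_0_lt_compat; auto].
      * apply Rmult_le_compat_l; [lra|]. apply Cmod_cbinom; auto.
    + assert (Hw2 : Cmod (v + R + 1)%C <= 2 + Rabs y).
      { eapply Rle_trans; [apply Cmod_triangle|]. rewrite Cmod_1. replace (v + R)%C with w by (unfold w; ring). lra. }
      assert (Hw3 : 0 < Cmod (v + R + 1)%C).
      { apply Cmod_gt_0. intros E. apply (f_equal fst) in E. simpl in E. lra. }
      assert (HS := exp_neg_le_square (sg - ka) (Rabs y) ltac:(lra) Hy0). fold mu in HS.
      assert (HS2 : exp (- ((sg - ka) * Rabs y)) <= / mu ^ 2 * / Cmod (v + R + 1)%C ^ 2).
      { eapply Rle_trans; [exact HS|]. apply Rmult_le_compat_l; [lra|]. apply Rinv_le_contravar; [apply pow_lt; auto|].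
        apply pow_incr. lra. }
      assert (EX : exp (ka * Cmod w) * (exp (p * INR n + A) * exp (- (p / 2 * x) - sg * Rabs y)) <=
         exp (A + ka) * exp (p * INR n) * exp (- ((sg - ka) * Rabs y))).
      { rewrite <- !exp_plus. apply exp_le. assert (ka * Cmod w <= ka * (1 + Rabs y)) by (apply Rmult_le_compat_l; lra). nra. }
      assert (Eq : (/ (u * exp (- p))) ^ n = (/ u) ^ n * exp (p * INR n)).
      { rewrite Rinv_mult, exp_Ropp, Rinv_inv, Rpow_mult_distr. f_equal. rewrite Rmult_comm, exp_INR_mult. reflexivity. }
      rewrite Eq.
      assert (Hun : 0 <= (/ u) ^ n) by (apply pow_le; lra).
      apply Rle_trans with (R * (/ u) ^ n * (exp (A + ka) * exp (p * INR n) * exp (- ((sg - ka) * Rabs y)))).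
      * replace (R * ((/ u) ^ n * exp (ka * Cmod w)) * (exp (p * INR n + A) * exp (- (p / 2 * x) - sg * Rabs y)))
          with (R * (/ u) ^ n * (exp (ka * Cmod w) * (exp (p * INR n + A) * exp (- (p / 2 * x) - sg * Rabs y)))) by ring.
        apply Rmult_le_compat_l; [apply Rmult_le_pos; lra|auto].
      * apply Rle_trans with (R * (/ u) ^ n * (exp (A + ka) * exp (p * INR n) * (/ mu ^ 2 * / Cmod (v + R + 1)%C ^ 2))); [|right; unfold Rdiv; ring].
        apply Rmult_le_compat_l; [apply Rmult_le_pos; lra|]. apply Rmult_le_compat_l; [|auto].
        apply Rmult_le_pos; apply Rlt_le, exp_pos.
  - apply Rle_trans with (R * (exp (p * INR n + A) * (/ u') ^ n) * exp (- (del * sqrt (2 * R)))); [|lra].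
    apply Rle_trans with (R * ((/ u') ^ n * exp (del * Cmod w)) * (exp (p * INR n + A) * exp (- (p / 2 * x) - sg * Rabs y))).
    + apply Rmult_le_compat; auto.
      * apply Rmult_le_pos; [apply Cmod_ge_0|apply Rlt_le, Rinv_0_lt_compat; auto].
      * apply Rmult_le_compat_l; [lra|]. rewrite <- Eu' at 1. apply Cmod_cbinom; auto.
    + assert (Hsq : sqrt (2 * R) <= Cmod w).
      { apply Rsqr_incr_0_var; [|apply Cmod_ge_0]. rewrite Rsqr_sqrt by lra. unfold Rsqr. rewrite Cmod_sqr. fold x y.
        assert (HS := Cmod_sqr v). rewrite Hv in HS. rewrite Ey.
        assert (x * x + snd v * snd v = 2 * R * x) by (rewrite Ex; lra). nra. }
      assert (EX : exp (del * Cmod w) * exp (- (p / 2 * x) - sg * Rabs y) <= exp (- (del * sqrt (2 * R)))).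
      { rewrite <- exp_plus. apply exp_le.
        assert (del * sqrt (2 * R) <= del * Cmod w) by (apply Rmult_le_compat_l; lra).
        assert (del * Cmod w <= del * (x + Rabs y)) by (apply Rmult_le_compat_l; lra). nra. }
      replace (R * ((/ u') ^ n * exp (del * Cmod w)) * (exp (p * INR n + A) * exp (- (p / 2 * x) - sg * Rabs y)))
        with (R * (exp (p * INR n + A) * (/ u') ^ n) * (exp (del * Cmod w) * exp (- (p / 2 * x) - sg * Rabs y))) by ring.
      apply Rmult_le_compat_l; [|auto]. repeat apply Rmult_le_pos; try lra; try (apply Rlt_le, exp_pos). apply pow_le; lra.
Qed.

Lemma csum_members P X (f : nat -> C) : (forall m, ~ P m -> f m = 0%C) -> ~ P 0%nat ->
  csum (seq 0 (S X)) f = csum (members P X) f.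
Proof.
  intros Hf HP. induction X as [|X IH].
  - simpl. rewrite (Hf 0%nat) by auto. ring.
  - rewrite csum_S, IH, members_S, csum_app. f_equal.
    destruct (excluded_middle_informative (P (S X))) as [H|H]; cbn [csum]; [ring|auto].
Qed.

Lemma sqrt_exp_small del K eps : 0 < del -> 0 <= K -> 0 < eps ->
  exists R0, forall R, R0 <= R -> 0 < R -> R * K * exp (- (del * sqrt (2 * R))) <= eps.
Proof.
  intros Hd HK He. set (s0 := 27 * (K + 1) / (del ^ 3 * eps)).
  assert (Hd3 : 0 < del ^ 3) by (apply pow_lt; auto).
  assert (Hs0 : 0 < s0) by (apply Rdiv_lt_0_compat; nra).
  exists (s0 * s0). intros R HR HR0. set (s := sqrt (2 * R)).
  assert (Hss : s * s = 2 * R) by (apply sqrt_sqrt; lra).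
  assert (Hs : s0 <= s).
  { unfold s. rewrite <- (sqrt_square s0) by lra. apply sqrt_le_1_alt. nra. }
  assert (E : (del * s / 3) ^ 3 <= exp (del * s)).
  { replace (del * s) with (INR 3 * (del * s / 3)) at 2 by (simpl; field). rewrite exp_INR_mult. apply pow_incr.
    split; [apply Rmult_le_pos; [nra|lra]|]. generalize (exp_ineq1_le (del * s / 3)). lra. }
  rewrite exp_Ropp. apply Rmult_le_reg_r with (exp (del * s)); [apply exp_pos|].
  rewrite Rmult_assoc, Rinv_l, Rmult_1_r by (generalize (exp_pos (del * s)); lra).
  apply Rle_trans with (eps * (del * s / 3) ^ 3); [|apply Rmult_le_compat_l; lra].
  assert (E2 : del ^ 3 * eps * s0 = 27 * (K + 1)) by (unfold s0; field; split; [lra|nra]).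
  assert (E3 : 27 * (K + 1) <= del ^ 3 * eps * s) by (rewrite <- E2; apply Rmult_le_compat_l; nra).
  replace (eps * (del * s / 3) ^ 3) with (del ^ 3 * eps * s * (s * s) / 27) by field.
  rewrite Hss. nra.
Qed.

Lemma clim_RtoC u l : Un_cv u l -> clim (fun n => RtoC (u n)) (RtoC l).
Proof.
  intros H eps He. destruct (H eps He) as [N HN]. exists N. intros n Hn.
  rewrite <- RtoC_minus, Cmod_R. now apply HN.
Qed.

(** The partial sum over [m <= N] is [- 2] times the contour mean on the circle of diameter [N + 1/2]; the truncation [X] of
   the product tends to infinity first. *)
Lemma partial_sum_bound P d L c theta p u : balanced P d -> 0 < d <= 1 -> 0 <= c < PI * d -> Rabs theta < c -> 0 < p ->
  0 < u < 1 -> u / (1 - u) < c - Rabs theta ->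
  (forall m, Un_cv (fun X => other_factors P X m) (L m)) -> (forall m, L m <> 0) ->
  exists C1, 0 <= C1 /\ forall n eps, 0 < eps -> exists N1, forall N, (N1 <= N)%nat ->
    Cmod (csum (members P N) (fun m => RtoC (INR m / L m) * (cbinom (INR m) n * Cexp (((- p)%R, theta) * (INR m - INR n)))))%C
    <= C1 * (/ (u * exp (- p))) ^ n + eps.
Proof.
  intros HB Hd Hc Hth Hp Hu Hku HL HL0.
  destruct (integrand_bound P d c theta p u HB Hd Hc Hth Hp Hu Hku) as [C1 [HC1 H]].
  exists (2 * C1). split; [lra|]. intros n eps He. destruct (H n) as [K [del [HK [Hdel HI]]]].
  destruct (sqrt_exp_small del K (eps / 2) Hdel HK ltac:(lra)) as [R0 HR0].
  destruct (INR_unbounded (2 * R0)) as [N1 HN1]. exists N1. intros N HN.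
  set (R := (INR N + 1 / 2) / 2). assert (HN0 := pos_INR N). assert (HNN : INR N1 <= INR N) by (apply le_INR; auto).
  assert (HR : 0 < R) by (unfold R; lra).
  assert (H2R : 2 * R = INR N + 1 / 2) by (unfold R; field).
  specialize (HR0 R ltac:(unfold R; lra) HR).
  destruct (HI R N H2R) as [X0 HX0].
  set (q := (/ (u * exp (- p))) ^ n) in *.
  assert (Hq : 0 <= q) by (apply pow_le, Rlt_le, Rinv_0_lt_compat, Rmult_lt_0_compat; [lra|apply exp_pos]).
  set (Psi := fun w => (cbinom w n * Cexp (((- p)%R, theta) * (w - INR n)))%C).
  change (Cmod (csum (members P N) (fun m => RtoC (INR m / L m) * Psi (INR m))%C) <= 2 * C1 * q + eps).
  assert (Hlt : forall m, INR m < 2 * R <-> (m <= N)%nat).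
  { intros m. rewrite H2R. split; intros Hm.
    - assert (INR m < INR (S N)) by (rewrite S_INR; lra). apply INR_lt in H0. lia.
    - assert (INR m <= INR N) by (apply le_INR; auto). lra. }
  destruct (circle_mean_bound R HR) as [M0 HM0].
  assert (Fin : forall X, X0 <= INR X -> (N <= X)%nat ->
    Cmod (csum (members P N) (fun m => RtoC (INR m / other_factors P X m) * Psi (INR m))%C) <= 2 * C1 * q + eps).
  { intros X HX HNX.
    assert (CS := contour_sum P X (fun v => Psi (R + v)%C) R HR (has_residues_binomial_exp R ((- p)%R, theta)%C n HR)).
    assert (Hint : forall m, INR m <> 2 * R).
    { intros m Hm. assert (INR m < INR (S N)) by (rewrite S_INR; lra). assert (INR N < INR m) by lra.
      apply INR_lt in H0, H1. lia. }
    specialize (CS Hint).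
    assert (Bd := clim_Cmod_le _ _ (C1 * q + eps / 2) CS).
    assert (Es : csum (members P X) (fun m => if Rlt_dec (INR m) (2 * R) then INR m / other_factors P X m * Psi (R + (INR m - R)) else 0)%C
       = csum (members P N) (fun m => RtoC (INR m / other_factors P X m) * Psi (INR m))%C).
    { clear - HNX Hlt. assert (G : forall k Y, (forall m, In m (members P k) -> other_factors P Y m <> 0) -> csum (members P (N + k)) (fun m => if Rlt_dec (INR m) (2 * R) then INR m / other_factors P Y m * Psi (R + (INR m - R)) else 0)%C
         = csum (members P N) (fun m => RtoC (INR m / other_factors P Y m) * Psi (INR m))%C).
      { intros k Y _. induction k as [|k IH].
        - rewrite Nat.add_0_r. apply csum_ext. intros m Hm. apply in_members in Hm.
          destruct (Rlt_dec (INR m) (2 * R)) as [_|Hc]; [|exfalso; apply Hc, Hlt; lia].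
          rewrite RtoC_div by apply other_factors_neq0. f_equal. f_equal. ring.
        - rewrite Nat.add_succ_r, members_S, csum_app, IH.
          destruct (excluded_middle_informative (P (S (N + k)))); cbn [csum]; [|ring].
          destruct (Rlt_dec (INR (S (N + k))) (2 * R)) as [Hc|_]; [apply Hlt in Hc; lia|ring]. }
      replace X with (N + (X - N))%nat at 1 by lia. apply G. intros; apply other_factors_neq0. }
    cbn beta in Bd. rewrite Es in Bd. clear Es.
    set (S := csum (members P N) (fun m => RtoC (INR m / other_factors P X m) * Psi (INR m))%C) in *.
    assert (B2 : Cmod (- / 2 * S)%C <= C1 * q + eps / 2).
    { apply Bd. intros M1. exists (Datatypes.S (M1 + M0)). split; [lia|].
      eapply Rle_trans; [apply (cavg_le _ _ (fun t => C1 * q * (R / Cmod (R * cis t + R + 1)%C ^ 2) + eps / 2))|].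
      - intros j _. eapply Rle_trans; [apply HX0; [auto|apply Cmod_circle; lra]|]. lra.
      - rewrite rsum_plus, rsum_scal, rsum_const, length_seq.
        specialize (HM0 (Datatypes.S (M1 + M0)) ltac:(lia)).
        set (M := Datatypes.S (M1 + M0)) in *. assert (HMp : 0 < INR M) by (apply lt_0_INR; unfold M; lia).
        set (T := rsum (seq 0 M) _) in *. rewrite Rmult_plus_distr_l.
        replace (/ INR M * (INR M * (eps / 2))) with (eps / 2) by (field; lra).
        replace (/ INR M * (C1 * q * T)) with (C1 * q * (/ INR M * T)) by ring.
        assert (0 <= C1 * q) by (apply Rmult_le_pos; auto). nra. }
    rewrite Cmod_mult, Cmod_opp, Cmod_inv, Cmod_R, Rabs_pos_eq in B2 by (lra || (intros E; apply RtoC_inj in E; lra)). lra. }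
  apply (clim_Cmod_le (fun X => csum (members P N) (fun m => RtoC (INR m / other_factors P X m) * Psi (INR m))%C)).
  - apply clim_csum. intros m _. eapply clim_ext.
    2:{ rewrite Cmult_comm. apply clim_scal. apply clim_RtoC. apply is_lim_seq_Reals.
        apply is_lim_seq_div'; [apply is_lim_seq_const|apply is_lim_seq_Reals, HL|apply HL0]. }
    exists 0%nat. intros; apply Cmult_comm.
  - intros M. destruct (INR_unbounded X0) as [Y HY]. exists (M + N + Y)%nat. split; [lia|]. apply Fin; [|lia].
    assert (INR Y <= INR (M + N + Y)) by (apply le_INR; lia). lra.
Qed.

(** At an integer [m], [cbinom m n * z0 ^ (m - n)] is the coefficient of [a m] in the [n]-th Taylor coefficient at
   [z0 = exp (- p + i theta)]. *)
Lemma taylor_coef_bound P d L c theta p u : balanced P d -> 0 < d <= 1 -> 0 <= c < PI * d -> Rabs theta < c -> 0 < p ->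
  0 < u < 1 -> u / (1 - u) < c - Rabs theta ->
  (forall m, Un_cv (fun X => other_factors P X m) (L m)) -> (forall m, L m <> 0) ->
  exists C1, 0 <= C1 /\ forall n t, taylor_coef (reciprocal_coef P L) (Cexp ((- p)%R, theta)) n t ->
    Cmod t <= C1 * (/ (u * exp (- p))) ^ n.
Proof.
  intros HB Hd Hc Hth Hp Hu Hku HL HL0.
  destruct (partial_sum_bound P d L c theta p u HB Hd Hc Hth Hp Hu Hku HL HL0) as [C1 [HC1 H]].
  exists C1. split; auto. intros n t Ht. apply Rnot_lt_le. intros Hlt.
  set (B := C1 * (/ (u * exp (- p))) ^ n) in *.
  destruct (H n ((Cmod t - B) / 2) ltac:(lra)) as [N1 HN1].
  assert (Cmod t <= B + (Cmod t - B) / 2); [|lra].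
  apply (clim_Cmod_le _ _ _ Ht). intros N. exists (S (N + N1)). split; [lia|].
  assert (HP0 : ~ P 0%nat) by apply HB.
  rewrite (csum_members P); [|intros m Hm; unfold reciprocal_coef; destruct (excluded_middle_informative (P m)) as [Hc'|_]; [contradiction|ring]|exact HP0].
  erewrite csum_ext; [apply (HN1 (N + N1)%nat); lia|].
  intros m Hm. apply in_members in Hm. destruct Hm as [_ Hm].
  unfold reciprocal_coef. destruct (excluded_middle_informative (P m)); [|contradiction]. f_equal.
  rewrite cbinom_INR. destruct (le_lt_dec n m) as [Hnm|Hnm].
  - f_equal. rewrite Cexp_pow. f_equal. rewrite minus_INR, RtoC_minus by auto. ring.
  - rewrite bin_gt by auto. simpl (INR 0). ring.
Qed.

(** * Continuation by a Taylor series of large radius *)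

Definition has_expansion (f : C -> C) (z : C) : Prop :=
  exists (c : nat -> C) (r : R), 0 < r /\ forall y, Cmod (y - z)%C < r -> cseries (fun k => c k * (y - z) ^ k)%C (f y).

Lemma analytic_of_expansion f z : has_expansion f z -> analytic_at f z.
Proof.
  intros [c [r [Hr H]]]. exists c. apply locally_Cmod. exists r. split; auto. intros y Hy.
  apply is_Cpseries_cseries. auto.
Qed.

Lemma has_expansion_local f g z r : 0 < r -> (forall y, Cmod (y - z)%C < r -> f y = g y) -> has_expansion f z -> has_expansion g z.
Proof.
  intros Hr E [c [r' [Hr' H]]]. exists c, (Rmin r r'). split; [now apply Rmin_pos|]. intros y Hy.
  rewrite <- E by (eapply Rlt_le_trans; [exact Hy|apply Rmin_l]). apply H. eapply Rlt_le_trans; [exact Hy|apply Rmin_r].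
Qed.

Lemma taylor_coefs_ex a s B z : summable_at a s B -> Cmod z < s -> exists t, forall k, taylor_coef a z k (t k).
Proof.
  intros HB Hz. assert (Hc : forall k, exists l, taylor_coef a z k l).
  { intros k. destruct (taylor_coef_ex a s B z k HB Hz) as [l [Hl _]]. now exists l. }
  exists (fun k => proj1_sig (constructive_indefinite_description _ (Hc k))).
  intros k. apply (proj2_sig (constructive_indefinite_description _ (Hc k))).
Qed.

Lemma has_expansion_series (a : nat -> C) f z0 rho z :
  (forall s, 0 <= s < rho -> exists B, summable_at a s B) ->
  (forall y, Cmod (y - z0)%C < rho -> cseries (fun n => a n * (y - z0) ^ n)%C (f y)) ->
  Cmod (z - z0)%C < rho -> has_expansion f z.
Proof.
  intros Hs Hf Hz. set (w := (z - z0)%C) in *. assert (Hw0 := Cmod_ge_0 w).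
  destruct (Hs ((Cmod w + rho) / 2) ltac:(lra)) as [B HB].
  destruct (taylor_coefs_ex a _ B w HB ltac:(lra)) as [t Ht]. exists t, ((rho - Cmod w) / 2).
  split; [lra|]. intros y Hy. apply (taylor_expansion a _ B w t (y - z)%C (f y) HB); [lra|exact Ht|].
  eapply cseries_ext; [|apply Hf].
  - intros n. cbn beta. do 2 f_equal. unfold w. ring.
  - replace (y - z0)%C with (w + (y - z))%C by (unfold w; ring). eapply Rle_lt_trans; [apply Cmod_triangle|]. lra.
Qed.

(** On the segment from [z0] to [y], the supremum of the initial part on which [f = g] cannot be less than [1]: there both
   expansions agree on a segment, hence have the same coefficients. *)
Lemma identity_segment f g z0 y :
  (forall s, 0 <= s <= 1 -> has_expansion f (z0 + s * (y - z0))%C /\ has_expansion g (z0 + s * (y - z0))%C) ->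
  (exists r, 0 < r /\ forall w, Cmod (w - z0)%C < r -> f w = g w) -> f y = g y.
Proof.
  intros Hexp [r0 [Hr0 Hloc]]. set (h := (y - z0)%C) in *. set (zz := fun s : R => (z0 + s * h)%C).
  assert (Ey : zz 1 = y) by (unfold zz, h; ring). assert (E0 : zz 0 = z0) by (unfold zz; ring).
  destruct (Req_dec (Cmod h) 0) as [Hh|Hh].
  { apply Cmod_eq_0 in Hh. assert (y = z0) by (rewrite <- Ey; unfold zz; rewrite Hh; ring).
    apply Hloc. rewrite H, Cminus_diag, Cmod_0. auto. }
  assert (Hhp : 0 < Cmod h) by (generalize (Cmod_ge_0 h); lra).
  assert (Hdist : forall s t, Cmod (zz s - zz t)%C = Rabs (s - t) * Cmod h).
  { intros s t. unfold zz. replace (z0 + s * h - (z0 + t * h))%C with ((s - t) * h)%C by ring.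
    now rewrite Cmod_mult, <- RtoC_minus, Cmod_R. }
  set (E := fun s => 0 <= s <= 1 /\ forall s', 0 <= s' <= s -> f (zz s') = g (zz s')).
  destruct (completeness E) as [m [Hub Hlub]].
  { exists 1. intros s [Hs _]. lra. }
  { exists 0. split; [lra|]. intros s' Hs'. replace s' with 0 by lra. rewrite E0. apply Hloc.
    rewrite Cminus_diag, Cmod_0. auto. }
  assert (Hm0 : 0 <= m).
  { apply Hub. split; [lra|]. intros s' Hs'. replace s' with 0 by lra. rewrite E0. apply Hloc.
    rewrite Cminus_diag, Cmod_0. auto. }
  assert (Hm1 : m <= 1) by (apply Hlub; intros s [Hs _]; lra).
  assert (Hbelow : forall s, 0 <= s < m -> f (zz s) = g (zz s)).
  { intros s Hs. apply NNPP. intros Hc. assert (m <= s); [|lra]. apply Hlub. intros t [Ht HE].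
    apply Rnot_lt_le. intros Hlt. apply Hc, HE. lra. }
  assert (Hnear : exists r, 0 < r /\ forall w, Cmod (w - zz m)%C < r -> f w = g w).
  { destruct (Req_dec m 0) as [->|Hmn]; [rewrite E0; now exists r0|].
    destruct (Hexp m ltac:(lra)) as [[c [r [Hr Hc]]] [c' [r' [Hr' Hc']]]]. fold (zz m) in *.
    set (q := Rmin r r'). assert (Hq : 0 < q) by (now apply Rmin_pos).
    assert (Hq1 : q <= r) by apply Rmin_l. assert (Hq2 : q <= r') by apply Rmin_r.
    assert (Hdiff : forall w, Cmod (w - zz m)%C < q -> cseries (fun k => (c k - c' k) * (w - zz m) ^ k)%C (f w - g w)%C).
    { intros w Hw. replace (f w - g w)%C with (f w + (-1) * g w)%C by ring.
      eapply cseries_ext; [|apply cseries_plus; [apply Hc; lra|apply cseries_scal, Hc'; lra]]. intros n. cbn beta. ring. }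
    assert (Eq : forall k, (c k - c' k)%C = 0%C).
    { assert (Hq2' : Cmod (RtoC (q / 2)) = q / 2) by (rewrite Cmod_R, Rabs_pos_eq; lra).
      assert (H1 := Hdiff (zz m + RtoC (q / 2))%C). replace (zz m + RtoC (q / 2) - zz m)%C with (RtoC (q / 2)) in H1 by ring.
      rewrite Hq2' in H1. specialize (H1 ltac:(lra)). destruct (cseries_bounded _ _ H1) as [B HB].
      assert (HS : summable_at (fun k => (c k - c' k)%C) (q / 4) (B * / (1 - (q / 4) / (q / 2)))).
      { apply (summable_at_of_bound _ (q / 2)); [lra|]. intros n. specialize (HB n).
        rewrite Cmod_mult, Cmod_pow, Hq2' in HB. exact HB. }
      assert (Hmh : 0 < m * Cmod h) by (apply Rmult_lt_0_compat; lra).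
      apply (cseries_unique_coef _ (q / 4) _ (- h / Cmod h)%C (Rmin q (m * Cmod h)) HS); [lra| |now apply Rmin_pos|].
      - rewrite Cmod_div, Cmod_opp, Cmod_R, Rabs_pos_eq by (lra || (intros Hcc; apply RtoC_inj in Hcc; lra)). field. lra.
      - intros x Hx. assert (Hx1 : x < q) by (eapply Rlt_le_trans; [apply Hx|apply Rmin_l]).
        assert (Hx2 : x < m * Cmod h) by (eapply Rlt_le_trans; [apply Hx|apply Rmin_r]).
        set (s := m - x / Cmod h).
        assert (Hxh : 0 < x / Cmod h < m).
        { split; [apply Rdiv_lt_0_compat; lra|]. apply Rlt_div_l; [auto|lra]. }
        assert (Ez : (zz s - zz m = x * (- h / Cmod h))%C).
        { unfold zz, s. rewrite RtoC_minus, RtoC_div by lra. field. intros Hcc; apply RtoC_inj in Hcc; lra. }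
        rewrite <- Ez. replace (RtoC 0) with (f (zz s) - g (zz s))%C by (rewrite Hbelow by (unfold s; lra); ring).
        apply Hdiff. rewrite Hdist. unfold s. replace (m - x / Cmod h - m) with (- (x / Cmod h)) by ring.
        rewrite Rabs_Ropp, Rabs_pos_eq by lra. unfold Rdiv. rewrite Rmult_assoc, Rinv_l; lra. }
    exists q. split; auto. intros w Hw.
    apply (clim_unique (fun n => csum (seq 0 n) (fun k => c k * (w - zz m) ^ k)%C)); [apply Hc; lra|].
    eapply clim_ext; [|apply Hc'; lra]. exists 0%nat. intros n _. apply csum_ext. intros k _.
    replace (c k) with (c k - c' k + c' k)%C by ring. rewrite Eq. ring. }
  destruct Hnear as [r [Hr Hnear]].
  set (m' := Rmin 1 (m + r / (2 * Cmod h))).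
  assert (Hrh : 0 < r / (2 * Cmod h)) by (apply Rdiv_lt_0_compat; lra).
  assert (HE : E m').
  { assert (m' <= 1) by apply Rmin_l. assert (m' <= m + r / (2 * Cmod h)) by apply Rmin_r.
    assert (0 <= m') by (unfold m'; apply Rmin_glb; lra).
    split; [lra|]. intros s' Hs'. destruct (Rlt_le_dec s' m) as [Hlt|Hge]; [apply Hbelow; lra|].
    apply Hnear. rewrite Hdist, Rabs_pos_eq by lra.
    apply Rle_lt_trans with (r / (2 * Cmod h) * Cmod h); [apply Rmult_le_compat_r; lra|].
    replace (r / (2 * Cmod h) * Cmod h) with (r / 2) by (field; lra). lra. }
  assert (Hm' : m' <= m) by (apply Hub, HE).
  assert (m' = 1) by (unfold m' in *; destruct (Rle_lt_dec 1 (m + r / (2 * Cmod h))); [apply Rmin_left; auto|rewrite Rmin_right in Hm' by lra; lra]).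
  rewrite <- Ey. apply HE. lra.
Qed.

(** Overconvergence: the Taylor series at a point [z0] of the disc converges in a disc that reaches beyond
   [zeta], and agrees with the function on the common part, which is convex. *)
Lemma continuation_of_taylor_bound (a : nat -> C) z0 zeta rho K :
  (forall s, 0 <= s < 1 -> exists B, summable_at a s B) -> Cmod z0 < 1 -> 0 < rho -> Cmod (zeta - z0)%C < rho ->
  (forall n t, taylor_coef a z0 n t -> Cmod t <= K * (/ rho) ^ n) ->
  has_immediate_continuation a zeta.
Proof.
  intros Hs Hz0 Hrho Hz HK. assert (Hz00 := Cmod_ge_0 z0).
  destruct (Hs ((Cmod z0 + 1) / 2) ltac:(lra)) as [B HB].
  destruct (taylor_coefs_ex a _ B z0 HB ltac:(lra)) as [t Ht].
  assert (Hts : forall s, 0 <= s < rho -> exists B, summable_at t s B).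
  { intros s Hsr. exists (K * / (1 - s / rho)). apply (summable_at_of_bound t rho); auto.
    intros n. apply Rle_trans with (K * (/ rho) ^ n * rho ^ n).
    - apply Rmult_le_compat_r; [apply pow_le; lra|apply HK, Ht].
    - rewrite Rmult_assoc, <- Rpow_mult_distr, Rinv_l by lra. rewrite pow1. lra. }
  assert (Sum : forall (b : nat -> C) rad, (forall s, 0 <= s < rad -> exists B, summable_at b s B) ->
     forall z, exists v, Cmod z < rad -> cseries (fun n => b n * z ^ n)%C v).
  { intros b rad Hb z. destruct (Rlt_dec (Cmod z) rad) as [H|H]; [|exists 0%C; tauto].
    destruct (Hb (Cmod z) (conj (Cmod_ge_0 z) H)) as [B' HB'].
    assert (Hle : forall k, Cmod (b k * z ^ k)%C <= Cmod (b k) * Cmod z ^ k) by (intros k; rewrite Cmod_mult, Cmod_pow; lra).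
    destruct (summable_cseries (fun n => b n * z ^ n)%C _ _ HB' Hle) as [v [Hv _]]. exists v; auto. }
  set (f := fun z => proj1_sig (constructive_indefinite_description _ (Sum a 1 Hs z))).
  assert (Hf : forall z, Cmod z < 1 -> cseries (fun n => a n * z ^ n)%C (f z)) by
    (intros z; apply (proj2_sig (constructive_indefinite_description _ (Sum a 1 Hs z)))).
  set (T := fun z => proj1_sig (constructive_indefinite_description _ (Sum t rho Hts (z - z0)%C))).
  assert (HT : forall z, Cmod (z - z0)%C < rho -> cseries (fun n => t n * (z - z0) ^ n)%C (T z)) by
    (intros z; apply (proj2_sig (constructive_indefinite_description _ (Sum t rho Hts (z - z0)%C)))).
  assert (Xf : forall z, Cmod z < 1 -> has_expansion f z).
  { intros z Hz1. apply (has_expansion_series a f 0%C 1); auto.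
    - intros y Hy. replace (y - 0)%C with y in * by ring. auto.
    - replace (z - 0)%C with z by ring. auto. }
  assert (XT : forall z, Cmod (z - z0)%C < rho -> has_expansion T z).
  { intros z Hz1. apply (has_expansion_series t T z0 rho); auto. }
  assert (Agree : forall y, Cmod y < 1 -> Cmod (y - z0)%C < rho -> f y = T y).
  { intros y Hy Hyr. apply (identity_segment f T z0 y).
    - intros s Hs1. split.
      + apply Xf. replace (z0 + s * (y - z0))%C with ((1 - s)%R * z0 + s * y)%C by (rewrite RtoC_minus; ring).
        eapply Rle_lt_trans; [apply Cmod_triangle|]. rewrite !Cmod_mult, !Cmod_R, !Rabs_pos_eq by lra.
        destruct (Req_dec s 0) as [->|]; [lra|]. nra.
      + apply XT. replace (z0 + s * (y - z0) - z0)%C with (s * (y - z0))%C by ring.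
        rewrite Cmod_mult, Cmod_R, Rabs_pos_eq by lra. generalize (Cmod_ge_0 (y - z0)). nra.
    - exists (Rmin rho ((1 - Cmod z0) / 2)). split; [apply Rmin_pos; lra|]. intros w Hw.
      assert (H1 : Cmod (w - z0)%C < rho) by (eapply Rlt_le_trans; [exact Hw|apply Rmin_l]).
      assert (H2 : Cmod (w - z0)%C < (1 - Cmod z0) / 2) by (eapply Rlt_le_trans; [exact Hw|apply Rmin_r]).
      apply (clim_unique (fun n => csum (seq 0 n) (fun k => t k * (w - z0) ^ k)%C)); [|now apply HT].
      apply (taylor_expansion a _ B z0 t (w - z0)%C (f w) HB); [lra|exact Ht|].
      replace (z0 + (w - z0))%C with w by ring. apply Hf.
      replace w with (z0 + (w - z0))%C by ring. eapply Rle_lt_trans; [apply Cmod_triangle|]. lra. }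
  exists (fun z => Cmod (z - z0)%C < rho), (fun z => if Rlt_dec (Cmod z) 1 then f z else T z).
  split; [|split].
  - apply locally_Cmod. exists (rho - Cmod (zeta - z0)%C). split; [lra|]. intros y Hy.
    replace (y - z0)%C with ((y - zeta) + (zeta - z0))%C by ring. eapply Rle_lt_trans; [apply Cmod_triangle|]. lra.
  - intros z [H|H]; apply analytic_of_expansion.
    + apply (has_expansion_local f _ z (1 - Cmod z)); [unfold unit_disc in H; lra| |now apply Xf].
      intros y Hy. destruct (Rlt_dec (Cmod y) 1) as [|Hc1]; auto. exfalso. apply Hc1.
      replace y with (y - z + z)%C by ring. eapply Rle_lt_trans; [apply Cmod_triangle|]. lra.
    + apply (has_expansion_local T _ z (rho - Cmod (z - z0)%C)); [lra| |now apply XT].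
      intros y Hy. destruct (Rlt_dec (Cmod y) 1) as [Hy1|]; auto. symmetry. apply Agree; auto.
      replace (y - z0)%C with ((y - z) + (z - z0))%C by ring. eapply Rle_lt_trans; [apply Cmod_triangle|]. lra.
  - intros z H. apply is_Cpseries_cseries. destruct (Rlt_dec (Cmod z) 1) as [Hz1|]; [auto|contradiction].
Qed.

(** * The equivalence *)

(** Any [c] between [PI * Delta] and [PI * b] works for all [theta] at once; then [u] is small depending on [c], and [p] is small
   depending on [u]. *)
Lemma regular_series_of_large_density (Lam : nat -> Prop) Delta b : 0 <= Delta < b -> density_ge Lam b ->
  exists a, series_on Lam a /\ root_condition Lam a /\
    forall theta, Rabs theta <= PI * Delta -> has_immediate_continuation a (cis theta).
Proof.
  intros Hb Hdens. assert (HPI := PI_RGT_0). assert (Hb1 := density_ge_le1 Lam b Hdens).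
  assert (HP := greedy_balanced Lam b ltac:(lra) Hdens). set (P := greedy Lam b) in *.
  set (L := fun m => proj1_sig (constructive_indefinite_description _ (other_factors_limit P m))).
  assert (HL : forall m, Un_cv (fun X => other_factors P X m) (L m)) by
    (intros m; apply (proj2_sig (constructive_indefinite_description _ (other_factors_limit P m)))).
  assert (HL0 : forall m, L m <> 0).
  { intros m E. destruct (other_factors_limit_bounds P b L ltac:(lra) HP HL 1 ltac:(lra)) as [A [_ H]].
    specialize (H m). rewrite E, Rabs_R0 in H. generalize (exp_pos (- (1 * INR m + A))). lra. }
  destruct (reciprocal_coef_bounds P b L ltac:(lra) HP HL) as [B1 [B2 B3]].
  exists (reciprocal_coef P L). split; [|split].
  - apply series_on_of_bounds; auto.
    + intros m Hm. unfold reciprocal_coef. destruct (excluded_middle_informative (P m)) as [[_ [H _]]|]; [contradiction|reflexivity].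
    + intros N. destruct (balanced_infinite P b ltac:(lra) HP N) as [n [Hn HPn]]. exists n. auto.
  - now apply root_condition_of_bounds.
  - intros theta Hth. set (c := PI * (Delta + b) / 2).
    assert (Hc : PI * Delta < c < PI * b) by (unfold c; nra).
    set (s := c - PI * Delta). assert (Hs : 0 < s) by (unfold s; lra).
    set (ka := s / 2). set (u := ka / (1 + ka)).
    assert (Hka : 0 < ka) by (unfold ka; lra).
    assert (Hu : 0 < u < 1).
    { unfold u. split; [apply Rdiv_lt_0_compat; lra|]. apply Rlt_div_l; [lra|lra]. }
    assert (Eu : u / (1 - u) = ka) by (unfold u; field; lra).
    (* [exp (- p) = (1 + u / 2) / (1 + u)] lies between [1 / (1 + u)] and [1]. *)
    set (q := (1 + u / 2) / (1 + u)). set (p := - ln q).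
    assert (Hq : 0 < q < 1).
    { unfold q. split; [apply Rdiv_lt_0_compat; lra|]. apply Rlt_div_l; [lra|lra]. }
    assert (Hp : 0 < p) by (unfold p; assert (ln q < ln 1) by (apply ln_increasing; lra); rewrite ln_1 in H; lra).
    assert (Eq : exp (- p) = q) by (unfold p; rewrite Ropp_involutive; apply exp_ln; lra).
    assert (Hq2 : 1 - q < u * q).
    { unfold q. apply Rmult_lt_reg_r with (1 + u); [lra|].
      replace ((1 - (1 + u / 2) / (1 + u)) * (1 + u)) with (u / 2) by (field; lra).
      replace (u * ((1 + u / 2) / (1 + u)) * (1 + u)) with (u * (1 + u / 2)) by (field; lra). nra. }
    assert (Hcp : 0 <= PI * Delta) by nra.
    destruct (taylor_coef_bound P b L c theta p u HP ltac:(lra) ltac:(lra) ltac:(lra) Hp Hu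
       ltac:(rewrite Eu; unfold ka, s in *; lra) HL HL0) as [K [HK HT]].
    rewrite Eq in HT.
    assert (Ez : Cexp ((- p)%R, theta) = (q * cis theta)%C) by (unfold Cexp; simpl fst; simpl snd; now rewrite Eq).
    apply (continuation_of_taylor_bound _ (q * cis theta)%C _ (u * q) K).
    + intros s' Hs'. apply subexponential_summable; auto.
    + rewrite Cmod_circle; lra.
    + nra.
    + replace (cis theta - q * cis theta)%C with ((1 - q)%R * cis theta)%C by (rewrite RtoC_minus; ring).
      rewrite Cmod_circle; lra.
    + rewrite <- Ez. exact HT.
Qed.

Theorem corollary1 :
  forall (Delta : R) (Lam : nat -> Prop),
    0 <= Delta <= 1 ->
    (forall m : nat, Lam m -> (0 < m)%nat) ->
    let A := forall a : nat -> C, series_on Lam a -> root_condition Lam a ->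
      has_singularity_on a (closed_arc (- (PI * Delta)) (PI * Delta)) in
    let A' := forall a : nat -> C, series_on Lam a -> root_condition Lam a ->
      forall alpha beta : R, beta - alpha = 2 * PI * Delta ->
        has_singularity_on a (closed_arc alpha beta) in
    let B := minimum_density Lam <= Delta in
    (A <-> A') /\ (A <-> B).
Proof.
  intros Delta Lam HD _ A A' B.
  assert (BA' : B -> A').
  { intros HB a H1 H2 alpha beta Hab. now apply (singularity_of_small_density Delta Lam). }
  assert (A'A : A' -> A).
  { intros H a H1 H2. apply H; auto. ring. }
  assert (AB : A -> B).
  { intros HA. apply Rnot_lt_le. intros Hlt.
    destruct (proj2 (minimum_density_spec Lam) Delta Hlt) as [b [Hb [_ Hdens]]].
    destruct (regular_series_of_large_density Lam Delta b ltac:(lra) Hdens) as [a [H1 [H2 Hreg]]].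
    destruct (HA a H1 H2) as [zeta [[theta [Hth ->]] Hsing]]. apply Hsing, Hreg. apply Rabs_le. lra. }
  split; split; auto.
Qed.
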